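(* Let $m=m(n)\to\infty$ as $n\to\infty$. For each $n$ let $\xi_\alpha=\xi_{\alpha,n}\in\mathbb{R}$ and $\mathbf{y}_\alpha=\mathbf{y}_{\alpha,n}\in\mathbb{R}^n$, $\alpha\le m$, be mutually independent random variables and random vectors satisfying Assumption 1 and Assumption 2 (both stated in the context), and consider the $n\times n$ matrices $$\mathcal{L}_n=\sum_{\alpha=1}^m \xi_\alpha \mathbf{y}_\alpha\mathbf{y}_\alpha^T.$$ Let $Q_\alpha:=\mathbf{E}\,\mathbf{y}_\alpha\mathbf{y}_\alpha^T$ be such that, as $n\to\infty$, $$\sup_\alpha\|Q_\alpha\|_{op}=O(n^{-1}),\qquad \sup_\alpha|\operatorname{Tr}Q_\alpha-1|=o(1),$$ and $$\frac1m\sum_{\alpha=1}^m Q_\alpha=\frac1n I_n+B_n,\qquad\text{where } \|B_n\|_{HS}=o(n^{-1/2}).$$ Then as $n\to\infty$ the empirical spectral distributions $N_{\mathcal{L}_n}$ converge in probability to a non-random probability measure $N_{\mathcal{L}}$ whose Stieltjes transform $f$ is uniquely determined by the equation $$zf(z)=-1+f(z)\int\frac{d\widetilde\sigma(\xi)}{1+\xi f(z)}$$ in the class of Stieltjes transforms of non-negative measures.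
   Context: $\|D\|_{op}$ and $\|D\|_{HS}$ denote the operator and Hilbert-Schmidt norms; $(\cdot,\cdot)$ is the Euclidean inner product. For a real symmetric $n\times n$ matrix $M$ with eigenvalues $(\lambda_i)_i$, its empirical spectral distribution is $N_M(\Delta)=|\{i:\lambda_i\in\Delta\}|/n$, $\Delta\subset\mathbb{R}$. The Stieltjes transform of a non-negative measure $N$ is $\int\frac{N(d\lambda)}{\lambda-z}$, $\Im z\ne0$. Convergence in probability of the random measures $N_{\mathcal{L}_n}$ is with respect to the weak topology. Assumption 1. For every $n$, $\mathbf{y}_\alpha=\mathbf{y}_{\alpha,n}\in\mathbb{R}^n$, $\alpha\le m$, are mutually independent random vectors such that for all deterministic $n\times n$ matrices $D=D_n$ with $\|D\|_{op}=1$, $$\sup_\alpha \mathbf{Var}(D\mathbf{y}_\alpha,\mathbf{y}_\alpha)=o(1),\quad n\to\infty.$$ Assumption 2. For every $n$, $\xi_\alpha=\xi_{\alpha,n}\in\mathbb{R}$, $\alpha\le m$, are mutually independent copies of a random variable $\xi_n$ with cumulative distribution function $\sigma_n$. Let $\widetilde\sigma_n$ be the signed measure defined for every bounded $\Delta\subset\mathbb{R}$ by $\widetilde\sigma_n(\Delta)=\frac mn\int_\Delta\xi\,d\sigma_n(\xi)$. As $n\to\infty$, $\widetilde\sigma_n$ converges weakly to a signed measure $\widetilde\sigma$ such that $|\widetilde\sigma(\mathbb{R})|<\infty$, and $$\sup_n\int|\xi^p d\widetilde\sigma_n(\xi)|=\sup_n\frac mn\mathbf{E}|\xi_n|^{p+1}<\infty,\quad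 p=1,2,3.$$ *)

(* Defs.v *)
From HB Require Import structures.
From mathcomp Require Import all_boot all_order all_algebra.
From mathcomp Require Import all_classical all_reals all_analysis.
From mathcomp Require Export complex.

Set Implicit Arguments.
Unset Strict Implicit.
Unset Printing Implicit Defensive.

Import Order.TTheory GRing.Theory Num.Theory.
Import numFieldNormedType.Exports.

Local Open Scope classical_set_scope.
Local Open Scope ring_scope.
Local Open Scope complex_scope.

Section matrices.
Context {R : realType}.

Definition edot n (u v : 'cV[R]_n) : R := \sum_i u i 0 * v i 0.

Definition enorm n (u : 'cV[R]_n) : R := Num.sqrt (edot u u).

Definition opnorm n (D : 'M[R]_n) : R :=
  sup [set enorm (D *m u) | u in [set u : 'cV[R]_n | enorm u <= 1]].

Definition hsnorm n (D : 'M[R]_n) : R :=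
  Num.sqrt (\sum_i \sum_j D i j ^+ 2).

(* The eigenvalues listed with multiplicity, in an unspecified order; the list
   exists whenever [M] is symmetric, and defaults to [::] when the
   characteristic polynomial of [M] does not split over [R]. *)
Definition eigenvalues n (M : 'M[R]_n) : seq R :=
  xget [::] [set s | char_poly M = \prod_(x <- s) ('X - x%:P)].

Definition esd n (M : 'M[R]_n) : {measure set (measurableTypeR R) -> \bar R} :=
  mscale (n%:R^-1)%:nng
    (msum (fun k => dirac ((eigenvalues M)`_k : measurableTypeR R))
       (size (eigenvalues M))).

End matrices.

Lemma esdE (R : realType) n (M : 'M[R]_n) (A : set R) :
  esd M A = ((\sum_(x <- eigenvalues M) \1_A x) / n%:R)%:E.
Proof.
rewrite /esd /= /mscale /= /msum (big_nth 0) big_mkord mulrC EFinM -sumEFin.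
by congr (_ * _)%E; apply: eq_bigr.
Qed.

Section integrals.
Context {R : realType}.
Let borelR := measurableTypeR R.

Definition Cintegrable (mu : {measure set borelR -> \bar R}) (g : R -> R[i]) :=
  mu.-integrable [set: borelR] (fun x => (complex.Re (g x))%:E) /\
  mu.-integrable [set: borelR] (fun x => (complex.Im (g x))%:E).

Definition Cintegral (mu : {measure set borelR -> \bar R}) (g : R -> R[i]) :
    R[i] :=
  (\int[mu]_x complex.Re (g x)) +i* (\int[mu]_x complex.Im (g x)).

Definition hahn_pos_set (nu : {charge set borelR -> \bar R}) : set borelR :=
  sval (cid (Hahn_decomposition nu)).

Definition hahn_neg_set (nu : {charge set borelR -> \bar R}) : set borelR :=
  sval (cid (svalP (cid (Hahn_decomposition nu)))).

Definition hahnP (nu : {charge set borelR -> \bar R}) :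
    hahn_decomposition nu (hahn_pos_set nu) (hahn_neg_set nu) :=
  svalP (cid (svalP (cid (Hahn_decomposition nu)))).

(* Integration against a signed measure, as the difference of the integrals
   against the two parts of its Jordan decomposition. *)
Definition charge_integral (nu : {charge set borelR -> \bar R}) (g : R -> R) :
    R :=
  \int[jordan_pos (hahnP nu)]_x g x - \int[jordan_neg (hahnP nu)]_x g x.

Definition charge_Cintegral (nu : {charge set borelR -> \bar R})
    (g : R -> R[i]) : R[i] :=
  Cintegral (jordan_pos (hahnP nu)) g - Cintegral (jordan_neg (hahnP nu)) g.

Definition charge_weak_cvg (nu : nat -> {charge set borelR -> \bar R})
    (nu_lim : {charge set borelR -> \bar R}) :=
  forall phi : R -> R, continuous phi -> bounded_fun phi ->
    charge_integral (nu n) phi @[n --> \oo] --> charge_integral nu_lim phi.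

Definition stieltjes_kernel (z : R[i]) (x : R) : R[i] := (x%:C - z)^-1.

Definition has_stieltjes (mu : {measure set borelR -> \bar R}) :=
  forall z : R[i], complex.Im z != 0 -> Cintegrable mu (stieltjes_kernel z).

Definition stieltjes (mu : {measure set borelR -> \bar R}) (z : R[i]) : R[i] :=
  Cintegral mu (stieltjes_kernel z).

End integrals.

Section probability.
Context {R : realType}.

(* Families of sets of events rather than of random elements, so that real
   random variables and random vectors can occur in the same family. *)
Definition mutually_independent d (T : measurableType d)
    (P : probability T R) (I : finType) (F : I -> set (set T)) :=
  forall (J : {set I}) (E : I -> set T),
    (forall i, i \in J -> F i (E i)) ->
    P (\bigcap_(i in [set i | i \in J]) E i) = (\prod_(i in J) P (E i))%E.

Definition sigma_rv d (T : measurableType d) (P : probability T R)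
    (X : {RV P >-> R}) : set (set T) :=
  preimage_set_system [set: T] X measurable.

Definition sigma_rvec d (T : measurableType d) (P : probability T R) n
    (X : 'I_n -> {RV P >-> R}) : set (set T) :=
  g_sigma_preimage (fun i => X i : T -> R).

Definition rvec d (T : measurableType d) (P : probability T R) n
    (X : 'I_n -> {RV P >-> R}) (w : T) : 'cV[R]_n := \col_i X i w.

Definition second_moment_mx d (T : measurableType d) (P : probability T R) n
    (X : 'I_n -> {RV P >-> R}) : 'M[R]_n :=
  \matrix_(i, j) fine 'E_P[fun w => X i w * X j w].

(* Convergence in probability, in the weak topology, of random measures to a
   deterministic one; the sets of [mu] such that
   [`|\int[mu]_x phi x - \int[mu_lim]_x phi x| < eps] form a subbasis of
   neighbourhoods of [mu_lim]. *)
Definition weak_cvg_in_probability (d : nat -> measure_display)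
    (T : forall n, measurableType (d n)) (P : forall n, probability (T n) R)
    (mu : forall n, T n -> {measure set (measurableTypeR R) -> \bar R})
    (mu_lim : {measure set (measurableTypeR R) -> \bar R}) :=
  forall phi : R -> R, continuous phi -> bounded_fun phi ->
  forall eps : R, 0 < eps ->
    P n [set w | eps <= `|\int[mu n w]_x phi x - \int[mu_lim]_x phi x| ]
      @[n --> \oo] --> 0%E.

End probability.

Section model.
Context {R : realType}.
Variables (d : nat -> measure_display) (T : forall n, measurableType (d n)).
Variables (P : forall n, probability (T n) R) (m : nat -> nat).
Variables (xi : forall n, 'I_(m n) -> {RV (P n) >-> R}).
Variables (y : forall n, 'I_(m n) -> 'I_n -> {RV (P n) >-> R}).
Variables (sigma : nat -> cumulativeBounded (0 : R) (1 : R)).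
Variables (sigmat : nat -> {charge set (measurableTypeR R) -> \bar R}).
Variable sigmat_lim : {charge set (measurableTypeR R) -> \bar R}.

Definition jointly_independent n :=
  mutually_independent (P n)
    (fun k : 'I_(m n) + 'I_(m n) =>
       match k with
       | inl a => sigma_rv (xi a)
       | inr a => sigma_rvec (y a)
       end).

(* The dimension is restricted to [0 < n] because no matrix of size 0 has norm
   1, so that quantifying over [n = 0] would make the condition vacuous. *)
Definition assumption1 :=
  forall D : forall n, 'M[R]_n,
    (forall n, (0 < n)%N -> opnorm (D n) = 1) ->
    \big[maxe/0%E]_(a < m n)
       'V_(P n)[fun w => edot (D n *m rvec (y a) w) (rvec (y a) w)]
      @[n --> \oo] --> 0%E.

(* [sigma n] is the distribution function of [xi_n], and [d sigma_n] the
   corresponding Lebesgue-Stieltjes measure. A [charge] is finite-valued. *)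
Definition assumption2 :=
  [/\ (forall n (a : 'I_(m n)) r, (0 < n)%N ->
         cdf (xi a) r = (sigma n r)%:E),
      (forall n (A : set (measurableTypeR R)), (0 < n)%N ->
         measurable A -> bounded_set (A : set R) ->
         sigmat n A = (((m n)%:R / n%:R)%:E *
           \int[lebesgue_stieltjes_measure (sigma n)]_(x in A) x%:E)%E),
      charge_weak_cvg sigmat sigmat_lim &
      forall p, (1 <= p <= 3)%N ->
        (ereal_sup [set ((m n)%:R / n%:R)%:E *
           \int[lebesgue_stieltjes_measure (sigma n)]_x (`|x| ^+ p.+1)%:E
           | n in [set n | (0 < n)%N]] < +oo)%E].

Definition Lmx n (w : T n) : 'M[R]_n :=
  \sum_(a < m n) xi a w *: (rvec (y a) w *m (rvec (y a) w)^T).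

Definition limit_equation (f : R[i] -> R[i]) :=
  forall z : R[i], complex.Im z != 0 ->
    z * f z =
    -1 + f z * charge_Cintegral sigmat_lim (fun x => (1 + x%:C * f z)^-1).

End model.

(* Main.v *)
Require Import Defs.
From HB Require Import structures.
From mathcomp Require Import all_boot all_order all_algebra.
From mathcomp Require Import all_classical all_reals all_analysis.
From mathcomp Require Import measurable_realfun spectral ring lra.

(* Let [G = (L - z)^-1] and let [G_a] be the resolvent with the [a]-th summand removed. The
   rank-one formula [y^T G D y = y^T G_a D y / (1 + xi y^T G_a y)] and the variance bound, which
   allows replacing [y_a^T G_a D y_a] by its mean given [G_a], turn [L G = 1 + z G] into
   [1 + z g = g int dsigma~_n(x) / (1 + x g) + error] for [g = E Tr G / n], where the error is controlled
   by the fluctuations of [Tr G / n] and of [Tr G Q_a]. Far up on the imaginary axis, the same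
   expansion tested against the conjugate of a fluctuation is a contraction, so the fluctuations
   vanish there; the Taylor expansion of the resolvent propagates this to the whole upper
   half-plane. The limit equation has at most one solution in the upper half-plane, so [g]
   converges by compactness. Poisson kernels are dense among the continuous functions vanishing
   at infinity and the spectral distributions are tight, hence weak convergence; the limit measure
   represents the limiting positive functional. *)

Set Implicit Arguments.
Unset Strict Implicit.
Unset Printing Implicit Defensive.

Import Order.TTheory GRing.Theory Num.Theory.
Import numFieldNormedType.Exports.

Local Open Scope classical_set_scope.
Local Open Scope ring_scope.
Local Open Scope complex_scope.

(** * Frobenius norm, operator bounds and resolvents *)

(** The hypotheses provide [o(1)] without a rate, and the [Q_a] need not be multiples of the
    identity. The expansion of one trace therefore involves [Tr (G Q_a)] for every [a], so the
    traces against [I / n] and against all the [Q_a] are handled as one finite family, and the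
    largest deviation of [Tr (G D)] from [g Tr D] is estimated by itself. The factor obtained is of
    order [K^3 / Im z], below 1 only for large [Im z]; this forces the start high on the imaginary
    axis. Sizes: [E xi^2] is of order [n / m] and every test matrix [D] has norm of order [1 / n],
    so each of the [m] summands contributes an error [o(1 / m)]. The matrix [B] enters through
    [Tr (G D B)]: the Frobenius norm of [G D] is of order [n^(-1/2)], that of [B] is [o(n^(-1/2))],
    and the prefactor is of order [n]. The measure [sigma~] is signed, but [x sigma~(dx)] is a limit
    of [(m / n) x^2 sigma_n(dx)], hence positive; uniqueness rests on this. *)

Notation nc := ComplexField.Normc.normc.
Notation toC := (real_complex _).
Notation toCmx := (map_mx toC).

Section cauchy_schwarz.
Variable R : rcfType.

(** Lagrange's identity: the double sum of the squares [(a_i b_j - a_j b_i)^2] equals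
    [2 (A B - S^2)]. *)
Lemma CauchySchwarz_sum (I : finType) (a b : I -> R) :
  \sum_i a i * b i <= Num.sqrt (\sum_i a i ^+ 2) * Num.sqrt (\sum_i b i ^+ 2).
Proof.
set A := \sum_i a i ^+ 2; set B := \sum_i b i ^+ 2; set S := \sum_i _.
have A0 : 0 <= A by apply: sumr_ge0 => i _; exact: sqr_ge0.
have B0 : 0 <= B by apply: sumr_ge0 => i _; exact: sqr_ge0.
rewrite -sqrtrM//; apply: le_trans (ler_norm _) _; rewrite -sqrtr_sqr ler_wsqrtr//.
have : 0 <= \sum_i \sum_j (a i * b j - a j * b i) ^+ 2.
  by apply: sumr_ge0 => i _; apply: sumr_ge0 => j _; exact: sqr_ge0.
under eq_bigr do under eq_bigr do rewrite sqrrB !exprMn.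
under eq_bigr do rewrite big_split sumrB /=.
rewrite big_split sumrB /=.
have -> : \sum_i \sum_j a i ^+ 2 * b j ^+ 2 = A * B.
  by rewrite mulr_suml; apply: eq_bigr => i _; rewrite mulr_sumr.
have -> : \sum_i \sum_j a j ^+ 2 * b i ^+ 2 = A * B.
  by rewrite mulrC mulr_suml; apply: eq_bigr => i _; rewrite mulr_sumr;
     apply: eq_bigr => j _; rewrite mulrC.
have -> : \sum_i \sum_j a i * b j * (a j * b i) *+ 2 = S ^+ 2 *+ 2.
  rewrite expr2 mulr_suml -sumrMnl; apply: eq_bigr => i _.
  by rewrite mulr_sumr -sumrMnl; apply: eq_bigr => j _; congr (_ *+ _); ring.
by rewrite addrAC -mulr2n -mulrnBl pmulrn_lge0// subr_ge0.
Qed.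

End cauchy_schwarz.

Section complex_modulus.
Variable R : rcfType.
Implicit Types (x y z : R[i]).

Lemma normc_sqr z : nc z ^+ 2 = complex.Re z ^+ 2 + complex.Im z ^+ 2.
Proof. by case: z => a b /=; rewrite sqr_sqrtr// addr_ge0// sqr_ge0. Qed.

Lemma normc_ge0 z : 0 <= nc z.
Proof. by case: z => a b /=; exact: sqrtr_ge0. Qed.

Lemma normcM x y : nc (x * y) = nc x * nc y.
Proof. exact: ComplexField.Normc.normcM. Qed.

Lemma normcD x y : nc (x + y) <= nc x + nc y.
Proof. exact: le_normcD. Qed.

Lemma normcB x y : nc (x - y) <= nc x + nc y.
Proof. by rewrite -(normcN y); exact: le_normcD. Qed.

Lemma normc_real (a : R) : nc a%:C = `|a|.
Proof. by rewrite /= expr0n addr0 sqrtr_sqr. Qed.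

Lemma normc0 : nc (0 : R[i]) = 0.
Proof. by rewrite (normc_real 0) normr0. Qed.

Lemma normc1 : nc (1 : R[i]) = 1.
Proof. by rewrite (normc_real 1) normr1. Qed.

Lemma normc_conj z : nc z^* = nc z.
Proof. by case: z => a b /=; rewrite sqrrN. Qed.

Lemma normcV z : nc z^-1 = (nc z)^-1.
Proof. exact: ComplexField.Normc.normcV. Qed.

Lemma normcX z k : nc (z ^+ k) = nc z ^+ k.
Proof. by elim: k => [|k ih]; rewrite ?expr0 ?normc1// !exprS normcM ih. Qed.

Lemma normc_eq0 z : (nc z == 0) = (z == 0).
Proof.
apply/eqP/eqP => [/ComplexField.Normc.eq0_normc//|->]; exact: normc0.
Qed.

Lemma normc_gt0 z : (0 < nc z) = (z != 0).
Proof. by rewrite lt_neqAle normc_ge0 eq_sym normc_eq0 andbT. Qed.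

Lemma normr_Re_le z : `|complex.Re z| <= nc z.
Proof.
rewrite -sqrtr_sqr -(ger0_norm (normc_ge0 z)) -[leRHS]sqrtr_sqr ler_wsqrtr//.
by rewrite normc_sqr lerDl sqr_ge0.
Qed.

Lemma normr_Im_le z : `|complex.Im z| <= nc z.
Proof.
rewrite -sqrtr_sqr -(ger0_norm (normc_ge0 z)) -[leRHS]sqrtr_sqr ler_wsqrtr//.
by rewrite normc_sqr lerDr sqr_ge0.
Qed.

Lemma normc_le_ReIm z : nc z <= `|complex.Re z| + `|complex.Im z|.
Proof.
rewrite -(ler_pXn2r (n := 2)) ?nnegrE ?addr_ge0 ?normc_ge0//.
rewrite normc_sqr sqrrD !real_normK ?num_real// lerD2r lerDl.
by rewrite mulrn_wge0// mulr_ge0.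
Qed.

Lemma normc_sum (I : Type) (r : seq I) (P : pred I) (F : I -> R[i]) :
  nc (\sum_(i <- r | P i) F i) <= \sum_(i <- r | P i) nc (F i).
Proof.
elim/big_ind2 : _ => //; first by rewrite normc0.
by move=> x1 x2 y1 y2 h1 h2; apply: le_trans (normcD _ _) (lerD h1 h2).
Qed.

Lemma ReM_real (a : R) z : complex.Re (a%:C * z) = a * complex.Re z.
Proof. by case: z => x y /=; rewrite mul0r subr0. Qed.

Lemma ImM_real (a : R) z : complex.Im (a%:C * z) = a * complex.Im z.
Proof. by case: z => x y /=; rewrite mul0r addr0. Qed.

Lemma Re_mulc x y :
  complex.Re (x * y) = complex.Re x * complex.Re y - complex.Im x * complex.Im y.
Proof. by case: x y => [a b] [c d]. Qed.

Lemma Im_mulc x y :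
  complex.Im (x * y) = complex.Re x * complex.Im y + complex.Im x * complex.Re y.
Proof. by case: x y => [a b] [c d]. Qed.

Lemma Re_invc z : complex.Re z^-1 = complex.Re z / nc z ^+ 2.
Proof. by rewrite normc_sqr; case: z. Qed.

Lemma Im_invc z : complex.Im z^-1 = - complex.Im z / nc z ^+ 2.
Proof. by rewrite normc_sqr; case: z => a b /=; rewrite mulNr. Qed.

Lemma complex_ext x y :
  complex.Re x = complex.Re y -> complex.Im x = complex.Im y -> x = y.
Proof. by case: x y => [a b] [c d] /= -> ->. Qed.

End complex_modulus.

Section frobenius.
Variable R : rcfType.
Local Notation C := R[i].

(** On columns the resulting norm is the Euclidean one, so a single norm with values in [R] serves
    vectors and matrices. *)
Definition fsq p q (A : 'M[C]_(p, q)) : R := \sum_i \sum_j nc (A i j) ^+ 2.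
Definition fnorm p q (A : 'M[C]_(p, q)) : R := Num.sqrt (fsq A).

Lemma fsq_ge0 p q (A : 'M[C]_(p, q)) : 0 <= fsq A.
Proof. by apply: sumr_ge0 => i _; apply: sumr_ge0 => j _; exact: sqr_ge0. Qed.

Lemma fnorm_ge0 p q (A : 'M[C]_(p, q)) : 0 <= fnorm A.
Proof. exact: sqrtr_ge0. Qed.

Lemma fnorm_sqr p q (A : 'M[C]_(p, q)) : fnorm A ^+ 2 = fsq A.
Proof. by rewrite sqr_sqrtr// fsq_ge0. Qed.

Lemma fsq_tr p q (A : 'M[C]_(p, q)) : fsq A^T = fsq A.
Proof.
by rewrite /fsq exchange_big; apply: eq_bigr => i _; apply: eq_bigr => j _;
  rewrite mxE.
Qed.

Lemma fnorm_tr p q (A : 'M[C]_(p, q)) : fnorm A^T = fnorm A.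
Proof. by rewrite /fnorm fsq_tr. Qed.

Lemma fsq_col p q (A : 'M[C]_(p, q)) : fsq A = \sum_j fsq (col j A).
Proof.
rewrite /fsq exchange_big; apply: eq_bigr => j _; apply: eq_bigr => i _.
by rewrite big_ord1 mxE.
Qed.

Lemma normc_trM p q (A : 'M[C]_(p, q)) (B : 'M[C]_(q, p)) :
  nc (\tr (A *m B)) <= fnorm A * fnorm B.
Proof.
rewrite -(fnorm_tr B) /mxtrace.
under eq_bigr do rewrite mxE.
rewrite pair_big/=; apply: le_trans (normc_sum _ _ _) _.
under eq_bigr do rewrite normcM.
apply: le_trans (CauchySchwarz_sum _ _) _.
rewrite /fnorm /fsq !pair_big/=; apply: ler_wpM2l; first exact: sqrtr_ge0.
by apply: ler_wsqrtr; apply: ler_sum => i _; rewrite mxE.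
Qed.

Lemma fnormZ p q (a : C) (A : 'M[C]_(p, q)) : fnorm (a *: A) = nc a * fnorm A.
Proof.
have -> : nc a = Num.sqrt (nc a ^+ 2) by rewrite sqrtr_sqr ger0_norm ?normc_ge0.
rewrite /fnorm -sqrtrM ?sqr_ge0//; congr Num.sqrt; rewrite /fsq mulr_sumr.
apply: eq_bigr => i _; rewrite mulr_sumr; apply: eq_bigr => j _.
by rewrite mxE normcM exprMn.
Qed.

Lemma fnorm0 p q : fnorm (0 : 'M[C]_(p, q)) = 0.
Proof. by rewrite -(scale0r 0) fnormZ normc0 mul0r. Qed.

Lemma fnorm_eq0 p q (A : 'M[C]_(p, q)) : fnorm A = 0 -> A = 0.
Proof.
move=> A0; have : fsq A = 0 by rewrite -fnorm_sqr A0 expr0n.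
move/eqP; rewrite psumr_eq0; last first.
  by move=> i _; apply: sumr_ge0 => j _; exact: sqr_ge0.
move=> /allP h; apply/matrixP => i j; rewrite mxE; apply/eqP.
have := h i (mem_index_enum _) => /=; rewrite psumr_eq0; last first.
  by move=> k _; exact: sqr_ge0.
move=> /allP/(_ j (mem_index_enum _)) /=.
by rewrite sqrf_eq0 normc_eq0.
Qed.

Lemma fnorm1 n : fnorm (1%:M : 'M[C]_n) = Num.sqrt n%:R.
Proof.
congr Num.sqrt; rewrite /fsq (eq_bigr (fun=> 1)) ?sumr_const ?card_ord//.
move=> i _; rewrite (bigD1 i)//= big1 ?addr0 => [|j ji].
  by rewrite mxE eqxx normc1 expr1n.
by rewrite mxE eq_sym (negbTE ji) normc0 expr0n.
Qed.

(** Only upper bounds of operator norms are ever needed; as a relation they compose by multiplying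
    constants, with no supremum involved. *)
Definition opbound n (A : 'M[C]_n) (c : R) :=
  forall x : 'cV[C]_n, fnorm (A *m x) <= c * fnorm x.

(** The squared Frobenius norm adds up over columns, and [A] acts on each column separately. *)
Lemma opbound_fnorm n q (A : 'M[C]_n) c (B : 'M[C]_(n, q)) : 0 <= c ->
  opbound A c -> fnorm (A *m B) <= c * fnorm B.
Proof.
move=> c0 Ac; have -> : c = Num.sqrt (c ^+ 2) by rewrite sqrtr_sqr ger0_norm.
rewrite /fnorm -sqrtrM ?sqr_ge0//; apply: ler_wsqrtr.
rewrite !fsq_col mulr_sumr; apply: ler_sum => j _.
rewrite colE -mulmxA -colE -!fnorm_sqr -exprMn.
by rewrite ler_pXn2r ?nnegrE ?fnorm_ge0 ?mulr_ge0 ?fnorm_ge0.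
Qed.

Lemma opboundM n (A B : 'M[C]_n) a b : 0 <= a ->
  opbound A a -> opbound B b -> opbound (A *m B) (a * b).
Proof.
move=> a0 Aa Bb x; rewrite -mulmxA; apply: le_trans (Aa _) _.
by rewrite -mulrA ler_wpM2l.
Qed.

Lemma opboundZ n (A : 'M[C]_n) a (k : C) :
  opbound A a -> opbound (k *: A) (nc k * a).
Proof.
move=> Aa x; rewrite -scalemxAl fnormZ -mulrA ler_wpM2l ?normc_ge0//.
Qed.

Lemma opbound1 n : opbound (1%:M : 'M[C]_n) 1.
Proof. by move=> x; rewrite mul1mx mul1r. Qed.

Lemma opboundX n (A : 'M[C]_n) a k : 0 <= a ->
  opbound A a -> opbound (A ^+ k) (a ^+ k).
Proof.
move=> a0 Aa; elim: k => [|k ih]; first by rewrite expr0; exact: opbound1.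
by rewrite !exprS; exact: opboundM.
Qed.

Lemma opbound_fsq n (A : 'M[C]_n) a : 0 <= a ->
  opbound A a -> fnorm A <= a * Num.sqrt n%:R.
Proof. by move=> a0 Aa; rewrite -fnorm1 -{1}[A]mulmx1 opbound_fnorm. Qed.

Lemma opbound_tr n (A : 'M[C]_n) a : 0 <= a ->
  opbound A a -> nc (\tr A) <= a * n%:R.
Proof.
move=> a0 Aa; rewrite -[A]mulmx1; apply: le_trans (normc_trM _ _) _.
have <- : Num.sqrt n%:R * Num.sqrt n%:R = n%:R :> R by rewrite -expr2 sqr_sqrtr.
by rewrite fnorm1 mulrA ler_wpM2r ?sqrtr_ge0 ?opbound_fsq.
Qed.

(** The factor [sqrt n] lost here is what the Hilbert-Schmidt hypothesis on the averaged covariance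
    error compensates. *)
Lemma opbound_trM n (A B : 'M[C]_n) a : 0 <= a ->
  opbound A a -> nc (\tr (A *m B)) <= a * Num.sqrt n%:R * fnorm B.
Proof.
move=> a0 Aa; apply: le_trans (normc_trM _ _) _.
by rewrite ler_wpM2r ?fnorm_ge0 ?opbound_fsq.
Qed.

(* The bilinear (not sesquilinear) form [x^T A y]. *)
Definition bform n (x : 'cV[C]_n) (A : 'M[C]_n) (y : 'cV[C]_n) : C :=
  (x^T *m A *m y) 0 0.

Lemma bformE n (x : 'cV[C]_n) (A : 'M[C]_n) (y : 'cV[C]_n) :
  bform x A y = \sum_i \sum_j x i 0 * A i j * y j 0.
Proof.
rewrite /bform mxE exchange_big; apply: eq_bigr => j _ /=.
by rewrite mxE mulr_suml; apply: eq_bigr => i _; rewrite mxE.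
Qed.

Lemma bform_tr n (x : 'cV[C]_n) (A : 'M[C]_n) (y : 'cV[C]_n) :
  bform x A y = \tr (A *m (y *m x^T)).
Proof. by rewrite mulmxA mxtrace_mulC mulmxA /mxtrace big_ord1. Qed.

Lemma bform_le n (x : 'cV[C]_n) (A : 'M[C]_n) (y : 'cV[C]_n) a :
  opbound A a -> nc (bform x A y) <= a * (fnorm x * fnorm y).
Proof.
move=> Aa; have -> : bform x A y = \tr (x^T *m (A *m y)).
  by rewrite mulmxA /mxtrace big_ord1.
apply: le_trans (normc_trM _ _) _; rewrite fnorm_tr mulrCA.
by rewrite ler_wpM2l ?fnorm_ge0.
Qed.

Lemma fnorm_delta n (k : 'I_n) : fnorm (delta_mx k 0 : 'cV[C]_n) = 1.
Proof.
rewrite /fnorm /fsq (bigD1 k)//= big_ord1 big1 => [|l lk].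
  by rewrite mxE !eqxx normc1 expr1n addr0 sqrtr1.
by rewrite big_ord1 mxE (negbTE lk) normc0 expr0n.
Qed.

Lemma opbound_entry n (A : 'M[C]_n) a i j : opbound A a -> nc (A i j) <= a.
Proof.
move=> Aa; have := bform_le (delta_mx i 0) (delta_mx j 0) Aa.
rewrite !fnorm_delta !mulr1 /bform; congr (nc _ <= _).
by rewrite trmx_delta -rowE -colE !mxE.
Qed.

End frobenius.

(** * Resolvents of real symmetric matrices off the real axis *)

Section resolvent.
Variable R : realType.
Local Notation C := R[i].

Lemma fnorm_toC n (u : 'cV[R]_n) : fnorm (toCmx u) = enorm u.
Proof.
congr Num.sqrt; apply: eq_bigr => i _.
by rewrite big_ord1 mxE normc_real real_normK ?num_real// expr2.
Qed.

Lemma fsq_ReIm n (x : 'cV[C]_n) :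
  fsq x = enorm (map_mx (@complex.Re R) x) ^+ 2 +
          enorm (map_mx (@complex.Im R) x) ^+ 2.
Proof.
rewrite !sqr_sqrtr; try by apply: sumr_ge0 => i _; rewrite -expr2 sqr_ge0.
rewrite /fsq -big_split; apply: eq_bigr => i _.
by rewrite big_ord1 normc_sqr !mxE !expr2.
Qed.

Lemma Re_mulmx_real n (D : 'M[R]_n) (x : 'cV[C]_n) :
  map_mx (@complex.Re R) (toCmx D *m x) = D *m map_mx (@complex.Re R) x.
Proof.
apply/matrixP => i j; rewrite !mxE raddf_sum; apply: eq_bigr => k _.
by rewrite !mxE /=; case: (x k j) => a b /=; rewrite mul0r subr0.
Qed.

Lemma Im_mulmx_real n (D : 'M[R]_n) (x : 'cV[C]_n) :
  map_mx (@complex.Im R) (toCmx D *m x) = D *m map_mx (@complex.Im R) x.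
Proof.
apply/matrixP => i j; rewrite !mxE raddf_sum; apply: eq_bigr => k _.
by rewrite !mxE /=; case: (x k j) => a b /=; rewrite mul0r addr0.
Qed.

(** A real matrix acts separately on real and imaginary parts, whose squared norms add up. *)
Lemma opbound_real n (D : 'M[R]_n) c : 0 <= c ->
  (forall u : 'cV[R]_n, enorm (D *m u) <= c * enorm u) ->
  opbound (toCmx D) c.
Proof.
move=> c0 Dc x; rewrite -(ler_pXn2r (n := 2)) ?nnegrE ?mulr_ge0 ?fnorm_ge0//.
rewrite exprMn !fnorm_sqr !fsq_ReIm Re_mulmx_real Im_mulmx_real mulrDr -!exprMn.
by apply: lerD; rewrite ler_pXn2r ?nnegrE ?mulr_ge0 ?sqrtr_ge0.
Qed.

Lemma real_opbound n (D : 'M[R]_n) c (u : 'cV[R]_n) :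
  opbound (toCmx D) c -> enorm (D *m u) <= c * enorm u.
Proof. by move=> Dc; rewrite -!fnorm_toC map_mxM. Qed.

Definition resolvent n (L : 'M[R]_n) (z : C) : 'M[C]_n :=
  invmx (toCmx L - z%:M).

Section symmetric.
Variables (n : nat) (L : 'M[R]_n) (z : C).
Hypotheses (symL : L^T = L) (z0 : complex.Im z != 0).

(** Pairing with the conjugate of [x] gives a number of imaginary part [- Im z |x|^2], because
    [x^* L x] is real; Cauchy-Schwarz then removes one factor [|x|]. Invertibility and the resolvent
    bound both follow. *)
Lemma sub_scalar_ge (x : 'cV[C]_n) :
  `|complex.Im z| * fnorm x <= fnorm ((toCmx L - z%:M) *m x).
Proof.
have [x0|xn0] := eqVneq (fnorm x) 0; first by rewrite x0 mulr0 fnorm_ge0.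
have xp : 0 < fnorm x by rewrite lt_neqAle eq_sym xn0 fnorm_ge0.
rewrite -(ler_pM2r xp) -mulrA -expr2 fnorm_sqr.
pose xc := (map_mx (@conjc R) x)^T.
have fxc : fnorm xc = fnorm x.
  rewrite fnorm_tr; congr Num.sqrt; apply: eq_bigr => i _; apply: eq_bigr => j _.
  by rewrite mxE normc_conj.
rewrite -fxc [leRHS]mulrC; apply: le_trans _ (normc_trM xc _).
apply: le_trans _ (normr_Im_le _).
rewrite mulmxBl mulmxBr raddfB/= mul_scalar_mx -scalemxAr mxtraceZ.
have xx : \tr (xc *m x) = (fsq x)%:C.
  rewrite /mxtrace big_ord1 mxE /fsq rmorph_sum; apply: eq_bigr => i _.
  rewrite big_ord1 !mxE normc_sqr; case: (x i 0) => a b /=.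
  by apply/eqP; rewrite eq_complex /=; apply/andP; split; apply/eqP; ring.
(* The scalar equals its transpose, which is its conjugate since [L] is symmetric with real
   entries. *)
have xLx : complex.Im (\tr (xc *m (toCmx L *m x))) = 0.
  suff : complex.Im (\tr (xc *m (toCmx L *m x))) =
         - complex.Im (\tr (xc *m (toCmx L *m x))) by move=> ?; lra.
  rewrite -[in LHS]mxtrace_tr !trmx_mul trmxK -mulmxA map_trmx symL.
  rewrite -[in LHS](conjcK (\tr _)).
  have -> : (\tr (x^T *m (toCmx L *m map_mx (@conjc R) x)))^* =
            \tr (xc *m (toCmx L *m x)).
    rewrite -trace_map_mx !map_mxM/= -map_trmx; congr (\tr (_ *m (_ *m _))).
      by apply/matrixP => i j; rewrite !mxE conjc_real.
    by apply/matrixP => i j; rewrite !mxE conjcK.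
  by case: (\tr _).
rewrite raddfB/= xLx sub0r normrN xx.
have -> : complex.Im (z * (fsq x)%:C) = complex.Im z * fsq x.
  by case: z => a b /=; rewrite mulr0 add0r.
by rewrite normrM (ger0_norm (fsq_ge0 x)).
Qed.

Lemma sub_scalar_unit : toCmx L - z%:M \in unitmx.
Proof.
rewrite -unitmx_tr -row_free_unit; apply/inj_row_free => v vL.
apply/trmx_inj; rewrite trmx0; apply: fnorm_eq0; apply/eqP.
have := sub_scalar_ge v^T; rewrite -[_ *m v^T]trmxK trmx_mul trmxK vL.
rewrite trmx0 fnorm0.
by rewrite pmulr_rle0 ?normr_gt0// => h; rewrite eq_le h fnorm_ge0.
Qed.

Lemma mulmx_resolvent : (toCmx L - z%:M) *m resolvent L z = 1%:M.
Proof. by rewrite mulmxV// sub_scalar_unit. Qed.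

Lemma resolvent_mulmx : resolvent L z *m (toCmx L - z%:M) = 1%:M.
Proof. by rewrite mulVmx// sub_scalar_unit. Qed.

Lemma opbound_resolvent : opbound (resolvent L z) `|complex.Im z|^-1.
Proof.
move=> x; have := sub_scalar_ge (resolvent L z *m x).
by rewrite mulmxA mulmx_resolvent mul1mx ler_pdivlMl ?normr_gt0.
Qed.

Lemma mulmx_toC_resolvent :
  toCmx L *m resolvent L z = 1%:M + z *: resolvent L z.
Proof.
by rewrite -mulmx_resolvent mulmxBl mul_scalar_mx subrK.
Qed.

End symmetric.

Lemma resolventB n (L L' : 'M[R]_n) z : L^T = L -> L'^T = L' ->
  complex.Im z != 0 ->
  resolvent L z - resolvent L' z =
  - (resolvent L' z *m toCmx (L - L') *m resolvent L z).
Proof.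
move=> sL sL' z0; rewrite map_mxB/=.
have -> : toCmx L - toCmx L' = (toCmx L - z%:M) - (toCmx L' - z%:M).
  by rewrite opprB addrA subrK.
rewrite mulmxBr mulmxBl resolvent_mulmx// mul1mx -mulmxA mulmx_resolvent//.
by rewrite mulmx1 opprB.
Qed.

Lemma resolvent_identity n (L : 'M[R]_n) z w : L^T = L ->
  complex.Im z != 0 -> complex.Im w != 0 ->
  resolvent L z = resolvent L w + (z - w) *: (resolvent L w *m resolvent L z).
Proof.
move=> sL z0 w0; apply/eqP; rewrite eq_sym -subr_eq0 addrAC addr_eq0; apply/eqP.
have -> : (z - w) *: (resolvent L w *m resolvent L z) =
   resolvent L w *m ((toCmx L - w%:M) - (toCmx L - z%:M)) *m resolvent L z.
  rewrite opprB [_ + (_ - toCmx L)]addrC addrA subrK -raddfB/= mul_mx_scalar.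
  by rewrite scalemxAl.
rewrite mulmxBr mulmxBl resolvent_mulmx// mul1mx -mulmxA mulmx_resolvent//.
by rewrite mulmx1 opprB.
Qed.

(** Iterating the first resolvent identity. The remainder is exact and still contains the resolvent
    at [z], so nothing about convergence is needed here; it is small once [|z - w| < |Im w|] and [p]
    is large. *)
Lemma resolvent_expansion n (L : 'M[R]_n) z w p : L^T = L ->
  complex.Im z != 0 -> complex.Im w != 0 ->
  resolvent L z = \sum_(k < p) (z - w) ^+ k *: resolvent L w ^+ k.+1 +
     (z - w) ^+ p *: (resolvent L w ^+ p *m resolvent L z).
Proof.
move=> sL z0 w0; elim: p => [|p {1}->].
  by rewrite big_ord0 add0r !expr0 scale1r mul1mx.
rewrite big_ord_recr/= -addrA; congr (_ + _).
rewrite {1}(@resolvent_identity _ L z w)// mulmxDr scalerDr exprSr.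
rewrite -[resolvent L w ^+ p *m _]/(_ * _) -exprSr; congr (_ + _).
rewrite -scalemxAr scalerA -exprSr mulmxA.
by rewrite -[resolvent L w ^+ p *m _]/(_ * _) -exprSr.
Qed.

End resolvent.

(** * Spectrum of a symmetric matrix *)

Section spectrum.
Variable R : realType.
Local Notation C := R[i].

Lemma char_poly_conj (F : fieldType) n (P D : 'M[F]_n) : P \in unitmx ->
  char_poly (invmx P *m D *m P) = char_poly D.
Proof.
move=> Pu; rewrite /char_poly.
have PP : map_mx polyC (invmx P) *m map_mx polyC P = 1%:M :> 'M[{poly F}]_n.
  by rewrite -map_mxM mulVmx// map_scalar_mx.
have -> : char_poly_mx (invmx P *m D *m P) =
  map_mx polyC (invmx P) *m char_poly_mx D *m map_mx polyC P.
  rewrite /char_poly_mx mulmxBr mulmxBl !map_mxM; congr (_ - _).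
  by rewrite mul_mx_scalar -scalemxAl PP scalemx1.
by rewrite !det_mulmx mulrAC -det_mulmx PP det1 mul1r.
Qed.

Lemma resolvent_conj n (L : 'M[R]_n) (P : 'M[C]_n) (e : 'I_n -> R) z :
  P \in unitmx -> complex.Im z != 0 ->
  toCmx L = invmx P *m diag_mx (\row_i (e i)%:C) *m P ->
  \tr (resolvent L z) = \sum_i ((e i)%:C - z)^-1.
Proof.
move=> Pu z0; rewrite /resolvent => ->.
have ez i : (e i)%:C - z != 0.
  apply: contra z0 => /eqP/(congr1 (@complex.Im R)); case: z => a b /=.
  by rewrite sub0r => /eqP; rewrite oppr_eq0.
pose D' : 'M[C]_n := diag_mx (\row_i ((e i)%:C - z)^-1).
have DD' : (diag_mx (\row_i (e i)%:C) - z%:M) *m D' = 1%:M.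
  rewrite -diag_const_mx -raddfB/= mulmx_diag -diag_const_mx; congr diag_mx.
  by apply/rowP => i; rewrite !mxE divff.
have -> : invmx P *m diag_mx (\row_i (e i)%:C) *m P - z%:M =
          invmx P *m (diag_mx (\row_i (e i)%:C) - z%:M) *m P.
  by rewrite mulmxBr mulmxBl mul_mx_scalar -scalemxAl mulVmx// scalemx1.
set M := _ - z%:M in DD' *.
have MM : invmx P *m M *m P *m (invmx P *m D' *m P) = 1%:M.
  by rewrite !mulmxA mulmxK// -[_ *m M *m D']mulmxA DD' mulmx1 mulVmx.
have [Mu _] := mulmx1_unit MM.
rewrite -[invmx (_ *m P)]mulmx1 -MM mulKmx// mxtrace_mulC mulmxA mulmxV//.
by rewrite mul1mx mxtrace_diag; apply: eq_bigr => i _; rewrite mxE.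
Qed.

Lemma symmetric_diag n (L : 'M[R]_n) : L^T = L ->
  exists (P : 'M[C]_n) (e : 'I_n -> R), P \in unitmx /\
    toCmx L = invmx P *m diag_mx (\row_i (e i)%:C) *m P.
Proof.
move=> symL.
have Ls : toCmx L \is symmetricmx.
  apply/sesquiP; rewrite expr0 scale1r; apply/matrixP => i j.
  by rewrite !mxE -{1}symL mxE.
have Lr : toCmx L \is a mxOver Num.real.
  by apply/mxOverP => i j; rewrite mxE complex_real.
have hN := symmetric_normalmx Ls Lr.
have hR := hermitian_spectral_diag_real (realsym_hermsym Ls Lr).
exists (spectralmx (toCmx L)), (fun i => complex.Re (spectral_diag (toCmx L) 0 i)).
split; first exact: spectral_unit.
rewrite {1}(orthomx_spectralP hN); congr (_ *m diag_mx _ *m _).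
by apply/rowP => i; rewrite mxE RRe_real// (mxOverP hR).
Qed.

(** [eigenvalues] is an arbitrary choice of list; unique factorization into monic linear factors
    ties it, up to order, to the diagonal of a diagonalization. *)
Lemma eigenvaluesP n (L : 'M[R]_n) : L^T = L ->
  exists P : 'M[C]_n, exists e : 'I_n -> R, 
   [/\ P \in unitmx, toCmx L = invmx P *m diag_mx (\row_i (e i)%:C) *m P &
    perm_eq (eigenvalues L) [seq e i | i <- enum 'I_n]].
Proof.
move=> /symmetric_diag[P [e [Pu LP]]]; exists P, e; split=> //.
(* The factorization is computed over [R[i]] and descends to [R] by injectivity of the coefficient
   map. *)
have cL : char_poly L = \prod_(x <- [seq e i | i <- enum 'I_n]) ('X - x%:P).
  apply: (map_poly_inj (real_complex R)).
  rewrite map_char_poly LP char_poly_conj// char_poly_trig ?diag_mx_is_trig//.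
  rewrite rmorph_prod/= big_map big_enum/=; apply: eq_bigr => i _.
  by rewrite !mxE eqxx mulr1n rmorphB/= map_polyX map_polyC.
apply: prod_XsubC_eq; rewrite -cL.
by rewrite -(@xgetPex _ [::] [set s | char_poly L = \prod_(x <- s) ('X - x%:P)])//;
  exists [seq e i | i <- enum 'I_n].
Qed.

Lemma size_eigenvalues n (L : 'M[R]_n) : L^T = L -> size (eigenvalues L) = n.
Proof.
move=> /eigenvaluesP[P [e [_ _ /perm_size ->]]].
by rewrite size_map size_enum_ord.
Qed.

Lemma tr_resolvent n (L : 'M[R]_n) z : L^T = L -> complex.Im z != 0 ->
  \tr (resolvent L z) = \sum_(x <- eigenvalues L) (x%:C - z)^-1.
Proof.
move=> /eigenvaluesP[P [e [Pu LP pe]]] z0; rewrite (resolvent_conj Pu z0 LP).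
by rewrite (perm_big _ pe)/= big_map big_enum.
Qed.

End spectrum.

(** * Real and complex expectations *)

Notation rint P f := (integrable P [set: _] (EFin \o f)).

Section real_integrals.
Context d (T : measurableType d) (R : realType).
Variable P : {finite_measure set T -> \bar R}.

Lemma rint_le (f g : T -> R) : measurable_fun [set: T] f ->
  (forall w, `|f w| <= g w) -> rint P g -> rint P f.
Proof.
move=> mf fg; apply: le_integrable => //; first exact/measurable_EFinP.
move=> w _ /=; rewrite lee_fin; apply: le_trans (fg w) (ler_norm _).
Qed.

Lemma rint_cst c : rint P (fun=> c).
Proof.
apply/integrableP; split; first exact: measurable_cst.
by rewrite integral_cst// lte_mul_pinfty// ltey_eq fin_num_measure.
Qed.

Lemma rint_bounded (f : T -> R) c : measurable_fun [set: T] f ->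
  (forall w, `|f w| <= c) -> rint P f.
Proof. by move=> mf fc; apply: rint_le mf fc _; exact: rint_cst. Qed.

Lemma rintD (f g : T -> R) : rint P f -> rint P g -> rint P (fun w => f w + g w).
Proof. by move=> fi gi; apply: (integrableD measurableT fi gi). Qed.

Lemma rintB (f g : T -> R) : rint P f -> rint P g -> rint P (fun w => f w - g w).
Proof. by move=> fi gi; apply: (integrableB measurableT fi gi). Qed.

Lemma rintZ (k : R) (f : T -> R) : rint P f -> rint P (fun w => k * f w).
Proof. by move=> fi; apply: (integrableZl measurableT k fi). Qed.

Lemma rint_norm (f : T -> R) : rint P f -> rint P (fun w => `|f w|).
Proof. exact: integrable_norm. Qed.

Lemma rint_meas (f : T -> R) : rint P f -> measurable_fun [set: T] f.
Proof. by move/integrableP => [/measurable_EFinP]. Qed.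

Lemma rint_sum (I : Type) (s : seq I) (f : I -> T -> R) :
  (forall i, rint P (f i)) -> rint P (fun w => \sum_(i <- s) f i w).
Proof.
move=> fi; elim: s => [|i s ih].
  by under [X in EFin \o X]eq_fun do rewrite big_nil; exact: rint_cst.
by under [X in EFin \o X]eq_fun do rewrite big_cons; exact: rintD.
Qed.

Lemma RintegralT_sum (I : Type) (s : seq I) (f : I -> T -> R) :
  (forall i, rint P (f i)) ->
  \int[P]_w (\sum_(i <- s) f i w) = \sum_(i <- s) \int[P]_w f i w.
Proof.
move=> fi; elim: s => [|i s ih].
  by under eq_Rintegral do rewrite big_nil; rewrite big_nil Rintegral_cst// mul0r.
under eq_Rintegral do rewrite big_cons.
by rewrite big_cons RintegralD// ?ih//; exact: rint_sum.
Qed.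

Lemma RintegralT_le (f g : T -> R) : rint P f -> rint P g ->
  (forall w, f w <= g w) -> \int[P]_w f w <= \int[P]_w g w.
Proof. by move=> fi gi fg; apply: le_Rintegral. Qed.

Lemma normr_RintegralT_le (f g : T -> R) : rint P f -> rint P g ->
  (forall w, `|f w| <= g w) -> `|\int[P]_w f w| <= \int[P]_w g w.
Proof.
move=> fi gi fg; apply: le_trans (le_normr_Rintegral _ fi) _ => //.
by apply: RintegralT_le => //; exact: rint_norm.
Qed.

End real_integrals.

Lemma RintegralT_cst d (T : measurableType d) (R : realType)
  (P : probability T R) (c : R) : \int[P]_w c = c.
Proof.
rewrite Rintegral_cst//; have -> : fine (P [set: T]) = 1 by rewrite probability_setT.
exact: mulr1.
Qed.

(** The variance, expanded from the integral of [(f - e)^2] with [e] the mean, is nonnegative. *)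
Lemma Rintegral_sqr_le d (T : measurableType d) (R : realType)
  (P : probability T R) (f : T -> R) : rint P f -> rint P (fun w => f w ^+ 2) ->
  (\int[P]_w f w) ^+ 2 <= \int[P]_w (f w ^+ 2).
Proof.
move=> fi f2i; set e := \int[P]_w f w.
have : 0 <= \int[P]_w (f w ^+ 2 - 2 * e * f w + e ^+ 2).
  apply: Rintegral_ge0 => w _.
  have -> : f w ^+ 2 - 2 * e * f w + e ^+ 2 = (f w - e) ^+ 2 by ring.
  exact: sqr_ge0.
have i2 : rint P (fun w => 2 * e * f w) by exact: rintZ.
rewrite RintegralD//; [|exact: rintB|exact: rint_cst].
rewrite RintegralB// RintegralZl// RintegralT_cst -/e.
have -> : forall x, x - 2 * e * e + e ^+ 2 = x - e ^+ 2 by move=> x; ring.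
by rewrite subr_ge0.
Qed.

Arguments rint_bounded {d T R P f} c.

(** * Measurability of complex-valued functions and random matrices *)

Section complex_measurability.
Context d (T : measurableType d) (R : realType).
Implicit Types f g : T -> R[i].

Definition cmeas f :=
  measurable_fun [set: T] (fun w => complex.Re (f w)) /\
  measurable_fun [set: T] (fun w => complex.Im (f w)).

Lemma cmeas_cst c : cmeas (fun=> c).
Proof. by split; exact: measurable_cst. Qed.

Lemma cmeas_real (f : T -> R) : measurable_fun [set: T] f ->
  cmeas (fun w => (f w)%:C).
Proof. by split => //=; exact: measurable_cst. Qed.

Lemma cmeasD f g : cmeas f -> cmeas g -> cmeas (fun w => f w + g w).
Proof.
move=> [fr fi] [gr gi]; split; under eq_fun do rewrite raddfD;
  exact: measurable_funD.
Qed.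

Lemma cmeasN f : cmeas f -> cmeas (fun w => - f w).
Proof.
by move=> [fr fi]; split; under eq_fun do rewrite raddfN;
  exact: measurable_funN.
Qed.

Lemma cmeasB f g : cmeas f -> cmeas g -> cmeas (fun w => f w - g w).
Proof. by move=> fm gm; apply: cmeasD => //; exact: cmeasN. Qed.

Lemma cmeasM f g : cmeas f -> cmeas g -> cmeas (fun w => f w * g w).
Proof.
move=> [fr fi] [gr gi]; split.
  under eq_fun do rewrite Re_mulc.
  by apply: measurable_funB; exact: measurable_funM.
under eq_fun do rewrite Im_mulc.
by apply: measurable_funD; exact: measurable_funM.
Qed.

Lemma cmeas_conj f : cmeas f -> cmeas (fun w => (f w)^*).
Proof.
move=> [fr fi]; split.
  have -> : (fun w => complex.Re (f w)^*) = fun w => complex.Re (f w).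
    by apply/funext => w; case: (f w).
  exact: fr.
have -> : (fun w => complex.Im (f w)^*) = fun w => - complex.Im (f w).
  by apply/funext => w; case: (f w).
exact: measurable_funN.
Qed.

Lemma cmeas_sum (I : Type) (s : seq I) (F : I -> T -> R[i]) :
  (forall i, cmeas (F i)) -> cmeas (fun w => \sum_(i <- s) F i w).
Proof.
move=> h; elim: s => [|i s ih].
  by under eq_fun do rewrite big_nil; exact: cmeas_cst.
by under eq_fun do rewrite big_cons; exact: cmeasD.
Qed.

Lemma cmeas_prod (I : Type) (s : seq I) (F : I -> T -> R[i]) :
  (forall i, cmeas (F i)) -> cmeas (fun w => \prod_(i <- s) F i w).
Proof.
move=> h; elim: s => [|i s ih].
  by under eq_fun do rewrite big_nil; exact: cmeas_cst.
by under eq_fun do rewrite big_cons; exact: cmeasM.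
Qed.

(** Inversion is continuous away from 0 but not at 0, where it takes the default value 0; that point
    is split off as a measurable singleton. *)
Lemma measurable_invr : measurable_fun [set: R] (@GRing.inv R).
Proof.
have -> : [set: R] = [set 0] `|` ~` [set (0 : R)] by rewrite setUv.
apply/measurable_funU => //; first exact: measurableC.
split; first exact: measurable_fun_set1.
apply: open_continuous_measurable_fun.
  by rewrite openC; exact/accessible_closed_set1/hausdorff_accessible/Rhausdorff.
by move=> x; rewrite inE /= => /eqP x0; exact: inv_continuous.
Qed.

Lemma measurable_normc f : cmeas f -> measurable_fun [set: T] (fun w => nc (f w)).
Proof.
move=> [fr fi].
have -> : (fun w => nc (f w)) =
  fun w => Num.sqrt (complex.Re (f w) ^+ 2 + complex.Im (f w) ^+ 2).
  by apply/funext => w; case: (f w).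
apply: (measurableT_comp (continuous_measurable_fun (@sqrt_continuous R))).
by apply: measurable_funD; exact: measurable_funX.
Qed.

Lemma cmeasV f : cmeas f -> cmeas (fun w => (f w)^-1).
Proof.
move=> fm; have [fr fi] := fm.
have m2 : measurable_fun [set: T] (fun w => (nc (f w) ^+ 2)^-1).
  apply: (measurableT_comp measurable_invr); apply: measurable_funX.
  exact: measurable_normc.
split; first by under eq_fun do rewrite Re_invc; exact: measurable_funM.
under eq_fun do rewrite Im_invc; apply: measurable_funM => //.
exact: measurable_funN.
Qed.

Definition mxmeas p q (M : T -> 'M[R[i]]_(p, q)) :=
  forall i j, cmeas (fun w => M w i j).

Lemma mxmeas_cst p q (A : 'M[R[i]]_(p, q)) : mxmeas (fun=> A).
Proof. by move=> i j; exact: cmeas_cst. Qed.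

Lemma mxmeasD p q (A B : T -> 'M[R[i]]_(p, q)) :
  mxmeas A -> mxmeas B -> mxmeas (fun w => A w + B w).
Proof. by move=> mA mB i j; under eq_fun do rewrite mxE; exact: cmeasD. Qed.

Lemma mxmeasZ p q f (A : T -> 'M[R[i]]_(p, q)) :
  cmeas f -> mxmeas A -> mxmeas (fun w => f w *: A w).
Proof. by move=> mf mA i j; under eq_fun do rewrite mxE; exact: cmeasM. Qed.

Lemma mxmeas_tr p q (A : T -> 'M[R[i]]_(p, q)) :
  mxmeas A -> mxmeas (fun w => (A w)^T).
Proof. by move=> mA i j; under eq_fun do rewrite mxE; exact: mA. Qed.

Lemma mxmeasM p q r (A : T -> 'M[R[i]]_(p, q)) (B : T -> 'M[R[i]]_(q, r)) :
  mxmeas A -> mxmeas B -> mxmeas (fun w => A w *m B w).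
Proof.
move=> mA mB i j; under eq_fun do rewrite mxE.
by apply: cmeas_sum => k; exact: cmeasM.
Qed.

Lemma cmeas_det n (A : T -> 'M[R[i]]_n) : mxmeas A -> cmeas (fun w => \det (A w)).
Proof.
move=> mA; rewrite /determinant; apply: cmeas_sum => s.
by apply: cmeasM; [exact: cmeas_cst|exact: cmeas_prod].
Qed.

Lemma cmeas_tr n (A : T -> 'M[R[i]]_n) : mxmeas A -> cmeas (fun w => \tr (A w)).
Proof. by move=> mA; rewrite /mxtrace; exact: cmeas_sum. Qed.

Lemma mxmeas_adj n (A : T -> 'M[R[i]]_n) : mxmeas A -> mxmeas (fun w => \adj (A w)).
Proof.
move=> mA i j; under eq_fun do rewrite mxE.
apply: cmeasM; first exact: cmeas_cst.
by apply: cmeas_det => k l; under eq_fun do rewrite !mxE; exact: mA.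
Qed.

(** Cramer's rule: adjugate and determinant are polynomial in the entries, and [L w - z] is
    invertible for every [w], so the default branch of [invmx] never occurs. *)
Lemma mxmeas_resolvent n (L : T -> 'M[R]_n) z :
  (forall w, (L w)^T = L w) -> complex.Im z != 0 ->
  (forall i j, measurable_fun [set: T] (fun w => L w i j)) ->
  mxmeas (fun w => resolvent (L w) z).
Proof.
move=> symL z0 mL.
have mLz : mxmeas (fun w => toCmx (L w) - z%:M).
  apply: mxmeasD => [i j|]; last exact: mxmeas_cst.
  by under eq_fun do rewrite mxE; exact: cmeas_real.
rewrite /resolvent; under eq_fun do rewrite /invmx sub_scalar_unit//.
apply: mxmeasZ; last exact: mxmeas_adj.
by apply: cmeasV; exact: cmeas_det.
Qed.

End complex_measurability.

Section complex_expectation.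
Context d (T : measurableType d) (R : realType).
Variable P : {finite_measure set T -> \bar R}.
Implicit Types f g : T -> R[i].

Definition cint f :=
  rint P (fun w => complex.Re (f w)) /\ rint P (fun w => complex.Im (f w)).

Definition cexp f : R[i] :=
  (\int[P]_w complex.Re (f w)) +i* (\int[P]_w complex.Im (f w)).

Lemma cint_meas f : cint f -> cmeas f.
Proof. by move=> [/rint_meas ? /rint_meas]. Qed.

Lemma cint_le f (g : T -> R) : cmeas f -> (forall w, nc (f w) <= g w) ->
  rint P g -> cint f.
Proof.
move=> [fr fi] fg gi; split; apply: rint_le gi => // w; apply: le_trans (fg w).
  exact: normr_Re_le.
exact: normr_Im_le.
Qed.

Lemma cint_bounded f c : cmeas f -> (forall w, nc (f w) <= c) -> cint f.
Proof. by move=> fm fc; apply: cint_le fm fc _; exact: rint_cst. Qed.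

Lemma rint_normc f : cint f -> rint P (fun w => nc (f w)).
Proof.
move=> fi; have [fr fim] := fi.
apply: (rint_le (g := fun w => `|complex.Re (f w)| + `|complex.Im (f w)|)).
- exact/measurable_normc/cint_meas.
- by move=> w; rewrite ger0_norm ?normc_ge0 ?normc_le_ReIm.
- by apply: rintD; exact: rint_norm.
Qed.

Lemma cint_cst c : cint (fun=> c).
Proof. by split; exact: rint_cst. Qed.

Lemma cint_real (f : T -> R) : rint P f -> cint (fun w => (f w)%:C).
Proof. by move=> fi; split => //=; exact: rint_cst. Qed.

Lemma cintD f g : cint f -> cint g -> cint (fun w => f w + g w).
Proof.
move=> [fr fi] [gr gi]; split; under [X in EFin \o X]eq_fun do rewrite raddfD/=;
  exact: rintD.
Qed.

Lemma cintZ c f : cint f -> cint (fun w => c * f w).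
Proof.
move=> fi; apply: (cint_le (g := fun w => nc c * nc (f w))).
- by apply: cmeasM; [exact: cmeas_cst|exact: cint_meas].
- by move=> w; rewrite normcM.
- by apply: rintZ; exact: rint_normc.
Qed.

Lemma cintB f g : cint f -> cint g -> cint (fun w => f w - g w).
Proof.
move=> [fr fi] [gr gi]; split; under [X in EFin \o X]eq_fun do rewrite raddfB/=;
  exact: rintB.
Qed.

Lemma cint_sum (I : Type) (s : seq I) (F : I -> T -> R[i]) :
  (forall i, cint (F i)) -> cint (fun w => \sum_(i <- s) F i w).
Proof.
move=> h; elim: s => [|i s ih].
  by under eq_fun do rewrite big_nil; exact: cint_cst.
by under eq_fun do rewrite big_cons; exact: cintD.
Qed.

Lemma eq_cexp f g : (forall w, f w = g w) -> cexp f = cexp g.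
Proof. by move=> /funext ->. Qed.

Lemma cexpD f g : cint f -> cint g -> cexp (fun w => f w + g w) = cexp f + cexp g.
Proof.
move=> [fr fi] [gr gi]; apply: complex_ext; rewrite /= -RintegralD//;
by apply: eq_Rintegral => w _; rewrite raddfD.
Qed.

Lemma cexpB f g : cint f -> cint g -> cexp (fun w => f w - g w) = cexp f - cexp g.
Proof.
move=> [fr fi] [gr gi]; apply: complex_ext; rewrite /= -RintegralB//;
by apply: eq_Rintegral => w _; rewrite raddfB.
Qed.

Lemma cexpZ c f : cint f -> cexp (fun w => c * f w) = c * cexp f.
Proof.
move=> [fr fi]; apply: complex_ext.
  rewrite Re_mulc /= -!RintegralZl// -RintegralB//; try exact: rintZ.
  by apply: eq_Rintegral => w _; rewrite Re_mulc.
rewrite Im_mulc /= -!RintegralZl// -RintegralD//; try exact: rintZ.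
by apply: eq_Rintegral => w _; rewrite Im_mulc.
Qed.

Lemma cexp_sum (I : Type) (s : seq I) (F : I -> T -> R[i]) :
  (forall i, cint (F i)) ->
  cexp (fun w => \sum_(i <- s) F i w) = \sum_(i <- s) cexp (F i).
Proof.
move=> h; elim: s => [|i s ih].
  rewrite big_nil (eq_cexp (g := fun=> 0)) => [|w]; last by rewrite big_nil.
  by apply: complex_ext; rewrite /= Rintegral_cst// mul0r.
rewrite big_cons -ih -cexpD//; last exact: cint_sum.
by apply: eq_cexp => w; rewrite big_cons.
Qed.

(* Multiplying by the conjugate of [cexp f] makes the integral real. *)
Lemma normc_cexp_le f (g : T -> R) : cint f -> rint P g ->
  (forall w, nc (f w) <= g w) -> nc (cexp f) <= \int[P]_w g w.
Proof.
move=> fi gi fg; have [->|f0] := eqVneq (cexp f) 0.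
  by rewrite normc0; apply: Rintegral_ge0 => w _; exact: le_trans (normc_ge0 _) (fg w).
have ncf : 0 < nc (cexp f) by rewrite normc_gt0.
rewrite -(ler_pM2l ncf) -RintegralZl// -expr2.
set u := (cexp f)^*.
have -> : nc (cexp f) ^+ 2 = complex.Re (u * cexp f).
  by rewrite normc_sqr /u; case: (cexp f) => a b /=; ring.
rewrite -cexpZ//; apply: RintegralT_le; first by have [] := cintZ u fi.
  exact: rintZ.
move=> w; apply: le_trans (ler_norm _) _; apply: le_trans (normr_Re_le _) _.
by rewrite normcM normc_conj ler_wpM2l ?normc_ge0.
Qed.

End complex_expectation.
Arguments cint_bounded {d T R P f} c.
Arguments cint_le {d T R P f} g.
Arguments rint_le {d T R P f} g.

(** * Independence of groups *)

Section independence.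
Context d (T : measurableType d) (R : realType) (P : probability T R).

Lemma sub_g_sigma_measurable (G : set (set T)) : G `<=` measurable ->
  <<s G >> `<=` measurable.
Proof. by move=> Gm; apply: smallest_sub => //; exact: sigma_algebra_measurable. Qed.

Lemma g_sigma_measurable_fun (G : set (set T)) d' (T' : measurableType d')
    (f : T -> T') : G `<=` measurable ->
  measurable_fun [set: g_sigma_algebraType G] (f : g_sigma_algebraType G -> T') ->
  measurable_fun [set: T] f.
Proof.
move=> Gm mf _ B mB; apply: (sub_g_sigma_measurable Gm).
exact: (mf measurableT B mB).
Qed.

(** Quantified over the generated sigma-algebras, since the functions to be multiplied are
    measurable with respect to these. *)
Definition indep2 (G1 G2 : set (set T)) := forall A B, <<s G1 >> A -> <<s G2 >> B ->
  P (A `&` B) = (P A * P B)%E.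

Section product_rule.
Variables G1 G2 : set (set T).
Hypotheses (G1m : G1 `<=` measurable) (G2m : G2 `<=` measurable).
Hypothesis ind : indep2 G1 G2.
Local Notation T1 := (g_sigma_algebraType G1).
Local Notation T2 := (g_sigma_algebraType G2).

(* The law of the diagonal map into the two sub-sigma-algebras is a product. *)
Lemma ge0_indep_integral (X : T1 -> \bar R) (Y : T2 -> \bar R) :
  measurable_fun [set: T1] X -> measurable_fun [set: T2] Y ->
  (forall w, 0 <= X w)%E -> (forall w, 0 <= Y w)%E ->
  (\int[P]_w (X w * Y w) = (\int[P]_w X w) * (\int[P]_w Y w))%E.
Proof.
move=> mX mY X0 Y0.
have m1 : measurable_fun [set: T] (id : T -> T1).
  by move=> _ B mB; rewrite setTI; exact: (sub_g_sigma_measurable G1m).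
have m2 : measurable_fun [set: T] (id : T -> T2).
  by move=> _ B mB; rewrite setTI; exact: (sub_g_sigma_measurable G2m).
pose I1 : {mfun T >-> T1} := mfun_Sub (mem_set m1).
pose I2 : {mfun T >-> T2} := mfun_Sub (mem_set m2).
have mdg : measurable_fun [set: T] (fun w => (w, w) : T1 * T2).
  exact: measurable_fun_pair.
pose dg : {mfun T >-> (T1 * T2)%type} := mfun_Sub (mem_set mdg).
pose P1 := distribution P I1; pose P2 := distribution P I2.
have prodE A : measurable A -> (P1 \x P2)%E A = distribution P dg A.
  apply: product_measure_unique => A1 A2 mA1 mA2.
  exact: ind.
have mXY : measurable_fun [set: (T1 * T2)%type] (fun z => X z.1 * Y z.2)%E.
  apply: emeasurable_funM.
    exact: (measurableT_comp mX measurable_fst).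
  exact: (measurableT_comp mY measurable_snd).
have XY0 z : (0 <= X z.1 * Y z.2)%E by exact: mule_ge0.
have -> : (\int[P]_w (X w * Y w) =
           \int[distribution P dg]_z (X z.1 * Y z.2))%E.
  by rewrite ge0_integral_distribution.
rewrite (eq_measure_integral (P1 \x P2)%E); last first.
  by move=> A mA _; apply/esym; exact: prodE.
rewrite fubini_tonelli1//.
have -> : (\int[P]_w Y w = \int[P2]_w Y w)%E.
  by rewrite /P2 ge0_integral_distribution.
have -> : (\int[P]_w X w = \int[P1]_w X w)%E.
  by rewrite /P1 ge0_integral_distribution.
rewrite -ge0_integralZr//; last exact: integral_ge0.
apply: eq_integral => x _; rewrite /fubini_F/=.
by rewrite ge0_integralZl.
Qed.

Lemma rint_indep (X : T1 -> R) (Y : T2 -> R) :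
  measurable_fun [set: T1] X -> measurable_fun [set: T2] Y ->
  rint P (X : T -> R) -> rint P (Y : T -> R) -> rint P (fun w => X w * Y w).
Proof.
move=> mX mY iX iY; apply/integrableP; split.
  apply/measurable_EFinP; apply: measurable_funM; [exact: rint_meas iX|exact: rint_meas iY].
have -> : (\int[P]_x `|(EFin \o (fun w : T => (X w * Y w)%R)) x| =
   (\int[P]_w (`|X w|%:E)) * \int[P]_w (`|Y w|%:E))%E.
  rewrite -(@ge0_indep_integral (fun w => `|X w|%:E) (fun w => `|Y w|%:E))//.
  - by apply: eq_integral => w _ /=; rewrite normrM EFinM.
  - by apply: measurableT_comp => //; exact: measurableT_comp.
  - by apply: measurableT_comp => //; exact: measurableT_comp.
have [/= _ hX] := integrableP _ _ _ iX; have [/= _ hY] := integrableP _ _ _ iY.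
apply: lte_mul_pinfty => //.
  by apply: integral_ge0 => w _; rewrite lee_fin.
rewrite ge0_fin_numE//.
by apply: integral_ge0 => w _; rewrite lee_fin.
Qed.

Lemma ge0_Rintegral_indep (X : T1 -> R) (Y : T2 -> R) :
  measurable_fun [set: T1] X -> measurable_fun [set: T2] Y ->
  rint P (X : T -> R) -> rint P (Y : T -> R) ->
  (forall w, 0 <= X w) -> (forall w, 0 <= Y w) ->
  \int[P]_w (X w * Y w) = (\int[P]_w X w) * (\int[P]_w Y w).
Proof.
move=> mX mY iX iY X0 Y0; rewrite /Rintegral.
have := @ge0_indep_integral (EFin \o X) (EFin \o Y); rewrite /= => h.
under eq_integral do rewrite EFinM.
rewrite h ?fineM ?integrable_fin_num//; first exact/measurable_EFinP.
exact/measurable_EFinP.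
Qed.

Lemma Rintegral_indep (X : T1 -> R) (Y : T2 -> R) :
  measurable_fun [set: T1] X -> measurable_fun [set: T2] Y ->
  rint P (X : T -> R) -> rint P (Y : T -> R) ->
  \int[P]_w (X w * Y w) = (\int[P]_w X w) * (\int[P]_w Y w).
Proof.
move=> mX mY iX iY.
(* The nonnegative case extends by bilinearity to four products of positive and negative parts; this
   form of the parts makes measurability and domination by [|x|] immediate. *)
pose pos (x : R) := (`|x| + x) / 2; pose neg (x : R) := (`|x| - x) / 2.
have pos0 x : 0 <= pos x.
  by rewrite divr_ge0// -lerBlDr sub0r; have := ler_norm (- x); rewrite normrN.
have neg0 x : 0 <= neg x by rewrite divr_ge0// subr_ge0 ler_norm.
have xE x : x = pos x - neg x by rewrite /pos /neg; lra.
have mpos d' (T' : measurableType d') (f : T' -> R) : measurable_fun [set: T'] f ->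
    measurable_fun [set: T'] (fun w => pos (f w)).
  move=> mf; apply: measurable_funM => //; apply: measurable_funD => //.
  exact: measurableT_comp.
have mneg d' (T' : measurableType d') (f : T' -> R) : measurable_fun [set: T'] f ->
    measurable_fun [set: T'] (fun w => neg (f w)).
  move=> mf; apply: measurable_funM => //; apply: measurable_funB => //.
  exact: measurableT_comp.
have posle x : `|pos x| <= `|x|.
  by rewrite ger0_norm// /pos ler_pdivrMr//; have := ler_norm x; lra.
have negle x : `|neg x| <= `|x|.
  rewrite ger0_norm// /neg ler_pdivrMr//; have := ler_norm (- x).
  by rewrite normrN; lra.
have ipos (f : T -> R) : rint P f -> rint P (fun w => pos (f w)).
  move=> fi; apply: (rint_le (fun w => `|f w|)) => //; last exact: rint_norm.
  by apply: mpos; exact: rint_meas fi.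
have ineg (f : T -> R) : rint P f -> rint P (fun w => neg (f w)).
  move=> fi; apply: (rint_le (fun w => `|f w|)) => //; last exact: rint_norm.
  by apply: mneg; exact: rint_meas fi.
have hX : \int[P]_w X w = \int[P]_w pos (X w) - \int[P]_w neg (X w).
  rewrite -RintegralB//; try exact: ipos; try exact: ineg.
  by apply: eq_Rintegral => w _; rewrite -xE.
have hY : \int[P]_w Y w = \int[P]_w pos (Y w) - \int[P]_w neg (Y w).
  rewrite -RintegralB//; try exact: ipos; try exact: ineg.
  by apply: eq_Rintegral => w _; rewrite -xE.
have ge0E := ge0_Rintegral_indep.
have pp := ge0E _ _ (mpos _ _ _ mX) (mpos _ _ _ mY) (ipos _ iX) (ipos _ iY).
have pn := ge0E _ _ (mpos _ _ _ mX) (mneg _ _ _ mY) (ipos _ iX) (ineg _ iY).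
have np := ge0E _ _ (mneg _ _ _ mX) (mpos _ _ _ mY) (ineg _ iX) (ipos _ iY).
have nn := ge0E _ _ (mneg _ _ _ mX) (mneg _ _ _ mY) (ineg _ iX) (ineg _ iY).
have ipp := rint_indep (mpos _ _ _ mX) (mpos _ _ _ mY) (ipos _ iX) (ipos _ iY).
have ipn := rint_indep (mpos _ _ _ mX) (mneg _ _ _ mY) (ipos _ iX) (ineg _ iY).
have inp := rint_indep (mneg _ _ _ mX) (mpos _ _ _ mY) (ineg _ iX) (ipos _ iY).
have inn := rint_indep (mneg _ _ _ mX) (mneg _ _ _ mY) (ineg _ iX) (ineg _ iY).
rewrite hX hY mulrBl !mulrBr -pp// -pn// -np// -nn//.
rewrite -!RintegralB//; last exact: rintB; last exact: rintB.
by apply: eq_Rintegral => w _; rewrite {1}(xE (X w)) {1}(xE (Y w)); ring.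
Qed.

Lemma cint_indep (X : T1 -> R[i]) (Y : T2 -> R[i]) : cmeas X -> cmeas Y ->
  cint P (X : T -> _) -> cint P (Y : T -> _) -> cint P (fun w => X w * Y w).
Proof.
move=> [Xr Xi] [Yr Yi] [iXr iXi] [iYr iYi]; split.
  by under [X in EFin \o X]eq_fun do rewrite Re_mulc; apply: rintB; exact: rint_indep.
by under [X in EFin \o X]eq_fun do rewrite Im_mulc; apply: rintD; exact: rint_indep.
Qed.

Lemma cexp_indep (X : T1 -> R[i]) (Y : T2 -> R[i]) : cmeas X -> cmeas Y ->
  cint P (X : T -> _) -> cint P (Y : T -> _) ->
  cexp P (fun w => X w * Y w) = cexp P X * cexp P Y.
Proof.
move=> [Xr Xi] [Yr Yi] [iXr iXi] [iYr iYi]; apply: complex_ext.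
  rewrite Re_mulc /= -!Rintegral_indep// -RintegralB//; try exact: rint_indep.
  by apply: eq_Rintegral => w _; rewrite Re_mulc.
rewrite Im_mulc /= -!Rintegral_indep// -RintegralD//; try exact: rint_indep.
by apply: eq_Rintegral => w _; rewrite Im_mulc.
Qed.

End product_rule.

Section grouping.
Variables (I : finType) (F : I -> set (set T)).
Hypothesis Fm : forall i, F i `<=` measurable.
Hypothesis FI : forall i, setI_closed (F i).
Hypothesis FT : forall i, F i [set: T].
Hypothesis Find : mutually_independent P F.

Definition group (J : {set I}) : set (set T) := [set A | exists2 i, i \in J & F i A].

(* The pi-system generating the sigma-algebra of [group J]. *)
Definition cylinders (J : {set I}) : set (set T) :=
  [set A | exists2 E : I -> set T, (forall i, i \in J -> F i (E i)) &
    A = \bigcap_(i in [set i | i \in J]) E i].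

Lemma group_measurable J : group J `<=` measurable.
Proof. by move=> A [i _ /Fm]. Qed.

Lemma cylinders_measurable J : cylinders J `<=` measurable.
Proof.
move=> _ [E EF ->]; apply: fin_bigcap_measurable.
  exact: finite_finset.
by move=> i iJ; exact/Fm/EF.
Qed.

Lemma cylinders_setI J : setI_closed (cylinders J).
Proof.
move=> _ _ [E EF ->] [E' EF' ->]; exists (fun i => E i `&` E' i).
  by move=> i iJ; apply: FI; [exact: EF|exact: EF'].
by rewrite bigcapI.
Qed.

Lemma cylindersT J : cylinders J [set: T].
Proof. by exists (fun=> setT) => //; apply/esym/bigcapT. Qed.

Lemma group_cylinders J : group J `<=` cylinders J.
Proof.
move=> A [i iJ FA]; exists (fun j => if j == i then A else setT).
  by move=> j _; case: eqP => [->|_] //.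
apply/seteqP; split => [w Aw j _|w h]; first by case: ifP.
by have := h i iJ; rewrite /= eqxx.
Qed.

Lemma sub_sigma_group J : <<s group J >> `<=` <<s cylinders J >>.
Proof. by apply: sub_smallest2r; [exact: smallest_sigma_algebra|exact: group_cylinders]. Qed.

Lemma indep_cylinders (J1 J2 : {set I}) A B : (forall i, i \in J1 -> i \notin J2) ->
  cylinders J1 A -> cylinders J2 B -> P (A `&` B) = (P A * P B)%E.
Proof.
move=> dJ [E1 EF1 ->] [E2 EF2 ->].
(* Both families are glued into one over the disjoint union, to which the product rule applies; the
   resulting product then splits along [J1]. *)
pose E i := if i \in J1 then E1 i else E2 i.
have J2E i : i \in J2 -> E i = E2 i.
  by move=> iJ; rewrite /E; case: ifP => // /dJ; rewrite iJ.
have J1E i : i \in J1 -> E i = E1 i by rewrite /E => ->.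
rewrite (_ : _ `&` _ = \bigcap_(i in [set i | i \in J1 :|: J2]) E i); last first.
  apply/seteqP; split => [w [h1 h2] i /=|w h].
    by rewrite inE => /orP[iJ|iJ]; [rewrite J1E//; exact: h1|rewrite J2E//; exact: h2].
  by split=> i /= iJ; [rewrite -J1E//|rewrite -J2E//]; apply: h; rewrite /= inE iJ ?orbT.
rewrite Find; last first.
  move=> i; rewrite inE => /orP[iJ|iJ]; [rewrite J1E//; exact: EF1|].
  by rewrite J2E//; exact: EF2.
rewrite Find// Find// (bigID [in J1])/=; congr (_ * _)%E.
  apply: eq_big => [i|i /andP[_ iJ]]; last by rewrite J1E.
  by rewrite inE; case: (i \in J1); rewrite ?andbF.
apply: eq_big => [i|i /andP[+ iJ]]; last by rewrite inE (negbTE iJ) => /J2E ->.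
rewrite inE; case: (boolP (i \in J1)) => [/dJ/negbTE ->|_] //=.
by rewrite andbT.
Qed.

Lemma eq_group_measure (J : {set I}) (m1 m2 : {measure set T -> \bar R}) :
  (m1 [set: T] < +oo)%E -> (forall A, cylinders J A -> m1 A = m2 A) ->
  forall A, <<s group J >> A -> m1 A = m2 A.
Proof.
move=> m1T m12 A /sub_sigma_group.
apply: (g_sigma_algebra_measure_unique (cylinders J) _ (fun=> setT)) => //.
- exact: cylinders_measurable.
- by move=> _; exact: cylindersT.
- exact: bigcup_const.
- exact: cylinders_setI.
Qed.

(** Cylinders are replaced by generated sets one factor at a time: for fixed [B], restriction to [B]
    and scaling by [P B] are two finite measures that agree on a pi-system containing the whole
    space. *)
Lemma indep_group (J1 J2 : {set I}) : (forall i, i \in J1 -> i \notin J2) ->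
  indep2 (group J1) (group J2).
Proof.
move=> dJ.
have prodm B (mB : measurable B) (J : {set I}) :
    (forall A, cylinders J A -> P (A `&` B) = (P A * P B)%E) ->
    forall A, <<s group J >> A -> P (A `&` B) = (P A * P B)%E.
  move=> h A GA.
  have PBf : P B \is a fin_num by exact: fin_num_measure.
  have PB0 : 0 <= fine (P B) by rewrite fine_ge0.
  have -> : P (A `&` B) = mrestr P mB A by [].
  have -> : (P A * P B)%E = mscale (NngNum PB0) P A.
    by rewrite /mscale /= fineK// muleC.
  apply: eq_group_measure GA; first by rewrite /mrestr ltey_eq fin_num_measure//.
  move=> A' cA'; change (P (A' `&` B) = (fine (P B))%:E * P A')%E.
  by rewrite h// fineK// muleC.
have mG J A : <<s group J >> A -> measurable A.
  by apply: sub_g_sigma_measurable; exact: group_measurable.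
move=> A B GA GB; rewrite setIC muleC; apply: (prodm A (mG _ _ GA) J2) => // B' cB'.
rewrite setIC muleC; apply: (prodm B' _ J1) => //; first exact: cylinders_measurable cB'.
by move=> A' cA'; exact (indep_cylinders dJ cA' cB').
Qed.

End grouping.
End independence.

(** * Rank-one perturbations *)

Section rank_one.
Variable R : realType.
Local Notation C := R[i].
Variables (n : nat) (L : 'M[R]_n) (x : R) (u : 'cV[R]_n) (z : C).
Hypotheses (symL : L^T = L) (z0 : complex.Im z != 0).
Local Notation Y := (toCmx u).
Local Notation L1 := (L + x *: (u *m u^T)).
Local Notation G := (resolvent L1 z).
Local Notation G' := (resolvent L z).
Local Notation s := `|complex.Im z|.

Lemma rank_one_sym : L1^T = L1.
Proof. by rewrite linearD linearZ /= trmx_mul trmxK symL. Qed.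

Lemma resolvent_rank_one : G - G' = - (x%:C *: (G' *m (Y *m Y^T) *m G)).
Proof.
rewrite resolventB// ?rank_one_sym// addrC addKr map_mxZ map_mxM/= -map_trmx.
by rewrite -scalemxAr -scalemxAl.
Qed.

(** The difference is a single quadratic form in [Y], as the perturbation has rank one; therefore no
    factor [n] appears. *)
Lemma normc_tr_rank_one D c : 0 <= c -> opbound D c ->
  nc (\tr (G *m D) - \tr (G' *m D)) <= `|x| * fsq Y * (c / s ^+ 2).
Proof.
move=> c0 Dc.
have -> : \tr (G *m D) - \tr (G' *m D) = - (x%:C * bform Y (G *m D *m G') Y).
  rewrite -raddfB/= -mulmxBl resolvent_rank_one mulNmx raddfN/= -scalemxAl mxtraceZ.
  congr (- (_ * _)).
  by rewrite bform_tr -[_ *m G' *m _]mulmxA [RHS]mxtrace_mulC !mulmxA.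
rewrite normcN normcM normc_real -mulrA ler_wpM2l//.
have h : opbound (G *m D *m G') (s^-1 * c * s^-1).
  apply: opboundM; [by rewrite mulr_ge0 ?invr_ge0|apply: opboundM|].
  - by rewrite invr_ge0.
  - by apply: opbound_resolvent => //; exact: rank_one_sym.
  - exact: Dc.
  - exact: opbound_resolvent.
apply: le_trans (bform_le _ _ h) _.
rewrite -expr2 fnorm_sqr mulrC ler_wpM2l ?fsq_ge0//.
by rewrite mulrAC -expr2 exprVn mulrC.
Qed.

(** The resolvent identity [G' = G + x G' Y Y^T G], multiplied by [D] and placed between [Y^T] and
    [Y]. Without division, it needs no lower bound on the random denominator [1 + x Y^T G' Y]. *)
Lemma bform_rank_one D :
  bform Y (G' *m D) Y = (1 + x%:C * bform Y G' Y) * bform Y (G *m D) Y.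
Proof.
have e : G' *m D = G *m D + x%:C *: (G' *m Y *m (Y^T *m (G *m D))).
  rewrite -[X in X *m D](subrK G) -opprB resolvent_rank_one opprK mulmxDl addrC.
  by rewrite -scalemxAl !mulmxA.
rewrite /bform e mulmxDr mulmxDl mxE mulrDl mul1r; congr (_ + _).
rewrite -scalemxAr -scalemxAl mxE -mulrA; congr (_ * _).
have -> : Y^T *m (G' *m Y *m (Y^T *m (G *m D))) *m Y =
  (Y^T *m G' *m Y) *m (Y^T *m (G *m D) *m Y) by rewrite !mulmxA.
by rewrite mxE big_ord1.
Qed.

End rank_one.

Section grouped_measurability.
Context (R : realType) d (T : measurableType d) (P : probability T R) (n m : nat).
Variables (xi : 'I_m -> {RV P >-> R}) (y : 'I_m -> 'I_n -> {RV P >-> R}).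

Definition entry_sigma (k : 'I_m + 'I_m) : set (set T) :=
  match k with inl a => sigma_rv (xi a) | inr a => sigma_rvec (y a) end.

Lemma sigma_rv_measurable a : sigma_rv (xi a) `<=` measurable.
Proof. by move=> _ [B mB <-]; exact: (measurable_funP (xi a)). Qed.

Lemma sigma_rvecE a i (B : set R) : measurable B -> sigma_rvec (y a) (y a i @^-1` B).
Proof.
move=> mB; apply: sub_gen_smallest.
rewrite (bigD1 i)//=; left; exists B => //.
by rewrite setTI.
Qed.

Lemma entry_sigma_measurable k : entry_sigma k `<=` measurable.
Proof.
case: k => a /=; first exact: sigma_rv_measurable.
apply: sub_g_sigma_measurable => A.
elim/big_ind : _ => // [B1 B2 h1 h2 [/h1|/h2]//|i _ [B mB <-]].
exact: (measurable_funP (y a i)).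
Qed.

Lemma entry_sigma_setI k : setI_closed (entry_sigma k).
Proof.
case: k => a /=; last first.
  move=> A B hA hB; exact: (@measurableI _ (g_sigma_algebraType
    (\big[setU/set0]_(i < n) preimage_set_system [set: T] (y a i) measurable))).
move=> _ _ [A mA <-] [B mB <-]; exists (A `&` B); first exact: measurableI.
by rewrite preimage_setI setIACA setIid.
Qed.

Lemma entry_sigmaT k : entry_sigma k [set: T].
Proof.
case: k => a /=; last first.
  exact: (@measurableT _ (g_sigma_algebraType
    (\big[setU/set0]_(i < n) preimage_set_system [set: T] (y a i) measurable))).
by exists [set: R] => //; rewrite preimage_setT setIT.
Qed.

Lemma measurable_xi_group (J : {set 'I_m + 'I_m}) a : inl a \in J ->
  measurable_fun [set: g_sigma_algebraType (group entry_sigma J)] (xi a : T -> R).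
Proof.
move=> aJ _ B mB; apply: sub_gen_smallest; exists (inl a) => //=.
by exists B.
Qed.

Lemma measurable_y_group (J : {set 'I_m + 'I_m}) a i : inr a \in J ->
  measurable_fun [set: g_sigma_algebraType (group entry_sigma J)] (y a i : T -> R).
Proof.
move=> aJ _ B mB; apply: sub_gen_smallest; exists (inr a) => //=.
by rewrite setTI; exact: sigma_rvecE.
Qed.

Lemma group_entry_measurable (J : {set 'I_m + 'I_m}) : group entry_sigma J `<=` measurable.
Proof. by apply: group_measurable; exact: entry_sigma_measurable. Qed.

End grouped_measurability.

(** * The matrix model at a fixed size *)

Section sample_covariance.
Context (R : realType) d (T : measurableType d) (P : probability T R) (n m : nat).
Variables (xi : 'I_m -> {RV P >-> R}) (y : 'I_m -> 'I_n -> {RV P >-> R}).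
Local Notation C := R[i].

Definition ycol a w : 'cV[C]_n := toCmx (rvec (y a) w).
Definition ysq a w : R := fsq (ycol a w).
Definition gram a w : 'M[R]_n := rvec (y a) w *m (rvec (y a) w)^T.
Definition covmx w : 'M[R]_n := \sum_(a < m) xi a w *: gram a w.
Definition covmx_but a w : 'M[R]_n := \sum_(b < m | b != a) xi b w *: gram b w.
Definition rsv z w := resolvent (covmx w) z.
Definition rsv_but a z w := resolvent (covmx_but a w) z.

(* [K] bounds all the moments and norms, [rho] all the quantities that tend
   to 0 as [n] grows. *)
Record regular (Q : 'I_m -> 'M[R]_n) (B : 'M[R]_n) (K rho : R) : Prop := Regular {
  reg_n : (0 < n)%N;
  reg_m : (0 < m)%N;
  reg_K : 1 <= K;
  reg_rho0 : 0 < rho;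
  reg_rho1 : rho <= 1;
  reg_rhon : 1 <= rho ^+ 2 * n%:R;
  reg_ind : mutually_independent P (entry_sigma xi y);
  reg_id : forall a b (g : C),
    cexp P (fun w => (xi a w)%:C * (1 + (xi a w)%:C * g)^-1) =
    cexp P (fun w => (xi b w)%:C * (1 + (xi b w)%:C * g)^-1);
  reg_xi2i : forall a, rint P (fun w => xi a w ^+ 2);
  reg_xi2 : forall a, m%:R * \int[P]_w (xi a w ^+ 2) <= K * n%:R;
  reg_xi1 : forall a, m%:R * `|\int[P]_w xi a w| <= K * n%:R;
  reg_y4i : forall a, rint P (fun w => ysq a w ^+ 2);
  reg_y4 : forall a, \int[P]_w (ysq a w ^+ 2) <= K;
  reg_Qop : forall a, opbound (toCmx (Q a)) (K / n%:R);
  reg_Qtr : forall a, `|\tr (Q a) - 1| <= rho;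
  reg_Qmom : forall a i j, \int[P]_w (y a i w * y a j w) = Q a i j;
  reg_var : forall a (D : 'M[R]_n) c, 0 <= c -> opbound (toCmx D) c ->
    \int[P]_w ((edot (D *m rvec (y a) w) (rvec (y a) w) - \tr (D *m Q a)) ^+ 2)
      <= rho ^+ 2 * c ^+ 2;
  reg_B : Num.sqrt n%:R * fnorm (toCmx B) <= rho;
  reg_avg : m%:R^-1 *: \sum_(a < m) Q a = n%:R^-1 *: 1%:M + B
}.

(** The approximate equation asks the same constant to dominate also [m |c| / n], with [c] the mean
    of [xi / (1 + xi g)]; it is reached by enlarging [K]. *)
Lemma regular_mono Q B K K' rho : K <= K' -> regular Q B K rho -> regular Q B K' rho.
Proof.
move=> KK' [n0 m0 K1 r0 r1 rn i id x2i x2 x1 y4i y4 qo qt qm qv b av].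
have nn : 0 <= n%:R :> R by [].
split => //; first exact: le_trans KK'.
- by move=> a; apply: le_trans (x2 a) _; rewrite ler_wpM2r.
- by move=> a; apply: le_trans (x1 a) _; rewrite ler_wpM2r.
- by move=> a; apply: le_trans KK'.
- move=> a x; apply: le_trans (qo a x) _; rewrite ler_wpM2r ?fnorm_ge0//.
  by rewrite ler_wpM2r ?invr_ge0.
Qed.

Lemma gram_sym a w : (gram a w)^T = gram a w.
Proof. by rewrite /gram trmx_mul trmxK. Qed.

Lemma covmx_but_sym a w : (covmx_but a w)^T = covmx_but a w.
Proof.
rewrite /covmx_but linear_sum; apply: eq_bigr => b _.
by rewrite linearZ/= gram_sym.
Qed.

Lemma covmxE a w : covmx w = covmx_but a w + xi a w *: gram a w.
Proof. by rewrite /covmx (bigD1 a)//= addrC. Qed.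

Lemma covmx_sym w : (covmx w)^T = covmx w.
Proof.
by rewrite /covmx linear_sum; apply: eq_bigr => b _; rewrite linearZ/= gram_sym.
Qed.

Lemma ysq_ge0 a w : 0 <= ysq a w.
Proof. exact: fsq_ge0. Qed.

Lemma ysqE a w : ysq a w = \sum_i y a i w ^+ 2.
Proof.
by apply: eq_bigr => i _; rewrite big_ord1 !mxE normc_real real_normK ?num_real.
Qed.

Lemma normr_yy_le a i j w : `|y a i w * y a j w| <= ysq a w.
Proof.
have h k : y a k w ^+ 2 <= ysq a w.
  by rewrite ysqE (bigD1 k)//= lerDl sumr_ge0// => l _; exact: sqr_ge0.
rewrite normrM -(ler_pXn2r (n := 2)) ?nnegrE ?mulr_ge0 ?ysq_ge0//.
rewrite exprMn !real_normK ?num_real// [leRHS]expr2.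
exact: ler_pM (sqr_ge0 _) (sqr_ge0 _) (h i) (h j).
Qed.

Lemma measurable_ysq a : measurable_fun [set: T] (ysq a).
Proof.
have -> : ysq a = fun w => \sum_i y a i w ^+ 2.
  by apply/funext => w; exact: ysqE.
by apply: measurable_sum => i; exact: measurable_funX.
Qed.

Lemma measurable_covmx i j : measurable_fun [set: T] (fun w => covmx w i j).
Proof.
under eq_fun do rewrite /covmx summxE.
apply: measurable_sum => a; under eq_fun do rewrite !mxE big_ord1 !mxE.
by apply: measurable_funM => //; exact: measurable_funM.
Qed.

Lemma measurable_covmx_but a (J : {set 'I_m + 'I_m}) i j :
  (forall b, b != a -> inl b \in J /\ inr b \in J) ->
  measurable_fun [set: g_sigma_algebraType (group (entry_sigma xi y) J)]
    (fun w => covmx_but a w i j).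
Proof.
move=> hJ; under eq_fun do rewrite /covmx_but summxE big_mkcond/=.
apply: measurable_sum => b; case: (b != a) (hJ b) => [/(_ isT)[bl br]|_]; last exact: measurable_cst.
under eq_fun do rewrite !mxE big_ord1 !mxE.
apply: measurable_funM; first exact: measurable_xi_group.
by apply: measurable_funM; exact: measurable_y_group.
Qed.

Lemma mxmeas_rsv z : complex.Im z != 0 -> mxmeas (rsv z).
Proof.
move=> z0; apply: mxmeas_resolvent => //; first exact: covmx_sym.
exact: measurable_covmx.
Qed.

Lemma mxmeas_rsv_but a z (J : {set 'I_m + 'I_m}) : complex.Im z != 0 ->
  (forall b, b != a -> inl b \in J /\ inr b \in J) ->
  mxmeas (rsv_but a z : g_sigma_algebraType (group (entry_sigma xi y) J) -> _).
Proof.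
move=> z0 hJ; apply: mxmeas_resolvent => //; first exact: covmx_but_sym.
by move=> i j; exact: measurable_covmx_but.
Qed.

Lemma mxmeas_rsv_butT a z : complex.Im z != 0 -> mxmeas (rsv_but a z : T -> _).
Proof.
move=> z0 i j.
have hJ b : b != a -> inl b \in [set: 'I_m + 'I_m]%SET /\
  inr b \in [set: 'I_m + 'I_m]%SET by rewrite !inE.
have [mr mi] := mxmeas_rsv_but z0 hJ i j.
by split; apply: g_sigma_measurable_fun; [|exact: mr| |exact: mi];
  exact: group_entry_measurable.
Qed.

Section bounds.
Variables (Q : 'I_m -> 'M[R]_n) (B : 'M[R]_n) (K rho : R).
Hypothesis reg : regular Q B K rho.

Let n0 := reg_n reg.
Let K1 := reg_K reg.

Lemma ngt0 : 0 < n%:R :> R. Proof. by rewrite ltr0n. Qed.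
Lemma mgt0 : 0 < m%:R :> R. Proof. by rewrite ltr0n (reg_m reg). Qed.
Lemma K_gt0 : 0 < K. Proof. exact: lt_le_trans K1. Qed.
Lemma Kn_ge0 : 0 <= K / n%:R. Proof. by rewrite divr_ge0// ltW ?K_gt0. Qed.

(** Indexing the entries of [y y^T - Q] by pairs turns quadratic forms into single sums, linear in
    the matrix. *)
Definition centered a (p : 'I_n * 'I_n) w := y a p.1 w * y a p.2 w - Q a p.1 p.2.

Lemma Q_sym a i j : Q a i j = Q a j i.
Proof.
by rewrite -!(reg_Qmom reg); apply: eq_Rintegral => w _; rewrite mulrC.
Qed.

Lemma rint_centered2 a p q : rint P (fun w => centered a p w * centered a q w).
Proof.
have mc r : measurable_fun [set: T] (centered a r).
  by apply: measurable_funB => //; exact: measurable_funM.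
have ic r : rint P (fun w => centered a r w ^+ 2).
  apply: (rint_le (fun w => 2 * ysq a w ^+ 2 + 2 * Q a r.1 r.2 ^+ 2)).
  - exact: measurable_funX.
  - move=> w; rewrite ger0_norm ?sqr_ge0// /centered.
    have h1 := normr_yy_le a r.1 r.2 w; have := ysq_ge0 a w.
    set t := y a r.1 w * y a r.2 w in h1 *; move: (ysq a w) h1 => q1 h1 q0.
    have : t ^+ 2 <= q1 ^+ 2 by rewrite -real_normK ?num_real// ler_sqr.
    by have := sqr_ge0 (t + Q a r.1 r.2); rewrite !expr2; nra.
  - by apply: rintD; [apply: rintZ; exact: (reg_y4i reg)|exact: rint_cst].
apply: (rint_le (fun w => centered a p w ^+ 2 + centered a q w ^+ 2)).
- exact: measurable_funM.
- move=> w; rewrite ler_norml; apply/andP; split.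
    by have := sqr_ge0 (centered a p w + centered a q w); rewrite !expr2; nra.
  by have := sqr_ge0 (centered a p w - centered a q w); rewrite !expr2; nra.
- exact: rintD.
Qed.

Lemma quad_centered a (D : 'M[R]_n) w :
  edot (D *m rvec (y a) w) (rvec (y a) w) - \tr (D *m Q a) =
  \sum_p D p.1 p.2 * centered a p w.
Proof.
under [RHS]eq_bigr do rewrite mulrBr.
rewrite sumrB; congr (_ - _).
  rewrite /edot -(pair_bigA _ (fun i j => D i j * (y a i w * y a j w)))/=.
  apply: eq_bigr => i _; rewrite mxE mulr_suml; apply: eq_bigr => j _.
  by rewrite !mxE; ring.
rewrite /mxtrace -(pair_bigA _ (fun i j => D i j * Q a i j))/=.
by apply: eq_bigr => i _; rewrite mxE; apply: eq_bigr => j _; rewrite Q_sym.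
Qed.

(* [D] is independent of [y_a], so the variance bound applies after freezing it. *)
Lemma var_indep a (D : T -> 'M[R]_n) c (J : {set 'I_m + 'I_m}) : 0 <= c ->
  (forall i j, measurable_fun
     [set: g_sigma_algebraType (group (entry_sigma xi y) J)] (fun w => D w i j)) ->
  inr a \notin J ->
  (forall w, opbound (toCmx (D w)) c) ->
  rint P (fun w => (\sum_p D w p.1 p.2 * centered a p w) ^+ 2) /\
  \int[P]_w ((\sum_p D w p.1 p.2 * centered a p w) ^+ 2) <= rho ^+ 2 * c ^+ 2.
Proof.
move=> c0 mD aJ Dc.
have sq (e : 'I_n * 'I_n -> R) (f : 'I_n * 'I_n -> R) :
    (\sum_p e p * f p) ^+ 2 = \sum_p \sum_q (e p * e q) * (f p * f q).
  rewrite expr2 mulr_suml; apply: eq_bigr => p _; rewrite mulr_sumr.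
  by apply: eq_bigr => q _; ring.
pose J1 : {set 'I_m + 'I_m} := [set inr a]%SET.
have dJ i : i \in J1 -> i \notin J by rewrite inE => /eqP ->.
have ind := indep_group (@entry_sigma_measurable _ _ _ _ _ _ xi y)
  (@entry_sigma_setI _ _ _ _ _ _ xi y) (@entry_sigmaT _ _ _ _ _ _ xi y)
  (reg_ind reg) dJ.
have gm := @group_entry_measurable _ _ _ P _ _ xi y.
have Dle w i j : `|D w i j| <= c.
  by rewrite -normc_real; have := opbound_entry i j (Dc w); rewrite mxE.
have mDD p q : measurable_fun [set: g_sigma_algebraType (group (entry_sigma xi y) J)]
    (fun w => D w p.1 p.2 * D w q.1 q.2) by exact: measurable_funM.
have iDD p q : rint P (fun w => D w p.1 p.2 * D w q.1 q.2).
  apply: (rint_bounded (c * c)).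
    exact: g_sigma_measurable_fun (gm J) (mDD p q).
  by move=> w; rewrite normrM ler_pM.
have mcc p q : measurable_fun [set: g_sigma_algebraType (group (entry_sigma xi y) J1)]
    (fun w => centered a p w * centered a q w).
  have mc r : measurable_fun [set: g_sigma_algebraType (group (entry_sigma xi y) J1)]
      (centered a r).
    apply: measurable_funB => //; apply: measurable_funM;
    by apply: measurable_y_group; rewrite inE.
  exact: measurable_funM.
have ip p q := rint_indep (gm J1) (gm J) ind (mcc p q) (mDD p q)
  (rint_centered2 a p q) (iDD p q).
have ep p q := Rintegral_indep (gm J1) (gm J) ind (mcc p q) (mDD p q)
  (rint_centered2 a p q) (iDD p q).
have is1 : rint P (fun w => (\sum_p D w p.1 p.2 * centered a p w) ^+ 2).
  under [X in EFin \o X]eq_fun do rewrite sq.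
  apply: rint_sum => p; apply: rint_sum => q.
  by under [X in EFin \o X]eq_fun do rewrite mulrC; exact: ip.
split=> //.
(* Independence replaces the products of centered entries by the covariances [cc p q]. At each fixed
   [w] the remaining sum is exactly the variance of the form with the deterministic matrix [D w], to
   which [reg_var] applies pointwise. *)
pose cc p q := \int[P]_w (centered a p w * centered a q w).
have -> : \int[P]_w ((\sum_p D w p.1 p.2 * centered a p w) ^+ 2) =
    \int[P]_w (\sum_p \sum_q D w p.1 p.2 * D w q.1 q.2 * cc p q).
  under eq_Rintegral do rewrite sq.
  rewrite !RintegralT_sum; last 2 first.
  - move=> p; apply: rint_sum => q.
    by under [X in EFin \o X]eq_fun do rewrite mulrC; exact: rintZ.
  - move=> p; apply: rint_sum => q.
    by under [X in EFin \o X]eq_fun do rewrite mulrC; exact: ip.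
  apply: eq_bigr => p _; rewrite !RintegralT_sum; last 2 first.
  - by move=> q; under [X in EFin \o X]eq_fun do rewrite mulrC; exact: rintZ.
  - by move=> q; under [X in EFin \o X]eq_fun do rewrite mulrC; exact: ip.
  apply: eq_bigr => q _; rewrite RintegralZr// -/(cc p q) mulrC -ep.
  by apply: eq_Rintegral => w _; rewrite mulrC.
rewrite -[leRHS]mulr1 -[X in _ * X](_ : fine (P setT) = 1); last first.
  by rewrite probability_setT.
rewrite -Rintegral_cst//; apply: RintegralT_le.
- apply: rint_sum => p; apply: rint_sum => q.
  by under [X in EFin \o X]eq_fun do rewrite mulrC; exact: rintZ.
- exact: rint_cst.
move=> w; apply: le_trans _ (reg_var reg a c0 (Dc w)).
rewrite le_eqVlt; apply/orP; left; apply/eqP.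
under [RHS]eq_Rintegral do rewrite quad_centered sq.
rewrite RintegralT_sum; last first.
  by move=> p; apply: rint_sum => q; apply: rintZ; exact: rint_centered2.
apply: eq_bigr => p _; rewrite RintegralT_sum; last first.
  by move=> q; apply: rintZ; exact: rint_centered2.
by apply: eq_bigr => q _; rewrite RintegralZl//; exact: rint_centered2.
Qed.

End bounds.
End sample_covariance.

(** * Leave-one-out estimates *)

Section leave_one_out.
Context (R : realType) d (T : measurableType d) (P : probability T R) (n m : nat).
Variables (xi : 'I_m -> {RV P >-> R}) (y : 'I_m -> 'I_n -> {RV P >-> R}).
Variables (Q : 'I_m -> 'M[R]_n) (B : 'M[R]_n) (K rho : R).
Hypothesis reg : regular xi y Q B K rho.
Local Notation C := R[i].

Definition only (k : 'I_m + 'I_m) : {set 'I_m + 'I_m} := [set k]%SET.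
(** These indices carry all the randomness of the leave-one-out resolvent. *)
Definition others a : {set 'I_m + 'I_m} := (~: [set inl a; inr a])%SET.
Definition sub_sigma (J : {set 'I_m + 'I_m}) :=
  g_sigma_algebraType (group (entry_sigma xi y) J).

Lemma sub_sigma_mono (J J' : {set 'I_m + 'I_m}) d' (T' : measurableType d') (f : T -> T') :
  {subset J <= J'} -> measurable_fun [set: sub_sigma J] (f : sub_sigma J -> T') ->
  measurable_fun [set: sub_sigma J'] (f : sub_sigma J' -> T').
Proof.
move=> JJ mf _ A mA; have := mf measurableT A mA.
apply: sub_smallest2r => [|B' [i iJ FB]]; first exact: smallest_sigma_algebra.
by exists i => //; exact: JJ.
Qed.

Lemma sub_sigma_meas J d' (T' : measurableType d') (f : T -> T') :
  measurable_fun [set: sub_sigma J] (f : sub_sigma J -> T') ->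
  measurable_fun [set: T] f.
Proof. by apply: g_sigma_measurable_fun; exact: group_entry_measurable. Qed.

Lemma sub_sigma_cmeas J (f : T -> C) : cmeas (f : sub_sigma J -> C) -> cmeas f.
Proof. by move=> [fr fi]; split; [exact: sub_sigma_meas fr|exact: sub_sigma_meas fi]. Qed.

Lemma sub_sigma_cmono (J J' : {set 'I_m + 'I_m}) (f : T -> C) :
  {subset J <= J'} -> cmeas (f : sub_sigma J -> C) -> cmeas (f : sub_sigma J' -> C).
Proof.
by move=> JJ [fr fi]; split; [exact: sub_sigma_mono JJ fr|exact: sub_sigma_mono JJ fi].
Qed.

Lemma only_others k (J : {set 'I_m + 'I_m}) : k \notin J ->
  indep2 P (group (entry_sigma xi y) (only k)) (group (entry_sigma xi y) J).
Proof.
move=> kJ; apply: indep_group.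
- exact: entry_sigma_measurable.
- exact: entry_sigma_setI.
- exact: entry_sigmaT.
- exact: reg_ind reg.
- by move=> i; rewrite inE => /eqP ->.
Qed.

Section factor.
Variables (k : 'I_m + 'I_m) (J : {set 'I_m + 'I_m}).
Hypothesis kJ : k \notin J.
Variables (X Y : T -> R) (X' Y' : T -> C).
Hypothesis mX : measurable_fun [set: sub_sigma (only k)] (X : sub_sigma (only k) -> R).
Hypothesis mY : measurable_fun [set: sub_sigma J] (Y : sub_sigma J -> R).
Hypotheses (iX : rint P X) (iY : rint P Y).

Lemma rint_factor : rint P (fun w => X w * Y w).
Proof.
exact: (rint_indep (@group_entry_measurable _ _ _ _ _ _ _ _ _)
  (@group_entry_measurable _ _ _ _ _ _ _ _ _) (only_others kJ) mX mY iX iY).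
Qed.

Lemma Rintegral_factor :
  \int[P]_w (X w * Y w) = (\int[P]_w X w) * (\int[P]_w Y w).
Proof.
exact: (Rintegral_indep (@group_entry_measurable _ _ _ _ _ _ _ _ _)
  (@group_entry_measurable _ _ _ _ _ _ _ _ _) (only_others kJ) mX mY iX iY).
Qed.

Hypothesis mX' : cmeas (X' : sub_sigma (only k) -> C).
Hypothesis mY' : cmeas (Y' : sub_sigma J -> C).
Hypotheses (iX' : cint P X') (iY' : cint P Y').

Lemma cint_factor : cint P (fun w => X' w * Y' w).
Proof.
exact: (cint_indep (@group_entry_measurable _ _ _ _ _ _ _ _ _)
  (@group_entry_measurable _ _ _ _ _ _ _ _ _) (only_others kJ) mX' mY' iX' iY').
Qed.

Lemma cexp_factor : cexp P (fun w => X' w * Y' w) = cexp P X' * cexp P Y'.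
Proof.
exact: (cexp_indep (@group_entry_measurable _ _ _ _ _ _ _ _ _)
  (@group_entry_measurable _ _ _ _ _ _ _ _ _) (only_others kJ) mX' mY' iX' iY').
Qed.

End factor.

Lemma measurable_xi_only a :
  measurable_fun [set: sub_sigma (only (inl a))] (xi a : sub_sigma (only (inl a)) -> R).
Proof. by apply: measurable_xi_group; rewrite inE. Qed.

Lemma measurable_ysq_group (J : {set 'I_m + 'I_m}) a : inr a \in J ->
  measurable_fun [set: sub_sigma J] (ysq y a : sub_sigma J -> R).
Proof.
move=> aJ; have -> : ysq y a = fun w => \sum_i y a i w ^+ 2.
  by apply/funext => w; exact: ysqE.
apply: measurable_sum => i; apply: measurable_funX; exact: measurable_y_group.
Qed.

Let K1 := reg_K reg.
Let rho0 := reg_rho0 reg.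
Let rho1 := reg_rho1 reg.
Let K0 : 0 < K := K_gt0 reg.
Let n0 : 0 < n%:R :> R := ngt0 reg.
Let m0 : 0 < m%:R :> R := mgt0 reg.

(** From [1 <= rho^2 n] and [rho <= 1]; every stray factor [1 / n] is absorbed into [rho] this
    way. *)
Lemma inv_n_le : n%:R^-1 <= rho.
Proof.
have h := reg_rhon reg; rewrite -[leLHS]mul1r ler_pdivrMr//.
apply: le_trans h _; apply: ler_wpM2r; first exact: ltW.
by rewrite expr2 -[leRHS]mul1r ler_wpM2r// ltW.
Qed.

Lemma rint_xi a : rint P (xi a).
Proof.
apply: (rint_le (fun w => 1 + xi a w ^+ 2)) => //.
  by move=> w; have := sqr_ge0 (`|xi a w| - 1); rewrite -[xi a w ^+ 2]real_normK ?num_real// !expr2; nra.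
by apply: rintD; [exact: rint_cst|exact: reg_xi2i reg a].
Qed.

Lemma rint_ysq a : rint P (ysq y a).
Proof.
apply: (rint_le (fun w => 1 + ysq y a w ^+ 2)).
- exact: measurable_ysq.
- move=> w; rewrite ger0_norm ?ysq_ge0//.
  by have := sqr_ge0 (ysq y a w - 1); rewrite !expr2; have := ysq_ge0 y a w; nra.
by apply: rintD; [exact: rint_cst|exact: reg_y4i reg a].
Qed.

Lemma int_ysq_ge0 a : 0 <= \int[P]_w ysq y a w.
Proof. by apply: Rintegral_ge0 => w _; exact: ysq_ge0. Qed.

Lemma int_ysq_le a : \int[P]_w ysq y a w <= 2 * K.
Proof.
have : \int[P]_w ysq y a w <= \int[P]_w (1 + ysq y a w ^+ 2).
  apply: RintegralT_le; [exact: rint_ysq| |].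
    by apply: rintD; [exact: rint_cst|exact: reg_y4i reg a].
  by move=> w; have := sqr_ge0 (ysq y a w - 1); rewrite !expr2; have := ysq_ge0 y a w; nra.
rewrite RintegralD//; [|exact: rint_cst|exact: reg_y4i reg a].
rewrite RintegralT_cst.
by have := reg_y4 reg a; have := K1; lra.
Qed.

Lemma int_xi2_ge0 a : 0 <= \int[P]_w (xi a w ^+ 2).
Proof. by apply: Rintegral_ge0 => w _; exact: sqr_ge0. Qed.

Lemma int_xi2_le a : \int[P]_w (xi a w ^+ 2) <= K * n%:R / m%:R.
Proof. by rewrite ler_pdivlMr// mulrC; exact: reg_xi2 reg a. Qed.

(** Young's inequality [|x| <= rho x^2 / 2 + 1 / (2 rho)], together with [1 / (2 rho) <= rho n / 2].
    The outcome is [o(n)], which suffices since deleting a summand changes a trace by a multiple of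
    [|xi| |y|^2 / n]. *)
Lemma int_absxi_le a : \int[P]_w `|xi a w| <= K * rho * n%:R.
Proof.
have : \int[P]_w `|xi a w| <= \int[P]_w (rho / 2 * xi a w ^+ 2 + (2 * rho)^-1).
  apply: RintegralT_le; first by apply: rint_norm; exact: rint_xi.
    by apply: rintD; [apply: rintZ; exact: reg_xi2i reg a|exact: rint_cst].
  move=> w; rewrite -[xi a w ^+ 2]real_normK ?num_real//.
  have -> : rho / 2 * `|xi a w| ^+ 2 + (2 * rho)^-1 =
    `|xi a w| + (2 * rho)^-1 * (rho * `|xi a w| - 1) ^+ 2.
    by field; rewrite gt_eqF.
  by rewrite lerDl mulr_ge0 ?sqr_ge0// invr_ge0 mulr_ge0// ltW.
rewrite RintegralD//; [|by apply: rintZ; exact: reg_xi2i reg a|exact: rint_cst].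
rewrite RintegralT_cst RintegralZl//; last exact: reg_xi2i reg a.
move=> h; apply: le_trans h _.
have h1 : \int[P]_w (xi a w ^+ 2) <= K * n%:R.
  apply: le_trans (int_xi2_le a) _; rewrite ler_pdivrMr//.
  by apply: ler_peMr; [rewrite mulr_ge0// ltW|rewrite ler1n (reg_m reg)].
have h2 : (2 * rho)^-1 <= rho * n%:R / 2.
  rewrite -[leLHS]mul1r ler_pdivrMr ?mulr_gt0//.
  by have := reg_rhon reg; rewrite expr2; lra.
have : rho / 2 * \int[P]_w (xi a w ^+ 2) <= rho / 2 * (K * n%:R).
  by rewrite ler_wpM2l// divr_ge0// ltW.
have : rho * n%:R <= K * rho * n%:R.
  by apply: ler_wpM2r; [exact: ltW|apply: ler_peMl => //; exact: ltW].
by lra.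
Qed.

Lemma rint_absxi_ysq a : rint P (fun w => `|xi a w| * ysq y a w).
Proof.
apply: (rint_factor (k := inl a) (J := only (inr a))).
- by rewrite inE.
- by apply: measurableT_comp => //; exact: measurable_xi_only.
- by apply: measurable_ysq_group; rewrite inE.
- by apply: rint_norm; exact: rint_xi.
- exact: rint_ysq.
Qed.

Lemma int_absxi_ysq_le a :
  \int[P]_w (`|xi a w| * ysq y a w) <= 2 * K ^+ 2 * rho * n%:R.
Proof.
rewrite (Rintegral_factor (k := inl a) (J := only (inr a))); last 5 first.
- by rewrite inE.
- by apply: measurableT_comp => //; exact: measurable_xi_only.
- by apply: measurable_ysq_group; rewrite inE.
- by apply: rint_norm; exact: rint_xi.
- exact: rint_ysq.
have -> : 2 * K ^+ 2 * rho * n%:R = (K * rho * n%:R) * (2 * K) by ring.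
apply: ler_pM; [exact: Rintegral_ge0|exact: int_ysq_ge0|exact: int_absxi_le|].
exact: int_ysq_le.
Qed.

Lemma rint_xi2_ysq2 a : rint P (fun w => xi a w ^+ 2 * ysq y a w ^+ 2).
Proof.
apply: (rint_factor (k := inl a) (J := only (inr a))).
- by rewrite inE.
- by apply: measurable_funX; exact: measurable_xi_only.
- by apply: measurable_funX; apply: measurable_ysq_group; rewrite inE.
- exact: reg_xi2i reg a.
- exact: reg_y4i reg a.
Qed.

Lemma int_xi2_ysq2_le a :
  \int[P]_w (xi a w ^+ 2 * ysq y a w ^+ 2) <= K ^+ 2 * n%:R / m%:R.
Proof.
rewrite (Rintegral_factor (k := inl a) (J := only (inr a))); last 5 first.
- by rewrite inE.
- by apply: measurable_funX; exact: measurable_xi_only.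
- by apply: measurable_funX; apply: measurable_ysq_group; rewrite inE.
- exact: reg_xi2i reg a.
- exact: reg_y4i reg a.
have -> : K ^+ 2 * n%:R / m%:R = (K * n%:R / m%:R) * K by ring.
apply: ler_pM; [exact: int_xi2_ge0| |exact: int_xi2_le|exact: reg_y4 reg a].
by apply: Rintegral_ge0 => w _; exact: sqr_ge0.
Qed.

Section fixed_z.
Variable z : C.
Hypothesis z0 : complex.Im z != 0.
Local Notation s := `|complex.Im z|.
Local Notation G := (rsv xi y z).
Local Notation G' a := (rsv_but xi y a z).
Local Notation q a := (ysq y a).
Local Notation Y a := (ycol y a).

Let s0 : 0 < s. Proof. by rewrite normr_gt0. Qed.

Lemma opbound_rsv w : opbound (G w) s^-1.
Proof. by apply: opbound_resolvent => //; exact: covmx_sym. Qed.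

Lemma opbound_rsv_but a w : opbound (G' a w) s^-1.
Proof. by apply: opbound_resolvent => //; exact: covmx_but_sym. Qed.

Lemma opbound_rsvM (D : 'M[C]_n) c w : opbound D c -> opbound (G w *m D) (s^-1 * c).
Proof.
by move=> Dc; apply: (opboundM _ (opbound_rsv w) Dc); rewrite invr_ge0.
Qed.

Lemma opbound_rsv_butM (D : 'M[C]_n) c a w :
  opbound D c -> opbound (G' a w *m D) (s^-1 * c).
Proof.
by move=> Dc; apply: (opboundM _ (opbound_rsv_but a w) Dc); rewrite invr_ge0.
Qed.

Lemma normc_tr_rsv_but a D c w : 0 <= c -> opbound D c ->
  nc (\tr (G w *m D) - \tr (G' a w *m D)) <= `|xi a w| * q a w * (c / s ^+ 2).
Proof.
move=> c0 Dc; rewrite /rsv (covmxE _ _ a).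
by apply: normc_tr_rank_one => //; exact: covmx_but_sym.
Qed.

Lemma normc_tr_rsv D c w : 0 <= c -> opbound D c ->
  nc (\tr (G w *m D)) <= s^-1 * c * n%:R.
Proof.
by move=> c0 Dc; apply: opbound_tr (opbound_rsvM w Dc); rewrite mulr_ge0// invr_ge0.
Qed.

Lemma normc_tr_rsv_but_le a D c w : 0 <= c -> opbound D c ->
  nc (\tr (G' a w *m D)) <= s^-1 * c * n%:R.
Proof.
by move=> c0 Dc; apply: opbound_tr (opbound_rsv_butM a w Dc);
  rewrite mulr_ge0// invr_ge0.
Qed.

Lemma bform_rsv_but a D w : bform (Y a w) (G' a w *m D) (Y a w) =
  (1 + (xi a w)%:C * bform (Y a w) (G' a w) (Y a w)) *
  bform (Y a w) (G w *m D) (Y a w).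
Proof.
rewrite /rsv (covmxE _ _ a) /ycol.
by apply: bform_rank_one => //; exact: covmx_but_sym.
Qed.

Lemma normc_bform_rsv a D c w : opbound D c ->
  nc (bform (Y a w) (G w *m D) (Y a w)) <= s^-1 * c * q a w.
Proof.
move=> Dc; apply: le_trans (bform_le _ _ (opbound_rsvM w Dc)) _.
by rewrite -expr2 fnorm_sqr.
Qed.

Lemma normc_bform_rsv_but a D c w : opbound D c ->
  nc (bform (Y a w) (G' a w *m D) (Y a w)) <= s^-1 * c * q a w.
Proof.
move=> Dc; apply: le_trans (bform_le _ _ (opbound_rsv_butM a w Dc)) _.
by rewrite -expr2 fnorm_sqr.
Qed.

(* [L G = 1 + z G], traced against [D]. *)
Lemma tr_rsv_sum D w : \tr D + z * \tr (G w *m D) =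
  \sum_a (xi a w)%:C * bform (Y a w) (G w *m D) (Y a w).
Proof.
have : \tr (toCmx (covmx xi y w) *m G w *m D) = \tr D + z * \tr (G w *m D).
  rewrite mulmx_toC_resolvent ?covmx_sym// mulmxDl mul1mx raddfD/=.
  by rewrite -scalemxAl mxtraceZ.
move=> <-; rewrite /covmx (raddf_sum (map_mx toC)) !mulmx_suml raddf_sum.
apply: eq_bigr => a _ /=; rewrite map_mxZ map_mxM/= -map_trmx bform_tr -!scalemxAl mxtraceZ.
by rewrite -mulmxA mxtrace_mulC.
Qed.

Lemma mxmeas_ycol (J : {set 'I_m + 'I_m}) a : inr a \in J ->
  mxmeas (Y a : sub_sigma J -> _).
Proof.
move=> aJ i j; rewrite /ycol; under eq_fun do rewrite !mxE.
by apply: cmeas_real; exact: measurable_y_group.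
Qed.

Lemma mxmeas_ycolT a : mxmeas (Y a : T -> _).
Proof.
by move=> i j; rewrite /ycol; under eq_fun do rewrite !mxE; exact: cmeas_real.
Qed.

Lemma cmeas_bform d' (T' : measurableType d') (U : T' -> 'cV[C]_n)
    (M : T' -> 'M[C]_n) : mxmeas U -> mxmeas M ->
  cmeas (fun w => bform (U w) (M w) (U w)).
Proof.
move=> mU mM; rewrite /bform; apply: mxmeasM => //; apply: mxmeasM => //.
exact: mxmeas_tr.
Qed.

Lemma othersP a b : b != a -> inl b \in others a /\ inr b \in others a.
Proof. by move=> ba; rewrite !inE /= !orbF; split; apply: contra ba => /eqP[->]. Qed.

Lemma mxmeas_rsv_others a : mxmeas (G' a : sub_sigma (others a) -> _).
Proof. by apply: mxmeas_rsv_but => //; exact: othersP. Qed.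

(** The variance hypothesis concerns real matrices, so it is applied to the real and imaginary parts
    of the leave-one-out resolvent; each contributes [rho^2 / (Im z)^2], whence the factor 2. *)
Lemma quad_form_variance a :
  rint P (fun w => nc (bform (Y a w) (G' a w) (Y a w) -
                       \tr (G' a w *m toCmx (Q a))) ^+ 2) /\
  \int[P]_w (nc (bform (Y a w) (G' a w) (Y a w) -
                 \tr (G' a w *m toCmx (Q a))) ^+ 2) <= 2 * rho ^+ 2 / s ^+ 2.
Proof.
pose Dr w : 'M[R]_n := map_mx (@complex.Re R) (G' a w).
pose Di w : 'M[R]_n := map_mx (@complex.Im R) (G' a w).
have mG := mxmeas_rsv_others a.
have hC (M : 'M[C]_n) w : bform (Y a w) M (Y a w) - \tr (M *m toCmx (Q a)) =
    \sum_p M p.1 p.2 * (centered y Q a p w)%:C.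
  rewrite bformE -(pair_bigA _ (fun i j => M i j * (centered y Q a (i, j) w)%:C))/=.
  rewrite /mxtrace -sumrB; apply: eq_bigr => i _.
  rewrite [(M *m _) i i]mxE -sumrB; apply: eq_bigr => j _; rewrite !mxE /centered/=.
  by rewrite rmorphB rmorphM/= (Q_sym reg a j i); ring.
have hn w : nc (bform (Y a w) (G' a w) (Y a w) - \tr (G' a w *m toCmx (Q a))) ^+ 2 =
    (\sum_p Dr w p.1 p.2 * centered y Q a p w) ^+ 2 +
    (\sum_p Di w p.1 p.2 * centered y Q a p w) ^+ 2.
  rewrite hC normc_sqr !raddf_sum; congr (_ ^+ 2 + _ ^+ 2); apply: eq_bigr => p _.
    by rewrite /= [_ * _%:C]mulrC ReM_real mulrC mxE.
  by rewrite /= [_ * _%:C]mulrC ImM_real mulrC mxE.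
have s'0 : 0 <= s^-1 by rewrite invr_ge0.
(* On a real vector [u], the product [Dr u] is the entrywise real part of [G' u], hence not
   longer. *)
have obr w : opbound (toCmx (Dr w)) s^-1.
  apply: opbound_real => // u; rewrite -!fnorm_toC.
  apply: le_trans (opbound_rsv_but a w (toCmx u)); rewrite -[leLHS]ger0_norm ?fnorm_ge0//.
  rewrite -(ler_pXn2r (n := 2)) ?nnegrE ?fnorm_ge0//ger0_norm ?fnorm_ge0//.
  rewrite !fnorm_sqr; apply: ler_sum => i _; rewrite !big_ord1.
  rewrite ler_pXn2r ?nnegrE ?normc_ge0//.
  rewrite mxE normc_real; apply: le_trans (normr_Re_le _); rewrite !mxE raddf_sum.
  rewrite le_eqVlt; apply/orP; left; apply/eqP; congr `|_|; apply: eq_bigr => j _.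
  by rewrite /= !mxE mulrC [_ * _%:C]mulrC ReM_real.
have obi w : opbound (toCmx (Di w)) s^-1.
  apply: opbound_real => // u; rewrite -!fnorm_toC.
  apply: le_trans (opbound_rsv_but a w (toCmx u)); rewrite -[leLHS]ger0_norm ?fnorm_ge0//.
  rewrite -(ler_pXn2r (n := 2)) ?nnegrE ?fnorm_ge0//ger0_norm ?fnorm_ge0//.
  rewrite !fnorm_sqr; apply: ler_sum => i _; rewrite !big_ord1.
  rewrite ler_pXn2r ?nnegrE ?normc_ge0//.
  rewrite mxE normc_real; apply: le_trans (normr_Im_le _); rewrite !mxE raddf_sum.
  rewrite le_eqVlt; apply/orP; left; apply/eqP; congr `|_|; apply: eq_bigr => j _.
  by rewrite /= !mxE mulrC [_ * _%:C]mulrC ImM_real.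
have aJ : inr a \notin others a by rewrite !inE eqxx orbT.
have mDr i j : measurable_fun [set: sub_sigma (others a)]
    (fun w : sub_sigma (others a) => Dr w i j).
  by under eq_fun do rewrite mxE; have [] := mG i j.
have mDi i j : measurable_fun [set: sub_sigma (others a)]
    (fun w : sub_sigma (others a) => Di w i j).
  by under eq_fun do rewrite mxE; have [] := mG i j.
have [ir er] := var_indep reg s'0 mDr aJ obr.
have [ii ei] := var_indep reg s'0 mDi aJ obi.
split.
  by under [X in EFin \o X]eq_fun do rewrite hn; exact: rintD.
under eq_Rintegral do rewrite hn.
rewrite RintegralD//; apply: le_trans (lerD er ei) _.
by rewrite exprVn; lra.
Qed.

End fixed_z.

(** Given [M], which does not involve [y_a], the matrix [y_a y_a^T] has mean [Q_a]; independence is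
    used entry by entry. *)
Lemma cexp_bform a (M : T -> 'M[C]_n) k :
  mxmeas (M : sub_sigma (others a) -> _) -> (forall w, opbound (M w) k) ->
  cexp P (fun w => bform (ycol y a w) (M w) (ycol y a w)) =
  cexp P (fun w => \tr (M w *m toCmx (Q a))).
Proof.
move=> mM Mk.
have iM i j : cint P (fun w => M w i j).
  apply: (cint_bounded k) => [|w]; first exact: sub_sigma_cmeas (mM i j).
  exact: opbound_entry.
have iyy i j : cint P (fun w => (y a i w * y a j w)%:C).
  apply: cint_real; apply: (rint_le (ysq y a)); last exact: rint_ysq.
    exact: measurable_funM.
  by move=> w; exact: normr_yy_le.
have myy i j : cmeas (fun w : sub_sigma (only (inr a)) => (y a i w * y a j w)%:C).
  apply: cmeas_real; apply: measurable_funM;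
  by apply: measurable_y_group; rewrite inE.
have aJ : inr a \notin others a by rewrite !inE eqxx orbT.
have iyM i j := cint_factor aJ (myy i j) (mM i j) (iyy i j) (iM i j).
transitivity (cexp P (fun w => \sum_i \sum_j (y a i w * y a j w)%:C * M w i j)).
  apply: eq_cexp => w; rewrite bformE; apply: eq_bigr => i _.
  by apply: eq_bigr => j _; rewrite rmorphM/= ![ycol _ _ _ _ _]mxE !mxE; ring.
transitivity (cexp P (fun w => \sum_i \sum_j (Q a i j)%:C * M w i j)); last first.
  apply: eq_cexp => w; rewrite /mxtrace; apply: eq_bigr => i _.
  rewrite mxE; apply: eq_bigr => j _.
  by rewrite [toCmx _ j i]mxE (Q_sym reg) mulrC.
rewrite !cexp_sum; [|by move=> i; apply: cint_sum => j; exact: cintZ|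
  by move=> i; exact: cint_sum].
apply: eq_bigr => i _; rewrite !cexp_sum//; last by move=> j; exact: cintZ.
apply: eq_bigr => j _; rewrite (cexp_factor aJ (myy i j))//.
rewrite cexpZ//; congr (_ * _); apply: complex_ext => /=; first exact: reg_Qmom reg a i j.
exact: RintegralT_cst.
Qed.
End leave_one_out.

(** * The approximate equation *)

Section approximate_equation.
Context (R : realType) d (T : measurableType d) (P : probability T R) (n m : nat).
Variables (xi : 'I_m -> {RV P >-> R}) (y : 'I_m -> 'I_n -> {RV P >-> R}).
Variables (Q : 'I_m -> 'M[R]_n) (B : 'M[R]_n) (K rho : R).
Hypothesis reg : regular xi y Q B K rho.
Local Notation C := R[i].
Variable z : C.
Hypothesis z0 : complex.Im z != 0.
Local Notation S := `|complex.Im z|^-1.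
Local Notation G := (rsv xi y z).
Local Notation G' a := (rsv_but xi y a z).
Local Notation q a := (ysq y a).
Local Notation Y a := (ycol y a).
Local Notation sub_sigma := (sub_sigma xi y).
(** [v] is a test variable and [va a] a version of it that does not see the [a]-th summand. With
    [v = 1] the result is the scalar equation for [g]; with [v] the conjugate of a fluctuation it is
    the contraction. [H] dominates the bounded quantities, [h] bounds the denominators from below,
    [delta] measures the weighted fluctuations of the traces. *)
Variables (H h : R) (g c : C) (v : T -> C) (va : 'I_m -> T -> C) (delta : R).
Hypothesis KH : K <= H.
Hypothesis SH : S <= H.
Hypothesis gH : nc g <= H.
Hypothesis h0 : 0 < h.
Hypothesis hg : forall x : R, h <= nc (1 + x%:C * g).
Hypothesis cE :
  forall a, cexp P (fun w => (xi a w)%:C * (1 + (xi a w)%:C * g)^-1) = c.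
Hypothesis cB : m%:R * nc c <= K * n%:R.
Hypothesis vm : cmeas v.
Hypothesis vam : forall a, cmeas (va a : sub_sigma (others a) -> C).
Hypothesis vH : forall w, nc (v w) <= H.
Hypothesis vaH : forall a w, nc (va a w) <= H.
Hypothesis vva : forall a w,
  nc (v w - va a w) <= `|xi a w| * q a w * (K / n%:R * H ^+ 2).
Hypothesis deltaP : forall a,
  \int[P]_w (nc (v w) * nc (\tr (G w *m toCmx (Q a)) - g)) <= delta.
Variable D : 'M[C]_n.
Hypothesis DK : opbound D (K / n%:R).

Unset Implicit Arguments.
Let K1 := reg_K reg.
Let rho0 := reg_rho0 reg.
Let rho1 := reg_rho1 reg.
Let K0 : 0 < K := K_gt0 reg.
Let n0 : 0 < n%:R :> R := ngt0 reg.
Let m0 : 0 < m%:R :> R := mgt0 reg.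
Let S0 : 0 < S. Proof. by rewrite invr_gt0 normr_gt0. Qed.
Let H0 : 0 < H. Proof. exact: lt_le_trans K0 KH. Qed.
Let Kn0 : 0 <= K / n%:R := Kn_ge0 reg.

Let mG : mxmeas G := mxmeas_rsv xi y z0.
Let mG' a : mxmeas (G' a : T -> _) := mxmeas_rsv_butT xi y a z0.
Let vamT a : cmeas (va a) := sub_sigma_cmeas (vam a).
Let mxiC a : cmeas (fun w => (xi a w)%:C).
Proof. exact: cmeas_real. Qed.
Let mYT a := mxmeas_ycolT y a.

Let t a w := \tr (G w *m toCmx (Q a)).
Let t' a w := \tr (G' a w *m toCmx (Q a)).
Let A a w := bform (Y a w) (G' a w) (Y a w).
(** Leave-one-out version of the integrand bounded by [delta], independent of [xi_a] and [y_a]. *)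
Let U a w := nc (va a w) * nc (t' a w - g).

Let mU a : measurable_fun [set: sub_sigma (others a)] (U a : sub_sigma (others a) -> R).
Proof.
apply: measurable_funM; first exact/measurable_normc/vam.
apply: measurable_normc; apply: cmeasB; last exact: cmeas_cst.
apply: cmeas_tr; apply: mxmeasM; last exact: mxmeas_cst.
exact: mxmeas_rsv_others.
Qed.

Let t'_le a w : nc (t' a w) <= S * K.
Proof.
apply: le_trans (normc_tr_rsv_but_le xi y z0 a w Kn0 (reg_Qop reg a)) _.
by rewrite -mulrA divfK// gt_eqF.
Qed.

Let t_le a w : nc (t a w) <= S * K.
Proof.
apply: le_trans (normc_tr_rsv xi y z0 w Kn0 (reg_Qop reg a)) _.
by rewrite -mulrA divfK// gt_eqF.
Qed.

Let SKH : S * K <= H ^+ 2.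
Proof. by rewrite expr2; apply: ler_pM => //; exact: ltW. Qed.

Let H1 : 1 <= H. Proof. exact: le_trans K1 KH. Qed.

Let HH : H <= H ^+ 2.
Proof. by rewrite expr2 ler_peMl// ltW. Qed.

Let t'g_le a w : nc (t' a w - g) <= 2 * H ^+ 2.
Proof.
apply: le_trans (normcB _ _) _.
by have := t'_le a w; have := SKH; have := HH; have := gH; lra.
Qed.

Let iU a : rint P (U a).
Proof.
apply: (rint_bounded (H * (2 * H ^+ 2))); first exact: sub_sigma_meas (mU a).
move=> w; rewrite ger0_norm ?mulr_ge0 ?normc_ge0//.
by apply: ler_pM; rewrite ?normc_ge0.
Qed.

Let ivt a : rint P (fun w => nc (v w) * nc (t a w - g)).
Proof.
apply: (rint_bounded (H * (2 * H ^+ 2))).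
  apply: measurable_funM; first exact: measurable_normc.
  apply: measurable_normc; apply: cmeasB; last exact: cmeas_cst.
  by apply: cmeas_tr; apply: mxmeasM => //; exact: mxmeas_cst.
move=> w; rewrite ger0_norm ?mulr_ge0 ?normc_ge0//.
apply: ler_pM; rewrite ?normc_ge0//; apply: le_trans (normcB _ _) _.
by have := t_le a w; have := SKH; have := HH; have := gH; lra.
Qed.

(** Passing to the leave-one-out quantities costs [x K H^2 / n] twice, with [x = |xi| |y|^2]. The
    prefactors give [K (H^3 + 2 H^4) <= 3 H^5], and the mean [2 K^2 rho n] of [x] turns this into
    [6 H^7 rho]. *)
Let U_le a : \int[P]_w U a w <= delta + 6 * H ^+ 7 * rho.
Proof.
have pw w : U a w <= nc (v w) * nc (t a w - g) +
    (3 * H ^+ 5 / n%:R) * (`|xi a w| * q a w).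
  have x0 : 0 <= `|xi a w| * q a w by rewrite mulr_ge0 ?ysq_ge0.
  set x := `|xi a w| * q a w in x0 *.
  have e1 : nc (va a w) <= nc (v w) + x * (K / n%:R * H ^+ 2).
    have := normcB (v w) (v w - va a w); rewrite opprB addrC subrK.
    by have := vva a w; rewrite -/x; lra.
  have e2 : nc (t' a w - g) <= nc (t a w - g) + x * (K / n%:R * H ^+ 2).
    have -> : t' a w - g = (t a w - g) - (t a w - t' a w) by ring.
    apply: le_trans (normcB _ _) _; rewrite lerD2l.
    apply: le_trans (normc_tr_rsv_but xi y z0 a w Kn0 (reg_Qop reg a)) _.
    rewrite -/x; apply: ler_wpM2l => //; apply: ler_wpM2l => //.
    by rewrite -exprVn ler_pXn2r ?nnegrE//; exact: ltW.
  have e3 := t'g_le a w.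
  have e0 : 0 <= x * (K / n%:R * H ^+ 2).
    by apply: mulr_ge0 => //; apply: mulr_ge0 => //; exact/exprn_ge0/ltW.
  have e4 : nc (v w) * nc (t' a w - g) <=
      nc (v w) * nc (t a w - g) + H * (x * (K / n%:R * H ^+ 2)).
    apply: le_trans (ler_wpM2l (normc_ge0 _) e2) _; rewrite mulrDr lerD2l.
    exact: ler_wpM2r.
  have e5 : U a w <= nc (v w) * nc (t' a w - g) + x * (K / n%:R * H ^+ 2) * (2 * H ^+ 2).
    apply: le_trans (ler_wpM2r (normc_ge0 _) e1) _; rewrite mulrDl lerD2l.
    exact: ler_wpM2l.
  apply: le_trans e5 _; apply: le_trans (lerD e4 (lexx _)) _; rewrite -addrA lerD2l.
  have -> : H * (x * (K / n%:R * H ^+ 2)) + x * (K / n%:R * H ^+ 2) * (2 * H ^+ 2) =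
     (K * (H ^+ 3 + 2 * H ^+ 4)) * (x / n%:R) by ring.
  have -> : 3 * H ^+ 5 / n%:R * x = 3 * H ^+ 5 * (x / n%:R) by ring.
  apply: ler_wpM2r; first by rewrite divr_ge0// ltW.
  have h34 : H ^+ 3 <= H ^+ 4 by rewrite [leRHS]exprS ler_peMl// exprn_ge0// ltW.
  have -> : 3 * H ^+ 5 = H * (3 * H ^+ 4) by ring.
  apply: ler_pM => //; [exact: ltW| |by lra].
  by rewrite addr_ge0 ?mulr_ge0 ?exprn_ge0// ltW.
apply: le_trans (RintegralT_le (iU a) _ pw) _.
  by apply: rintD; [exact: (ivt a)|apply: rintZ; exact: rint_absxi_ysq reg a].
rewrite RintegralD//; last by apply: rintZ; exact: rint_absxi_ysq reg a.
rewrite RintegralZl//; last exact: rint_absxi_ysq reg a.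
apply: lerD; first exact: deltaP.
have hx := int_absxi_ysq_le reg a.
have c50 : 0 <= 3 * H ^+ 5 / n%:R by rewrite divr_ge0 ?mulr_ge0 ?exprn_ge0// ltW.
apply: le_trans (ler_wpM2l c50 hx) _.
have -> : 3 * H ^+ 5 / n%:R * (2 * K ^+ 2 * rho * n%:R) = (6 * H ^+ 5 * rho) * K ^+ 2.
  by field; rewrite gt_eqF.
have -> : 6 * H ^+ 7 * rho = (6 * H ^+ 5 * rho) * H ^+ 2 by ring.
apply: ler_wpM2l; first by rewrite !mulr_ge0 ?exprn_ge0// ltW.
by rewrite ler_pXn2r ?nnegrE// ltW.
Qed.

Let b a w := bform (Y a w) (G w *m D) (Y a w).
Let b' a w := bform (Y a w) (G' a w *m D) (Y a w).
Let r (x : R) : C := x%:C * (1 + x%:C * g)^-1.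

Let mb a : cmeas (b a).
Proof. by apply: cmeas_bform => //; apply: mxmeasM => //; exact: mxmeas_cst. Qed.

Let mb' a : cmeas (b' a).
Proof. by apply: cmeas_bform => //; apply: mxmeasM => //; exact: mxmeas_cst. Qed.

Let r_le x : nc (r x) <= `|x| * h^-1.
Proof.
rewrite /r normcM normc_real normcV ler_wpM2l// lef_pV2 ?posrE//.
exact: lt_le_trans h0 (hg x).
Qed.

Let mr : forall d' (T' : measurableType d') (X : T' -> R),
  measurable_fun [set: T'] X -> cmeas (fun w => r (X w)).
Proof.
move=> d' T' X mX; apply: cmeasM; first exact: cmeas_real.
apply: cmeasV; apply: cmeasD; first exact: cmeas_cst.
by apply: cmeasM; [exact: cmeas_real|exact: cmeas_cst].
Qed.

(** A chain of approximations for the [a]-th term of [Tr (L G D)]: free the test variable of the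
    [a]-th summand ([f1]), replace the random denominator by [1 + xi g] ([f2]), average over [xi_a]
    and [y_a] ([f3], with factor [c]), return to [v] and the full resolvent ([f4]). Each error has
    to be [o(1 / m)]. *)
Let f0 a w := v w * ((xi a w)%:C * b a w).
Let f1 a w := va a w * ((xi a w)%:C * b a w).
Let f2 a w := r (xi a w) * (va a w * b' a w).
Let f3 a w := va a w * \tr (G' a w *m (D *m toCmx (Q a))).
Let f4 a w := v w * \tr (G w *m (D *m toCmx (Q a))).

Let x0 a w : 0 <= `|xi a w| * q a w. Proof. by rewrite mulr_ge0 ?ysq_ge0. Qed.

Let xb_le a w : nc ((xi a w)%:C * b a w) <= S * (K / n%:R) * (`|xi a w| * q a w).
Proof.
rewrite normcM normc_real mulrCA ler_wpM2l//; exact: normc_bform_rsv.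
Qed.

Let if0 a : cint P (f0 a).
Proof.
apply: (cint_le (fun w => H * (S * (K / n%:R) * (`|xi a w| * q a w)))).
- by apply: cmeasM => //; exact: cmeasM.
- by move=> w; rewrite normcM; apply: ler_pM; rewrite ?normc_ge0.
- by do 2 apply: rintZ; exact: rint_absxi_ysq reg a.
Qed.

Let if1 a : cint P (f1 a).
Proof.
apply: (cint_le (fun w => H * (S * (K / n%:R) * (`|xi a w| * q a w)))).
- by apply: cmeasM => //; exact: cmeasM.
- by move=> w; rewrite normcM; apply: ler_pM; rewrite ?normc_ge0.
- by do 2 apply: rintZ; exact: rint_absxi_ysq reg a.
Qed.

(** The cost is a multiple of [xi^2 |y|^4 / n^2], of mean of order [1 / (n m)], and
    [1 / n <= rho]. *)
Let f01 a : nc (cexp P (f0 a) - cexp P (f1 a)) <= K ^+ 4 * S * H ^+ 2 * rho / m%:R.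
Proof.
rewrite -(cexpB (if0 a) (if1 a)).
have i2 := rint_xi2_ysq2 reg a.
apply: le_trans (normc_cexp_le (cintB (if0 a) (if1 a))
  (rintZ (K / n%:R * H ^+ 2 * (S * (K / n%:R))) i2) _) _.
  move=> w; rewrite /f0 /f1 -mulrBl normcM.
  have -> : K / n%:R * H ^+ 2 * (S * (K / n%:R)) * (xi a w ^+ 2 * q a w ^+ 2) =
   `|xi a w| * q a w * (K / n%:R * H ^+ 2) * (S * (K / n%:R) * (`|xi a w| * q a w)).
    by rewrite -[xi a w ^+ 2]real_normK ?num_real//; ring.
  by apply: ler_pM; rewrite ?normc_ge0.
rewrite RintegralZl//.
have c1 : 0 <= K / n%:R * H ^+ 2 * (S * (K / n%:R)).
  by rewrite !mulr_ge0 ?invr_ge0 ?exprn_ge0// ltW.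
apply: le_trans (ler_wpM2l c1 (int_xi2_ysq2_le reg a)) _.
have -> : K / n%:R * H ^+ 2 * (S * (K / n%:R)) * (K ^+ 2 * n%:R / m%:R) =
   (K ^+ 4 * S * H ^+ 2 / m%:R) * n%:R^-1.
  by field; rewrite !gt_eqF// normr_gt0.
have -> : K ^+ 4 * S * H ^+ 2 * rho / m%:R = (K ^+ 4 * S * H ^+ 2 / m%:R) * rho by ring.
apply: ler_wpM2l (inv_n_le reg).
by rewrite !mulr_ge0 ?invr_ge0 ?exprn_ge0// ltW.
Qed.

Let if2 a : cint P (f2 a).
Proof.
apply: (cint_le (fun w => h^-1 * (H * (S * (K / n%:R))) * (`|xi a w| * q a w))).
- by apply: cmeasM; [exact: mr|exact: cmeasM].
- move=> w; rewrite /f2 normcM [nc (va a w * _)]normcM.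
  have -> : h^-1 * (H * (S * (K / n%:R))) * (`|xi a w| * q a w) =
    (`|xi a w| * h^-1) * (H * (S * (K / n%:R) * q a w)) by ring.
  apply: ler_pM; rewrite ?mulr_ge0 ?normc_ge0//.
  by apply: ler_pM; rewrite ?normc_ge0//; exact: normc_bform_rsv_but.
- by apply: rintZ; exact: rint_absxi_ysq reg a.
Qed.

(** Everything but [xi_a]: a function of [xi_a] factors out while [y_a] and the leave-one-out
    resolvent stay together. *)
Let Jx a : {set 'I_m + 'I_m} := (~: [set inl a])%SET.

Let others_Jx a : {subset others a <= Jx a}.
Proof. by move=> k; rewrite !inE negb_or => /andP[]. Qed.

(** Weighted Young majorant of [q |A - t'|]: the fourth moment carries [rho], and the variance,
    which is of order [rho^2], carries [1 / rho]; both parts are of order [rho]. *)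
Let W a w := rho / 2 * q a w ^+ 2 + (2 * rho)^-1 * nc (A a w - t' a w) ^+ 2.

Let mA a : cmeas (fun w : sub_sigma (Jx a) => A a w - t' a w).
Proof.
have mg i j : cmeas (fun w : sub_sigma (Jx a) => G' a w i j).
  apply: (sub_sigma_cmono (@others_Jx a)).
  exact: (mxmeas_rsv_others xi y z0 a i j).
apply: cmeasB.
  by apply: cmeas_bform => //; apply: mxmeas_ycol; rewrite !inE.
by apply: cmeas_tr; apply: mxmeasM => //; exact: mxmeas_cst.
Qed.

Let mW a : measurable_fun [set: sub_sigma (Jx a)] (W a : sub_sigma (Jx a) -> R).
Proof.
apply: measurable_funD; apply: measurable_funM => //; apply: measurable_funX.
  by apply: measurable_ysq_group; rewrite !inE.
exact: measurable_normc.
Qed.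

Let iW a : rint P (W a).
Proof.
have [i2 _] := quad_form_variance reg z0 a.
by apply: rintD; apply: rintZ => //; exact: reg_y4i reg a.
Qed.

Let W_le a : \int[P]_w W a w <= rho * (K + 2 * S ^+ 2).
Proof.
have [i2 e2] := quad_form_variance reg z0 a.
rewrite RintegralD//; [|apply: rintZ; exact: reg_y4i reg a|exact: rintZ].
rewrite !RintegralZl//; last exact: reg_y4i reg a.
have r20 : 0 <= (2 * rho)^-1 by rewrite invr_ge0 mulr_ge0// ltW.
have h1 := ler_wpM2l r20 e2.
have -> : rho * (K + 2 * S ^+ 2) = rho * K + 2 * rho * S ^+ 2 by ring.
have e3 : (2 * rho)^-1 * (2 * rho ^+ 2 / `|complex.Im z| ^+ 2) = rho * S ^+ 2.
  by field; rewrite !gt_eqF// normr_gt0.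
rewrite e3 in h1; apply: lerD.
  have := reg_y4 reg a; have h2 : 0 <= rho / 2 by rewrite divr_ge0// ltW.
  move=> h3; apply: le_trans (ler_wpM2l h2 h3) _.
  by apply: ler_wpM2r; [exact: ltW|rewrite ler_pdivrMr//; lra].
apply: le_trans h1 _; have : 0 <= rho * S ^+ 2 by rewrite mulr_ge0 ?exprn_ge0// ltW.
by lra.
Qed.

Let qA_le a w : q a w * nc (A a w - t' a w) <= W a w.
Proof.
rewrite /W; move: (ysq_ge0 y a w) (normc_ge0 (A a w - t' a w)).
move: (q a w) (nc _) => x u x_ge0 u_ge0.
have -> : rho / 2 * x ^+ 2 + (2 * rho)^-1 * u ^+ 2 =
    x * u + (2 * rho)^-1 * (rho * x - u) ^+ 2 by field; rewrite gt_eqF.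
by rewrite lerDl mulr_ge0 ?sqr_ge0// invr_ge0 mulr_ge0// ltW.
Qed.

Let mxi2 a : measurable_fun [set: sub_sigma (only (inl a))]
  (fun w : sub_sigma (only (inl a)) => xi a w ^+ 2).
Proof. by apply: measurable_funX; exact: measurable_xi_only. Qed.

Let inJx (a : 'I_m) : inl a \notin Jx a.
Proof. by rewrite !inE eqxx. Qed.

Let mqU a : measurable_fun [set: sub_sigma (Jx a)]
  (fun w : sub_sigma (Jx a) => q a w * U a w).
Proof.
apply: measurable_funM; first by apply: measurable_ysq_group; rewrite !inE.
exact: (sub_sigma_mono (@others_Jx a) (mU a)).
Qed.

Let inothers (a : 'I_m) : inr a \notin others a.
Proof. by rewrite !inE eqxx orbT. Qed.

Let mqonly a : measurable_fun [set: sub_sigma (only (inr a))]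
  (q a : sub_sigma (only (inr a)) -> R).
Proof. by apply: measurable_ysq_group; rewrite inE. Qed.

Let iqU a : rint P (fun w => q a w * U a w).
Proof. exact: (rint_factor reg (inothers a) (mqonly a) (mU a) (rint_ysq reg a) (iU a)). Qed.

Let qU_le a : \int[P]_w (q a w * U a w) <= 2 * K * (delta + 6 * H ^+ 7 * rho).
Proof.
rewrite (Rintegral_factor reg (inothers a) (mqonly a) (mU a) (rint_ysq reg a) (iU a)).
apply: ler_pM; [exact: int_ysq_ge0| |exact: int_ysq_le reg a|exact: U_le].
by apply: Rintegral_ge0 => w _; rewrite mulr_ge0 ?normc_ge0.
Qed.

(** The central replacement of the quadratic form [A] by [g]. It splits as [(A - t') + (t' - g)]:
    the first part is governed by the variance of the form, the second by the fluctuation of the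
    trace, hence by [delta]. *)
Let f12 a : nc (cexp P (f1 a) - cexp P (f2 a)) <=
  (K ^+ 2 * S * h^-1 * H * (K + 2 * S ^+ 2) * rho +
   2 * K ^+ 3 * S * h^-1 * (delta + 6 * H ^+ 7 * rho)) / m%:R.
Proof.
rewrite -(cexpB (if1 a) (if2 a)).
have i2 := reg_xi2i reg a.
have iW2 := rint_factor reg (inJx a) (mxi2 a) (mW a) i2 (iW a).
have iU2 := rint_factor reg (inJx a) (mxi2 a) (mqU a) i2 (iqU a).
have eW2 := Rintegral_factor reg (inJx a) (mxi2 a) (mW a) i2 (iW a).
have eU2 := Rintegral_factor reg (inJx a) (mxi2 a) (mqU a) i2 (iqU a).
pose k := S * (K / n%:R) * h^-1.
have k0 : 0 <= k by rewrite !mulr_ge0 ?invr_ge0// ltW.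
apply: le_trans (normc_cexp_le (cintB (if1 a) (if2 a))
  (rintD (rintZ (k * H) iW2) (rintZ k iU2)) _) _.
  move=> w.
  have hne : 1 + (xi a w)%:C * g != 0.
    by rewrite -normc_gt0; exact: lt_le_trans h0 (hg _).
  (* Since [b' = (1 + xi A) b], the random denominator cancels; only [1 + xi g], bounded below by
     [h], remains, and a factor [xi^2] appears whose mean is of order [n / m]. *)
  have -> : f1 a w - f2 a w = va a w * (- ((xi a w)%:C ^+ 2 * b a w * (A a w - g) *
      (1 + (xi a w)%:C * g)^-1)).
    rewrite /f1 /f2 /r /b' (bform_rsv_but _ _ z0) -/(A a w) -/(b a w).
    by field.
  rewrite normcM normcN (_ : nc (_ * _ * _ * _) = xi a w ^+ 2 * nc (b a w) *
    nc (A a w - g) * nc (1 + (xi a w)%:C * g)^-1); last first.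
    by rewrite 3!normcM normcX normc_real real_normK ?num_real.
  have hV : nc (1 + (xi a w)%:C * g)^-1 <= h^-1.
    by rewrite normcV lef_pV2 ?posrE//; exact: lt_le_trans h0 (hg _).
  have hb := normc_bform_rsv xi y z0 a w DK; rewrite -/(b a w) in hb.
  have hAg : nc (A a w - g) <= nc (A a w - t' a w) + nc (t' a w - g).
    have -> : A a w - g = (A a w - t' a w) + (t' a w - g) by ring.
    exact: normcD.
  have x20 : 0 <= xi a w ^+ 2 by exact: sqr_ge0.
  have e1 : xi a w ^+ 2 * nc (b a w) * nc (A a w - g) * nc (1 + (xi a w)%:C * g)^-1 <=
     xi a w ^+ 2 * (S * (K / n%:R) * q a w) *
       (nc (A a w - t' a w) + nc (t' a w - g)) * h^-1.
    apply: (ler_pM _ (normc_ge0 _) _ hV).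
      exact: mulr_ge0 (mulr_ge0 x20 (normc_ge0 _)) (normc_ge0 _).
    apply: (ler_pM _ (normc_ge0 _) _ hAg).
      exact: mulr_ge0 x20 (normc_ge0 _).
    exact: ler_wpM2l.
  apply: le_trans (ler_wpM2l (normc_ge0 _) e1) _.
  have -> : nc (va a w) * (xi a w ^+ 2 * (S * (K / n%:R) * q a w) *
       (nc (A a w - t' a w) + nc (t' a w - g)) * h^-1) =
    k * xi a w ^+ 2 * (nc (va a w) * (q a w * nc (A a w - t' a w)) + q a w * U a w).
    by rewrite /k /U; ring.
  have -> : k * H * (xi a w ^+ 2 * W a w) + k * (xi a w ^+ 2 * (q a w * U a w)) =
    k * xi a w ^+ 2 * (H * W a w + q a w * U a w) by ring.
  apply: ler_wpM2l; first by rewrite mulr_ge0.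
  rewrite lerD2r; apply: ler_pM; rewrite ?normc_ge0// mulr_ge0 ?normc_ge0//.
  exact: ysq_ge0.
rewrite RintegralD//; [|exact: rintZ|exact: rintZ].
rewrite !RintegralZl// eW2 eU2.
have W0 : 0 <= \int[P]_w W a w.
  apply: Rintegral_ge0 => w _; apply: le_trans (qA_le a w).
  by rewrite mulr_ge0 ?normc_ge0// ysq_ge0.
have qU0 : 0 <= \int[P]_w (q a w * U a w).
  by apply: Rintegral_ge0 => w _; rewrite !mulr_ge0 ?normc_ge0// ysq_ge0.
have x2 := int_xi2_le reg a; have x20 := int_xi2_ge0 xi a.
have e1 : (\int[P]_w (xi a w ^+ 2)) * (\int[P]_w W a w) <=
    (K * n%:R / m%:R) * (rho * (K + 2 * S ^+ 2)).
  exact: ler_pM x20 W0 x2 (W_le a).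
have e2 : (\int[P]_w (xi a w ^+ 2)) * (\int[P]_w (q a w * U a w)) <=
    (K * n%:R / m%:R) * (2 * K * (delta + 6 * H ^+ 7 * rho)).
  exact: ler_pM x20 qU0 x2 (qU_le a).
have kH0 : 0 <= k * H by rewrite mulr_ge0// ltW.
apply: le_trans (lerD (ler_wpM2l kH0 e1) (ler_wpM2l k0 e2)) _.
rewrite le_eqVlt; apply/orP; left; apply/eqP; rewrite /k.
by field; rewrite !gt_eqF// normr_gt0.
Qed.

(** No error arises: the independent factor in [xi_a] has mean [c], and [y_a] is then averaged with
    the scalar [va a] absorbed into the matrix. *)
Let f23 a : cexp P (f2 a) = c * cexp P (f3 a).
Proof.
have mM : mxmeas (fun w : sub_sigma (others a) => va a w *: (G' a w *m D)).
  apply: mxmeasZ => //; apply: mxmeasM; last exact: mxmeas_cst.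
  exact: mxmeas_rsv_others.
have oM w : opbound (va a w *: (G' a w *m D)) (H * (S * (K / n%:R))).
  move=> x; apply: le_trans (opboundZ _ (opbound_rsv_butM xi y z0 a w DK) _) _.
  by apply: ler_wpM2r; [exact: fnorm_ge0|apply: ler_wpM2r => //; rewrite mulr_ge0// ltW].
have E w : va a w * b' a w = bform (Y a w) (va a w *: (G' a w *m D)) (Y a w).
  by rewrite /bform -scalemxAr -scalemxAl mxE.
have ivab : cint P (fun w => va a w * b' a w).
  apply: (cint_le (fun w => H * (S * (K / n%:R)) * q a w)).
  - exact: cmeasM.
  - move=> w; rewrite normcM -mulrA; apply: ler_pM; rewrite ?normc_ge0//.
    exact: normc_bform_rsv_but.
  - by apply: rintZ; exact: rint_ysq reg a.
have ir : cint P (fun w => r (xi a w)).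
  apply: (cint_le (fun w => h^-1 * `|xi a w|)); first exact: mr.
    by move=> w; rewrite mulrC.
  by apply: rintZ; apply: rint_norm; exact: rint_xi reg a.
have mvab : cmeas (fun w : sub_sigma (Jx a) => va a w * b' a w).
  apply: cmeasM; first exact: sub_sigma_cmono (@others_Jx a) (vam a).
  have mGJ i j : cmeas (fun w : sub_sigma (Jx a) => G' a w i j).
    exact: sub_sigma_cmono (@others_Jx a) (mxmeas_rsv_others xi y z0 a i j).
  apply: cmeas_bform; first by apply: mxmeas_ycol; rewrite !inE.
  by apply: mxmeasM => //; exact: mxmeas_cst.
rewrite (cexp_factor reg (inJx a) (mr _ _ _ (@measurable_xi_only _ _ _ _ _ _ xi y a)) mvab)//.
rewrite cE; congr (_ * _); rewrite (eq_cexp _ E) (cexp_bform reg mM oM).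
by apply: eq_cexp => w; rewrite -scalemxAl mxtraceZ /f3 mulmxA.
Qed.

Let DQ a : opbound (D *m toCmx (Q a)) (K / n%:R * (K / n%:R)).
Proof. exact: opboundM Kn0 DK (reg_Qop reg a). Qed.

Let KK0 : 0 <= K / n%:R * (K / n%:R). Proof. by rewrite mulr_ge0. Qed.

Let if3 a : cint P (f3 a).
Proof.
apply: (cint_bounded (H * (S * (K / n%:R * (K / n%:R)) * n%:R))).
  apply: cmeasM => //; apply: cmeas_tr; apply: mxmeasM => //; exact: mxmeas_cst.
move=> w; rewrite normcM; apply: ler_pM; rewrite ?normc_ge0//.
exact: normc_tr_rsv_but_le.
Qed.

Let if4 a : cint P (f4 a).
Proof.
apply: (cint_bounded (H * (S * (K / n%:R * (K / n%:R)) * n%:R))).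
  apply: cmeasM => //; apply: cmeas_tr; apply: mxmeasM => //; exact: mxmeas_cst.
move=> w; rewrite normcM; apply: ler_pM; rewrite ?normc_ge0//.
exact: normc_tr_rsv.
Qed.

Let f34 a : nc (c * cexp P (f3 a) - c * cexp P (f4 a)) <=
  2 * K ^+ 3 * (K ^+ 3 * H ^+ 2 * S + H * K ^+ 2 * S ^+ 2) * rho / m%:R.
Proof.
rewrite -mulrBr normcM -(cexpB (if3 a) (if4 a)).
pose k := (K ^+ 3 * H ^+ 2 * S + H * K ^+ 2 * S ^+ 2) / n%:R ^+ 2.
have k0 : 0 <= k.
  by rewrite mulr_ge0 ?invr_ge0 ?exprn_ge0 ?addr_ge0 ?mulr_ge0 ?exprn_ge0 ?invr_ge0// ltW.
have ix := rint_absxi_ysq reg a.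
have e1 : nc (cexp P (fun w => f3 a w - f4 a w)) <=
    \int[P]_w (k * (`|xi a w| * q a w)).
  apply: normc_cexp_le; [exact: cintB|exact: rintZ|move=> w].
  have -> : f3 a w - f4 a w =
    - ((v w - va a w) * \tr (G' a w *m (D *m toCmx (Q a))) +
    v w * (\tr (G w *m (D *m toCmx (Q a))) - \tr (G' a w *m (D *m toCmx (Q a))))).
    by rewrite /f3 /f4; ring.
  rewrite normcN; apply: le_trans (normcD _ _) _; rewrite !normcM.
  have -> : k * (`|xi a w| * q a w) =
     `|xi a w| * q a w * (K / n%:R * H ^+ 2) * (S * (K / n%:R * (K / n%:R)) * n%:R) +
     H * (`|xi a w| * q a w * (K / n%:R * (K / n%:R) / `|complex.Im z| ^+ 2)).
    by rewrite /k; field; rewrite !gt_eqF// normr_gt0.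
  apply: lerD; apply: ler_pM; rewrite ?normc_ge0//.
    exact: normc_tr_rsv_but_le.
  exact: normc_tr_rsv_but.
rewrite RintegralZl// in e1.
have e2 := le_trans e1 (ler_wpM2l k0 (int_absxi_ysq_le reg a)).
have cn : nc c <= K * n%:R / m%:R by rewrite ler_pdivlMr// mulrC.
apply: le_trans (ler_pM (normc_ge0 _) (normc_ge0 _) cn e2) _.
rewrite le_eqVlt; apply/orP; left; apply/eqP; rewrite /k.
by field; rewrite !gt_eqF// normr_gt0.
Qed.

Set Implicit Arguments.
(** The coefficients of [rho] collected from, in order, [f01], the two halves of [f12], [f34] and
    the term in [B]; here [12 H^7] is twice the [6 H^7] of [U_le]. *)
Definition approx_cst : R :=
  K ^+ 4 * S * H ^+ 2 + K ^+ 2 * S * h^-1 * H * (K + 2 * S ^+ 2) +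
  12 * K ^+ 3 * S * h^-1 * H ^+ 7 +
  2 * K ^+ 3 * (K ^+ 3 * H ^+ 2 * S + H * K ^+ 2 * S ^+ 2) + K ^+ 2 * H * S.

(** Summation of the chain over [a]. The [f0] add up to [Tr D + z Tr (G D)], while the [f4] produce
    the sum of the [Q_a], which is [(m / n) I + m B]. *)
Lemma approximate_equation :
  nc (cexp P (fun w => v w * (\tr D +
       (z - c * (m%:R / n%:R)%:C) * \tr (G w *m D)))) <=
  approx_cst * rho + 2 * K ^+ 3 * S * h^-1 * delta.
Proof.
have f04 a : nc (cexp P (f0 a) - c * cexp P (f4 a)) <=
   ((approx_cst - K ^+ 2 * H * S) * rho + 2 * K ^+ 3 * S * h^-1 * delta) / m%:R.
  have alg (p p1 p2 p3 p4 : C) : p2 = p3 -> p - p4 = (p - p1) + (p1 - p2) + (p3 - p4).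
    by move=> ->; ring.
  rewrite (alg _ (cexp P (f1 a)) _ _ _ (f23 a)); apply: le_trans (normcD _ _) _.
  apply: le_trans (lerD (le_trans (normcD _ _) (lerD (f01 a) (f12 a))) (f34 a)) _.
  by rewrite le_eqVlt; apply/orP; left; apply/eqP; rewrite /approx_cst; ring.
have mtr (M : 'M[C]_n) : cmeas (fun w => \tr (G w *m M)).
  by apply: cmeas_tr; apply: mxmeasM => //; exact: mxmeas_cst.
have ivD : cint P (fun w => v w * \tr (G w *m D)).
  apply: (cint_bounded (H * (S * (K / n%:R) * n%:R))); first exact: cmeasM.
  by move=> w; rewrite normcM; apply: ler_pM; rewrite ?normc_ge0//; exact: normc_tr_rsv.
have trDB w : nc (\tr (G w *m (D *m toCmx B))) <= S * K * rho / n%:R.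
  have := opbound_trM (toCmx B) (mulr_ge0 (ltW S0) Kn0) (opbound_rsvM xi y z0 w DK).
  rewrite -mulmxA => hh; apply: le_trans hh _; rewrite -mulrA.
  have -> : S * K * rho / n%:R = S * (K / n%:R) * rho by ring.
  by apply: ler_wpM2l (reg_B reg); rewrite mulr_ge0// ltW.
have ivB : cint P (fun w => v w * \tr (G w *m (D *m toCmx B))).
  apply: (cint_bounded (H * (S * K * rho / n%:R))); first exact: cmeasM.
  by move=> w; rewrite normcM; apply: ler_pM; rewrite ?normc_ge0.
have sumQ : \sum_a toCmx (Q a) = (m%:R / n%:R)%:C%:M + m%:R%:C *: toCmx B.
  have := reg_avg reg; move/(congr1 (fun M => m%:R *: M)).
  rewrite scalerA divff ?gt_eqF// scale1r scalerDr scalerA => /(congr1 (map_mx toC)).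
  rewrite raddf_sum/= => ->; rewrite map_mxD !map_mxZ/= map_mx1; congr (_ + _).
  by rewrite scalemx1.
have -> : cexp P (fun w => v w * (\tr D + (z - c * (m%:R / n%:R)%:C) * \tr (G w *m D)))
  = \sum_a (cexp P (f0 a) - c * cexp P (f4 a)) +
    c * m%:R%:C * cexp P (fun w => v w * \tr (G w *m (D *m toCmx B))).
  have i0 : cint P (fun w => \sum_a f0 a w) := cint_sum _ if0.
  have i4 : cint P (fun w => \sum_a f4 a w) := cint_sum _ if4.
  have <- : cexp P (fun w => \sum_a f0 a w - c * \sum_a f4 a w) =
      \sum_a (cexp P (f0 a) - c * cexp P (f4 a)).
    rewrite (cexpB i0 (cintZ c i4)) (cexpZ c i4) (cexp_sum _ if0) (cexp_sum _ if4).
    by rewrite mulr_sumr sumrB.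
  rewrite -(cexpZ _ ivB) -(cexpD (cintB i0 (cintZ c i4)) (cintZ _ ivB)).
  apply: eq_cexp => w; rewrite /f0 -mulr_sumr /b -(tr_rsv_sum xi y z0).
  rewrite /f4 -mulr_sumr.
  have -> : \sum_a \tr (G w *m (D *m toCmx (Q a))) =
     (m%:R / n%:R)%:C * \tr (G w *m D) + m%:R%:C * \tr (G w *m (D *m toCmx B)).
    rewrite -raddf_sum -mulmx_sumr -mulmx_sumr sumQ mulmxDr mulmxDr raddfD/=.
    by rewrite mul_mx_scalar -!scalemxAr !mxtraceZ.
  by ring.
apply: le_trans (normcD _ _) _.
(* The [m] equal bounds absorb the factor [1 / m]; the term [K^2 H S rho] is reserved for [B]. *)
have -> : approx_cst * rho + 2 * K ^+ 3 * S * h^-1 * delta =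
  (\sum_(a < m) ((approx_cst - K ^+ 2 * H * S) * rho +
     2 * K ^+ 3 * S * h^-1 * delta) / m%:R) + K ^+ 2 * H * S * rho.
  rewrite sumr_const card_ord -(mulr_natr (_ / _)) divfK ?gt_eqF//; ring.
apply: lerD.
  by apply: le_trans (normc_sum _ _ _) _; exact: ler_sum.
rewrite normcM.
have e1 : nc (cexp P (fun w => v w * \tr (G w *m (D *m toCmx B)))) <= H * (S * K * rho / n%:R).
  rewrite -[leRHS](RintegralT_cst P); apply: normc_cexp_le => //; first exact: rint_cst.
  by move=> w; rewrite normcM; apply: ler_pM; rewrite ?normc_ge0.
have e2 : nc (c * m%:R%:C) <= K * n%:R.
  by rewrite normcM normc_real ger0_norm// mulrC.
apply: le_trans (ler_pM (normc_ge0 _) (normc_ge0 _) e2 e1) _.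
rewrite le_eqVlt; apply/orP; left; apply/eqP.
by field; rewrite !gt_eqF// normr_gt0.
Qed.

End approximate_equation.

Set Implicit Arguments.

(** * Empirical averages and tightness *)

Section empirical.
Variable R : realType.
Local Notation C := R[i].

Definition empirical n (L : 'M[R]_n) (phi : R -> R) : R :=
  n%:R^-1 * \sum_(x <- eigenvalues L) phi x.

(** A smooth substitute for the indicator of [|x| >= eta]: there it is at least [1/2], and its
    integral is an affine function of the Stieltjes transform at [i eta]. *)
Definition mass_out (eta x : R) : R := x ^+ 2 / (x ^+ 2 + eta ^+ 2).

Section symmetric.
Variables (n : nat) (L : 'M[R]_n).
Hypotheses (n0 : (0 < n)%N) (symL : L^T = L).

Let nR0 : 0 < n%:R :> R. Proof. by rewrite ltr0n. Qed.

Lemma empirical_cst (c : R) : empirical L (fun=> c) = c.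
Proof.
rewrite /empirical big_const_seq count_predT size_eigenvalues// iter_addr_0.
by rewrite -[X in _ * X]mulr_natl mulrA mulVf ?mul1r// gt_eqF.
Qed.

Lemma empirical_le phi psi : (forall x, phi x <= psi x) ->
  empirical L phi <= empirical L psi.
Proof. by move=> h; rewrite ler_wpM2l ?invr_ge0//; exact: ler_sum. Qed.

Lemma empiricalD phi psi :
  empirical L (fun x => phi x + psi x) = empirical L phi + empirical L psi.
Proof. by rewrite /empirical big_split mulrDr. Qed.

Lemma empiricalB phi psi :
  empirical L (fun x => phi x - psi x) = empirical L phi - empirical L psi.
Proof. by rewrite /empirical sumrB mulrBr. Qed.

Lemma empiricalZ c phi : empirical L (fun x => c * phi x) = c * empirical L phi.
Proof. by rewrite /empirical -mulr_sumr mulrCA. Qed.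

Lemma normr_empirical_le phi psi : (forall x, `|phi x| <= psi x) ->
  `|empirical L phi| <= empirical L psi.
Proof.
move=> h; rewrite normrM ger0_norm ?invr_ge0// ler_wpM2l ?invr_ge0//.
by apply: le_trans (ler_norm_sum _ _ _) _; exact: ler_sum.
Qed.

Lemma empirical_stieltjes z : complex.Im z != 0 ->
  (n%:R^-1)%:C * \tr (resolvent L z) =
  empirical L (fun x => complex.Re (stieltjes_kernel z x)) +i*
  empirical L (fun x => complex.Im (stieltjes_kernel z x)).
Proof.
move=> z0; rewrite tr_resolvent//; apply: complex_ext.
  by rewrite ReM_real raddf_sum.
by rewrite ImM_real raddf_sum.
Qed.

End symmetric.

Lemma Im_stieltjes_kernel (t s x : R) :
  complex.Im (stieltjes_kernel (t +i* s) x) = s / ((x - t) ^+ 2 + s ^+ 2).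
Proof. by rewrite /stieltjes_kernel /= sub0r sqrrN mulNr opprK. Qed.

Lemma mass_out_kernel (eta x : R) : 0 < eta ->
  1 - eta * complex.Im (stieltjes_kernel (0 +i* eta) x) = mass_out eta x.
Proof.
move=> e0; rewrite Im_stieltjes_kernel subr0 /mass_out; field.
by rewrite gt_eqF// ltr_wpDl ?sqr_ge0// exprn_gt0.
Qed.

(** The imaginary part of [g^* (1 + x g)] is [- Im g], as the term with [x] becomes real. This keeps
    all denominators away from 0 uniformly in [x]. *)
Lemma normc_1Dreal_ge (g : C) (x : R) : 0 < complex.Im g ->
  complex.Im g / nc g <= nc (1 + x%:C * g).
Proof.
move=> Ig; have g0 : 0 < nc g.
  by rewrite normc_gt0; apply: contraTneq Ig => ->; rewrite ltxx.
rewrite ler_pdivrMr// -(normc_conj g) -normcM [_ * g^*]mulrC.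
apply: le_trans (normr_Im_le _).
have -> : complex.Im (g^* * (1 + x%:C * g)) = - complex.Im g.
  by case: (g) => a b /=; ring.
by rewrite normrN ler_norm.
Qed.

End empirical.

Section fixed_size.
Context (R : realType) d (T : measurableType d) (P : probability T R) (n m : nat).
Variables (xi : 'I_m -> {RV P >-> R}) (y : 'I_m -> 'I_n -> {RV P >-> R}).
Variables (Q : 'I_m -> 'M[R]_n) (B : 'M[R]_n) (K rho : R).
Hypothesis reg : regular xi y Q B K rho.
Local Notation C := R[i].
Local Notation G z := (rsv xi y z).

Let K1 : 1 <= K := reg_K reg.
Let rho0 : 0 < rho := reg_rho0 reg.
Let rho1 : rho <= 1 := reg_rho1 reg.
Let K0 : 0 < K := K_gt0 reg.
Let n0 : 0 < n%:R :> R := ngt0 reg.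
Let m0 : 0 < m%:R :> R := mgt0 reg.

Definition gN z w : C := (n%:R^-1)%:C * \tr (G z w).
Definition gbar z : C := cexp P (gN z).

(** [None] stands for the normalized trace. The family contains every trace that occurs in the error
    terms for its own members, so a maximum over it gives a closed inequality. *)
Definition Dfam (o : option 'I_m) : 'M[C]_n :=
  if o is Some a then toCmx (Q a) else (n%:R^-1)%:C%:M.

Lemma tr_Dfam_None : \tr (Dfam None) = 1.
Proof.
by rewrite /= mxtrace_scalar -rmorphMn/= -mulr_natr mulVf ?rmorph1 ?gt_eqF.
Qed.

Lemma tr_mul_Dfam_None (M : 'M[C]_n) : \tr (M *m Dfam None) = (n%:R^-1)%:C * \tr M.
Proof. by rewrite /= mul_mx_scalar mxtraceZ. Qed.

Lemma opbound_Dfam o : opbound (Dfam o) (K / n%:R).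
Proof.
case: o => [a|] /=; first exact: reg_Qop reg a.
move=> x; rewrite mul_scalar_mx fnormZ ler_wpM2r ?fnorm_ge0// normc_real.
by rewrite ger0_norm ?invr_ge0// -[leLHS]mul1r ler_wpM2r ?invr_ge0.
Qed.

Lemma tr_Q_near1 a : nc (\tr (toCmx (Q a)) - 1) <= rho.
Proof.
have -> : \tr (toCmx (Q a)) - 1 = (\tr (Q a) - 1)%:C.
  by rewrite rmorphB rmorph1/= trace_map_mx.
by rewrite normc_real; exact: reg_Qtr reg a.
Qed.

Lemma tr_Dfam_le o : nc (\tr (Dfam o)) <= 2.
Proof.
case: o => [a|]; last by rewrite tr_Dfam_None normc1 ler1n.
have -> : \tr (Dfam (Some a)) = (\tr (toCmx (Q a)) - 1) + 1 by rewrite subrK.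
apply: le_trans (normcD _ _) _; rewrite normc1.
by have := tr_Q_near1 a; have := rho1; lra.
Qed.

Section fixed_z.
Variable z : C.
Hypothesis z0 : complex.Im z != 0.
Local Notation S := `|complex.Im z|^-1.
Let S0 : 0 < S. Proof. by rewrite invr_gt0 normr_gt0. Qed.

Lemma mxmeas_G : mxmeas (G z). Proof. exact: mxmeas_rsv. Qed.

Lemma cmeas_gN : cmeas (gN z).
Proof. apply: cmeasM; [exact: cmeas_cst|apply: cmeas_tr; exact: mxmeas_G]. Qed.

Lemma gN_le w : nc (gN z w) <= S.
Proof.
rewrite /gN normcM normc_real ger0_norm ?invr_ge0// mulrC ler_pdivrMr//.
by apply: opbound_tr; [exact: ltW|exact: opbound_rsv].
Qed.

Lemma cint_gN : cint P (gN z).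
Proof. exact: (cint_bounded S cmeas_gN gN_le). Qed.

Lemma gbar_le : nc (gbar z) <= S.
Proof.
rewrite -[leRHS](RintegralT_cst P); apply: (normc_cexp_le cint_gN); last exact: gN_le.
exact: rint_cst.
Qed.

(* [1 + z g] is the mean of [x / (x - z)]. *)
Lemma one_plus_z_gbar : nc (1 + z * gbar z) <= K ^+ 2 * (S + S ^+ 2).
Proof.
set D := Dfam None.
have DK : opbound D n%:R^-1.
  move=> x; rewrite mul_scalar_mx fnormZ ler_wpM2r ?fnorm_ge0// normc_real.
  by rewrite ger0_norm ?invr_ge0.
pose b a w := bform (ycol y a w) (G z w *m D) (ycol y a w).
pose M a w := rsv_but xi y a z w *m D.
pose b' a w := bform (ycol y a w) (M a w) (ycol y a w).
pose A a w := bform (ycol y a w) (rsv_but xi y a z w) (ycol y a w).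
(* The rank-one formula gives [xi b = xi b' - xi^2 A b]. In the first term [xi_a] is independent of
   [b'], so only [|E xi|] matters; the second is controlled by [E xi^2]. Both are of order
   [n / m]. *)
pose p a w := (xi a w)%:C * b' a w.
pose r a w := (xi a w)%:C ^+ 2 * A a w * b a w.
have mA a : cmeas (A a) by apply: cmeas_bform; [exact: mxmeas_ycolT|exact: mxmeas_rsv_butT].
have mM a : mxmeas (M a) by apply: mxmeasM; [exact: mxmeas_rsv_butT|exact: mxmeas_cst].
have mb a : cmeas (b a).
  by apply: cmeas_bform; [exact: mxmeas_ycolT|apply: mxmeasM; [exact: mxmeas_G|exact: mxmeas_cst]].
have mb' a : cmeas (b' a) by apply: cmeas_bform; [exact: mxmeas_ycolT|exact: mM].
have mx a : cmeas (fun w => (xi a w)%:C) by exact: cmeas_real.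
have ble a w : nc (b a w) <= S * n%:R^-1 * ysq y a w by exact: normc_bform_rsv.
have b'le a w : nc (b' a w) <= S * n%:R^-1 * ysq y a w by exact: normc_bform_rsv_but.
have Ale a w : nc (A a w) <= S * ysq y a w.
  by apply: le_trans (bform_le _ _ (opbound_rsv_but xi y z0 a w)) _; rewrite -expr2 fnorm_sqr.
have ip a : cint P (p a).
  apply: (cint_le (fun w => S * n%:R^-1 * (`|xi a w| * ysq y a w))).
  - exact: cmeasM (mx a) (mb' a).
  - by move=> w; rewrite /p normcM normc_real mulrCA; apply: ler_wpM2l (b'le a w).
  - by apply: rintZ; exact: rint_absxi_ysq reg a.
have rle a w : nc (r a w) <= S ^+ 2 / n%:R * (xi a w ^+ 2 * ysq y a w ^+ 2).
  rewrite /r normcM [nc (_ ^+ 2 * A a w)]normcM normcX normc_real real_normK ?num_real//.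
  have -> : S ^+ 2 / n%:R * (xi a w ^+ 2 * ysq y a w ^+ 2) =
    xi a w ^+ 2 * (S * ysq y a w) * (S * n%:R^-1 * ysq y a w) by ring.
  have x20 := sqr_ge0 (xi a w).
  apply: ler_pM (ble a w); [exact: mulr_ge0 x20 (normc_ge0 _)|exact: normc_ge0|].
  exact: ler_wpM2l.
have ir a : cint P (r a).
  apply: (cint_le (fun w => S ^+ 2 / n%:R * (xi a w ^+ 2 * ysq y a w ^+ 2))) => //.
    apply: cmeasM => //; apply: cmeasM => //; exact: cmeasM.
  by apply: rintZ; exact: rint_xi2_ysq2 reg a.
have pw w : 1 + z * gN z w = \sum_a (p a w - r a w).
  have := tr_rsv_sum xi y z0 D w.
  rewrite tr_Dfam_None tr_mul_Dfam_None -/(gN z w) => ->.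
  apply: eq_bigr => a _; rewrite -/(b a w) /p /r /b' /M (bform_rsv_but xi y z0).
  by rewrite -/(A a w) -/(b a w); ring.
have pe a : nc (cexp P (p a)) <= K ^+ 2 * S / m%:R.
  pose Jx : {set 'I_m + 'I_m} := (~: [set inl a])%SET.
  have kJ : inl a \notin Jx by rewrite !inE eqxx.
  have sJ : {subset others a <= Jx}.
    by move=> k; rewrite !inE negb_or => /andP[].
  have mMo : mxmeas (M a : sub_sigma xi y (others a) -> _).
    by apply: mxmeasM; [exact: mxmeas_rsv_others|exact: mxmeas_cst].
  have oM w : opbound (M a w) (S * n%:R^-1) by exact: opbound_rsv_butM.
  have mbJ : cmeas (b' a : sub_sigma xi y Jx -> C).
    apply: cmeas_bform; first by apply: mxmeas_ycol; rewrite !inE.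
    by move=> i j; exact: sub_sigma_cmono sJ (mMo i j).
  have mxo : cmeas (fun w : sub_sigma xi y (only (inl a)) => (xi a w)%:C).
    by apply: cmeas_real; exact: measurable_xi_only.
  have ix : cint P (fun w => (xi a w)%:C) by apply: cint_real; exact: rint_xi reg a.
  have ib' : cint P (b' a).
    apply: (cint_le (fun w => S * n%:R^-1 * ysq y a w)) => //.
    by apply: rintZ; exact: rint_ysq reg a.
  rewrite (cexp_factor reg kJ mxo mbJ ix ib') normcM (cexp_bform reg mMo oM).
  have e1 : nc (cexp P (fun w => (xi a w)%:C)) <= K * n%:R / m%:R.
    rewrite (_ : cexp _ _ = (\int[P]_w xi a w)%:C); last first.
      by apply: complex_ext => //=; rewrite RintegralT_cst.
    by rewrite normc_real ler_pdivlMr// mulrC; exact: reg_xi1 reg a.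
  have tle w : nc (\tr (M a w *m toCmx (Q a))) <= S * K / n%:R.
    have nn : 0 <= n%:R^-1 :> R by rewrite invr_ge0.
    rewrite /M -mulmxA; apply: le_trans (normc_tr_rsv_but_le xi y z0 a w _
      (opboundM nn DK (reg_Qop reg a))) _; first by rewrite mulr_ge0 ?(Kn_ge0 reg).
    by rewrite le_eqVlt; apply/orP; left; apply/eqP; field; rewrite !gt_eqF// normr_gt0.
  have e2 : nc (cexp P (fun w => \tr (M a w *m toCmx (Q a)))) <= S * K / n%:R.
    rewrite -[leRHS](RintegralT_cst P); apply: normc_cexp_le => //; last exact: rint_cst.
    apply: (cint_bounded (S * K / n%:R)) => //; apply: cmeas_tr.
    by apply: mxmeasM; [exact: mM|exact: mxmeas_cst].
  apply: le_trans (ler_pM (normc_ge0 _) (normc_ge0 _) e1 e2) _.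
  by rewrite le_eqVlt; apply/orP; left; apply/eqP; field; rewrite !gt_eqF// normr_gt0.
have re a : nc (cexp P (r a)) <= K ^+ 2 * S ^+ 2 / m%:R.
  have i2 := rint_xi2_ysq2 reg a.
  apply: le_trans (normc_cexp_le (ir a) (rintZ (S ^+ 2 / n%:R) i2) (rle a)) _.
  rewrite RintegralZl//.
  have c0 : 0 <= S ^+ 2 / n%:R by rewrite mulr_ge0 ?invr_ge0 ?exprn_ge0// ltW.
  apply: le_trans (ler_wpM2l c0 (int_xi2_ysq2_le reg a)) _.
  by rewrite le_eqVlt; apply/orP; left; apply/eqP; field; rewrite !gt_eqF// normr_gt0.
clearbody p r.
have ipr a : cint P (fun w => p a w - r a w) := cintB (ip a) (ir a).
have -> : 1 + z * gbar z = \sum_a (cexp P (p a) - cexp P (r a)).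
  transitivity (cexp P (fun w => 1 + z * gN z w)).
    rewrite (cexpD (cint_cst P 1) (cintZ z cint_gN)) (cexpZ z cint_gN).
    by congr (_ + _); apply: complex_ext => /=; rewrite RintegralT_cst.
  rewrite (eq_cexp _ pw) (cexp_sum _ ipr); apply: eq_bigr => a _.
  exact: (cexpB (ip a) (ir a)).
apply: le_trans (normc_sum _ _ _) _.
have -> : K ^+ 2 * (S + S ^+ 2) =
    \sum_(a < m) (K ^+ 2 * S / m%:R + K ^+ 2 * S ^+ 2 / m%:R).
  by rewrite sumr_const card_ord -(mulr_natr (_ / _ + _)); field; rewrite !gt_eqF// normr_gt0.
apply: ler_sum => a _; apply: le_trans (normcB _ _) _; exact: lerD.
Qed.

End fixed_z.
End fixed_size.

(** * Tightness in the mean, fluctuations and the scalar equation *)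

Section contraction.
Context (R : realType) d (T : measurableType d) (P : probability T R) (n m : nat).
Variables (xi : 'I_m -> {RV P >-> R}) (y : 'I_m -> 'I_n -> {RV P >-> R}).
Variables (Q : 'I_m -> 'M[R]_n) (B : 'M[R]_n) (K rho : R).
Hypothesis reg : regular xi y Q B K rho.
Local Notation C := R[i].
Local Notation G z := (rsv xi y z).
Local Notation gN := (gN xi y).
Local Notation gbar := (gbar xi y).
Local Notation Dfam := (Dfam Q).
Local Notation emp w := (empirical (covmx xi y w)).

Let K1 : 1 <= K := reg_K reg.
Let rho0 : 0 < rho := reg_rho0 reg.
Let rho1 : rho <= 1 := reg_rho1 reg.
Let K0 : 0 < K := K_gt0 reg.
Let n0 : 0 < n%:R :> R := ngt0 reg.
Let m0 : 0 < m%:R :> R := mgt0 reg.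

Lemma gN_empirical z w : complex.Im z != 0 ->
  gN z w = emp w (fun x => complex.Re (stieltjes_kernel z x)) +i*
           emp w (fun x => complex.Im (stieltjes_kernel z x)).
Proof. by move=> z0; rewrite -empirical_stieltjes//; exact: covmx_sym. Qed.

Lemma emp_mass_out eta w : 0 < eta ->
  emp w (mass_out eta) = 1 - eta * complex.Im (gN (0 +i* eta) w).
Proof.
move=> e0; rewrite gN_empirical /=; last by rewrite gt_eqF.
have -> : mass_out eta =
    fun x => 1 - eta * complex.Im (stieltjes_kernel (0 +i* eta) x).
  by apply/funext => x; rewrite mass_out_kernel.
rewrite empiricalB empiricalZ empirical_cst//; first exact: reg_n reg.
exact: covmx_sym.
Qed.

(** [1 - eta Im g = Re (1 + i eta g)], and [1 + z g] is of order [1 / eta] with a constant depending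
    on [K] only. This is the tightness of the mean spectral distribution. *)
Lemma mean_mass_out eta : 1 <= eta ->
  rint P (fun w => emp w (mass_out eta)) /\
  \int[P]_w emp w (mass_out eta) <= 2 * K ^+ 2 / eta.
Proof.
move=> e1; have e0 : 0 < eta by exact: lt_le_trans e1.
set z : C := 0 +i* eta.
have z0 : complex.Im z != 0 by rewrite gt_eqF.
have hE w : emp w (mass_out eta) = 1 - eta * complex.Im (gN z w).
  exact: emp_mass_out.
have [_ ig] := cint_gN reg z0.
have ii : rint P (fun w => 1 - eta * complex.Im (gN z w)).
  by apply: rintB; [exact: rint_cst|exact: rintZ].
split; first by under [X in EFin \o X]eq_fun do rewrite hE.
under eq_Rintegral do rewrite hE.
rewrite RintegralB//; [|exact: rint_cst|exact: rintZ].
rewrite RintegralT_cst RintegralZl//.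
have gE (g : C) : 1 - eta * complex.Im g = complex.Re (1 + z * g).
  by rewrite /z; case: g => a b /=; ring.
rewrite -[\int[P]_w complex.Im _]/(complex.Im (gbar z)) gE.
apply: le_trans (ler_norm _) _; apply: le_trans (normr_Re_le _) _.
apply: le_trans (one_plus_z_gbar reg z0) _.
rewrite /z /= gtr0_norm//.
have -> : 2 * K ^+ 2 / eta = K ^+ 2 * (2 * eta^-1) by ring.
apply: ler_wpM2l; first exact: sqr_ge0.
have i0 : 0 < eta^-1 by rewrite invr_gt0.
have : eta^-1 ^+ 2 <= eta^-1.
  by rewrite expr2 ler_piMl ?invf_le1// ltW.
by lra.
Qed.

(** The Poisson kernel at [t + i s] dominates [k (1 - mass_out eta)], because
    [(x - t)^2 <= 2 x^2 + 2 t^2]; the condition on [eta] makes the mean of [mass_out eta] at most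
    [1/2]. *)
Lemma Im_gbar_ge t s eta : 0 < s -> 1 <= eta -> 4 * K ^+ 2 <= eta ->
  s / (2 * (2 * eta ^+ 2 + 2 * t ^+ 2 + s ^+ 2)) <= complex.Im (gbar (t +i* s)).
Proof.
move=> s0 e1 eK; have e0 : 0 < eta by exact: lt_le_trans e1.
set z : C := t +i* s.
have z0 : complex.Im z != 0 by rewrite gt_eqF.
have [iM eM] := mean_mass_out e1.
set k := s / (2 * eta ^+ 2 + 2 * t ^+ 2 + s ^+ 2).
have p0 : 0 < 2 * eta ^+ 2 + 2 * t ^+ 2 + s ^+ 2.
  by rewrite ltr_wpDl ?exprn_gt0// addr_ge0// mulr_ge0// ?sqr_ge0.
have k0 : 0 <= k by rewrite divr_ge0 ?ltW.
have pw w : k * (1 - emp w (mass_out eta)) <= complex.Im (gN z w).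
  rewrite gN_empirical//.
  rewrite -[complex.Im (_ +i* _)]/(emp w (fun x => complex.Im (stieltjes_kernel z x))).
  rewrite -{1}(empirical_cst (reg_n reg) (covmx_sym xi y w) 1).
  rewrite -empiricalB -empiricalZ; apply: empirical_le => x.
  rewrite Im_stieltjes_kernel /k /mass_out -mulrA; apply: ler_wpM2l; first exact: ltW.
  have h1 : 0 < x ^+ 2 + eta ^+ 2 by rewrite ltr_wpDl ?sqr_ge0// exprn_gt0.
  have h2 : 0 < (x - t) ^+ 2 + s ^+ 2 by rewrite ltr_wpDl ?sqr_ge0// exprn_gt0.
  have -> : 1 - x ^+ 2 / (x ^+ 2 + eta ^+ 2) = eta ^+ 2 / (x ^+ 2 + eta ^+ 2).
    by field; rewrite gt_eqF.
  suff hh : eta ^+ 2 * ((x - t) ^+ 2 + s ^+ 2) <=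
      (2 * eta ^+ 2 + 2 * t ^+ 2 + s ^+ 2) * (x ^+ 2 + eta ^+ 2).
    rewrite -subr_ge0; set p := 2 * eta ^+ 2 + _ + _ in p0 hh *.
    have -> : ((x - t) ^+ 2 + s ^+ 2)^-1 - p^-1 * (eta ^+ 2 / (x ^+ 2 + eta ^+ 2)) =
      (p * (x ^+ 2 + eta ^+ 2) - eta ^+ 2 * ((x - t) ^+ 2 + s ^+ 2)) /
      (p * (x ^+ 2 + eta ^+ 2) * ((x - t) ^+ 2 + s ^+ 2)).
      by field; rewrite !gt_eqF.
    by rewrite divr_ge0 ?subr_ge0// !mulr_ge0// ltW.
  apply: le_trans (_ : eta ^+ 2 * (2 * x ^+ 2 + 2 * t ^+ 2 + s ^+ 2) <= _).
    apply: ler_wpM2l; first exact: sqr_ge0.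
    by have := sqr_ge0 (x + t); rewrite !expr2; nra.
  have a0 := sqr_ge0 x; have b0 := sqr_ge0 t; have c0 := sqr_ge0 s; have d0 := sqr_ge0 eta.
  move: (x ^+ 2) (t ^+ 2) (s ^+ 2) (eta ^+ 2) a0 b0 c0 d0 => X TT SS E a0 b0 c0 d0.
  by nra.
have [_ ig] := cint_gN reg z0.
have ii : rint P (fun w => k * (1 - emp w (mass_out eta))).
  by apply: rintZ; apply: rintB => //; exact: rint_cst.
apply: le_trans _ (RintegralT_le ii ig pw).
rewrite RintegralZl//; last by apply: rintB => //; exact: rint_cst.
rewrite RintegralB//; last exact: rint_cst.
rewrite RintegralT_cst.
have -> : s / (2 * (2 * eta ^+ 2 + 2 * t ^+ 2 + s ^+ 2)) = k * 2^-1.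
  by rewrite /k invfM; ring.
apply: ler_wpM2l => //.
have : 2 * K ^+ 2 / eta <= 2^-1 by rewrite ler_pdivrMr//; lra.
by lra.
Qed.

(** On the axis the identity for [mass_out] gives [1 / (2 eta)] directly, against [1 / (6 eta)] from
    the general bound; combined with [|g| <= 1 / eta] this gives denominators at least [1/2]. *)
Lemma Im_gbar_axis eta : 1 <= eta -> 4 * K ^+ 2 <= eta ->
  (2 * eta)^-1 <= complex.Im (gbar (0 +i* eta)).
Proof.
move=> e1 eK; have e0 : 0 < eta by exact: lt_le_trans e1.
set z : C := 0 +i* eta.
have z0 : complex.Im z != 0 by rewrite gt_eqF.
have [iM eM] := mean_mass_out e1.
have [_ ig] := cint_gN reg z0.
have hE : complex.Im (gbar z) = eta^-1 * (1 - \int[P]_w emp w (mass_out eta)).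
  under eq_Rintegral do rewrite emp_mass_out//.
  rewrite RintegralB//; [|exact: rint_cst|exact: rintZ].
  by rewrite RintegralT_cst RintegralZl// opprB addrCA subrr addr0 mulKf ?gt_eqF.
rewrite hE invfM mulrC; apply: ler_wpM2l; first by rewrite invr_ge0 ltW.
have : 2 * K ^+ 2 / eta <= 2^-1 by rewrite ler_pdivrMr//; lra.
by lra.
Qed.

(** Centred at the mean normalized trace times [Tr D], not at its own mean: smallness then contains
    both concentration and the closeness of the mean of [Tr (G Q_a)] to [g]. A general [M] allows
    powers of the resolvent, which are its Taylor coefficients. *)
Definition fluct (M : T -> 'M[C]_n) o w : C :=
  \tr (M w *m Dfam o) - cexp P (fun w' => (n%:R^-1)%:C * \tr (M w')) * \tr (Dfam o).

Lemma fluct_cexp_le (M : T -> 'M[C]_n) k : 0 <= k -> mxmeas M -> (forall w, opbound (M w) k) ->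
  nc (cexp P (fun w' => (n%:R^-1)%:C * \tr (M w'))) <= k.
Proof.
move=> k0 mM Mk.
have le1 w : nc ((n%:R^-1)%:C * \tr (M w)) <= k.
  rewrite normcM normc_real ger0_norm ?invr_ge0// mulrC ler_pdivrMr//.
  exact: opbound_tr.
rewrite -[leRHS](RintegralT_cst P); apply: normc_cexp_le; [|exact: rint_cst|exact: le1].
apply: (cint_bounded k) => //; apply: cmeasM; [exact: cmeas_cst|exact: cmeas_tr].
Qed.

Lemma fluct_le (M : T -> 'M[C]_n) k o w : 0 <= k -> mxmeas M -> (forall w, opbound (M w) k) ->
  nc (fluct M o w) <= k * (K + 2).
Proof.
move=> k0 mM Mk; rewrite /fluct; apply: le_trans (normcB _ _) _.
rewrite mulrDr; apply: lerD.
  have kK : 0 <= k * (K / n%:R) by rewrite mulr_ge0// (Kn_ge0 reg).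
  apply: le_trans (opbound_tr kK (opboundM k0 (Mk w) (opbound_Dfam reg o))) _.
  by rewrite -mulrA divfK// gt_eqF.
rewrite normcM; apply: ler_pM; rewrite ?normc_ge0//; first exact: fluct_cexp_le.
exact: tr_Dfam_le reg o.
Qed.

Lemma cmeas_fluct M o : mxmeas M -> cmeas (fluct M o).
Proof.
move=> mM; apply: cmeasB; last exact: cmeas_cst.
by apply: cmeas_tr; apply: mxmeasM => //; exact: mxmeas_cst.
Qed.

Lemma rint_fluct (M : T -> 'M[C]_n) k o : 0 <= k -> mxmeas M -> (forall w, opbound (M w) k) ->
  rint P (fun w => nc (fluct M o w)).
Proof.
move=> k0 mM Mk; apply: rint_normc.
by apply: (cint_bounded (k * (K + 2))); [exact: cmeas_fluct|move=> w; exact: fluct_le].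
Qed.

Definition xi_transform (g : C) (a : 'I_m) : C :=
  cexp P (fun w => (xi a w)%:C * (1 + (xi a w)%:C * g)^-1).

(** Write [xi / (1 + xi g) = xi - g xi^2 / (1 + xi g)]: only [|E xi|] and [E xi^2] enter, and both
    are of order [n / m]. *)
Lemma xi_transform_le g a h : 0 < h -> (forall x : R, h <= nc (1 + x%:C * g)) ->
  m%:R * nc (xi_transform g a) <= K * (1 + nc g / h) * n%:R.
Proof.
move=> h0 hg.
have ne w : 1 + (xi a w)%:C * g != 0.
  by rewrite -normc_gt0; exact: lt_le_trans h0 (hg _).
have mV : cmeas (fun w => (1 + (xi a w)%:C * g)^-1).
  apply: cmeasV; apply: cmeasD; first exact: cmeas_cst.
  by apply: cmeasM; [exact: cmeas_real|exact: cmeas_cst].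
pose r w := (xi a w)%:C ^+ 2 * (1 + (xi a w)%:C * g)^-1.
have rle w : nc (r w) <= h^-1 * xi a w ^+ 2.
  rewrite /r normcM normcX normc_real real_normK ?num_real// mulrC.
  apply: ler_wpM2r; first exact: sqr_ge0.
  by rewrite normcV lef_pV2 ?posrE//; exact: lt_le_trans h0 (hg _).
have i2 := reg_xi2i reg a.
have ir : cint P r.
  apply: (cint_le (fun w => h^-1 * xi a w ^+ 2)) => //; last exact: rintZ.
  by apply: cmeasM => //; apply: cmeasM; exact: cmeas_real.
have ix : cint P (fun w => (xi a w)%:C) by apply: cint_real; exact: rint_xi reg a.
have -> : xi_transform g a = (\int[P]_w xi a w)%:C - g * cexp P r.
  have <- : cexp P (fun w => (xi a w)%:C) = (\int[P]_w xi a w)%:C.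
    by apply: complex_ext => //=; rewrite RintegralT_cst.
  rewrite -(cexpZ g ir) -(cexpB ix (cintZ g ir)); apply: eq_cexp => w.
  by rewrite /r; field; exact: ne.
have e1 : nc (cexp P r) <= h^-1 * (K * n%:R / m%:R).
  apply: le_trans (normc_cexp_le ir (rintZ h^-1 i2) rle) _.
  rewrite RintegralZl//; apply: ler_wpM2l (int_xi2_le reg a).
  by rewrite invr_ge0 ltW.
have e2 : nc ((\int[P]_w xi a w)%:C - g * cexp P r) <=
    `|\int[P]_w xi a w| + nc g * (h^-1 * (K * n%:R / m%:R)).
  apply: le_trans (normcB _ _) _; rewrite normc_real normcM lerD2l.
  by apply: ler_wpM2l => //; exact: normc_ge0.
apply: le_trans (ler_wpM2l (ltW m0) e2) _; rewrite mulrDr.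
have -> : K * (1 + nc g / h) * n%:R = K * n%:R + m%:R * (nc g * (h^-1 * (K * n%:R / m%:R))).
  by field; rewrite !gt_eqF.
by rewrite lerD2r; exact: reg_xi1 reg a.
Qed.

Section point.
Variable z : C.
Hypothesis z0 : complex.Im z != 0.
Local Notation S := `|complex.Im z|^-1.
Let S0 : 0 < S. Proof. by rewrite invr_gt0 normr_gt0. Qed.

Let mG : mxmeas (G z) := mxmeas_rsv xi y z0.
Let oG := opbound_rsv xi y z0.

Lemma fluct_Some a w : \tr (G z w *m toCmx (Q a)) - gbar z =
  fluct (G z) (Some a) w + gbar z * (\tr (toCmx (Q a)) - 1).
Proof. by rewrite /fluct /= -/(gN z) -[cexp P _]/(gbar z); ring. Qed.

Lemma fluct_point_le o w : nc (fluct (G z) o w) <= S * (K + 2).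
Proof. by apply: fluct_le => //; exact: ltW. Qed.

Lemma rint_fluct_point o : rint P (fun w => nc (fluct (G z) o w)).
Proof. by apply: (@rint_fluct _ S) => //; exact: ltW. Qed.

Lemma rint_trQ_gbar a : rint P (fun w => nc (\tr (G z w *m toCmx (Q a)) - gbar z)).
Proof.
apply: (rint_bounded (S * (K + 2) + S * rho)).
  apply: measurable_normc; apply: cmeasB; last exact: cmeas_cst.
  by apply: cmeas_tr; apply: mxmeasM => //; exact: mxmeas_cst.
move=> w; rewrite ger0_norm ?normc_ge0// fluct_Some; apply: le_trans (normcD _ _) _.
apply: lerD; first exact: fluct_point_le.
rewrite normcM.
exact: ler_pM (normc_ge0 _) (normc_ge0 _) (gbar_le reg z0) (tr_Q_near1 reg a).
Qed.

(** The approximate equation with test variable 1 and [D = I / n]. [K'] exceeds [K] because it must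
    also dominate [m |c| / n], and [delta] grows by [S rho] because [Tr Q_a] is only close to 1. *)
Lemma scalar_equation a0 h K' delta : 0 < h ->
  (forall x : R, h <= nc (1 + x%:C * gbar z)) -> K * (1 + S / h) <= K' ->
  (forall a, \int[P]_w nc (fluct (G z) (Some a) w) <= delta) ->
  nc (1 + (z - xi_transform (gbar z) a0 * (m%:R / n%:R)%:C) * gbar z) <=
  approx_cst K' z (K' + S + 1) h * rho + 2 * K' ^+ 3 * S * h^-1 * (delta + S * rho).
Proof.
move=> h0 hg KK' hd.
have KK : K <= K'.
  apply: le_trans KK'; apply: ler_peMr; first exact: ltW.
  by rewrite lerDl divr_ge0// ltW.
have reg' := regular_mono KK reg.
have K'0 : 0 < K' by exact: lt_le_trans KK.
have H1 : K' <= K' + S + 1 by have := S0; lra.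
have H2 : S <= K' + S + 1 by have := S0; lra.
have H3 : nc (gbar z) <= K' + S + 1 by apply: le_trans H2; exact: (gbar_le reg z0).
have cB : m%:R * nc (xi_transform (gbar z) a0) <= K' * n%:R.
  apply: le_trans (xi_transform_le a0 h0 hg) _; apply: ler_wpM2r; first exact: ltW.
  apply: le_trans KK'; apply: ler_wpM2l; first exact: ltW.
  rewrite lerD2l; apply: ler_wpM2r; first by rewrite invr_ge0 ltW.
  exact: (gbar_le reg z0).
have cE a : cexp P (fun w => (xi a w)%:C * (1 + (xi a w)%:C * gbar z)^-1) =
    xi_transform (gbar z) a0 by exact: reg_id reg a a0 (gbar z).
have one_le (w : T) : nc (1 : C) <= K' + S + 1.
  by rewrite normc1; have := S0; have := K'0; lra.
have dP a : \int[P]_w (nc (1 : C) * nc (\tr (G z w *m toCmx (Q a)) - gbar z)) <=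
    delta + S * rho.
  rewrite (_ : (fun w => _) = fun w => nc (\tr (G z w *m toCmx (Q a)) - gbar z)); last first.
    by apply/funext => w; rewrite normc1 mul1r.
  apply: le_trans (RintegralT_le (rint_trQ_gbar a)
    (rintD (rint_fluct_point (Some a)) (rint_cst P (S * rho))) _) _.
    move=> w; rewrite fluct_Some; apply: le_trans (normcD _ _) _; rewrite lerD2l.
    rewrite normcM.
    exact: ler_pM (normc_ge0 _) (normc_ge0 _) (gbar_le reg z0) (tr_Q_near1 reg a).
  rewrite RintegralD//; [|exact: rint_fluct_point|exact: rint_cst].
  by rewrite RintegralT_cst lerD2r.
have hv (a : 'I_m) (w : T) : nc (1 - 1 : C) <=
    `|xi a w| * ysq y a w * (K' / n%:R * (K' + S + 1) ^+ 2).
  rewrite subrr normc0; apply: mulr_ge0; first by rewrite mulr_ge0 ?ysq_ge0.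
  by apply: mulr_ge0; [exact: Kn_ge0 reg'|exact: sqr_ge0].
have vm : cmeas (fun _ : T => 1 : C) by exact: cmeas_cst.
have vam (a : 'I_m) : cmeas (fun _ : sub_sigma xi y (others a) => 1 : C) by exact: cmeas_cst.
have := approximate_equation reg' z0 (v := fun=> 1) (va := fun _ _ => 1)
  H1 H2 H3 h0 hg cE cB vm vam one_le (fun _ => one_le) hv dP (opbound_Dfam reg' None).
congr (nc _ <= _).
have -> : (fun w => 1 * (\tr (Dfam None) +
    (z - xi_transform (gbar z) a0 * (m%:R / n%:R)%:C) * \tr (G z w *m Dfam None))) =
   fun w => 1 + (z - xi_transform (gbar z) a0 * (m%:R / n%:R)%:C) * gN z w.
  by apply/funext => w; rewrite mul1r (tr_Dfam_None reg) tr_mul_Dfam_None.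
have ig := cint_gN reg z0.
rewrite (cexpD (cint_cst P 1) (cintZ _ ig)) (cexpZ _ ig).
by congr (_ + _); apply: complex_ext => /=; rewrite RintegralT_cst.
Qed.

End point.
End contraction.

(** * Contraction on the imaginary axis *)

Section axis.
Context (R : realType) d (T : measurableType d) (P : probability T R) (n m : nat).
Variables (xi : 'I_m -> {RV P >-> R}) (y : 'I_m -> 'I_n -> {RV P >-> R}).
Variables (Q : 'I_m -> 'M[R]_n) (B : 'M[R]_n) (K rho : R).
Hypothesis reg : regular xi y Q B K rho.
Local Notation C := R[i].

(** The constant in which [axis_contraction] ends, for the parameters [K' = 2 K] and [h = 1/2]. *)
Definition axis_cst (eta : R) : R :=
  let H := 2 * K + `|eta|^-1 + 1 in
  2 * (approx_cst (2 * K) (0 +i* eta) H 2^-1 * (2 * H + 1) + 3 * H).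

Variable eta : R.
(** With [2 K] in place of [K] and [h = 1/2], the factor of [delta] in the approximate equation is
    [32 K^3 / eta]; the threshold makes it at most [1/10]. *)
Hypothesis eta_large : 320 * K ^+ 3 <= eta.
Local Notation z := (0 +i* eta : C).
Local Notation G := (rsv xi y z).
Local Notation g := (gbar xi y z).
Local Notation Df := (Dfam Q).
Local Notation u := (fluct P Q G).
Local Notation S := `|eta|^-1.
Local Notation H := (2 * K + S + 1).
Local Notation K' := (2 * K).

Let K1 : 1 <= K := reg_K reg.
Let rho0 : 0 < rho := reg_rho0 reg.
Let rho1 : rho <= 1 := reg_rho1 reg.
Let K0 : 0 < K := K_gt0 reg.
Let n0 : 0 < n%:R :> R := ngt0 reg.
Let m0 : 0 < m%:R :> R := mgt0 reg.

Let K2 : K <= K ^+ 2. Proof. by rewrite expr2 ler_peMl// ltW. Qed.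
Let K3 : K ^+ 2 <= K ^+ 3. Proof. by rewrite [leRHS]exprS ler_peMl// exprn_ge0// ltW. Qed.
Let e320 : 320 <= eta. Proof. by have := K1; have := K2; have := K3; move: eta_large; lra. Qed.
Let e0 : 0 < eta. Proof. by have := e320; lra. Qed.
Let z0 : complex.Im z != 0. Proof. by rewrite gt_eqF. Qed.
Let S_eta : S = eta^-1. Proof. by rewrite gtr0_norm. Qed.
Let S0 : 0 < S. Proof. by rewrite S_eta invr_gt0. Qed.
Let S1 : S <= 2^-1.
Proof. by rewrite S_eta lef_pV2 ?posrE//; have := e320; lra. Qed.

Let g_Im : S / 2 <= complex.Im g.
Proof.
rewrite S_eta -invfM mulrC; apply: (Im_gbar_axis reg); first by have := e320; lra.
by have := K1; have := K2; have := K3; move: eta_large; lra.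
Qed.

Let hg (x : R) : 2^-1 <= nc (1 + x%:C * g).
Proof.
have Ig : 0 < complex.Im g by apply: lt_le_trans g_Im; rewrite divr_gt0.
apply: le_trans (normc_1Dreal_ge x Ig).
have g0 : 0 < nc g by apply: lt_le_trans (normr_Im_le _); rewrite normr_gt0 gt_eqF.
rewrite ler_pdivlMr//; apply: le_trans _ g_Im; rewrite mulrC.
by apply: ler_wpM2r; [rewrite invr_ge0|exact: (gbar_le reg z0)].
Qed.

Let reg' : regular xi y Q B K' rho.
Proof. by apply: regular_mono reg; have := K0; lra. Qed.

Let oD o := opbound_Dfam reg' o.
Let mG : mxmeas G := mxmeas_rsv xi y z0.

Let u_le o w : nc (u o w) <= H.
Proof.
apply: le_trans (fluct_point_le reg z0 o w) _ => /=.
have : S * (K + 2) <= 1 * (K + 2) by apply: ler_wpM2r; have := K0; have := S1; lra.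
by have := S0; have := K1; lra.
Qed.

Let mu o : cmeas (u o). Proof. exact: cmeas_fluct. Qed.
Let iu o : rint P (fun w => nc (u o w)). Proof. exact: (rint_fluct_point reg z0 o). Qed.
Let H0 : 0 < H. Proof. by have := S0; have := K0; lra. Qed.

Let iu2 o : rint P (fun w => nc (u o w) ^+ 2).
Proof.
apply: (rint_bounded (H ^+ 2)); first by apply: measurable_funX; exact: measurable_normc.
move=> w; rewrite ger0_norm ?sqr_ge0// ler_pXn2r ?nnegrE ?normc_ge0//.
exact: ltW.
Qed.

Let e o := \int[P]_w (nc (u o w) ^+ 2).
Let e_ge0 o : 0 <= e o. Proof. by apply: Rintegral_ge0 => w _; exact: sqr_ge0. Qed.

Let u1_le o : \int[P]_w nc (u o w) <= Num.sqrt (e o).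
Proof.
rewrite -[leLHS]ger0_norm; last by apply: Rintegral_ge0 => w _; exact: normc_ge0.
by rewrite -sqrtr_sqr ler_wsqrtr// Rintegral_sqr_le.
Qed.

Let sqrt_e_le o : Num.sqrt (e o) <= H.
Proof.
rewrite -[leRHS]ger0_norm ?(ltW H0)// -sqrtr_sqr ler_wsqrtr//.
rewrite -[leRHS](RintegralT_cst P); apply: RintegralT_le => //; first exact: rint_cst.
by move=> w; rewrite ler_pXn2r ?nnegrE ?normc_ge0// ltW.
Qed.

Let C1 := approx_cst K' z H 2^-1.
Let kappa := 2 * K' ^+ 3 * S * 2^-1^-1.

Let kappa_le : kappa <= 10^-1.
Proof.
rewrite /kappa S_eta invrK.
have -> : 2 * (2 * K) ^+ 3 * eta^-1 * 2 = 32 * K ^+ 3 / eta by ring.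
by rewrite ler_pdivrMr//; move: eta_large; lra.
Qed.

Let kappa_ge0 : 0 <= kappa.
Proof. by rewrite !mulr_ge0 ?exprn_ge0 ?invr_ge0 ?mulr_ge0// ltW. Qed.

Let C1_ge0 : 0 <= C1.
Proof.
by rewrite /C1 /approx_cst /= !addr_ge0 ?mulr_ge0 ?exprn_ge0 ?addr_ge0 ?mulr_ge0
  ?exprn_ge0 ?invr_ge0 ?addr_ge0 ?mulr_ge0// ltW.
Qed.

(** Tested against the conjugate of the worst fluctuation, the approximate equation has [(z - ct) E]
    on the left and at most [E / 10] plus small terms on the right; the scalar equation removes the
    deterministic part. *)
Lemma axis_contraction (a0 : 'I_m) o : e o <= axis_cst eta * rho.
Proof.
(* The error for one test matrix involves the fluctuations of all [Tr (G Q_a)], so the estimate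
   closes only at a maximizer. *)
have [om hom] : exists om, forall o, e o <= e om.
  case: (@Order.TotalTheory.arg_maxP _ _ _ (None : option 'I_m) xpredT e isT) => om _ h.
  by exists om => o'; exact: h.
apply: le_trans (hom o) _; clear o.
set E := e om in hom *; set f := Num.sqrt E.
have f0 : 0 <= f by exact: sqrtr_ge0.
have fH : f <= H by exact: sqrt_e_le.
have ff : f * f = E by rewrite -expr2 sqr_sqrtr// e_ge0.
have uf o : \int[P]_w nc (u o w) <= f.
  by apply: le_trans (u1_le o) _; rewrite ler_wsqrtr.
pose c := xi_transform xi g a0.
pose ct := c * (m%:R / n%:R)%:C.
have eB : nc (1 + (z - ct) * g) <= C1 * rho + kappa * (f + S * rho).
  have i2 : 0 < 2^-1 :> R by rewrite invr_gt0.
  have hk : K * (1 + S / 2^-1) <= K'.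
    rewrite invrK mulrC; apply: ler_wpM2r; first exact: ltW.
    by have := S1; lra.
  exact: (scalar_equation reg z0 a0 i2 hg hk (fun a => uf (Some a))).
have cB : m%:R * nc c <= K' * n%:R.
  have i2 : 0 < 2^-1 :> R by rewrite invr_gt0.
  apply: le_trans (xi_transform_le reg a0 i2 hg) _; apply: ler_wpM2r; first exact: ltW.
  rewrite invrK mulrC; apply: ler_wpM2r; first exact: ltW.
  by have := gbar_le reg z0 => /=; have := S1; lra.
have cE a : cexp P (fun w => (xi a w)%:C * (1 + (xi a w)%:C * g)^-1) = c.
  exact: (reg_id reg a a0 g).
pose v w : C := (u om w)^*.
pose va (a : 'I_m) w : C :=
  (\tr (rsv_but xi y a z w *m Df om) - g * \tr (Df om))^*.
have vm : cmeas v by exact: cmeas_conj.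
have vam a : cmeas (va a : sub_sigma xi y (others a) -> C).
  apply: cmeas_conj; apply: cmeasB; last exact: cmeas_cst.
  apply: cmeas_tr; apply: mxmeasM; last exact: mxmeas_cst.
  exact: mxmeas_rsv_others.
have vH w : nc (v w) <= H by rewrite normc_conj.
have vaH a w : nc (va a w) <= H.
  rewrite normc_conj; apply: le_trans (normcB _ _) _; rewrite normcM.
  have h1 := normc_tr_rsv_but_le xi y z0 a w (Kn_ge0 reg) (opbound_Dfam reg om).
  have h2 : nc g * nc (\tr (Df om)) <= S * 2.
    by apply: ler_pM; rewrite ?normc_ge0//; [exact: (gbar_le reg z0)|exact: tr_Dfam_le reg om].
  rewrite -[X in _ <= X]mulrA divfK ?gt_eqF// /= in h1.
  have : S * (K + 2) <= 1 * (K + 2) by apply: ler_wpM2r; have := K0; have := S1; lra.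
  by have := S0; have := K1; move: h1 h2; lra.
have KH : K' <= H by have := S0; lra.
have SH : S <= H by have := K0; lra.
have gH : nc g <= H by apply: le_trans SH; exact: (gbar_le reg z0).
have vva a w : nc (v w - va a w) <=
    `|xi a w| * ysq y a w * (K' / n%:R * H ^+ 2).
  rewrite /v /va -rmorphB normc_conj /fluct -[cexp P _]/g.
  have -> : forall p q r : C, p - r - (q - r) = p - q by move=> *; ring.
  apply: le_trans (normc_tr_rsv_but xi y z0 a w (Kn_ge0 reg') (oD om)) _.
  apply: ler_wpM2l; first by rewrite mulr_ge0 ?ysq_ge0.
  apply: ler_wpM2l; first exact: Kn_ge0 reg'.
  by rewrite -exprVn ler_pXn2r ?nnegrE//; exact: ltW.
(* By [2 |u u_a| <= |u|^2 + |u_a|^2], where both mean squares are at most [E]. *)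
have dP a : \int[P]_w (nc (v w) * nc (\tr (G w *m toCmx (Q a)) - g)) <= E + H * rho.
  have pw w : nc (v w) * nc (\tr (G w *m toCmx (Q a)) - g) <=
      2^-1 * nc (u om w) ^+ 2 + (2^-1 * nc (u (Some a) w) ^+ 2 + H * rho).
    have h1 : nc (\tr (G w *m toCmx (Q a)) - g) <= nc (u (Some a) w) + rho.
      rewrite (fluct_Some xi y Q z a w); apply: le_trans (normcD _ _) _; rewrite lerD2l.
      rewrite normcM -[leRHS]mul1r; apply: ler_pM; rewrite ?normc_ge0//.
        by apply: le_trans (gbar_le reg z0) _ => /=; have := S1; lra.
      exact: tr_Q_near1 reg a.
    have := ler_wpM2l (normc_ge0 (v w)) h1; rewrite mulrDr.
    have := ler_wpM2r (ltW rho0) (vH w).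
    rewrite {1 3}/v normc_conj.
    have := sqr_ge0 (nc (u om w) - nc (u (Some a) w)); rewrite !expr2; lra.
  have i1 : rint P (fun w => nc (v w) * nc (\tr (G w *m toCmx (Q a)) - g)).
    apply: (rint_le (fun w => 2^-1 * nc (u om w) ^+ 2 +
      (2^-1 * nc (u (Some a) w) ^+ 2 + H * rho))).
    - apply: measurable_funM; first exact: measurable_normc.
      apply: measurable_normc; apply: cmeasB; last exact: cmeas_cst.
      by apply: cmeas_tr; apply: mxmeasM => //; exact: mxmeas_cst.
    - by move=> w; rewrite ger0_norm ?mulr_ge0 ?normc_ge0.
    - apply: rintD; first exact: rintZ (iu2 om).
      by apply: rintD; [exact: rintZ (iu2 _)|exact: rint_cst].
  have i3 := rintD (rintZ 2^-1 (iu2 (Some a))) (rint_cst P (H * rho)).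
  apply: le_trans (RintegralT_le i1 (rintD (rintZ 2^-1 (iu2 om)) i3) pw) _.
  rewrite (RintegralD _ (rintZ 2^-1 (iu2 om)) i3)//.
  rewrite (RintegralD _ (rintZ 2^-1 (iu2 (Some a))) (rint_cst P (H * rho)))//.
  rewrite RintegralT_cst !RintegralZl// -!/(e _) -/E.
  by have := hom (Some a); lra.
have i20 : 0 < 2^-1 :> R by rewrite invr_gt0.
have := approximate_equation reg' z0 KH SH gH i20 hg cE cB vm vam vH vaH vva dP (oD om).
rewrite -/ct -/C1 -/kappa.
have iv : cint P v by apply: (cint_bounded H).
(* Substituting [Tr (G D) = g Tr D + u] isolates the scalar equation, and [v u = |u|^2] has mean
   [E]. *)
have -> : cexp P (fun w => v w * (\tr (Df om) + (z - ct) * \tr (G w *m Df om))) =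
    \tr (Df om) * (1 + (z - ct) * g) * cexp P v + (z - ct) * E%:C.
  have iE : cint P (fun w => (nc (u om w) ^+ 2)%:C) by apply: cint_real.
  have <- : cexp P (fun w => (nc (u om w) ^+ 2)%:C) = E%:C.
    by apply: complex_ext => //=; rewrite RintegralT_cst.
  rewrite -(cexpZ _ iv) -(cexpZ _ iE) -(cexpD (cintZ _ iv) (cintZ _ iE)).
  apply: eq_cexp => w.
  have -> : (nc (u om w) ^+ 2)%:C = v w * u om w.
    rewrite normc_sqr /v; case: (u om w) => a b; apply: complex_ext => /=; ring.
  have -> : u om w = \tr (G w *m Df om) - g * \tr (Df om) by [].
  by ring.
move=> h.
have h1 : nc ((z - ct) * E%:C) <= C1 * rho + kappa * (E + H * rho) +
   2 * (C1 * rho + kappa * (f + S * rho)) * f.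
  have -> : (z - ct) * E%:C = (\tr (Df om) * (1 + (z - ct) * g) * cexp P v +
     (z - ct) * E%:C) - \tr (Df om) * (1 + (z - ct) * g) * cexp P v by ring.
  apply: le_trans (normcB _ _) _; apply: lerD h _.
  rewrite normcM; apply: ler_pM; rewrite ?normc_ge0//.
    rewrite normcM; apply: ler_pM; rewrite ?normc_ge0//.
    exact: tr_Dfam_le reg om.
  apply: le_trans (normc_cexp_le iv (iu om) _) (uf om) => w.
  by rewrite normc_conj.
(* [|ct| <= 2 K] is far below [|z|], which is at least [320 K^3]. *)
have zct : 1 <= nc (z - ct).
  have ctK : nc ct <= K'.
    rewrite /ct normcM normc_real ger0_norm ?divr_ge0//.
    by rewrite mulrA ler_pdivrMr// mulrC.
  have ze : eta <= nc z by apply: le_trans _ (normr_Im_le _) => /=; exact: ler_norm.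
  have := normcD (z - ct) ct; rewrite subrK.
  by have := K1; have := K2; have := K3; move: eta_large; lra.
have h2 : E <= nc ((z - ct) * E%:C).
  rewrite normcM normc_real ger0_norm ?e_ge0//.
  by rewrite -[leLHS]mul1r ler_wpM2r// e_ge0.
have h3 := le_trans h2 h1.
(* In total [E <= 3 kappa E + (C1 (2 H + 1) + 3 H) rho]. Since [3 kappa <= 3/10], the first term is
   absorbed at the price of the factor 2 in [axis_cst]. *)
have kE : kappa * E <= 10^-1 * E by apply: ler_wpM2r; [exact: e_ge0|exact: kappa_le].
have t1 : C1 * rho * f <= C1 * rho * H by apply: ler_wpM2l => //; rewrite mulr_ge0// ltW.
have t2 : kappa * (f + S * rho) * f <= kappa * E + H * rho.
  rewrite mulrDr mulrDl -mulrA ff lerD2l.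
  have : kappa * (S * rho) * f <= 1 * rho * H.
    apply: ler_pM => //; first by rewrite mulr_ge0// mulr_ge0// ltW.
    rewrite mulrA; apply: ler_wpM2r; first exact: ltW.
    have : kappa * S <= 10^-1 * 2^-1 by apply: ler_pM => //; exact: ltW.
    by lra.
  by lra.
have t3 : kappa * (H * rho) <= H * rho.
  rewrite ler_piMl ?mulr_ge0 ?(ltW H0) ?(ltW rho0)//.
  by have := kappa_le; lra.
rewrite /axis_cst -/C1.
move: h3 kE t1 t2 t3; rewrite (mulrDr kappa E).
have -> : 2 * (C1 * rho + kappa * (f + S * rho)) * f =
  2 * (C1 * rho * f) + 2 * (kappa * (f + S * rho) * f) by ring.
have -> : 2 * (C1 * (2 * H + 1) + 3 * H) * rho =
  4 * (C1 * rho * H) + 2 * (C1 * rho) + 6 * (H * rho) by ring.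
have E0 : 0 <= E by exact: e_ge0.
have cr : 0 <= C1 * rho by rewrite mulr_ge0// ltW.
move: (kappa * E) (C1 * rho * f) (C1 * rho * H) (kappa * (f + S * rho) * f)
  (kappa * (H * rho)) (H * rho) (C1 * rho) cr => a1 a2 a3 a4 a5 a6 a7.
by lra.
Qed.

End axis.

(** * Continuation to the upper half-plane *)

Section continuation.
Context (R : realType) d (T : measurableType d) (P : probability T R) (n m : nat).
Variables (xi : 'I_m -> {RV P >-> R}) (y : 'I_m -> 'I_n -> {RV P >-> R}).
Variables (Q : 'I_m -> 'M[R]_n).
Local Notation C := R[i].
Local Notation G := (rsv xi y).
Local Notation fl := (fluct P Q).

Definition fluct_max (z : C) : R :=
  \big[Order.max/0]_(o : option 'I_m) \int[P]_w nc (fl (G z) o w).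

(** Size in mean of the Taylor coefficient of order [k] at [z]: the coefficient of the resolvent is
    its power [k + 1], and [fluct] is linear in the matrix. *)
Definition coef_max (z : C) (k : nat) : R :=
  \big[Order.max/0]_(o : option 'I_m) \int[P]_w nc (fl (fun w => G z w ^+ k.+1) o w).

Lemma fluct_max_ge0 z : 0 <= fluct_max z. Proof. exact: bigmax_ge_id. Qed.
Lemma coef_max_ge0 z k : 0 <= coef_max z k. Proof. exact: bigmax_ge_id. Qed.

Lemma le_fluct_max z o : \int[P]_w nc (fl (G z) o w) <= fluct_max z.
Proof. exact: (le_bigmax _ (fun o => \int[P]_w nc (fl (G z) o w))). Qed.

Lemma le_coef_max z k o :
  \int[P]_w nc (fl (fun w => G z w ^+ k.+1) o w) <= coef_max z k.
Proof.
exact: (le_bigmax _ (fun o => \int[P]_w nc (fl (fun w => G z w ^+ k.+1) o w))).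
Qed.

Variables (B : 'M[R]_n) (K rho : R).
Hypothesis reg : regular xi y Q B K rho.

Let K1 : 1 <= K := reg_K reg.
Let n0 : 0 < n%:R :> R := ngt0 reg.

Lemma mxmeas_exp (M : T -> 'M[C]_n) k : mxmeas M -> mxmeas (fun w => M w ^+ k).
Proof.
move=> mM; elim: k => [|k ih].
  by under eq_fun do rewrite expr0; exact: mxmeas_cst.
by under eq_fun do rewrite exprS; exact: mxmeasM.
Qed.

Lemma fluct_axis_le eta : 320 * K ^+ 3 <= eta ->
  fluct_max (0 +i* eta) <= Num.sqrt (axis_cst K eta * rho).
Proof.
move=> he; apply: bigmax_le => [|o _]; first exact: sqrtr_ge0.
have e0 : 0 < eta.
  have : 0 < K ^+ 3 by apply: exprn_gt0; exact: lt_le_trans K1.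
  by move: he; lra.
have z0 : complex.Im (0 +i* eta : C) != 0 by rewrite gt_eqF.
have := axis_contraction reg he (Ordinal (reg_m reg)) o.
move=> /(ler_wsqrtr)/le_trans h; apply: le_trans (h _ (lexx _)).
have iu := rint_fluct_point reg z0 o.
rewrite -[leLHS]ger0_norm; last by apply: Rintegral_ge0 => w _; exact: normc_ge0.
rewrite -sqrtr_sqr ler_wsqrtr// Rintegral_sqr_le//.
apply: (rint_bounded ((`|eta|^-1 * (K + 2)) ^+ 2)).
  by apply: measurable_funX; exact: rint_meas iu.
move=> w; rewrite ger0_norm ?sqr_ge0//.
have := fluct_point_le reg z0 o w => /= h1.
apply: lerXn2r; last exact: h1; rewrite nnegrE ?normc_ge0//.
exact: le_trans (normc_ge0 _) h1.
Qed.

Section expansion.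
Variables z z1 : C.
Hypotheses (z0 : complex.Im z != 0) (z10 : complex.Im z1 != 0).
Local Notation S := `|complex.Im z|^-1.
Local Notation S1 := `|complex.Im z1|^-1.
Let S0 : 0 <= S. Proof. by rewrite invr_ge0. Qed.
Let S10 : 0 <= S1. Proof. by rewrite invr_ge0. Qed.

Let rem p w := G z1 w ^+ p *m G z w.
Let mrem p : mxmeas (rem p).
Proof. by apply: mxmeasM; [apply: mxmeas_exp|]; exact: mxmeas_rsv. Qed.
Let orem p w : opbound (rem p w) (S1 ^+ p * S).
Proof.
apply: opboundM; [exact: exprn_ge0|apply: opboundX => //; exact: opbound_rsv|].
exact: opbound_rsv.
Qed.
Let mexp k : mxmeas (fun w => G z1 w ^+ k.+1).
Proof. by apply: mxmeas_exp; exact: mxmeas_rsv. Qed.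
Let oexp k w : opbound (G z1 w ^+ k.+1) (S1 ^+ k.+1).
Proof. by apply: opboundX => //; exact: opbound_rsv. Qed.

Lemma fluct_expansion p o w : fl (G z) o w =
  \sum_(k < p) (z - z1) ^+ k * fl (fun w => G z1 w ^+ k.+1) o w +
  (z - z1) ^+ p * fl (rem p) o w.
Proof.
have itr (M : T -> 'M[C]_n) k : 0 <= k -> mxmeas M -> (forall w, opbound (M w) k) ->
    cint P (fun w' => (n%:R^-1)%:C * \tr (M w')).
  move=> k0 mM Mk; apply: cintZ; apply: (cint_bounded (k * n%:R)); first exact: cmeas_tr.
  by move=> w'; exact: opbound_tr.
have ik k := itr _ _ (exprn_ge0 k.+1 S10) (mexp k) (oexp k).
have ir := itr _ _ (mulr_ge0 (exprn_ge0 p S10) S0) (mrem p) (orem p).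
have E w' : G z w' = \sum_(k < p) (z - z1) ^+ k *: G z1 w' ^+ k.+1 +
    (z - z1) ^+ p *: rem p w'.
  by rewrite {1}/rsv (resolvent_expansion p (covmx_sym xi y w') z0 z10).
have Et w' : (n%:R^-1)%:C * \tr (G z w') =
  \sum_(k < p) (z - z1) ^+ k * ((n%:R^-1)%:C * \tr (G z1 w' ^+ k.+1)) +
    (z - z1) ^+ p * ((n%:R^-1)%:C * \tr (rem p w')).
  rewrite E raddfD/= mxtraceZ raddf_sum mulrDr mulr_sumr mulrCA; congr (_ + _).
  by apply: eq_bigr => k _; rewrite /= mxtraceZ mulrCA.
rewrite /fluct (eq_cexp _ Et).
rewrite (cexpD (cint_sum _ (fun k : 'I_p => cintZ _ (ik k))) (cintZ _ ir)).
rewrite (cexp_sum _ (fun k : 'I_p => cintZ _ (ik k))) (cexpZ _ ir).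
under [X in _ - (X + _) * _]eq_bigr do rewrite (cexpZ _ (ik _)).
rewrite {1}E mulmxDl raddfD/= -scalemxAl mxtraceZ mulmx_suml raddf_sum.
rewrite (eq_bigr (fun k : 'I_p => (z - z1) ^+ k * \tr (G z1 w ^+ k.+1 *m Dfam Q o)));
  last by move=> k _; rewrite -scalemxAl; exact: mxtraceZ.
under [X in _ = X + _]eq_bigr do rewrite mulrBr.
rewrite sumrB mulrBr mulrDl mulr_suml.
under [X in _ = _ - X + _]eq_bigr do rewrite mulrA.
ring.
Qed.

Let rexp k o : rint P (fun w => nc (fl (fun w => G z1 w ^+ k.+1) o w)).
Proof. by apply: (@rint_fluct _ _ _ _ _ _ _ _ _ _ _ _ reg _ (S1 ^+ k.+1)) => //; exact: exprn_ge0. Qed.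

Let rem_le p o w : nc (fl (rem p) o w) <= S1 ^+ p * S * (K + 2).
Proof. by apply: (fluct_le reg) => //; rewrite mulr_ge0 ?exprn_ge0. Qed.

Let K20 : 0 <= K + 2. Proof. by have := K1; lra. Qed.

Lemma fluct_max_expansion p : fluct_max z <=
  \sum_(k < p) nc (z - z1) ^+ k * coef_max z1 k +
  (nc (z - z1) * S1) ^+ p * S * (K + 2).
Proof.
apply: bigmax_le => [|o _].
  apply: addr_ge0; last by rewrite !mulr_ge0 ?exprn_ge0 ?mulr_ge0 ?normc_ge0.
  by apply: sumr_ge0 => k _; rewrite mulr_ge0 ?exprn_ge0 ?normc_ge0// coef_max_ge0.
have irhs : rint P (fun w => \sum_(k < p) nc (z - z1) ^+ k *
    nc (fl (fun w => G z1 w ^+ k.+1) o w) + (nc (z - z1) * S1) ^+ p * S * (K + 2)).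
  by apply: rintD; [apply: rint_sum => k; exact: rintZ|exact: rint_cst].
apply: le_trans (RintegralT_le (rint_fluct_point reg z0 o) irhs _) _ => [w|].
  rewrite (fluct_expansion p); apply: le_trans (normcD _ _) _; apply: lerD.
    apply: le_trans (normc_sum _ _ _) _; apply: ler_sum => k _.
    by rewrite normcM normcX.
  rewrite normcM normcX exprMn -!mulrA; apply: ler_wpM2l.
    by rewrite exprn_ge0 ?normc_ge0.
  by rewrite mulrA; exact: rem_le.
rewrite RintegralD//; [|by apply: rint_sum => k; exact: rintZ|exact: rint_cst].
rewrite RintegralT_cst lerD2r RintegralT_sum; last by move=> k; exact: rintZ.
apply: ler_sum => k _; rewrite RintegralZl//; apply: ler_wpM2l.
  by rewrite exprn_ge0 ?normc_ge0.
exact: le_coef_max.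
Qed.

(** The expansion to order [k + 1], solved for its term of order [k]. *)
Lemma coef_max_expansion k : nc (z - z1) ^+ k * coef_max z1 k <=
  fluct_max z + \sum_(j < k) nc (z - z1) ^+ j * coef_max z1 j +
  (nc (z - z1) * S1) ^+ k.+1 * S * (K + 2).
Proof.
have [->|zz] := eqVneq (nc (z - z1) ^+ k) 0.
  rewrite mul0r; apply: addr_ge0; last by rewrite !mulr_ge0 ?exprn_ge0 ?mulr_ge0 ?normc_ge0.
  apply: addr_ge0; first exact: fluct_max_ge0.
  by apply: sumr_ge0 => j _; rewrite mulr_ge0 ?exprn_ge0 ?normc_ge0// coef_max_ge0.
have zp : 0 < nc (z - z1) ^+ k by rewrite lt_neqAle eq_sym zz exprn_ge0 ?normc_ge0.
rewrite -ler_pdivlMl//; apply: bigmax_le => [|o _].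
  apply: mulr_ge0; first by rewrite invr_ge0 ltW.
  apply: addr_ge0; last by rewrite !mulr_ge0 ?exprn_ge0 ?mulr_ge0 ?normc_ge0.
  apply: addr_ge0; first exact: fluct_max_ge0.
  by apply: sumr_ge0 => j _; rewrite mulr_ge0 ?exprn_ge0 ?normc_ge0// coef_max_ge0.
rewrite ler_pdivlMl// -RintegralZl//.
have i1 := rint_fluct_point reg z0 o.
have i2 : rint P (fun w => \sum_(j < k) nc (z - z1) ^+ j *
   nc (fl (fun w => G z1 w ^+ j.+1) o w)) by apply: rint_sum => j; exact: rintZ.
have i3 := rint_cst P ((nc (z - z1) * S1) ^+ k.+1 * S * (K + 2)).
apply: le_trans (RintegralT_le (rintZ _ (rexp k o)) (rintD (rintD i1 i2) i3) _) _ => [w|].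
  have : (z - z1) ^+ k * fl (fun w => G z1 w ^+ k.+1) o w = fl (G z) o w -
      \sum_(j < k) (z - z1) ^+ j * fl (fun w => G z1 w ^+ j.+1) o w -
      (z - z1) ^+ k.+1 * fl (rem k.+1) o w.
    by rewrite [in RHS](fluct_expansion k.+1) big_ord_recr /=; ring.
  rewrite -normcX -normcM => ->; apply: le_trans (normcB _ _) _; apply: lerD.
    apply: le_trans (normcB _ _) _; rewrite lerD2l.
    apply: le_trans (normc_sum _ _ _) _; apply: ler_sum => j _.
    by rewrite normcM normcX.
  rewrite normcM normcX exprMn -!mulrA; apply: ler_wpM2l.
    by rewrite exprn_ge0 ?normc_ge0.
  by rewrite mulrA; exact: rem_le.
rewrite (RintegralD _ (rintD i1 i2) i3)// (RintegralD _ i1 i2)// RintegralT_cst lerD2r.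
apply: lerD; first exact: le_fluct_max.
rewrite RintegralT_sum; last by move=> j; exact: rintZ.
apply: ler_sum => j _; rewrite RintegralZl//; apply: ler_wpM2l.
  by rewrite exprn_ge0 ?normc_ge0.
exact: le_coef_max.
Qed.

End expansion.
End continuation.

Lemma cvgr_sum (R : realType) (U : Type) (F : set_system U) {FF : Filter F} (I : Type)
    (r : seq I) (f : I -> U -> R) (a : I -> R) :
  (forall i, f i x @[x --> F] --> a i) ->
  \sum_(i <- r) f i x @[x --> F] --> \sum_(i <- r) a i.
Proof.
move=> h; elim: r => [|i r ih].
  by rewrite big_nil; under eq_fun do rewrite big_nil; exact: cvg_cst.
by rewrite big_cons; under eq_fun do rewrite big_cons; exact: cvgD.
Qed.

(** Vanishing along a segment forces the Taylor coefficients at its end to vanish. Induction on [k]: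
    once the lower coefficients tend to 0, the inequality divided by [h^k] bounds the upper limit of
    the [k]-th by [h c], for every [h]. *)
Lemma coefficients_cvg0 (R : realType) (e : nat -> nat -> R) (U : nat -> R -> R) (c : R) :
  (forall n k, 0 <= e n k) -> 0 <= c ->
  (forall h, 0 < h <= 1 -> U n h @[n --> \oo] --> 0) ->
  (\forall n \near \oo, forall k h, 0 < h <= 1 ->
     h ^+ k * e n k <= U n h + \sum_(j < k) h ^+ j * e n j + h ^+ k.+1 * c) ->
  forall k, e n k @[n --> \oo] --> 0.
Proof.
move=> e0 c0 U0 ineq k.
have [N] := ubnP k; elim: N k => // N ih k; rewrite ltnS => kN.
have ej j : (j < k)%N -> e n j @[n --> \oo] --> 0.
  by move=> jk; apply: ih; exact: leq_trans kN.
apply/cvgrPdist_lt => eps eps0.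
(* Chosen so that the remainder, divided by [h^k], is at most [eps / 2]. *)
pose h := Num.min 1 (eps / (2 * (c + 1))).
have h0 : 0 < h.
  by rewrite lt_min ltr01 /= divr_gt0// mulr_gt0// ltr_wpDl.
have h1 : h <= 1 by rewrite ge_min lexx.
have hc : h * c <= eps / 2.
  have : h * (c + 1) <= eps / (2 * (c + 1)) * (c + 1).
    by rewrite ler_wpM2r ?addr_ge0// ge_min lexx orbT.
  have -> : eps / (2 * (c + 1)) * (c + 1) = eps / 2 by field; rewrite gt_eqF// ltr_wpDl.
  by rewrite mulrDr mulr1; have := h0; lra.
have hk0 : 0 < h ^+ k by rewrite exprn_gt0.
have S0 : (U n h + \sum_(j < k) h ^+ j * e n j) @[n --> \oo] --> 0.
  rewrite -[X in _ --> X]addr0; apply: cvgD; first by apply: U0; rewrite h0 h1.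
  rewrite [X in _ --> X](_ : _ = \sum_(j < k) h ^+ j * 0); last first.
    by rewrite big1// => j _; rewrite mulr0.
  by apply: cvgr_sum => j; apply: cvgMl_tmp; exact: ej.
have t0 : 0 < h ^+ k * (eps / 2) by rewrite mulr_gt0// divr_gt0.
near=> n; rewrite sub0r normrN ger0_norm//.
have hn : U n h + \sum_(j < k) h ^+ j * e n j < h ^+ k * (eps / 2).
  have : `|0 - (U n h + \sum_(j < k) h ^+ j * e n j)| < h ^+ k * (eps / 2).
    by near: n; move/cvgrPdist_lt : S0; exact.
  by rewrite sub0r normrN; apply: le_lt_trans; exact: ler_norm.
have ineqn : forall k h, 0 < h <= 1 ->
    h ^+ k * e n k <= U n h + \sum_(j < k) h ^+ j * e n j + h ^+ k.+1 * c.
  by near: n; exact: ineq.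
rewrite -(ltr_pM2l hk0); apply: le_lt_trans (ineqn k h _) _; first by rewrite h0 h1.
have : h ^+ k.+1 * c <= h ^+ k * (eps / 2) by rewrite exprSr -mulrA ler_wpM2l// ltW.
have -> : h ^+ k * eps = h ^+ k * (eps / 2) + h ^+ k * (eps / 2) by field.
by move: hn; lra.
Unshelve. all: by end_near.
Qed.

(** * Vanishing of the fluctuations and the asymptotic scalar equation *)

Section asymptotics.
Context (R : realType) (d : nat -> measure_display) (T : forall n, measurableType (d n)).
Variables (P : forall n, probability (T n) R) (m : nat -> nat).
Variables (xi : forall n, 'I_(m n) -> {RV (P n) >-> R}).
Variables (y : forall n, 'I_(m n) -> 'I_n -> {RV (P n) >-> R}).
Variables (Q : forall n, 'I_(m n) -> 'M[R]_n) (B : forall n, 'M[R]_n).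
Variables (K : R) (rho : nat -> R).
Hypothesis reg : \forall n \near \oo, regular (@xi n) (@y n) (@Q n) (B n) K (rho n).
Hypothesis rho_cvg : rho n @[n --> \oo] --> 0.
Local Notation C := R[i].

Let fmax z n := fluct_max (@xi n) (@y n) (@Q n) z.
Let cmax z k n := coef_max (@xi n) (@y n) (@Q n) z k.

Let K1 : 1 <= K. Proof. by have [n /reg_K] := filter_ex reg. Qed.

Let K3 : 1 <= K ^+ 3. Proof. exact: exprn_ege1. Qed.

Let fmax_axis_cvg eta : 320 * K ^+ 3 <= eta -> fmax (0 +i* eta) n @[n --> \oo] --> 0.
Proof.
move=> he.
have : Num.sqrt (axis_cst K eta * rho n) @[n --> \oo] --> 0.
  rewrite -(@sqrtr0 R); apply: (@continuous_cvg _ _ _ _ _ _ (fun x : R => Num.sqrt x)).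
    exact: sqrt_continuous.
  by rewrite -[X in _ --> X](mulr0 (axis_cst K eta)); exact: cvgMl_tmp.
apply: squeeze_cvgr; last exact: cvg_cst.
by apply: filterS reg => n r; rewrite fluct_max_ge0 (fluct_axis_le r).
Qed.

Let cmax_cvg eta k : 320 * K ^+ 3 <= eta -> cmax (0 +i* eta) k n @[n --> \oo] --> 0.
Proof.
move=> he; have e0 : 0 < eta by move: K3 he; lra.
have e1 : 1 <= eta by move: K3 he; lra.
(* The points [i (eta + h)] lie above the contraction threshold, so the fluctuations are already
   known to vanish there. *)
move: k; apply: (@coefficients_cvg0 _ (fun n k => cmax (0 +i* eta) k n)
  (fun n h => fmax (0 +i* (eta + h)) n) (K + 2)).
- by move=> n k; exact: coef_max_ge0.
- by move: K1; lra.
- by move=> h /andP[h0 _]; apply: fmax_axis_cvg; move: he h0; lra.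
apply: filterS reg => n r k h /andP[h0 h1].
have z0 : complex.Im (0 +i* (eta + h) : C) != 0 by rewrite gt_eqF//= addr_gt0.
have z10 : complex.Im (0 +i* eta : C) != 0 by rewrite gt_eqF.
have nh : nc (0 +i* (eta + h) - 0 +i* eta) = h.
  have -> : 0 +i* (eta + h) - 0 +i* eta = 0 +i* h :> C by apply: complex_ext => /=; ring.
  by rewrite /nc expr0n add0r sqrtr_sqr ger0_norm// ltW.
have := coef_max_expansion r z0 z10 k; rewrite nh => /le_trans; apply.
apply: lerD => //; rewrite -mulrA exprMn -mulrA; apply: ler_wpM2l.
  by rewrite exprn_ge0// ltW.
rewrite mulrA; apply: ler_piMl; first by move: K1; lra.
have i1 : `|complex.Im (0 +i* eta : C)|^-1 <= 1.
  by rewrite /= gtr0_norm// invf_le1.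
have i2 : `|complex.Im (0 +i* (eta + h) : C)|^-1 <= 1.
  by rewrite /= gtr0_norm ?addr_gt0// invf_le1 ?addr_gt0//; move: e1 h0; lra.
by rewrite mulr_ile1 ?invr_ge0 ?exprn_ge0 ?exprn_ile1 ?invr_ge0.
Qed.

Lemma fluct_cvg0 (z : C) : 0 < complex.Im z ->
  fluct_max (@xi n) (@y n) (@Q n) z @[n --> \oo] --> 0.
Proof.
case: z => t s /= s0; set z := t +i* s.
have z0 : complex.Im z != 0 by rewrite gt_eqF.
(* The disc of radius [eta] about [i eta] contains [t + i s] once [t^2 + s^2 < 2 eta s]. These discs
   exhaust the upper half-plane, so one expansion replaces a chain of continuations. *)
pose eta := Num.max (320 * K ^+ 3) ((t ^+ 2 + s ^+ 2) / s).
have he : 320 * K ^+ 3 <= eta by rewrite le_max lexx.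
have hs : t ^+ 2 + s ^+ 2 <= eta * s by rewrite -ler_pdivrMr// le_max lexx orbT.
have e0 : 0 < eta by move: K3 he; lra.
set z1 : C := 0 +i* eta; have z10 : complex.Im z1 != 0 by rewrite gt_eqF.
set q := nc (z - z1) * `|complex.Im z1|^-1.
have q0 : 0 <= q by rewrite mulr_ge0 ?normc_ge0.
have q1 : q < 1.
  rewrite /q ger0_norm ?ltW// ltr_pdivrMr// mul1r.
  rewrite -(@ltr_pXn2r _ 2)// ?nnegrE ?normc_ge0 ?ltW//.
  rewrite normc_sqr/= subr0; have := mulr_gt0 e0 s0; move: hs; nra.
set c := `|complex.Im z|^-1 * (K + 2).
have c0 : 0 <= c by rewrite mulr_ge0// addr_ge0//; move: K1; lra.
apply/cvgrPdist_lt => eps eps0.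
have [p hp] : exists p, q ^+ p * c < eps / 2.
  have : q ^+ p * c @[p --> \oo] --> 0.
    rewrite -[X in _ --> X](mul0r c); apply: cvgMr_tmp; apply: cvg_expr.
    by rewrite ger0_norm.
  move=> /cvgrPdist_lt /(_ (eps / 2)) []; first by rewrite divr_gt0.
  move=> p _ /(_ p (leqnn p)) /=; rewrite sub0r normrN ger0_norm; first by exists p.
  by rewrite mulr_ge0// exprn_ge0.
have S0 : \sum_(k < p) nc (z - z1) ^+ k * cmax z1 k n @[n --> \oo] --> 0.
  rewrite [X in _ --> X](_ : _ = \sum_(k < p) nc (z - z1) ^+ k * 0); last first.
    by rewrite big1// => k _; rewrite mulr0.
  by apply: cvgr_sum => k; apply: cvgMl_tmp; exact: cmax_cvg.
near=> n; rewrite sub0r normrN ger0_norm; last exact: fluct_max_ge0.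
have r : regular (@xi n) (@y n) (@Q n) (B n) K (rho n) by near: n.
have hn : `|0 - \sum_(k < p) nc (z - z1) ^+ k * cmax z1 k n| < eps / 2.
  by near: n; move/cvgrPdist_lt : S0; apply; rewrite divr_gt0.
apply: le_lt_trans (fluct_max_expansion r z0 z10 p) _.
rewrite -/q -mulrA -/c [eps]splitr; apply: ltrD => //.
by move: hn; rewrite sub0r normrN; apply: le_lt_trans; exact: ler_norm.
Unshelve. all: by end_near.
Qed.

Lemma gbar_bounds (z : C) : 0 < complex.Im z -> exists2 c : R, 0 < c &
  \forall n \near \oo, c <= complex.Im (gbar (@xi n) (@y n) z) /\
    nc (gbar (@xi n) (@y n) z) <= `|complex.Im z|^-1.
Proof.
case: z => t s /= s0; have K0 : 0 < K ^+ 2 by rewrite exprn_gt0//; move: K1; lra.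
exists (s / (2 * (2 * (4 * K ^+ 2 + 1) ^+ 2 + 2 * t ^+ 2 + s ^+ 2))).
  rewrite divr_gt0// mulr_gt0// ltr_wpDl ?exprn_gt0// addr_ge0// mulr_ge0// ?sqr_ge0//.
apply: filterS reg => n r; split.
  by apply: (Im_gbar_ge r) => //; move: K0; lra.
have z0 : complex.Im (t +i* s : C) != 0 by rewrite gt_eqF.
by apply: le_trans (gbar_le r z0) _.
Qed.

Lemma scalar_equation_cvg (z : C) : 0 < complex.Im z ->
  exists2 e : nat -> R, e n @[n --> \oo] --> 0 &
  \forall n \near \oo, forall a, nc (1 + (z - xi_transform (@xi n)
     (gbar (@xi n) (@y n) z) a * ((m n)%:R / n%:R)%:C) * gbar (@xi n) (@y n) z) <= e n.
Proof.
move=> z0; have [c c0 hc] := gbar_bounds z0.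
have zn0 : complex.Im z != 0 by rewrite gt_eqF.
set S := `|complex.Im z|^-1; have S0 : 0 < S by rewrite invr_gt0 normr_gt0.
pose h := c / S; have h0 : 0 < h by rewrite divr_gt0.
pose K' := K * (1 + S / h).
exists (fun n => approx_cst K' z (K' + S + 1) h * rho n +
  2 * K' ^+ 3 * S * h^-1 * (fmax z n + S * rho n)).
  rewrite -[X in _ --> X]addr0 -[X in _ --> X + _](mulr0 (approx_cst K' z (K' + S + 1) h)).
  rewrite -[X in _ --> _ + X](mulr0 (2 * K' ^+ 3 * S * h^-1)).
  apply: cvgD; first exact: cvgMl_tmp.
  apply: cvgMl_tmp; rewrite -[X in _ --> X]addr0; apply: cvgD; first exact: fluct_cvg0.
  by rewrite -[X in _ --> X](mulr0 S); exact: cvgMl_tmp.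
apply: filterS2 reg hc => n r [c1 c2] a.
apply: (scalar_equation r zn0 a h0) => // [x|b]; last exact: le_fluct_max.
have g0 : 0 < complex.Im (gbar (@xi n) (@y n) z) by exact: lt_le_trans c1.
apply: le_trans (normc_1Dreal_ge x g0); rewrite /h.
apply: ler_pM => //; [exact: ltW|by rewrite invr_ge0 ltW|].
rewrite lef_pV2 ?posrE// normc_gt0.
by apply: contraTneq g0 => ->; rewrite ltxx.
Qed.

End asymptotics.

(** * Signed measures as functionals *)

Section bounded_functionals.
Variable R : realType.
Local Notation borelR := (measurableTypeR R).

Definition bmeas (f : R -> R) :=
  measurable_fun [set: borelR] f /\ exists c, forall x, `|f x| <= c.

Lemma bmeas_cst c : bmeas (fun=> c).
Proof. by split; [exact: measurable_cst|exists `|c|]. Qed.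

Lemma bmeasD f g : bmeas f -> bmeas g -> bmeas (fun x => f x + g x).
Proof.
move=> [mf [a fa]] [mg [b gb]]; split; first exact: measurable_funD.
by exists (a + b) => x; apply: le_trans (ler_normD _ _) _; exact: lerD.
Qed.

Lemma bmeasM f g : bmeas f -> bmeas g -> bmeas (fun x => f x * g x).
Proof.
move=> [mf [a fa]] [mg [b gb]]; split; first exact: measurable_funM.
by exists (a * b) => x; rewrite normrM ler_pM.
Qed.

Lemma bmeasZ c f : bmeas f -> bmeas (fun x => c * f x).
Proof. by apply: bmeasM; exact: bmeas_cst. Qed.

Lemma bmeasB f g : bmeas f -> bmeas g -> bmeas (fun x => f x - g x).
Proof.
move=> bf /(bmeasZ (-1)) bg; have := bmeasD bf bg.
by under [X in bmeas X -> _]eq_fun do rewrite mulN1r.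
Qed.

Lemma bmeas_indic (A : set borelR) : measurable A -> bmeas \1_A.
Proof.
move=> mA; split; first exact: measurable_indic.
by exists 1 => x; rewrite indicE; case: (_ \in _); rewrite ?normr1 ?normr0.
Qed.

Lemma bmeas_sum (I : Type) (r : seq I) (f : I -> R -> R) :
  (forall i, bmeas (f i)) -> bmeas (fun x => \sum_(i <- r) f i x).
Proof.
move=> h; elim: r => [|i r ih].
  by under eq_fun do rewrite big_nil; exact: bmeas_cst.
by under eq_fun do rewrite big_cons; exact: bmeasD.
Qed.

Lemma bmeas_rint (mu : {finite_measure set borelR -> \bar R}) f : bmeas f -> rint mu f.
Proof. by move=> [mf [c fc]]; exact: (rint_bounded c mf fc). Qed.

(** Covers integration against a charge, weighted expectations and empirical averages alike; [M]
    plays the role of a total variation bound. *)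
Record bounded_functional (L : (R -> R) -> R) (M : R) : Prop := BoundedFunctional {
  bfunD : forall f g, bmeas f -> bmeas g -> L (fun x => f x + g x) = L f + L g;
  bfunZ : forall c f, bmeas f -> L (fun x => c * f x) = c * L f;
  bfun_le : forall c f, bmeas f -> (forall x, `|f x| <= c) -> `|L f| <= M * c
}.

Section functional.
Variables (L : (R -> R) -> R) (M : R).
Hypothesis bL : bounded_functional L M.

Lemma bfunB f g : bmeas f -> bmeas g -> L (fun x => f x - g x) = L f - L g.
Proof.
move=> bf bg; under [in LHS]eq_fun do rewrite -mulN1r.
by rewrite (bfunD bL bf (bmeasZ _ bg)) (bfunZ bL _ bg) mulN1r.
Qed.

Lemma bfun_sum (I : Type) (r : seq I) (f : I -> R -> R) : (forall i, bmeas (f i)) ->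
  L (fun x => \sum_(i <- r) f i x) = \sum_(i <- r) L (f i).
Proof.
move=> h; elim: r => [|i r ih].
  under [in LHS]eq_fun do rewrite big_nil; rewrite big_nil.
  have := bfunZ bL 0 (bmeas_cst 0).
  by under [in LHS]eq_fun do rewrite mul0r; rewrite mul0r.
under [in LHS]eq_fun do rewrite big_cons; rewrite big_cons -ih.
exact: (bfunD bL (h i) (bmeas_sum r h)).
Qed.

End functional.

Definition step_approx (c eps : R) (N : nat) (f : R -> R) (x : R) : R :=
  - c + eps * \sum_(j < N) \1_[set u | - c + j.+1%:R * eps <= f u] x.

(* The sum counts the multiples of [eps] below [f + c]. *)
Lemma step_approx_le c eps N f x : 0 < eps -> `|f x| <= c -> 2 * c <= N%:R * eps ->
  `|f x - step_approx c eps N f x| <= eps.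
Proof.
move=> e0 /ler_normlP[f1 f2] hN; rewrite /step_approx.
set s := fun N => \sum_(j < N) \1_[set u | - c + j.+1%:R * eps <= f u] x : R.
have hs K : (K%:R * eps <= f x + c -> s K = K%:R) /\
    (f x + c < K%:R * eps -> eps * s K <= f x + c < eps * s K + eps).
  elim: K => [|K [ih1 ih2]].
    by rewrite /s !big_ord0 mul0r; split=> //; lra.
  rewrite /s big_ord_recr -/(s K) /= indicE.
  have [kf|fk] := leP (K.+1%:R * eps) (f x + c).
    rewrite mem_set/=; last by lra.
    have -> : s K = K%:R by apply: ih1; apply: le_trans kf; rewrite ler_pM2r// ler_nat.
    split=> [_|h]; first by rewrite -[in RHS]natr1.
    by exfalso; move: kf h; lra.
  rewrite memNset/= ?addr0; last by apply/negP; rewrite -ltNge; lra.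
  split=> [|_]; first by lra.
  have [kf'|/ih2//] := leP (K%:R * eps) (f x + c).
  by rewrite (ih1 kf') mulrC kf'/=; move: fk; rewrite -natr1 mulrDl mul1r.
have [h1 h2] := hs N; have [h|h] := leP (N%:R * eps) (f x + c).
  rewrite -/(s N) (h1 h) mulrC ler_norml; apply/andP; split; lra.
have /andP[h3 h4] := h2 h; rewrite -/(s N) ler_norml; apply/andP; split; lra.
Qed.

Lemma measurable_super f (a : R) : bmeas f -> measurable [set u | a <= f u].
Proof.
move=> [mf _]; rewrite -[X in measurable X]setTI.
have -> : [set u | a <= f u] = f @^-1` `[a, +oo[.
  by apply/seteqP; split => u /=; rewrite in_itv/= andbT.
exact: mf.
Qed.

(** Uniform approximation by step functions: the functionals agree on these, and each moves by at
    most [M eps]; [eps = e / (2 (M + 1))] keeps the total below [e]. *)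
Lemma eq_bounded_functional L1 L2 M : 0 <= M ->
  bounded_functional L1 M -> bounded_functional L2 M ->
  (forall A : set borelR, measurable A -> L1 \1_A = L2 \1_A) ->
  forall f, bmeas f -> L1 f = L2 f.
Proof.
move=> M0 b1 b2 h f bf; have [mf [c fc]] := bf.
have c0 : 0 <= c by apply: le_trans (fc 0).
apply/eqP; rewrite -subr_eq0 -normr_le0; apply/ler_addgt0Pr => e e0; rewrite add0r.
pose eps := e / (2 * (M + 1)).
have M1 : 0 < 2 * (M + 1) by move: M0; lra.
have eps0 : 0 < eps by rewrite divr_gt0.
have [N hN] : exists N, 2 * c <= N%:R * eps.
  exists (Num.truncn (2 * c / eps)).+1; rewrite -ler_pdivrMr//.
  by apply: ltW; rewrite truncnS_gt.
have bi (j : 'I_N) := bmeas_indic (measurable_super (- c + j.+1%:R * eps) bf).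
have bs : bmeas (step_approx c eps N f).
  by apply: bmeasD (bmeas_cst _) (bmeasZ _ (bmeas_sum _ bi)).
have es : L1 (step_approx c eps N f) = L2 (step_approx c eps N f).
  have cE : (fun=> - c) = (fun x => - c * (\1_[set: borelR] x)) :> (R -> R).
    by apply/funext => x; rewrite indicT mulr1.
  have E L : bounded_functional L M -> L (step_approx c eps N f) =
      - c * L \1_[set: borelR] +
      eps * \sum_(j < N) L \1_[set u | - c + j.+1%:R * eps <= f u].
    move=> b; rewrite [LHS](bfunD b (bmeas_cst _) (bmeasZ _ (bmeas_sum _ bi))).
    rewrite cE (bfunZ b _ (bmeas_indic measurableT)) (bfunZ b _ (bmeas_sum _ bi)).
    by rewrite (bfun_sum b _ bi).
  rewrite (E _ b1) (E _ b2) (h _ measurableT); congr (_ + _ * _).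
  by apply: eq_bigr => j _; apply: h; exact: measurable_super.
have bd : bmeas (fun x => f x - step_approx c eps N f x) by exact: bmeasB.
have dd x : `|f x - step_approx c eps N f x| <= eps by exact: step_approx_le.
have e1 := bfun_le b1 bd dd; have e2 := bfun_le b2 bd dd.
rewrite (bfunB b1 bf bs) in e1; rewrite (bfunB b2 bf bs) in e2.
have -> : L1 f - L2 f = (L1 f - L1 (step_approx c eps N f)) -
    (L2 f - L2 (step_approx c eps N f)) by rewrite es; ring.
apply: le_trans (ler_normB _ _) _; apply: le_trans (lerD e1 e2) _.
have -> : M * eps + M * eps = (2 * (M + 1)) * eps - 2 * eps by ring.
have -> : 2 * (M + 1) * eps = e by rewrite /eps mulrC divfK// gt_eqF.
by move: eps0; lra.
Qed.

Section charge.
Variable nu : {charge set borelR -> \bar R}.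
Local Notation jp := (jordan_pos (hahnP nu)).
Local Notation jn := (jordan_neg (hahnP nu)).

Definition charge_mass : R := fine (jp [set: borelR]) + fine (jn [set: borelR]).

Lemma charge_mass_ge0 : 0 <= charge_mass.
Proof. by rewrite addr_ge0// fine_ge0. Qed.

Lemma charge_functional : bounded_functional (charge_integral nu) charge_mass.
Proof.
split=> [f g bf bg|c f bf|c f bf fc]; rewrite /charge_integral.
- by rewrite !RintegralD//; [ring|exact: bmeas_rint..].
- by rewrite !RintegralZl//; [ring|exact: bmeas_rint..].
rewrite mulrDl; apply: le_trans (ler_normB _ _) _.
have h (mu : {finite_measure set borelR -> \bar R}) :
    `|\int[mu]_x f x| <= fine (mu [set: borelR]) * c.
  rewrite mulrC -(Rintegral_cst mu)//.
  apply: normr_RintegralT_le => //; first exact: bmeas_rint.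
  by apply: bmeas_rint; exact: bmeas_cst.
by apply: lerD; exact: h.
Qed.

Lemma charge_integral_indic (A : set borelR) : measurable A ->
  charge_integral nu \1_A = fine (nu A).
Proof.
move=> mA; rewrite (jordan_decomp (hahnP nu) mA) /charge_integral.
rewrite /Rintegral !integral_indic// !setIT /cadd/= cscaleN1.
by rewrite fineB ?fin_num_measure.
Qed.

End charge.
End bounded_functionals.

(** * The signed measures as weighted laws of the coefficients *)

Section law.
Context d (T : measurableType d) (R : realType) (P : probability T R).
Variables (X : {RV P >-> R}) (sg : cumulativeBounded (0 : R) (1 : R)).
Hypothesis cdfX : forall r, cdf X r = (sg r)%:E.
Local Notation borelR := (measurableTypeR R).
Local Notation mu := (lebesgue_stieltjes_measure sg).

Let mXb : measurable_fun [set: T] (X : T -> borelR).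
Proof. exact: (@measurable_funPT _ _ _ _ X). Qed.

HB.instance Definition _ := isMeasurableFun.Build _ _ T borelR (X : T -> borelR) mXb.

Let Xb : {mfun T >-> borelR} := (X : T -> borelR).

(** Both measures give [sg b - sg a] to a half-open interval, which determines them. *)
Lemma stieltjes_law (A : set borelR) : measurable A -> mu A = distribution P Xb A.
Proof.
move: A; apply: (@lebesgue_stieltjes_measure_unique _ sg (distribution P Xb)) => I [[a b]]/= _ <-.
rewrite /lebesgue_stieltjes_measure /measure_extension/=.
rewrite measurable_mu_extE/=; last exact: is_ocitv.
have [ab | ba] := leP a b; last first.
  by rewrite set_itv_ge ?wlength0 ?measure0// bnd_simp -leNgt ltW.
rewrite wlength_itv_bnd// EFinB -!cdfX /cdf.
have : `]a, b]%classic = `]-oo, b] `\` `]-oo, a] => [|->].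
  by rewrite -[RHS]setCK setCD setCitvl setUC -[LHS]setCK setCitv.
rewrite measureD ?setIidr//; first exact: subset_itvl.
by rewrite -ge0_fin_numE// fin_num_measure.
Qed.

Lemma ge0_stieltjes_integral (f : R -> \bar R) : measurable_fun [set: borelR] f ->
  (forall x, 0 <= f x)%E -> (\int[mu]_x f x = \int[P]_w f (X w))%E.
Proof.
move=> mf f0; rewrite -(ge0_integral_distribution Xb)//.
by apply: eq_measure_integral => A mA _; exact: stieltjes_law.
Qed.

Hypothesis X2 : rint P (fun w => X w ^+ 2).

Lemma square_rint : rint P X.
Proof.
apply: (rint_le (fun w => 1 + X w ^+ 2)) => [|w|].
- exact: measurable_funPT.
- by rewrite ler_norml; apply/andP; split; nra.
- by apply: rintD => //; exact: rint_cst.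
Qed.

Let mX : measurable_fun [set: T] X. Proof. exact: measurable_funPT. Qed.

Let mbX (f : R -> R) : bmeas f -> measurable_fun [set: T] (f \o X).
Proof. by move=> [mf _]; exact: measurableT_comp. Qed.

Lemma rint_mul_bmeas f : bmeas f -> rint P (fun w => X w * f (X w)).
Proof.
move=> bf; have [mf [c fc]] := bf; apply: (rint_le (fun w => c * `|X w|)) => [|w|].
- by apply: measurable_funM => //; exact: mbX.
- by rewrite normrM mulrC; apply: ler_wpM2r.
- by apply: rintZ; exact: rint_norm square_rint.
Qed.

Lemma stieltjes_integral_set (A : set borelR) : measurable A ->
  (\int[mu]_(x in A) x%:E = (\int[P]_w (X w * \1_A (X w)))%:E)%E.
Proof.
move=> mA; have -> : (\int[mu]_(x in A) x%:E = \int[distribution P Xb]_(x in A) x%:E)%E.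
  by apply: eq_measure_integral => B mB _; exact: stieltjes_law.
have mXA : measurable (Xb @^-1` A) by rewrite -[X in measurable X]setTI; exact: mXb.
have iX : P.-integrable (Xb @^-1` A) (EFin \o Xb).
  by apply: integrableS square_rint.
have mE : measurable_fun [set: borelR] (EFin : R -> \bar R) by exact: EFin_measurable.
rewrite (integral_pushforward (phi := Xb) mXb mE iX mA).
rewrite /Rintegral fineK; last first.
  by apply: integrable_fin_num => //; exact: rint_mul_bmeas (bmeas_indic mA).
rewrite integral_mkcond; apply: eq_integral => w _ /=.
rewrite patchE indicE.
have -> : (w \in Xb @^-1` A) = (X w \in A) by apply/idP/idP; rewrite !inE.
by case: (X w \in A); rewrite /= ?mulr1 ?mulr0.
Qed.

Variables (k : R) (nu : {charge set borelR -> \bar R}).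
Hypothesis k0 : 0 <= k.
Hypothesis nuE : forall A : set borelR, measurable A -> bounded_set (A : set R) ->
  (nu A = k%:E * \int[mu]_(x in A) x%:E)%E.

Lemma mean_functional : bounded_functional (fun f => k * \int[P]_w (X w * f (X w)))
  (k * \int[P]_w `|X w|).
Proof.
split=> [f g bf bg|c f bf|c f bf fc].
- under eq_Rintegral do rewrite mulrDr.
  by rewrite RintegralD//; [ring|exact: rint_mul_bmeas..].
- under eq_Rintegral do rewrite mulrCA.
  by rewrite RintegralZl//; [ring|exact: rint_mul_bmeas].
rewrite normrM ger0_norm// -mulrA; apply: ler_wpM2l => //.
have iX : rint P (fun w => `|X w|) by exact: rint_norm square_rint.
rewrite mulrC -RintegralZl//; apply: normr_RintegralT_le; first exact: rint_mul_bmeas.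
  exact: rintZ.
by move=> w; rewrite normrM mulrC; apply: ler_wpM2r.
Qed.

Let trunc n : set borelR := `[- n%:R, n%:R]%classic.

Let mtrunc n : measurable (trunc n). Proof. exact: measurable_itv. Qed.

Let nu_trunc (A : set borelR) n : measurable A ->
  charge_integral nu \1_(A `&` trunc n) =
  k * \int[P]_w (X w * \1_(A `&` trunc n) (X w)).
Proof.
move=> mA; have mAn : measurable (A `&` trunc n) by exact: measurableI.
rewrite charge_integral_indic// nuE//; last first.
  exists n%:R; split; first exact: num_real.
  move=> M nM x [_]; rewrite /trunc /= in_itv /= => /andP[x1 x2].
  by rewrite ler_norml; apply/andP; split; move: nM; lra.
by rewrite stieltjes_integral_set// -EFinM.
Qed.

Let trunc_union (A : set borelR) : \bigcup_n (A `&` trunc n) = A.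
Proof.
rewrite -setI_bigcupr; apply/setIidPl => x _.
exists (Num.truncn `|x|).+1 => //; rewrite /trunc /= in_itv /= -ler_norml.
by apply: ltW; rewrite truncnS_gt.
Qed.

(** The charge is prescribed on bounded sets only. Truncating at [n] and letting [n] grow recovers
    all indicators: by continuity from below of both Jordan parts on the left, by the second moment
    on the right. *)
Lemma charge_integral_mean f : bmeas f ->
  charge_integral nu f = k * \int[P]_w (X w * f (X w)).
Proof.
pose M := Num.max (charge_mass nu) (k * \int[P]_w `|X w|).
have M0 : 0 <= M by rewrite le_max charge_mass_ge0.
have mono L a : a <= M -> bounded_functional L a -> bounded_functional L M.
  move=> aM [h1 h2 h3]; split => // c g bg gc; apply: le_trans (h3 _ _ bg gc) _.
  by apply: ler_wpM2r => //; apply: le_trans (gc 0).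
move: f; apply: (eq_bounded_functional M0).
- by apply: mono (charge_functional nu); rewrite le_max lexx.
- by apply: mono mean_functional; rewrite le_max lexx orbT.
move=> A mA; have mAn n : measurable (A `&` trunc n) by exact: measurableI.
have c1 : charge_integral nu \1_(A `&` trunc n) @[n --> \oo] --> charge_integral nu \1_A.
  have h (la : {finite_measure set borelR -> \bar R}) :
      \int[la]_x \1_(A `&` trunc n) x @[n --> \oo] --> \int[la]_x \1_A x.
    have E B : measurable B -> \int[la]_x \1_B x = fine (la B).
      by move=> mB; rewrite /Rintegral integral_indic// setIT.
    rewrite E//; under eq_fun do rewrite E//.
    apply: fine_cvg; rewrite fineK ?fin_num_measure//.
    rewrite -[in X in _ --> X](trunc_union A); apply: nondecreasing_cvg_mu => //.
      by rewrite trunc_union.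
    move=> i j ij; apply/subsetPset; apply: setIS => x; rewrite /trunc /= !in_itv /=.
    have : (i%:R : R) <= j%:R by rewrite ler_nat.
    by move=> h /andP[x1 x2]; apply/andP; split; lra.
  by apply: cvgB; exact: h.
have c2 : k * \int[P]_w (X w * \1_(A `&` trunc n) (X w)) @[n --> \oo] -->
    k * \int[P]_w (X w * \1_A (X w)).
  apply: cvgMl_tmp; apply/cvgrPdist_le => e e0.
  (* The discarded part is at most [E X^2 / n], because [|X| <= X^2 / n] wherever [|X| > n]. *)
  exists (Num.truncn (\int[P]_w (X w ^+ 2) / e)).+1 => // n /= nn.
  have n0 : 0 < n%:R :> R by rewrite ltr0n; exact: leq_ltn_trans nn.
  have i1 := rint_mul_bmeas (bmeas_indic mA).
  have i2 := rint_mul_bmeas (bmeas_indic (mAn n)).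
  rewrite -RintegralB//; apply: (@le_trans _ _ (\int[P]_w (n%:R^-1 * X w ^+ 2))).
    apply: normr_RintegralT_le; [exact: rintB|exact: rintZ|move=> w].
    rewrite -mulrBr normrM.
    rewrite !indicE in_setI; case: (X w \in A) => /=; last first.
      by rewrite subrr normr0 mulr0 mulr_ge0 ?invr_ge0 ?sqr_ge0.
    case: (boolP (X w \in trunc n)) => h.
      by rewrite subrr normr0 mulr0 mulr_ge0 ?invr_ge0 ?sqr_ge0.
    rewrite subr0 normr1 mulr1 ler_pdivlMl// -real_normK ?num_real// expr2.
    apply: ler_wpM2r => //; apply: ltW; rewrite ltNge; apply: contra h => h.
    by rewrite inE /trunc /= in_itv /= -ler_norml.
  rewrite RintegralZl// ler_pdivrMl// -ler_pdivrMr//.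
  apply: ltW; apply: lt_le_trans (truncnS_gt _) _.
  by rewrite ler_nat.
have E : (fun n => k * \int[P]_w (X w * \1_(A `&` trunc n) (X w))) =
    (fun n => charge_integral nu \1_(A `&` trunc n)).
  by apply/funext => n; rewrite nu_trunc.
rewrite E in c2; exact: (cvg_unique _ c1 c2).
Qed.

End law.

(** * Uniqueness of the limit equation *)

Section complex_functions.
Variable R : realType.
Local Notation C := R[i].
Local Notation borelR := (measurableTypeR R).

Definition cb (f : R -> R) := continuous f /\ exists c, forall x, `|f x| <= c.

Lemma cb_bounded f : cb f -> bounded_fun f.
Proof.
move=> [_ [c fc]]; exists c; split; first exact: num_real.
by move=> M cM x _; apply: le_trans (fc x) (ltW cM).
Qed.

Lemma cb_bmeas f : cb f -> bmeas f.
Proof.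
move=> [cf fc]; split => //.
by apply: continuous_measurable_fun.
Qed.

Definition ccont (f : R -> C) :=
  continuous (fun x => complex.Re (f x)) /\ continuous (fun x => complex.Im (f x)).

Lemma ccont_cst c : ccont (fun=> c).
Proof. by split=> x; exact: cvg_cst. Qed.

Lemma ccont_real (f : R -> R) : continuous f -> ccont (fun x => (f x)%:C).
Proof. by move=> cf; split=> x /=; [exact: cf|exact: cvg_cst]. Qed.

Lemma ccontD f g : ccont f -> ccont g -> ccont (fun x => f x + g x).
Proof.
move=> [f1 f2] [g1 g2]; split=> x.
  by under eq_fun do rewrite raddfD; apply: cvgD; [exact: f1|exact: g1].
by under eq_fun do rewrite raddfD; apply: cvgD; [exact: f2|exact: g2].
Qed.

Lemma ccontM f g : ccont f -> ccont g -> ccont (fun x => f x * g x).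
Proof.
move=> [f1 f2] [g1 g2]; split.
  rewrite (_ : (fun x => _) = (fun x => complex.Re (f x) * complex.Re (g x) -
      complex.Im (f x) * complex.Im (g x))); last by apply/funext => x; rewrite Re_mulc.
  by move=> x; apply: cvgB; apply: cvgM; [exact: f1|exact: g1|exact: f2|exact: g2].
rewrite (_ : (fun x => _) = (fun x => complex.Re (f x) * complex.Im (g x) +
    complex.Im (f x) * complex.Re (g x))); last by apply/funext => x; rewrite Im_mulc.
by move=> x; apply: cvgD; apply: cvgM; [exact: f1|exact: g2|exact: f2|exact: g1].
Qed.

Lemma continuous_normc_sqr f : ccont f -> continuous (fun x => nc (f x) ^+ 2).
Proof.
move=> [f1 f2]; rewrite (_ : (fun x => _) = (fun x => complex.Re (f x) ^+ 2 +
    complex.Im (f x) ^+ 2)); last by apply/funext => x; rewrite normc_sqr.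
by move=> x; apply: cvgD; apply: cvgM; [exact: f1..|exact: f2|exact: f2].
Qed.

Lemma ccontV f : ccont f -> (forall x, f x != 0) -> ccont (fun x => (f x)^-1).
Proof.
move=> cf f0; have [f1 f2] := cf.
have cn : continuous (fun x => (nc (f x) ^+ 2)^-1).
  move=> x; apply: cvgV; last exact: continuous_normc_sqr.
  by rewrite expf_eq0 /= normc_eq0.
split.
  rewrite (_ : (fun x => _) = (fun x => complex.Re (f x) * (nc (f x) ^+ 2)^-1)).
    by move=> x; apply: cvgM; [exact: f1|exact: cn].
  by apply/funext => x; rewrite Re_invc.
rewrite (_ : (fun x => _) = (fun x => - complex.Im (f x) * (nc (f x) ^+ 2)^-1)).
  by move=> x; apply: cvgM; [apply: cvgN; exact: f2|exact: cn].
by apply/funext => x; rewrite Im_invc.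
Qed.

Definition ccb (f : R -> C) := ccont f /\ exists c, forall x, nc (f x) <= c.

Lemma ccb_cst c : ccb (fun=> c).
Proof. by split; [exact: ccont_cst|exists (nc c)]. Qed.

Lemma ccbD f g : ccb f -> ccb g -> ccb (fun x => f x + g x).
Proof.
move=> [cf [a fa]] [cg [b gb]]; split; first exact: ccontD.
by exists (a + b) => x; apply: le_trans (normcD _ _) _; exact: lerD.
Qed.

Lemma ccbM f g : ccb f -> ccb g -> ccb (fun x => f x * g x).
Proof.
move=> [cf [a fa]] [cg [b gb]]; split; first exact: ccontM.
by exists (a * b) => x; rewrite normcM ler_pM ?normc_ge0.
Qed.

Lemma ccbZ c f : ccb f -> ccb (fun x => c * f x).
Proof. by apply: ccbM; exact: ccb_cst. Qed.

Lemma ccb_Re f : ccb f -> cb (fun x => complex.Re (f x)).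
Proof.
move=> [[f1 _] [c fc]]; split=> //; exists c => x.
exact: le_trans (normr_Re_le _) (fc x).
Qed.

Lemma ccb_Im f : ccb f -> cb (fun x => complex.Im (f x)).
Proof.
move=> [[_ f2] [c fc]]; split=> //; exists c => x.
exact: le_trans (normr_Im_le _) (fc x).
Qed.

Definition rkernel (a : C) (x : R) : C := (1 + x%:C * a)^-1.

Lemma rkernel_neq0 (a : C) (x : R) : 0 < complex.Im a -> 1 + x%:C * a != 0.
Proof.
move=> a0; rewrite -normc_gt0; apply: lt_le_trans (normc_1Dreal_ge x a0).
by rewrite divr_gt0// normc_gt0; apply: contraTneq a0 => ->; rewrite ltxx.
Qed.

Lemma rkernel_le (a : C) (x h : R) : 0 < h -> h <= nc (1 + x%:C * a) -> nc (rkernel a x) <= h^-1.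
Proof. by move=> h0 h1; rewrite normcV lef_pV2 ?posrE//; exact: lt_le_trans h1. Qed.

Lemma ccb_rkernel a : 0 < complex.Im a -> ccb (rkernel a).
Proof.
move=> a0; split.
  apply: ccontV => [|x]; last exact: rkernel_neq0.
  apply: ccontD; first exact: ccont_cst.
  apply: ccontM; last exact: ccont_cst.
  by apply: ccont_real => x; exact: cvg_id.
exists (complex.Im a / nc a)^-1 => x.
apply: rkernel_le; last exact: normc_1Dreal_ge.
by rewrite divr_gt0// normc_gt0; apply: contraTneq a0 => ->; rewrite ltxx.
Qed.

(** This form shows that [x / (1 + x a)] stays bounded, hence is admissible as a test function. *)
Lemma mulx_rkernel a x : 0 < complex.Im a -> x%:C * rkernel a x = a^-1 * (1 - rkernel a x).
Proof.
move=> a0; have n0 := rkernel_neq0 x a0; rewrite /rkernel.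
have a1 : a != 0 by apply: contraTneq a0 => ->; rewrite ltxx.
by field; rewrite a1 n0.
Qed.

Lemma ccb_mulx_rkernel a : 0 < complex.Im a -> ccb (fun x => x%:C * rkernel a x).
Proof.
move=> a0; under eq_fun do rewrite mulx_rkernel// -mulN1r.
apply: ccbZ; apply: ccbD; first exact: ccb_cst.
by apply: ccbZ; exact: ccb_rkernel.
Qed.

Lemma rkernelB a b x : 0 < complex.Im a -> 0 < complex.Im b ->
  rkernel a x - rkernel b x = (b - a) * (x%:C * (rkernel a x * rkernel b x)).
Proof.
move=> a0 b0; have n0 := rkernel_neq0 x a0; have n1 := rkernel_neq0 x b0.
by rewrite /rkernel; field; rewrite n0 n1.
Qed.

Lemma ccb_mulx_rkernel2 a b : 0 < complex.Im a -> 0 < complex.Im b ->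
  ccb (fun x => x%:C * (rkernel a x * rkernel b x)).
Proof.
move=> a0 b0; under eq_fun do rewrite mulrA.
by apply: ccbM; [exact: ccb_mulx_rkernel|exact: ccb_rkernel].
Qed.

Lemma Im_rkernel a x : complex.Im (rkernel a x) = - complex.Im a * (x * nc (rkernel a x) ^+ 2).
Proof.
rewrite Im_invc normcV exprVn.
have -> : complex.Im (1 + x%:C * a) = x * complex.Im a by rewrite raddfD/= ImM_real add0r.
by ring.
Qed.

Definition clift (L : (R -> R) -> R) (f : R -> C) : C :=
  L (fun x => complex.Re (f x)) +i* L (fun x => complex.Im (f x)).

Lemma charge_CintegralE nu f : charge_Cintegral nu f = clift (charge_integral nu) f.
Proof. by []. Qed.

Section functional.
Variables (L : (R -> R) -> R) (M : R).
Hypothesis bL : bounded_functional L M.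

Lemma cliftD f g : ccb f -> ccb g -> clift L (fun x => f x + g x) = clift L f + clift L g.
Proof.
move=> cf cg; apply: complex_ext; rewrite raddfD/=.
  under [in LHS]eq_fun do rewrite raddfD.
  by apply: (bfunD bL); apply: cb_bmeas; exact: ccb_Re.
under [in LHS]eq_fun do rewrite raddfD.
by apply: (bfunD bL); apply: cb_bmeas; exact: ccb_Im.
Qed.

Lemma cliftZ c f : ccb f -> clift L (fun x => c * f x) = c * clift L f.
Proof.
move=> cf.
have [f1 f2] := (cb_bmeas (ccb_Re cf), cb_bmeas (ccb_Im cf)).
apply: complex_ext; rewrite ?Re_mulc ?Im_mulc/=.
  under [in LHS]eq_fun do rewrite Re_mulc.
  by rewrite (bfunB bL (bmeasZ _ f1) (bmeasZ _ f2)) !(bfunZ bL).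
under [in LHS]eq_fun do rewrite Im_mulc.
by rewrite (bfunD bL (bmeasZ _ f2) (bmeasZ _ f1)) !(bfunZ bL).
Qed.

Lemma cliftB f g : ccb f -> ccb g -> clift L (fun x => f x - g x) = clift L f - clift L g.
Proof.
move=> cf cg; rewrite -[in RHS]mulN1r -cliftZ// -cliftD//; last exact: ccbZ.
by under [in RHS]eq_fun do rewrite mulN1r.
Qed.

(* [L] need not be positive, but [x L(dx)] is. *)
Hypothesis posL : forall phi : R -> R, cb phi -> cb (fun x => x * phi x) ->
  (forall x, 0 <= phi x) -> 0 <= L (fun x => x * phi x).

Section solution.
Variables (z a : C).
Hypotheses (z0 : 0 < complex.Im z) (a0 : 0 < complex.Im a).
Hypothesis sol : z * a = -1 + a * clift L (rkernel a).

Let a1 : a != 0. Proof. by apply: contraTneq a0 => ->; rewrite ltxx. Qed.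

Lemma solutionE : clift L (rkernel a) = z + a^-1.
Proof.
apply: (mulfI a1); have -> : a * (z + a^-1) = z * a + 1 by field.
by rewrite sol; ring.
Qed.

(** The imaginary part of [L (1 / (1 + x a)) = z + 1 / a], where that of the integrand is [- Im a]
    times [x |r_a|^2]. *)
Lemma solution_mass : nc a ^+ 2 * L (fun x => x * nc (rkernel a x) ^+ 2) =
  1 - nc a ^+ 2 * complex.Im z / complex.Im a.
Proof.
have bI := cb_bmeas (ccb_Im (ccb_rkernel a0)).
have E x : x * nc (rkernel a x) ^+ 2 = - (complex.Im a)^-1 * complex.Im (rkernel a x).
  by rewrite Im_rkernel; field; rewrite gt_eqF.
under eq_fun do rewrite E; rewrite (bfunZ bL _ bI).
have -> : L (fun x => complex.Im (rkernel a x)) = complex.Im (clift L (rkernel a)) by [].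
rewrite solutionE raddfD/= Im_invc; field.
by rewrite normc_eq0 a1 gt_eqF.
Qed.

Lemma solution_mass_lt1 : nc a ^+ 2 * L (fun x => x * nc (rkernel a x) ^+ 2) < 1.
Proof.
rewrite solution_mass gtrBl divr_gt0// mulr_gt0// exprn_gt0//.
by rewrite normc_gt0.
Qed.

End solution.

Lemma cb_nc_rkernel a : 0 < complex.Im a -> cb (fun x => nc (rkernel a x) ^+ 2).
Proof.
move=> a0; have [c1 [d1 h1]] := ccb_rkernel a0; split.
  exact: continuous_normc_sqr.
exists (d1 ^+ 2) => x; rewrite ger0_norm ?sqr_ge0//.
by apply: lerXn2r; rewrite ?nnegrE ?normc_ge0//; exact: le_trans (normc_ge0 _) (h1 x).
Qed.

Lemma cbZ c f : cb f -> cb (fun x => c * f x).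
Proof.
move=> [cf [b fb]]; split; first by move=> x; apply: cvgMl_tmp; exact: cf.
by exists (`|c| * b) => x; rewrite normrM ler_wpM2l.
Qed.

Lemma cbD f g : cb f -> cb g -> cb (fun x => f x + g x).
Proof.
move=> [cf [b fb]] [cg [e ge]]; split; first by move=> x; apply: cvgD; [exact: cf|exact: cg].
by exists (b + e) => x; apply: le_trans (ler_normD _ _) _; exact: lerD.
Qed.

Lemma cb_mulx_nc_rkernel a : 0 < complex.Im a -> cb (fun x => x * nc (rkernel a x) ^+ 2).
Proof.
move=> a0.
have E x : x * nc (rkernel a x) ^+ 2 = - (complex.Im a)^-1 * complex.Im (rkernel a x).
  by rewrite Im_rkernel; field; rewrite gt_eqF.
by under eq_fun do rewrite E; apply: cbZ; apply: ccb_Im; exact: ccb_rkernel.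
Qed.

(* For two solutions, [1 = a b L(x r_a r_b)]; but [2 |Re(u v)| <= |u|^2 + |v|^2] and both
   [|a|^2 L(x |r_a|^2)] and [|b|^2 L(x |r_b|^2)] are less than 1. *)
Lemma solution_unique z a b : 0 < complex.Im z -> 0 < complex.Im a -> 0 < complex.Im b ->
  z * a = -1 + a * clift L (rkernel a) -> z * b = -1 + b * clift L (rkernel b) -> a = b.
Proof.
move=> z0 a0 b0 sa sb; apply: contrapT => /eqP; rewrite -subr_eq0 => ab.
have a1 : a != 0 by apply: contraTneq a0 => ->; rewrite ltxx.
have b1 : b != 0 by apply: contraTneq b0 => ->; rewrite ltxx.
have cab := ccb_mulx_rkernel2 a0 b0.
have ba : b - a != 0 by rewrite -opprB oppr_eq0.
(* Subtracting the two equations and cancelling [b - a], which is nonzero by contradiction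
   hypothesis. *)
have E1 : a * b * clift L (fun x => x%:C * (rkernel a x * rkernel b x)) = 1.
  apply: (mulfI ba); rewrite mulrCA -(cliftZ _ cab).
  under eq_fun do rewrite -rkernelB//.
  rewrite cliftB; [|exact: ccb_rkernel..].
  by rewrite (solutionE a0 sa) (solutionE b0 sb); field; rewrite a1 b1.
pose q x := complex.Re (a * b * (rkernel a x * rkernel b x)).
have cq : cb q.
  by apply: ccb_Re; apply: ccbZ; apply: ccbM; exact: ccb_rkernel.
have xq x : x * q x = complex.Re (a * b * (x%:C * (rkernel a x * rkernel b x))).
  by rewrite mulrCA ReM_real.
have cxq : cb (fun x => x * q x).
  by under eq_fun do rewrite xq; apply: ccb_Re; exact: ccbZ.
have Lq : L (fun x => x * q x) = 1.
  under eq_fun do rewrite xq.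
  rewrite -[LHS]/(complex.Re (clift L (fun x => a * b * (x%:C * (rkernel a x * rkernel b x))))).
  by rewrite (cliftZ _ cab) E1.
pose A x := nc a ^+ 2 * nc (rkernel a x) ^+ 2.
pose B x := nc b ^+ 2 * nc (rkernel b x) ^+ 2.
have phi0 x : 0 <= A x + B x + (- 2) * q x.
  rewrite /A /B -!exprMn -!normcM.
  have : q x <= nc (a * rkernel a x) * nc (b * rkernel b x).
    rewrite -normcM; apply: le_trans (ler_norm _) _.
    by apply: le_trans (normr_Re_le _) _; rewrite mulrACA.
  move: (nc (a * _)) (nc (b * _)) (q x) => u v r h; have := sqr_ge0 (u - v); rewrite sqrrB; lra.
have cA := cbZ (nc a ^+ 2) (cb_nc_rkernel a0).
have cB := cbZ (nc b ^+ 2) (cb_nc_rkernel b0).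
have cxA := cbZ (nc a ^+ 2) (cb_mulx_nc_rkernel a0).
have cxB := cbZ (nc b ^+ 2) (cb_mulx_nc_rkernel b0).
have E x : x * (A x + B x + (- 2) * q x) = nc a ^+ 2 * (x * nc (rkernel a x) ^+ 2) +
  nc b ^+ 2 * (x * nc (rkernel b x) ^+ 2) + (- 2) * (x * q x) by rewrite /A /B; ring.
have := posL (cbD (cbD cA cB) (cbZ (-2) cq)) _ phi0.
rewrite -/A -/B; under [X in cb X -> _]eq_fun do rewrite E.
under [X in _ -> 0 <= L X]eq_fun do rewrite E.
move=> /(_ (cbD (cbD cxA cxB) (cbZ (-2) cxq))).
rewrite (bfunD bL (bmeasD (cb_bmeas cxA) (cb_bmeas cxB)) (bmeasZ (-2) (cb_bmeas cxq))).
rewrite (bfunD bL (cb_bmeas cxA) (cb_bmeas cxB)) (bfunZ bL _ (cb_bmeas cxq)) Lq.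
rewrite (bfunZ bL _ (cb_bmeas (cb_mulx_nc_rkernel a0))).
rewrite (bfunZ bL _ (cb_bmeas (cb_mulx_nc_rkernel b0))).
by have := solution_mass_lt1 z0 a0 sa; have := solution_mass_lt1 z0 b0 sb; lra.
Qed.

End functional.
End complex_functions.

(** * Convergence of the solutions *)

Section convergence.
Variable R : realType.
Local Notation C := R[i].
Variables (Ln : nat -> (R -> R) -> R) (L : (R -> R) -> R) (Mn : nat -> R) (M M2 : R).
Hypothesis bLn : forall n, bounded_functional (Ln n) (Mn n).
Hypothesis bL : bounded_functional L M.
Hypothesis wL : forall phi, cb phi -> Ln n phi @[n --> \oo] --> L phi.
Hypothesis M20 : 0 <= M2.
(** In the application [x Ln(dx)] has mass bounded in [n]. This gives equicontinuity in [a] of the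
    integrals of [1 / (1 + x a)] without any uniform bound on the [Mn]. *)
Hypothesis lipL : \forall n \near \oo, forall (psi : R -> R) (c : R), cb psi -> cb (fun x => x * psi x) ->
  (forall x, `|psi x| <= c) -> `|Ln n (fun x => x * psi x)| <= M2 * c.
Hypothesis posLn : \forall n \near \oo, forall psi : R -> R, cb psi -> cb (fun x => x * psi x) ->
  (forall x, 0 <= psi x) -> 0 <= Ln n (fun x => x * psi x).

Lemma limit_pos psi : cb psi -> cb (fun x => x * psi x) ->
  (forall x, 0 <= psi x) -> 0 <= L (fun x => x * psi x).
Proof.
move=> c1 c2 p0; apply: (cvgr_to_ge (wL c2)).
by apply: filterS posLn => n h; exact: h.
Qed.

Lemma clift_cvg f : ccb f -> nc (clift (Ln n) f - clift L f) @[n --> \oo] --> 0.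
Proof.
move=> cf.
have h1 := wL (ccb_Re cf); have h2 := wL (ccb_Im cf).
apply/cvgrPdist_lt => e e0; have e2 : 0 < e / 2 by rewrite divr_gt0.
near=> n; rewrite sub0r normrN ger0_norm ?normc_ge0//.
apply: le_lt_trans (normc_le_ReIm _) _; rewrite [e]splitr; apply: ltrD.
  by rewrite distrC; near: n; move/cvgrPdist_lt : h1; apply.
by rewrite distrC; near: n; move/cvgrPdist_lt : h2; apply.
Unshelve. all: by end_near.
Qed.

Variables (z : C) (g : nat -> C) (c S : R) (e : nat -> R).
Hypotheses (z0 : 0 < complex.Im z) (c0 : 0 < c) (S0 : 0 < S).
Hypothesis g_bounds : \forall n \near \oo, c <= complex.Im (g n) /\ nc (g n) <= S.
Hypothesis e_cvg : e n @[n --> \oo] --> 0.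
Hypothesis g_eq : \forall n \near \oo,
  nc (1 + (z - clift (Ln n) (rkernel (g n))) * g n) <= e n.

(** Cluster points are confined by their coordinates, each at most [S] in absolute value, so only
    the modulus bound [2 S] is available for them. *)
Let h := c / (2 * S).
Let h0 : 0 < h. Proof. by rewrite divr_gt0// mulr_gt0. Qed.

Let denom_ge a x : c <= complex.Im a -> nc a <= 2 * S -> h <= nc (1 + x%:C * a).
Proof.
move=> ca aS; have a0 : 0 < complex.Im a by exact: lt_le_trans ca.
apply: le_trans (normc_1Dreal_ge x a0); rewrite /h.
apply: ler_pM => //; [exact: ltW|by rewrite invr_ge0 mulr_ge0// ltW|].
rewrite lef_pV2 ?posrE ?mulr_gt0// normc_gt0.
by apply: contraTneq a0 => ->; rewrite ltxx.
Qed.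

Let lip_rkernel : \forall n \near \oo, forall a b, c <= complex.Im a -> nc a <= 2 * S ->
  c <= complex.Im b -> nc b <= 2 * S ->
  nc (clift (Ln n) (rkernel a) - clift (Ln n) (rkernel b)) <=
    2 * M2 * h^-1 ^+ 2 * nc (a - b).
Proof.
apply: filterS lipL => n lip a b ca aS cb' bS.
have a0 : 0 < complex.Im a by exact: lt_le_trans ca.
have b0 : 0 < complex.Im b by exact: lt_le_trans cb'.
have ck := ccbM (ccb_rkernel a0) (ccb_rkernel b0).
have ckx := ccb_mulx_rkernel2 a0 b0.
rewrite -(cliftB (bLn n)); [|exact: ccb_rkernel..].
under eq_fun do rewrite rkernelB//.
rewrite (cliftZ (bLn n) _ ckx) normcM mulrC -(normcN (b - a)) opprB.
apply: ler_wpM2r; first exact: normc_ge0.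
have kle x : nc (rkernel a x * rkernel b x) <= h^-1 ^+ 2.
  rewrite normcM expr2; apply: ler_pM; rewrite ?normc_ge0//.
    by apply: rkernel_le => //; exact: denom_ge.
  by apply: rkernel_le => //; exact: denom_ge.
apply: le_trans (normc_le_ReIm _) _; rewrite -mulrA mulr_natl mulr2n.
apply: lerD; rewrite /clift/=.
  under eq_fun do rewrite ReM_real.
  apply: lip; [exact: ccb_Re ck| |].
    by have := ccb_Re ckx; under [X in cb X -> _]eq_fun do rewrite ReM_real.
  by move=> x; apply: le_trans (normr_Re_le _) (kle x).
under eq_fun do rewrite ImM_real.
apply: lip; [exact: ccb_Im ck| |].
  by have := ccb_Im ckx; under [X in cb X -> _]eq_fun do rewrite ImM_real.
by move=> x; apply: le_trans (normr_Im_le _) (kle x).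
Qed.

(** Equicontinuity lets [k] be fixed before [delta] and [n]; with this order of choice, cluster
    points solve the limit equation exactly. *)
Let near_equation a : c <= complex.Im a -> nc a <= 2 * S -> exists2 k : R, 0 <= k &
  forall delta, 0 < delta -> \forall n \near \oo,
    nc (1 + (z - clift L (rkernel a)) * a) <= delta + k * nc (g n - a).
Proof.
move=> ca aS; have a0 : 0 < complex.Im a by exact: lt_le_trans ca.
set k := nc z + (nc (clift L (rkernel a)) + 1) + 2 * M2 * h^-1 ^+ 2 * S.
exists k.
  rewrite !addr_ge0 ?normc_ge0//; apply: mulr_ge0; last exact: ltW.
  by apply: mulr_ge0; [exact: mulr_ge0|exact: sqr_ge0].
move=> delta d0; have cr := clift_cvg (ccb_rkernel a0).
(* [t <= 1] keeps the integral at [n] within 1 of its limit, and [t (2 S) <= delta / 2] leaves the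
   other half of [delta] to the equation error. *)
pose t := Num.min 1 (delta / (2 * (2 * S + 1))).
have t0 : 0 < t by rewrite lt_min ltr01 divr_gt0// mulr_gt0// addr_gt0// mulr_gt0.
have tS : t * (2 * S) <= delta / 2.
  have : t * (2 * S + 1) <= delta / (2 * (2 * S + 1)) * (2 * S + 1).
    by apply: ler_wpM2r; [rewrite addr_ge0// mulr_ge0// ltW|rewrite ge_min lexx orbT].
  have -> : delta / (2 * (2 * S + 1)) * (2 * S + 1) = delta / 2.
    by field; rewrite gt_eqF// addr_gt0// mulr_gt0.
  by rewrite mulrDr mulr1; move: t0; lra.
near=> n.
have [gc gS] : c <= complex.Im (g n) /\ nc (g n) <= S by near: n.
have gS2 : nc (g n) <= 2 * S by move: gS S0; lra.
have ge : nc (1 + (z - clift (Ln n) (rkernel (g n))) * g n) <= delta / 2.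
  apply: (@le_trans _ _ (e n)); first by near: n.
  apply: le_trans (ler_norm _) _; rewrite -[e n]subr0 distrC; apply: ltW.
  by near: n; move/cvgrPdist_lt : e_cvg; apply; rewrite divr_gt0.
have lt' : nc (clift (Ln n) (rkernel a) - clift L (rkernel a)) <= t.
  apply: le_trans (ler_norm _) _; rewrite -[X in `|X|]subr0 distrC; apply: ltW.
  by near: n; move/cvgrPdist_lt : cr; apply.
have lip : nc (clift (Ln n) (rkernel a) - clift (Ln n) (rkernel (g n))) <=
    2 * M2 * h^-1 ^+ 2 * nc (a - g n).
  have hl : forall a b, c <= complex.Im a -> nc a <= 2 * S ->
      c <= complex.Im b -> nc b <= 2 * S ->
      nc (clift (Ln n) (rkernel a) - clift (Ln n) (rkernel b)) <=
        2 * M2 * h^-1 ^+ 2 * nc (a - b) by near: n; exact: lip_rkernel.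
  exact: hl.
set A := clift (Ln n) (rkernel a) in lt' lip *.
set G := clift (Ln n) (rkernel (g n)) in ge lip *.
set A0 := clift L (rkernel a) in k lt' *.
have -> : 1 + (z - A0) * a = (1 + (z - G) * g n) + (A - A0) * a +
    ((z - A) * (a - g n) - (A - G) * g n) by ring.
have An : nc A <= nc A0 + 1.
  have -> : A = A0 + (A - A0) by ring.
  apply: le_trans (normcD _ _) _; apply: lerD => //.
  by apply: le_trans lt' _; rewrite ge_min lexx.
apply: le_trans (normcD _ _) _; apply: lerD.
  apply: le_trans (normcD _ _) _; rewrite [delta]splitr; apply: lerD => //.
  rewrite normcM; apply: le_trans tS; apply: ler_pM; rewrite ?normc_ge0//.
have -> : nc (g n - a) = nc (a - g n) by rewrite -(normcN (a - g n)) opprB.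
apply: le_trans (normcB _ _) _; rewrite /k [leRHS]mulrDl; apply: lerD.
  rewrite normcM; apply: ler_wpM2r; first exact: normc_ge0.
  by apply: le_trans (normcB _ _) _; rewrite lerD2l.
rewrite normcM mulrAC; apply: ler_pM => //; exact: normc_ge0.
Unshelve. all: by end_near.
Qed.

Let G n : R * R := (complex.Re (g n), complex.Im (g n)).
Let F := G @ \oo.
Let A0 : set (R * R) := `[- S, S]%classic `*` `[c, S]%classic.

Let FF : ProperFilter F. Proof. exact: fmap_proper_filter. Qed.

Let F_A0 : F A0.
Proof.
apply: filterS g_bounds => n [cg gS]; split; rewrite /= in_itv/=.
  by rewrite -ler_norml; exact: le_trans (normr_Re_le _) gS.
by rewrite cg/=; apply: le_trans gS; exact: le_trans (ler_norm _) (normr_Im_le _).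
Qed.

Let compact_A0 : compact A0. Proof. by apply: compact_setX; exact: segment_compact. Qed.

Let hausdorff_RR : hausdorff_space (R * R)%type. Proof. exact: norm_hausdorff. Qed.

Let box (q : R * R) r := [set p : R * R | `|q.1 - p.1| < r /\ `|q.2 - p.2| < r].

Let nbhs_box q r : 0 < r -> nbhs q (box q r).
Proof.
by move=> r0; exists (ball q.1 r, ball q.2 r); [split; exact: nbhsx_ballx|move=> p [p1 p2]].
Qed.

Let cluster_solution q : cluster F q ->
  A0 q /\ z * (q.1 +i* q.2) = -1 + (q.1 +i* q.2) * clift L (rkernel (q.1 +i* q.2)).
Proof.
move=> Fq; have Aq : A0 q.
  by apply: (compact_closed hausdorff_RR compact_A0) => B /(Fq _ _ F_A0).
split=> //; have [] := Aq; rewrite /= !in_itv/= -ler_norml => q1 /andP[cq q2].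
set a := q.1 +i* q.2.
have aS : nc a <= 2 * S.
  apply: le_trans (normc_le_ReIm _) _ => /=; rewrite mulr_natl mulr2n; apply: lerD => //.
  by rewrite ger0_norm//; exact: le_trans (ltW c0) cq.
have [k k0 hk] := near_equation (a := a) cq aS.
have E : 1 + (z - clift L (rkernel a)) * a = 0.
  apply/eqP; rewrite -normc_eq0 -normr_le0 ger0_norm ?normc_ge0//.
  apply/ler_addgt0Pr => t t0; rewrite add0r.
  pose r := t / (4 * (k + 1)).
  have k1 : 0 < 4 * (k + 1) by move: k0; lra.
  have r0 : 0 < r by rewrite divr_gt0.
  have kr : k * (2 * r) <= t / 2.
    have : (4 * (k + 1)) * r = t by rewrite /r mulrC divfK// gt_eqF.
    by move: r0; lra.
  have t2 : 0 < t / 2 by rewrite divr_gt0.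
  pose N := [set n | nc (1 + (z - clift L (rkernel a)) * a) <= t / 2 + k * nc (g n - a)].
  have FN : F (G @` N) by apply: filterS (hk _ t2) => n Nn; exists n.
  have [p [[n Nn Gn] [p1 p2]]] := Fq _ _ FN (nbhs_box q r0).
  apply: le_trans Nn _; rewrite [leRHS]splitr lerD2l; apply: le_trans kr.
  apply: ler_wpM2l => //; apply: le_trans (normc_le_ReIm _) _.
  rewrite mulr_natl mulr2n; move: p1 p2; rewrite -Gn /=.
  rewrite !raddfB/= => p1 p2; apply: lerD; rewrite distrC; exact: ltW.
by move: E; rewrite mulrBl; move/eqP; rewrite addrA subr_eq0 => /eqP E; rewrite [a * _]mulrC -E; ring.
Qed.

Lemma solution_cvg : exists a, [/\ c <= complex.Im a,
  z * a = -1 + a * clift L (rkernel a) & nc (g n - a) @[n --> \oo] --> 0].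
Proof.
have [p [Ap Fp]] := compact_A0 FF F_A0.
have [_ sp] := cluster_solution Fp.
have [] := Ap; rewrite /= !in_itv/= => /andP[p1 p1'] /andP[cp p2].
exists (p.1 +i* p.2); split=> //.
(* Slightly larger than the box holding the sequence, so that it is a compact neighbourhood of the
   cluster point; uniqueness of that point then yields convergence. *)
pose A : set (R * R) := `[- (S + 1), S + 1]%classic `*` `[c / 2, S + 1]%classic.
have cA : compact A by apply: compact_setX; exact: segment_compact.
have FA : F A.
  apply: filterS F_A0 => q []; rewrite /= !in_itv/= => /andP[q1 q2] /andP[q3 q4].
  split; rewrite /= in_itv/=; apply/andP; split; move: c0 q1 q2 q3 q4; lra.
have nA : nbhs p A.
  have m0 : 0 < Num.min 1 (c / 2) by rewrite lt_min ltr01 divr_gt0.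
  apply: filterS (nbhs_box p m0) => q [].
  rewrite !lt_min !ltr_norml => /andP[/andP[a1 a2] _] /andP[/andP[b1 b2] /andP[b3 b4]].
  split; rewrite /= in_itv/=; apply/andP; split; move: c0 p1 p1' cp p2; lra.
have Fset : cluster F = [set p].
  apply/seteqP; split=> [q Fq|q ->//].
  have [Aq sq] := cluster_solution Fq.
  have [_] := Aq; rewrite /= in_itv/= => /andP[cq _].
  have := solution_unique bL limit_pos z0 (a := q.1 +i* q.2) (b := p.1 +i* p.2)
    (lt_le_trans c0 cq) (lt_le_trans c0 cp) sq sp.
  by move=> [e1 e2]; rewrite [q]surjective_pairing e1 e2 -surjective_pairing.
have Fcvg : F --> p := compact_cluster_set1 hausdorff_RR cA nA FF FA Fset.
apply/cvgrPdist_lt => t t0; have t2 : 0 < t / 2 by rewrite divr_gt0.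
have : \forall n \near \oo, box p (t / 2) (G n) := Fcvg _ (nbhs_box p t2).
apply: filterS => n [/= h1 h2].
rewrite sub0r normrN ger0_norm ?normc_ge0//; apply: le_lt_trans (normc_le_ReIm _) _.
by rewrite [t]splitr !raddfB/=; apply: ltrD; rewrite distrC.
Qed.

End convergence.

(** * Monotone approximation families *)

Section approximation.
Variable R : realType.

(** Compactness is applied to [x] only; [y] may leave the segment, as grid points do later. *)
Lemma uniform_continuity (phi : R -> R) (M eps : R) : continuous phi -> 0 < eps ->
  exists2 r, 0 < r & forall x y, `|x| <= M -> `|x - y| < r -> `|phi x - phi y| <= eps.
Proof.
move=> cphi e0.
have /compact_near_coveringP cpt := @segment_compact R (- M) M.
have := cpt R (0^'+) (fun r x => forall y, `|x - y| < r -> `|phi x - phi y| <= eps) _.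
case=> [x _|r /= r0 hr].
  have e2 : 0 < eps / 2 by rewrite divr_gt0.
  have /cvgrPdist_lt /(_ _ e2) [/= rho rho0 hrho] := cphi x.
  have rho2 : 0 < rho / 2 by rewrite divr_gt0.
  near=> x' r => /= y xy.
  have xx : `|x - x'| < rho / 2 by near: x'; exact: nbhsx_ballx.
  have rr : r < rho / 2 by near: r; exact: nbhs_right_lt.
  have h1 : `|phi x - phi x'| < eps / 2.
    by apply: hrho => /=; move: xx rho0; lra.
  have h2 : `|phi x - phi y| < eps / 2.
    apply: hrho => /=; rewrite -(subrKA x'); apply: le_lt_trans (ler_normD _ _) _.
    by rewrite [rho]splitr; apply: ltrD => //; exact: lt_trans rr.
  rewrite -(subrKA (phi x)); apply: le_trans (ler_normD _ _) _.
  by rewrite [eps]splitr; apply: lerD; [rewrite distrC|]; exact: ltW.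
exists (r / 2); first by rewrite divr_gt0.
move=> x y; rewrite ler_norml => xM xy.
apply: (hr (r / 2)) => //.
- by rewrite /= sub0r normrN gtr0_norm ?divr_gt0//; move: r0; lra.
- by rewrite divr_gt0.
Unshelve. all: by end_near.
Qed.

(** A Riemann-Stieltjes sum of [phi] against the increments of [t |-> A t x]. It is used with ramps
    and with arctangent steps. *)
Definition family_sum (A : R -> R -> R) (phi : R -> R) (t : nat -> R) J x :=
  \sum_(j < J) phi (t j) * (A (t j.+1) x - A (t j) x).

Section family.
Variables (A : R -> R -> R).
Hypothesis A_mono : forall x s t, s <= t -> A s x <= A t x.
Hypothesis A01 : forall t x, 0 <= A t x <= 1.

Lemma telescope_ord (f : nat -> R) J : \sum_(j < J) (f j.+1 - f j) = f J - f 0%N.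
Proof.
elim: J => [|J ih]; first by rewrite big_ord0 subrr.
by rewrite big_ord_recr /= ih; ring.
Qed.

Lemma family_sum_le phi t J x c : (forall j, t j <= t j.+1) -> (forall x, `|phi x| <= c) ->
  `|family_sum A phi t J x| <= c.
Proof.
move=> tm pc; have c0 : 0 <= c by apply: le_trans (pc 0).
apply: le_trans (ler_norm_sum _ _ _) _.
apply: (@le_trans _ _ (\sum_(j < J) c * (A (t j.+1) x - A (t j) x))).
  apply: ler_sum => j _; rewrite normrM.
  have d0 : 0 <= A (t j.+1) x - A (t j) x by rewrite subr_ge0 A_mono.
  by rewrite (ger0_norm d0) ler_wpM2r.
rewrite -mulr_sumr (telescope_ord (fun j => A (t j) x)).
have /andP[a1 _] := A01 (t 0%N) x; have /andP[_ a2] := A01 (t J) x.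
by apply: ler_piMr => //; lra.
Qed.

End family.

(* The increments of [t |-> A t x] form a subprobability concentrated near [x]. *)
Lemma family_approx (phi : R -> R) (c M eps : R) : continuous phi ->
  (forall x, `|phi x| <= c) -> 0 < M -> 0 < eps ->
  exists eta tau, [/\ 0 < eta, 0 < tau & exists t J,
    (forall j, t j <= t j.+1) /\ forall A : R -> R -> R,
    (forall x s t, s <= t -> A s x <= A t x) -> (forall t x, 0 <= A t x <= 1) ->
    (forall t x, x + eta <= t -> 1 - tau <= A t x) ->
    (forall t x, t <= x - eta -> A t x <= tau) ->
    forall x, `|x| <= M -> `|phi x - family_sum A phi t J x| <= eps].
Proof.
move=> cphi pc M0 e0; have c0 : 0 <= c by apply: le_trans (pc 0).
have e2 : 0 < eps / 2 by rewrite divr_gt0.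
have [r r0 hr] := uniform_continuity M cphi e2.
pose eta := Num.min 1 (r / 2); have eta0 : 0 < eta by rewrite lt_min ltr01 divr_gt0.
have eta1 : eta <= 1 by rewrite ge_min lexx.
have etar : 2 * eta <= r by have : eta <= r / 2; [rewrite ge_min lexx orbT|lra].
(* The missing mass at the two ends costs [2 c tau], and the mass above and below the window around
   [x] costs [2 c tau] each: [6 c tau <= eps / 2]. *)
pose tau := eps / (12 * (c + 1)).
have tau0 : 0 < tau by rewrite divr_gt0// mulr_gt0// ltr_wpDl.
have ctau : 6 * (c * tau) <= eps / 2.
  have : 12 * (c + 1) * tau = eps by rewrite /tau mulrC divfK// gt_eqF// mulr_gt0// ltr_wpDl.
  by move: tau0; lra.
exists eta, tau; split => //.
pose J := (Num.truncn (2 * (M + 1) / eta)).+1.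
have hJ : 2 * (M + 1) <= J%:R * eta by rewrite -ler_pdivrMr// ltW// truncnS_gt.
(* A grid of mesh [eta <= 1] whose ends lie beyond [x - eta] and [x + eta] whenever [|x| <= M]. *)
pose t (j : nat) := - (M + 1) + j%:R * eta.
have tS j : t j.+1 = t j + eta by rewrite /t -natr1; ring.
exists t, J; split=> [j|A Am A01 Ahi Alo x xM]; first by rewrite tS lerDl ltW.
move: (xM); rewrite ler_norml => /andP[x1 x2].
set a := A ^~ x.
have AJ : 1 - tau <= a (t J) by apply: Ahi; rewrite /t; move: hJ; lra.
have A0 : a (t 0%N) <= tau by apply: Alo; rewrite /t mul0r; lra.
have AJ1 : a (t J) <= 1 by have /andP[] := A01 (t J) x.
have A00 : 0 <= a (t 0%N) by have /andP[] := A01 (t 0%N) x.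
have E : phi x - family_sum A phi t J x = phi x * (1 - (a (t J) - a (t 0%N))) +
    \sum_(j < J) (phi x - phi (t j)) * (a (t j.+1) - a (t j)).
  under [in RHS]eq_bigr do rewrite mulrBl.
  by rewrite sumrB -mulr_sumr (telescope_ord (fun j => a (t j))) /family_sum; ring.
rewrite E; apply: le_trans (ler_normD _ _) _.
have h1 : `|phi x * (1 - (a (t J) - a (t 0%N)))| <= c * (2 * tau).
  rewrite normrM; apply: ler_pM => //.
  by rewrite ger0_norm; lra.
(* The increments of [hi] and [lo] register only the mass carried above [x + eta] and below
   [x - eta]; each telescopes to at most [tau]. An interval meeting the window is handled by uniform
   continuity. *)
pose hi j := Num.max (a (t j)) (a (x + eta)).
pose lo j := Num.min (a (t j)) (a (x - eta)).
have h2 (j : nat) : `|(phi x - phi (t j)) * (a (t j.+1) - a (t j))| <=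
    eps / 2 * (a (t j.+1) - a (t j)) + 2 * c * (hi j.+1 - hi j) + 2 * c * (lo j.+1 - lo j).
  have aj : a (t j) <= a (t j.+1) by apply: Am; rewrite tS lerDl ltW.
  have d0 : 0 <= a (t j.+1) - a (t j) by rewrite subr_ge0.
  have hi0 : 0 <= hi j.+1 - hi j by rewrite subr_ge0 /hi ge_max !le_max aj lexx orbT.
  have lo0 : 0 <= lo j.+1 - lo j by rewrite subr_ge0 /lo le_min !ge_min aj lexx orbT.
  have pd : `|phi x - phi (t j)| <= 2 * c.
    by apply: le_trans (ler_normB _ _) _; rewrite mulr_natl mulr2n lerD.
  have c20 : 0 <= 2 * c by rewrite mulr_ge0.
  have P1 := mulr_ge0 c20 hi0; have P2 := mulr_ge0 c20 lo0.
  have P3 := mulr_ge0 (ltW e2) d0.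
  rewrite normrM (ger0_norm d0).
  have [k1|k1] := leP (x + eta) (t j).
    have hiE : hi j.+1 - hi j = a (t j.+1) - a (t j).
      by rewrite /hi !max_l//; apply: Am => //; rewrite tS; move: k1 eta0; lra.
    have := ler_wpM2r d0 pd; move: P2 P3; rewrite hiE; lra.
  have [k2|k2] := leP (t j.+1) (x - eta).
    have loE : lo j.+1 - lo j = a (t j.+1) - a (t j).
      by rewrite /lo !min_l//; apply: Am => //; move: k2 eta0; rewrite tS; lra.
    have := ler_wpM2r d0 pd; move: P1 P3; rewrite loE; lra.
  have : `|phi x - phi (t j)| <= eps / 2.
    apply: hr => //; rewrite ltr_norml; apply/andP; split; move: k1 k2 etar; rewrite tS; lra.
  by move=> /(ler_wpM2r d0); move: P1 P2; lra.
have h3 : `|\sum_(j < J) (phi x - phi (t j)) * (a (t j.+1) - a (t j))| <=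
    eps / 2 * (a (t J) - a (t 0%N)) + 2 * c * (hi J - hi 0%N) + 2 * c * (lo J - lo 0%N).
  apply: le_trans (ler_norm_sum _ _ _) _.
  apply: le_trans (ler_sum _ (fun (j : 'I_J) _ => h2 j)) _.
  rewrite !big_split/= -!mulr_sumr (telescope_ord (fun j => a (t j))).
  by rewrite (telescope_ord hi) (telescope_ord lo).
have h4 : hi J - hi 0%N <= tau.
  have u1 : hi J <= 1 by rewrite /hi ge_max AJ1; have /andP[] := A01 (x + eta) x.
  have u2 : 1 - tau <= hi 0%N by rewrite /hi le_max (Ahi (x + eta) x) ?orbT.
  by lra.
have h5 : lo J - lo 0%N <= tau.
  have u1 : lo J <= tau by rewrite /lo ge_min (Alo (x - eta) x) ?orbT.
  have u2 : 0 <= lo 0%N by rewrite /lo le_min A00; have /andP[] := A01 (x - eta) x.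
  by lra.
have c20 : 0 <= 2 * c by rewrite mulr_ge0.
have := ler_wpM2l c20 h4; have := ler_wpM2l c20 h5.
have : eps / 2 * (a (t J) - a (t 0%N)) <= eps / 2 by apply: ler_piMr; [exact: ltW|lra].
move: h1 h3 ctau; move: (`|_|) (`|_|) => u v; lra.
Qed.

End approximation.

(** * Positive tight functionals are integrals *)

Section riesz.
Variable R : realType.
Local Notation borelR := (measurableTypeR R).

Definition clamp (u : R) : R := Num.min 1 (Num.max 0 u).

Lemma clamp01 u : 0 <= clamp u <= 1.
Proof. by rewrite /clamp le_min ler01 le_max lexx ge_min lexx. Qed.

Lemma le_clamp u v : u <= v -> clamp u <= clamp v.
Proof. by move=> uv; rewrite /clamp le_min2 // le_max2. Qed.

Lemma clamp_ge1 u : 1 <= u -> clamp u = 1.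
Proof. by move=> u1; rewrite /clamp max_r ?min_l//; lra. Qed.

Lemma clamp_le0 u : u <= 0 -> clamp u = 0.
Proof. by move=> u0; rewrite /clamp max_l// min_r. Qed.

(** A continuous substitute for the indicator of [x <= s], descending from 1 at [s] to 0 at
    [s + h]. *)
Definition ramp (s h x : R) : R := clamp ((s + h - x) / h).

Lemma ramp01 s h x : 0 <= ramp s h x <= 1. Proof. exact: clamp01. Qed.

Lemma ramp1 s h x : 0 < h -> x <= s -> ramp s h x = 1.
Proof. by move=> h0 xs; apply: clamp_ge1; rewrite ler_pdivlMr//; lra. Qed.

Lemma ramp0 s h x : 0 < h -> s + h <= x -> ramp s h x = 0.
Proof. by move=> h0 xs; apply: clamp_le0; rewrite ler_pdivrMr//; lra. Qed.

Lemma le_ramp h x s t : 0 < h -> s <= t -> ramp s h x <= ramp t h x.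
Proof. by move=> h0 st; apply: le_clamp; rewrite ler_pM2r ?invr_gt0//; lra. Qed.

Lemma ramp_le_ramp s h t k x : 0 < h -> 0 < k -> s + h <= t -> ramp s h x <= ramp t k x.
Proof.
move=> h0 k0 st; have [xt|tx] := leP x t.
  by rewrite (ramp1 k0 xt); have /andP[] := ramp01 s h x.
by rewrite ramp0; [have /andP[] := ramp01 t k x|by []|lra].
Qed.

Lemma cb_ramp s h : cb (ramp s h).
Proof.
split; last by exists 1 => x; rewrite ger0_norm; have /andP[] := ramp01 s h x.
pose f : R -> R := fun x => (s + h - x) / h.
have -> : ramp s h = (cst 1 : R -> R^o) \min ((cst 0 : R -> R^o) \max (f : R -> R^o)) by [].
move=> x; apply: continuous_min; first exact: cst_continuous.
apply: continuous_max; first exact: cst_continuous.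
by apply: cvgMr_tmp; apply: cvgB; [exact: cvg_cst|exact: cvg_id].
Qed.

(** The slope of width [k h] is cut into [k] pieces of width [h]; after rescaling, the sum of the
    [clamp (v + j + 1)] for [j < k] is [min k (max 0 (v + k))]. *)
Lemma ramp_average s h k x : 0 < h -> (0 < k)%N ->
  \sum_(j < k) ramp (s + j%:R * h) h x = k%:R * ramp s (k%:R * h) x.
Proof.
move=> h0 k0; pose v := (s - x) / h.
have -> : ramp s (k%:R * h) x = clamp ((v + k%:R) / k%:R).
  by rewrite /ramp /v; congr clamp; field; rewrite !gt_eqF ?ltr0n.
have -> : k%:R * clamp ((v + k%:R) / k%:R) = Num.min k%:R (Num.max 0 (v + k%:R)).
  have kp : 0 < k%:R :> R by rewrite ltr0n.
  rewrite /clamp minr_pMr ?maxr_pMr ?ltW// mulr1 mulr0 mulrC divfK// gt_eqF//.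
have rE j : ramp (s + j%:R * h) h x = clamp (v + j.+1%:R).
  by rewrite /ramp /v -natr1; congr clamp; field; rewrite gt_eqF.
under eq_bigr do rewrite rE.
elim: k {k0} => [|k ih]; first by rewrite big_ord0 addr0 min_l// le_max lexx.
rewrite big_ord_recr/= ih /clamp -natr1 addrA; have := ler0n R k; move: k%:R => r r0.
have [a1|a1] := leP 0 (v + r); have [a2|a2] := leP 0 (v + r + 1); try lra.
- have [b1|b1] := leP r (v + r); have [b2|b2] := leP 1 (v + r + 1);
    have [b3|b3] := leP (r + 1) (v + r + 1); lra.
- have [b1|b1] := leP r 0; have [b2|b2] := leP 1 (v + r + 1);
    have [b3|b3] := leP (r + 1) (v + r + 1); lra.
- have [b1|b1] := leP r 0; have [b2|b2] := leP 1 0;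
    have [b3|b3] := leP (r + 1) 0; lra.
Qed.

Record positive_functional (l : (R -> R) -> R) : Prop := PositiveFunctional {
  tfunD : forall f g, cb f -> cb g -> l (fun x => f x + g x) = l f + l g;
  tfunZ : forall c f, cb f -> l (fun x => c * f x) = c * l f;
  tfun_le : forall f g, cb f -> cb g -> (forall x, f x <= g x) -> l f <= l g;
  tfun1 : l (fun=> 1) = 1
}.

(** Tightness is expressed through [mass_out], for which the model supplies a mean bound. *)
Record tight_functional (l : (R -> R) -> R) : Prop := TightFunctional {
  tfun_pos :> positive_functional l;
  tfun_tight : forall e, 0 < e -> exists2 M, 1 <= M & l (mass_out M) <= e
}.

Lemma cb_cst c : cb (fun=> c : R).
Proof. by split; [move=> x; exact: cvg_cst|exists `|c|]. Qed.

Lemma cbB (f g : R -> R) : cb f -> cb g -> cb (fun x => f x - g x).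
Proof.
move=> cf cg; under eq_fun do rewrite -mulN1r; apply: cbD => //; exact: cbZ.
Qed.

Lemma mass_out_ge0 (M x : R) : 0 <= mass_out M x.
Proof. by rewrite divr_ge0// ?addr_ge0 ?sqr_ge0. Qed.

Lemma mass_out_le1 (M x : R) : mass_out M x <= 1.
Proof.
rewrite /mass_out; have [->|h] := eqVneq (x ^+ 2 + M ^+ 2) 0; first by rewrite invr0 mulr0.
rewrite ler_pdivrMr; first by rewrite mul1r lerDl sqr_ge0.
by rewrite lt_neqAle eq_sym h addr_ge0 ?sqr_ge0.
Qed.

Lemma cb_mass_out (M : R) : 0 < M -> cb (mass_out M).
Proof.
move=> M0; split; last by exists 1 => x; rewrite ger0_norm ?mass_out_le1 ?mass_out_ge0.
have p x : x ^+ 2 + M ^+ 2 != 0 by rewrite gt_eqF// ltr_wpDl ?sqr_ge0// exprn_gt0.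
move=> x; apply: cvgM; first by apply: cvgM; exact: cvg_id.
apply: cvgV; first exact: p.
by apply: cvgD; [apply: cvgM; exact: cvg_id|exact: cvg_cst].
Qed.

Lemma mass_out_half (M x : R) : 0 < M -> M <= `|x| -> 1 <= 2 * mass_out M x.
Proof.
move=> M0 Mx; rewrite /mass_out mulrA ler_pdivlMr; last first.
  by rewrite ltr_wpDl ?sqr_ge0// exprn_gt0.
have : M ^+ 2 <= x ^+ 2.
  by rewrite -[x ^+ 2]real_normK ?num_real//; apply: lerXn2r; rewrite ?nnegrE// ltW.
by lra.
Qed.

Section positive.
Variable l : (R -> R) -> R.
Hypothesis tl : positive_functional l.

Lemma tfunB f g : cb f -> cb g -> l (fun x => f x - g x) = l f - l g.
Proof.
move=> cf cg; under [in LHS]eq_fun do rewrite -mulN1r.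
by rewrite (tfunD tl cf (cbZ _ cg)) (tfunZ tl _ cg) mulN1r.
Qed.

Lemma tfun_cst c : l (fun=> c) = c.
Proof.
rewrite -[RHS]mulr1 -(tfun1 tl) -(tfunZ tl _ (cb_cst 1)).
by under [in RHS]eq_fun do rewrite mulr1.
Qed.

Lemma cb_sum (I : Type) (r : seq I) (f : I -> R -> R) : (forall i, cb (f i)) ->
  cb (fun x => \sum_(i <- r) f i x).
Proof.
move=> h; elim: r => [|i r ih].
  by under eq_fun do rewrite big_nil; exact: cb_cst.
by under eq_fun do rewrite big_cons; exact: cbD.
Qed.

Lemma tfun_sum (I : Type) (r : seq I) (f : I -> R -> R) : (forall i, cb (f i)) ->
  l (fun x => \sum_(i <- r) f i x) = \sum_(i <- r) l (f i).
Proof.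
move=> h; elim: r => [|i r ih].
  by under [in LHS]eq_fun do rewrite big_nil; rewrite big_nil tfun_cst.
under [in LHS]eq_fun do rewrite big_cons; rewrite big_cons -ih.
exact: (tfunD tl (h i) (cb_sum r h)).
Qed.

Lemma tfun_norm_le f g : cb f -> cb g -> (forall x, `|f x| <= g x) -> `|l f| <= l g.
Proof.
move=> cf cg fg; rewrite ler_norml; apply/andP; split.
  rewrite -mulN1r -(tfunZ tl _ cg); apply: (tfun_le tl) => [||x] //; first exact: cbZ.
  by have := fg x; rewrite ler_norml mulN1r => /andP[].
by apply: (tfun_le tl) => // x; apply: le_trans (fg x); exact: ler_norm.
Qed.

Lemma tfun_family_sum eta phi t J : l (family_sum (fun s x => ramp s eta x) phi t J) =
  \sum_(j < J) phi (t j) * (l (ramp (t j.+1) eta) - l (ramp (t j) eta)).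
Proof.
have cd j := cbB (cb_ramp (t j.+1) eta) (cb_ramp (t j) eta).
rewrite [LHS](tfun_sum _ (fun j : 'I_J => cbZ (phi (t j)) (cd j))).
apply: eq_bigr => j _; rewrite (tfunZ tl _ (cd j)) (tfunB (cb_ramp _ _)) //.
exact: cb_ramp.
Qed.

(** It vanishes on [[-M, M]] and is 1 where [|x| >= M + 1]. Being a combination of ramps, it has the
    same value under [l] and under the constructed measure before the full representation is
    known. *)
Definition tail_ramp (M x : R) : R := 1 - ramp M 1 x + ramp (- (M + 1)) 1 x.

Lemma cb_tail_ramp M : cb (tail_ramp M).
Proof. exact: cbD (cbB (cb_cst 1) (cb_ramp M 1)) (cb_ramp _ _). Qed.

Lemma tfun_tail_ramp M : l (tail_ramp M) = 1 - l (ramp M 1) + l (ramp (- (M + 1)) 1).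
Proof.
rewrite [LHS](tfunD tl (cbB (cb_cst 1) (cb_ramp M 1)) (cb_ramp _ _)).
by rewrite (tfunB (cb_cst 1) (cb_ramp M 1)) tfun_cst.
Qed.

Lemma family_sum_approx eta phi t J c eps M : cb phi -> 0 < eta -> 0 <= eps ->
  (forall j, t j <= t j.+1) -> (forall x, `|phi x| <= c) ->
  (forall x, `|x| <= M + 2 ->
     `|phi x - family_sum (fun s x => ramp s eta x) phi t J x| <= eps) ->
  `|l phi - l (family_sum (fun s x => ramp s eta x) phi t J)| <=
     eps + 2 * c * l (tail_ramp M).
Proof.
move=> cphi eta0 eps0 tm pc close; have c0 : 0 <= c by apply: le_trans (pc 0).
have cd j := cbB (cb_ramp (t j.+1) eta) (cb_ramp (t j) eta).
have cf : cb (family_sum (fun s x => ramp s eta x) phi t J).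
  exact: (cb_sum _ (fun j : 'I_J => cbZ (phi (t j)) (cd j))).
have ct := cbZ (2 * c) (cb_tail_ramp M).
rewrite -(tfunZ tl _ (cb_tail_ramp M)) -[eps in leRHS]tfun_cst.
rewrite -(tfunB cphi cf) -(tfunD tl (cb_cst eps) ct).
apply: tfun_norm_le => [||x]; [exact: cbB|exact: cbD (cb_cst _) ct|].
have /andP[p1 p2] := ramp01 M 1 x; have /andP[p3 p4] := ramp01 (- (M + 1)) 1 x.
have tp : 0 <= tail_ramp M x by rewrite /tail_ramp; lra.
have [xM|Mx] := leP `|x| (M + 2).
  by apply: le_trans (close x xM) _; rewrite lerDl mulr_ge0// mulr_ge0.
have t1 : 1 <= tail_ramp M x.
  rewrite /tail_ramp; move: Mx; rewrite ltr_normr => /orP[h|h].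
    by rewrite ramp0//; lra.
  by rewrite [X in _ + X]ramp1//; lra.
have fc : `|family_sum (fun s x => ramp s eta x) phi t J x| <= c.
  by apply: family_sum_le => //; [move=> *; exact: le_ramp|move=> *; exact: ramp01].
apply: le_trans (ler_normB _ _) _; have := pc x.
have : 2 * c * 1 <= 2 * c * tail_ramp M x by rewrite ler_wpM2l// mulr_ge0.
by move: fc eps0; lra.
Qed.

End positive.

Section functional.
Variable l : (R -> R) -> R.
Hypothesis tl : tight_functional l.

Lemma tail_ramp_le M : 1 <= M -> l (tail_ramp M) <= 4 * l (mass_out M).
Proof.
move=> M1; have M0 : 0 < M by lra.
have cm := cb_mass_out M0.
rewrite -(tfunZ tl 4 cm); apply: (tfun_le tl) => [||x]; [exact: cb_tail_ramp|exact: (cbZ 4 cm)|].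
have /andP[p1 p2] := ramp01 M 1 x; have /andP[p3 p4] := ramp01 (- (M + 1)) 1 x.
have [xM|Mx] := leP M `|x|.
  by have := mass_out_half M0 xM; rewrite /tail_ramp; lra.
have := mass_out_ge0 M x; move: Mx; rewrite ltr_norml => /andP[x1 x2].
by rewrite /tail_ramp ramp1 ?ramp0//; lra.
Qed.

Lemma tfun_ramp01 s h : 0 <= l (ramp s h) <= 1.
Proof.
apply/andP; split.
  by rewrite -[leLHS](tfun_cst tl); apply: (tfun_le tl) => [||x]; [exact: cb_cst|exact: cb_ramp|case/andP: (ramp01 s h x)].
by rewrite -[leRHS](tfun_cst tl); apply: (tfun_le tl) => [||x]; [exact: cb_ramp|exact: cb_cst|case/andP: (ramp01 s h x)].
Qed.

Definition ramp_values (x : R) : set R :=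
  [set u | exists s h, [/\ x < s, 0 < h & u = l (ramp s h)]].

(** The infimum runs over ramps starting strictly to the right of [x], which builds in right
    continuity. *)
Definition ramp_cdf (x : R) : R := inf (ramp_values x).

Let has_inf_ramp x : has_inf (ramp_values x).
Proof.
split; first by exists (l (ramp (x + 1) 1)), (x + 1), 1; split=> //; lra.
by exists 0 => _ [s [h [_ _ ->]]]; case/andP: (tfun_ramp01 s h).
Qed.

Lemma ramp_cdf_le x s h : x < s -> 0 < h -> ramp_cdf x <= l (ramp s h).
Proof.
move=> xs h0; apply: ge_inf; first by case: (has_inf_ramp x).
by exists s, h.
Qed.

Lemma ramp_cdf_ge x b : (forall s h, x < s -> 0 < h -> b <= l (ramp s h)) -> b <= ramp_cdf x.
Proof.
move=> hb; apply: lb_le_inf; first by case: (has_inf_ramp x).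
by move=> _ [s [h [xs h0 ->]]]; exact: hb.
Qed.

Lemma le_ramp_cdf s h x : 0 < h -> s + h <= x -> l (ramp s h) <= ramp_cdf x.
Proof.
move=> h0 sx; apply: ramp_cdf_ge => t k xt k0.
apply: (tfun_le tl) => [||u]; [exact: cb_ramp..|].
by apply: ramp_le_ramp => //; lra.
Qed.

Lemma ramp_cdf_nd : {homo ramp_cdf : x y / x <= y}.
Proof.
by move=> x y xy; apply: ramp_cdf_ge => s h ys h0; apply: ramp_cdf_le => //; lra.
Qed.

Lemma ramp_cdf01 x : 0 <= ramp_cdf x <= 1.
Proof.
apply/andP; split.
  by apply: ramp_cdf_ge => s h _ _; case/andP: (tfun_ramp01 s h).
apply: (@le_trans _ _ (l (ramp (x + 1) 1))).
  by apply: ramp_cdf_le => //; lra.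
by case/andP: (tfun_ramp01 (x + 1) 1).
Qed.

Lemma ramp_cdf_rc : right_continuous ramp_cdf.
Proof.
move=> x; apply/cvgrPdist_le => e e0.
(* A ramp nearly optimal for [x] starts at some [s > x] and is therefore admissible for every [y] in
   [[x, s[]. *)
have [_ [s [h [xs h0 ->]]] hs] := inf_adherent e0 (has_inf_ramp x).
near=> y; have xy : x <= y by near: y; exact: nbhs_right_ge.
have ys : y < s by near: y; exact: nbhs_right_lt.
rewrite distrC ger0_norm ?subr_ge0 ?ramp_cdf_nd// lerBlDl.
by apply: le_trans (ltW hs); exact: ramp_cdf_le.
Unshelve. all: by end_near.
Qed.

Lemma ramp_cdf_tail M x : 1 <= M -> M + 1 <= x -> 1 - 2 * l (mass_out M) <= ramp_cdf x.
Proof.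
move=> M1 Mx; have M0 : 0 < M by lra.
apply: le_trans (@le_ramp_cdf (x - 1) 1 x _ _) => //; last by lra.
have -> : 1 - 2 * l (mass_out M) = l (fun x => 1 - 2 * mass_out M x).
  by rewrite (tfunB tl (cb_cst 1) (cbZ 2 (cb_mass_out M0))) (tfun_cst tl) (tfunZ tl _ (cb_mass_out M0)).
apply: (tfun_le tl) => [||u].
- exact: (cbB (cb_cst 1) (cbZ 2 (cb_mass_out M0))).
- exact: cb_ramp.
have [ux|xu] := leP u (x - 1).
  by rewrite ramp1//; have := mass_out_ge0 M u; lra.
have /andP[r0 _] := ramp01 (x - 1) 1 u.
have : 1 <= 2 * mass_out M u by apply: mass_out_half => //; apply: le_trans (ler_norm _); lra.
lra.
Qed.

Lemma ramp_cdf_lower M x : 1 <= M -> x <= - (M + 2) -> ramp_cdf x <= 2 * l (mass_out M).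
Proof.
move=> M1 Mx; have M0 : 0 < M by lra.
apply: (@le_trans _ _ (l (ramp (x + 1) 1))); first by apply: ramp_cdf_le => //; lra.
rewrite -(tfunZ tl 2 (cb_mass_out M0)); apply: (tfun_le tl) => [||u].
- exact: cb_ramp.
- exact: (cbZ 2 (cb_mass_out M0)).
have [ux|xu] := leP (x + 1 + 1) u.
  by rewrite ramp0//; have := mass_out_ge0 M u; lra.
have /andP[_ r0] := ramp01 (x + 1) 1 u; apply: le_trans r0 _.
by apply: mass_out_half => //; rewrite -normrN; apply: le_trans (ler_norm _); lra.
Qed.

Lemma ramp_cdf_Ny0 : ramp_cdf @ -oo --> (0 : R).
Proof.
apply/cvgrPdist_le => e e0; have e2 : 0 < e / 2 by rewrite divr_gt0.
have [M M1 hM] := tfun_tight tl e2.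
exists (- (M + 2)); split; first exact: num_real.
move=> x /ltW xM; rewrite sub0r normrN ger0_norm; last by case/andP: (ramp_cdf01 x).
by apply: le_trans (ramp_cdf_lower M1 xM) _; move: hM; lra.
Qed.

Lemma ramp_cdf_y1 : ramp_cdf @ +oo --> (1 : R).
Proof.
apply/cvgrPdist_le => e e0; have e2 : 0 < e / 2 by rewrite divr_gt0.
have [M M1 hM] := tfun_tight tl e2.
exists (M + 1); split; first exact: num_real.
move=> x /ltW xM; have /andP[_ r1] := ramp_cdf01 x.
rewrite ger0_norm ?subr_ge0//.
by have := ramp_cdf_tail M1 xM; move: hM; lra.
Qed.

#[local] HB.instance Definition _ :=
  isCumulative.Build R _ R ramp_cdf ramp_cdf_nd ramp_cdf_rc.

#[local] HB.instance Definition _ :=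
  isCumulativeBounded.Build R 0 1 ramp_cdf ramp_cdf_Ny0 ramp_cdf_y1.

Definition riesz_measure : probability borelR R :=
  lebesgue_stieltjes_measure (ramp_cdf : cumulativeBounded (0 : R) (1 : R)).

Lemma riesz_measure_itv x : riesz_measure `]-oo, x]%classic = (ramp_cdf x)%:E.
Proof. by rewrite -cdf_lebesgue_stieltjes_id /cdf /distribution /pushforward preimage_id. Qed.

Local Notation N := riesz_measure.

Lemma positive_Rintegral (mu : probability borelR R) :
  positive_functional (fun phi => \int[mu]_x phi x).
Proof.
split=> [f g cf cg|c f cf|f g cf cg fg|].
- by rewrite RintegralD//; exact: bmeas_rint (cb_bmeas _).
- by rewrite RintegralZl//; exact: bmeas_rint (cb_bmeas _).
- by apply: RintegralT_le => //; exact: bmeas_rint (cb_bmeas _).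
- exact: RintegralT_cst.
Qed.

Lemma riesz_ramp_bounds s h : 0 < h ->
  ramp_cdf s <= \int[N]_x ramp s h x <= ramp_cdf (s + h).
Proof.
move=> h0.
have E x : ramp_cdf x = \int[N]_u \1_(`]-oo, x]%classic : set borelR) u.
  rewrite /Rintegral integral_indic//.
  by rewrite setIT -[LHS]/(fine (ramp_cdf x)%:E) -riesz_measure_itv.
have ii (v : R) : rint N (\1_(`]-oo, v]%classic : set borelR)).
  by apply: bmeas_rint; apply: bmeas_indic; exact: measurable_itv.
have ir : rint N (ramp s h) by apply: bmeas_rint; apply: cb_bmeas; exact: cb_ramp.
rewrite (E s) (E (s + h)); apply/andP; split; apply: RintegralT_le => // u.
  have /andP[r0 _] := ramp01 s h u; rewrite indicE.
  have [us|us] := leP u s; first by rewrite mem_set ?ramp1//= in_itv.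
  by rewrite memNset//= in_itv/= leNgt us.
have /andP[_ r1] := ramp01 s h u; rewrite indicE.
have [us|us] := leP u (s + h); first by rewrite mem_set//= in_itv.
by rewrite (ramp0 h0 (ltW us)).
Qed.

(** Each side is only sandwiched between values of the distribution function. Cutting the ramp into
    [k] narrow ones makes the gaps telescope to at most 2 in total, hence to [2 / k] on average. *)
Lemma riesz_ramp s h : 0 < h -> \int[N]_x ramp s h x = l (ramp s h).
Proof.
move=> h0; apply/eqP; rewrite -subr_eq0 -normr_le0; apply/ler_addgt0Pr => e e0; rewrite add0r.
pose k := (Num.truncn (2 / e)).+1.
have k0 : 0 < k%:R :> R by rewrite ltr0n.
have ke : 2 <= k%:R * e by rewrite -ler_pdivrMr// ltW// truncnS_gt.
pose w := h / k%:R; have w0 : 0 < w by rewrite divr_gt0.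
have hw : h = k%:R * w by rewrite /w mulrC divfK// gt_eqF.
have av L : positive_functional L ->
    \sum_(j < k) L (ramp (s + j%:R * w) w) = k%:R * L (ramp s h).
  move=> pL; rewrite -(tfun_sum pL _ (fun j : 'I_k => cb_ramp (s + j%:R * w) w)).
  rewrite -(tfunZ pL _ (cb_ramp s h)); congr L; apply/funext => x.
  by rewrite ramp_average// hw.
rewrite -(ler_pM2l k0) -[k%:R in leLHS]ger0_norm// -normrM mulrBr.
rewrite -(av _ (positive_Rintegral N)) -(av _ tl) -sumrB.
pose F (j : nat) := ramp_cdf (s + j%:R * w); pose F' (j : nat) := ramp_cdf (s + j%:R * w - w).
apply: (@le_trans _ _ (\sum_(j < k) ((F j.+1 - F j) + (F' j.+1 - F' j)))).
  apply: le_trans (ler_norm_sum _ _ _) _; apply: ler_sum => j _.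
  have S1 : s + j.+1%:R * w = s + j%:R * w + w by rewrite -natr1; ring.
  have FF : F' j.+1 = F j by rewrite /F' /F S1 addrK.
  have /andP[a1 a2] := riesz_ramp_bounds (s + j%:R * w) w0.
  have a3 : l (ramp (s + j%:R * w) w) <= F j.+1 by apply: le_ramp_cdf; rewrite // S1.
  have a4 : F' j <= l (ramp (s + j%:R * w) w) by apply: ramp_cdf_le; rewrite // ltrBlDr ltrDl.
  have a5 : F' j <= F j by apply: ramp_cdf_nd; rewrite lerBlDr lerDl ltW.
  rewrite FF ler_norml; move: a1 a2 a3 a4 a5; rewrite -S1 -/(F j) -/(F j.+1).
  by move=> *; apply/andP; split; lra.
rewrite big_split/= (telescope_ord F) (telescope_ord F'); apply: le_trans ke.
have /andP[_ b1] := ramp_cdf01 (s + k%:R * w); have /andP[b2 _] := ramp_cdf01 (s + 0%:R * w).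
have /andP[_ b3] := ramp_cdf01 (s + k%:R * w - w).
have /andP[b4 _] := ramp_cdf01 (s + 0%:R * w - w).
by rewrite /F /F'; move: b1 b2 b3 b4; lra.
Qed.

Lemma riesz_representation phi : cb phi -> \int[N]_x phi x = l phi.
Proof.
move=> cphi; have [cont [c pc]] := cphi; have c0 : 0 <= c by apply: le_trans (pc 0).
apply/eqP; rewrite -subr_eq0 -normr_le0; apply/ler_addgt0Pr => e e0; rewrite add0r.
(* With [l (tail_ramp M) <= 4 l (mass_out M)] this gives a tail error
   [2 c l (tail_ramp M) <= e / 4]; the approximation adds [e / 4], and both errors occur once for
   [l] and once for the measure. *)
have C0 : 0 < 32 * (c + 1) by move: c0; lra.
have [M M1 hM] := tfun_tight tl (divr_gt0 e0 C0).
have e4 : 0 < e / 4 by rewrite divr_gt0.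
have M2 : 0 < M + 2 by lra.
have [eta [tau [eta0 tau0 [t [J [tm close]]]]]] := family_approx cont pc M2 e4.
have {}close x : `|x| <= M + 2 ->
    `|phi x - family_sum (fun s x => ramp s eta x) phi t J x| <= e / 4.
  apply: close => [u s s' ss'|s u|s u us|s u su]; first exact: le_ramp.
  - exact: ramp01.
  - by rewrite ramp1//; [move: tau0; lra|move: us eta0; lra].
  - by rewrite ramp0//; [exact: ltW|move: su; lra].
have h1 := family_sum_approx tl cphi eta0 (ltW e4) tm pc close.
have h2 := family_sum_approx (positive_Rintegral N) cphi eta0 (ltW e4) tm pc close.
have ht : \int[N]_x tail_ramp M x = l (tail_ramp M).
  by rewrite (tfun_tail_ramp (positive_Rintegral N)) (tfun_tail_ramp tl) !riesz_ramp.
have hs : \int[N]_x family_sum (fun s x => ramp s eta x) phi t J x =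
    l (family_sum (fun s x => ramp s eta x) phi t J).
  rewrite (tfun_family_sum (positive_Rintegral N)) (tfun_family_sum tl).
  by apply: eq_bigr => j _; rewrite !riesz_ramp.
rewrite ht hs in h2.
have hl : c * l (tail_ramp M) <= e / 8.
  have := ler_wpM2l c0 (tail_ramp_le M1).
  have m0 : 0 <= l (mass_out M).
    rewrite -(tfun_cst tl 0); apply: (tfun_le tl); [exact: cb_cst| |exact: mass_out_ge0].
    by apply: cb_mass_out; lra.
  have : 32 * (c + 1) * l (mass_out M) <= e by rewrite mulrC -ler_pdivlMr.
  by move: m0; nra.
set s := l (family_sum _ _ _ _) in h1 h2.
have -> : \int[N]_x phi x - l phi = (\int[N]_x phi x - s) - (l phi - s) by ring.
by apply: le_trans (ler_normB _ _) _; move: h1 h2 hl; lra.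
Qed.

End functional.
End riesz.

(** * Density of Poisson kernels *)

Section poisson_density.
Variable R : realType.

(** An induction principle for properties of test functions. The limit clause allows an error that
    is uniform up to a multiple of [mass_out], so tight families reach all bounded continuous
    functions, not only those vanishing at infinity. *)
Record poisson_class (G : (R -> R) -> Prop) : Prop := PoissonClass {
  pc_kernel : forall t s, 0 < s -> G (fun x => complex.Im (stieltjes_kernel (t +i* s) x));
  pcD : forall f g, G f -> G g -> G (fun x => f x + g x);
  pcZ : forall c f, G f -> G (fun x => c * f x);
  pc_lim : forall f k, cb f -> 0 <= k ->
    (forall e M, 0 < e -> 1 <= M -> exists2 g, G g &
       forall x, `|f x - g x| <= e + k * mass_out M x) -> G f
}.

Lemma inv_1Dsqr_lipschitz (u v : R) :
  `|(1 + u ^+ 2)^-1 - (1 + v ^+ 2)^-1| <= `|u - v|.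
Proof.
have pu : 0 < 1 + u ^+ 2 by rewrite ltr_pwDl// sqr_ge0.
have pv : 0 < 1 + v ^+ 2 by rewrite ltr_pwDl// sqr_ge0.
have -> : (1 + u ^+ 2)^-1 - (1 + v ^+ 2)^-1 =
    (v - u) * ((u + v) / ((1 + u ^+ 2) * (1 + v ^+ 2))).
  by field; rewrite !gt_eqF.
rewrite normrM distrC -[leRHS]mulr1; apply: ler_wpM2l => //.
rewrite normrM normfV (gtr0_norm (mulr_gt0 pu pv)) ler_pdivrMr ?mulr_gt0// mul1r.
have h1 := sqr_ge0 (u - 1); have h2 := sqr_ge0 (v - 1); have h3 := sqr_ge0 (u + 1).
have h4 := sqr_ge0 (v + 1); have h5 := sqr_ge0 (u * v); rewrite exprMn in h5.
have h6 := sqr_ge0 u; have h7 := sqr_ge0 v.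
rewrite ler_norml; apply/andP; split; lra.
Qed.

(** One-step error of the left-endpoint rule: the derivative of [atan] is 1-Lipschitz. *)
Lemma atan_increment (u v : R) : u <= v ->
  `|atan v - atan u - (v - u) * (1 + u ^+ 2)^-1| <= (v - u) ^+ 2.
Proof.
move=> uv; have [|c] := @MVT_segment R atan (fun x => (1 + x ^+ 2)^-1) u v uv.
  by apply: continuous_subspaceT => y; exact: continuous_atan.
rewrite in_itv/= => /andP[uc cv] ->.
have -> : (1 + c ^+ 2)^-1 * (v - u) - (v - u) * (1 + u ^+ 2)^-1 =
    (v - u) * ((1 + c ^+ 2)^-1 - (1 + u ^+ 2)^-1) by ring.
rewrite normrM ger0_norm ?subr_ge0// expr2; apply: ler_wpM2l; first by rewrite subr_ge0.
apply: le_trans (inv_1Dsqr_lipschitz _ _) _.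
by rewrite ger0_norm ?subr_ge0//; lra.
Qed.

(** The distribution function of a Cauchy law; its derivative in [t] is the Poisson kernel divided
    by [pi]. *)
Definition smooth_step (s t x : R) : R := 2^-1 + atan ((t - x) / s) / pi.

Lemma smooth_step_mono s x t t' : 0 < s -> t <= t' -> smooth_step s t x <= smooth_step s t' x.
Proof.
move=> s0 tt; rewrite /smooth_step lerD2l ler_pM2r ?invr_gt0 ?pi_gt0//.
by apply: le_atan; rewrite ler_pM2r ?invr_gt0//; lra.
Qed.

Lemma smooth_step01 s t x : 0 <= smooth_step s t x <= 1.
Proof.
have p0 := pi_gt0 R; have := atan_ltpi2 ((t - x) / s); have := atan_gtNpi2 ((t - x) / s).
rewrite /smooth_step; move: (atan _) => a h1 h2.
have : - 2^-1 < a / pi by rewrite ltr_pdivlMr//; lra.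
have : a / pi < 2^-1 by rewrite ltr_pdivrMr//; lra.
by move=> h3 h4; apply/andP; split; lra.
Qed.

Lemma smooth_step_tails eta tau : 0 < eta -> 0 < tau -> exists s, [/\ 0 < s,
  (forall t x, x + eta <= t -> 1 - tau <= smooth_step s t x) &
  (forall t x, t <= x - eta -> smooth_step s t x <= tau)].
Proof.
move=> eta0 tau0; have p0 := pi_gt0 R.
have pt : 0 < tau * pi by rewrite mulr_gt0.
have [u [u0 hu]] : exists u : R, 0 < u /\ pi / 2 - tau * pi <= atan u.
  have /cvgrPdist_le/(_ _ pt)/= := @cvgy_atan R.
  move=> [u0 [_ h]]; exists (Num.max u0 0 + 1); split.
    by rewrite ltr_wpDl// le_max lexx orbT.
  have /h : u0 < Num.max u0 0 + 1 by rewrite ltr_pwDr// le_max lexx.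
  by rewrite ler_norml => /andP[_]; lra.
have s0 : 0 < eta / u by rewrite divr_gt0.
have key v : u <= v -> (2^-1 - tau) * pi <= atan v.
  by move=> /le_atan; apply: le_trans; move: hu; lra.
have ue : u * (eta / u) = eta by rewrite mulrC divfK// gt_eqF.
exists (eta / u); split => // t x tx; rewrite /smooth_step.
  have : (2^-1 - tau) <= atan ((t - x) / (eta / u)) / pi.
    by rewrite ler_pdivlMr//; apply: key; rewrite ler_pdivlMr// ue; lra.
  by lra.
have : atan ((t - x) / (eta / u)) / pi <= - (2^-1 - tau).
  rewrite ler_pdivrMr// -[X in atan X]opprK atanN mulNr lerN2.
  by apply: key; rewrite -mulNr ler_pdivlMr// ue; lra.
by lra.
Qed.

Lemma cb_smooth_step s t : 0 < s -> cb (smooth_step s t).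
Proof.
move=> s0; split; last by exists 1 => x; rewrite ger0_norm; have /andP[] := smooth_step01 s t x.
move=> x; apply: cvgD; first exact: cvg_cst.
apply: cvgMr_tmp; apply: (@continuous_cvg _ _ _ _ _ _ (@atan R)); first exact: continuous_atan.
by apply: cvgMr_tmp; apply: cvgB; [exact: cvg_cst|exact: cvg_id].
Qed.

Section dense.
Variable G : (R -> R) -> Prop.
Hypothesis pc : poisson_class G.

Lemma pc_zero : G (fun=> 0).
Proof.
by have := pcZ pc 0 (pc_kernel pc 0 ltr01); under eq_fun do rewrite mul0r.
Qed.

Lemma pc_sum (I : Type) (r : seq I) (f : I -> R -> R) : (forall i, G (f i)) ->
  G (fun x => \sum_(i <- r) f i x).
Proof.
move=> h; elim: r => [|i r ih].
  by under eq_fun do rewrite big_nil; exact: pc_zero.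
by under eq_fun do rewrite big_cons; exact: (pcD pc).
Qed.

Lemma pc_step_increment s t t' : 0 < s -> t <= t' ->
  G (fun x => smooth_step s t' x - smooth_step s t x).
Proof.
move=> s0 tt; have p0 := pi_gt0 R.
apply: (pc_lim pc (k := 0)) => //.
  by apply: cbB; exact: cb_smooth_step.
move=> e M e0 _; pose d := (t' - t) / s.
have d0 : 0 <= d by rewrite divr_ge0 ?subr_ge0// ltW.
(* A left Riemann sum with [q] steps [h = d / q] has error at most
   [q h^2 / pi = d^2 / (q pi) <= e]. *)
pose q := (Num.truncn (d ^+ 2 / (pi * e))).+1.
have q0 : 0 < q%:R :> R by rewrite ltr0n.
pose h := d / q%:R.
have h0 : 0 <= h by rewrite divr_ge0.
have dq : q%:R * h = d by rewrite /h mulrC divfK// gt_eqF.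
have qh : q%:R * h ^+ 2 <= pi * e.
  have : d ^+ 2 <= q%:R * (pi * e) by rewrite -ler_pdivrMr ?mulr_gt0// ltW// truncnS_gt.
  rewrite -dq => hh; rewrite -(ler_pM2l q0); move: hh; nra.
pose tt_ (i : nat) := t + i%:R * (h * s).
exists (fun x => \sum_(i < q) (h * s / pi) *
    complex.Im (stieltjes_kernel (tt_ i +i* s) x)).
  by apply: pc_sum => i; apply: (pcZ pc); exact: (pc_kernel pc).
move=> x; rewrite mul0r addr0.
pose u (i : nat) := (tt_ i - x) / s.
have uS i : u i.+1 - u i = h by rewrite /u /tt_ -natr1; field; rewrite gt_eqF.
have u0 : u 0%N = (t - x) / s by rewrite /u /tt_ mul0r addr0.
have uq : u q = (t' - x) / s.
  have : q%:R * (h * s) = t' - t by rewrite mulrA dq /d divfK// gt_eqF.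
  by rewrite /u /tt_ => ->; rewrite subrKC.
have E : smooth_step s t' x - smooth_step s t x -
    \sum_(i < q) (h * s / pi) * complex.Im (stieltjes_kernel (tt_ i +i* s) x) =
    pi^-1 * \sum_(i < q) (atan (u i.+1) - atan (u i) - (u i.+1 - u i) * (1 + u i ^+ 2)^-1).
  rewrite sumrB (telescope_ord (fun i => atan (u i))) uq u0 mulrBr mulr_sumr.
  congr (_ - _); first by rewrite /smooth_step; ring.
  apply: eq_bigr => i _; rewrite uS Im_stieltjes_kernel /u.
  have pn : (pi : R) != 0 by rewrite gt_eqF.
  move: (pi : R) pn => p pn; field.
  by rewrite pn !gt_eqF// ltr_pwDl ?sqr_ge0// exprn_gt0.
rewrite E normrM (gtr0_norm (x := pi^-1)) ?invr_gt0// ler_pdivrMl//; apply: le_trans qh.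
apply: le_trans (ler_norm_sum _ _ _) _.
apply: (@le_trans _ _ (\sum_(i < q) h ^+ 2)).
  apply: ler_sum => i _; rewrite -[X in _ <= X ^+ 2](uS i); apply: atan_increment.
  by rewrite -subr_ge0 uS.
by rewrite sumr_const card_ord -[leLHS]mulr_natl.
Qed.

Lemma poisson_dense phi : cb phi -> G phi.
Proof.
move=> cphi; have [cont [c hc]] := cphi; have c0 : 0 <= c by apply: le_trans (hc 0).
(* Outside [[-M, M]] the function and its approximant are each at most [c], and [1 <= 2 mass_out M]
   there. *)
apply: (pc_lim pc (k := 4 * c)) => //; first by rewrite mulr_ge0.
move=> e M e0 M1; have M0 : 0 < M by lra.
have [eta [tau [eta0 tau0 [t [J [tm close]]]]]] := family_approx cont hc M0 e0.
have [s [s0 hi lo]] := smooth_step_tails eta0 tau0.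
exists (family_sum (smooth_step s) phi t J).
  by apply: pc_sum => j; apply: (pcZ pc); apply: pc_step_increment.
move=> x; have m0 := mass_out_ge0 M x; have cm0 := mulr_ge0 c0 m0.
have [xM|Mx] := leP `|x| M.
  apply: (@le_trans _ _ e); last by move: cm0; lra.
  apply: close => //; [by move=> *; exact: smooth_step_mono|exact: smooth_step01].
have := mass_out_half M0 (ltW Mx) => /(ler_wpM2l c0) hm.
have fc : `|family_sum (smooth_step s) phi t J x| <= c.
  by apply: family_sum_le => //; [move=> *; exact: smooth_step_mono|exact: smooth_step01].
by apply: le_trans (ler_normB _ _) _; have := hc x; move: fc hm e0; lra.
Qed.

End dense.
End poisson_density.

(** * Weak limit of the spectral distributions *)

Section kernels.
Variable R : realType.

Lemma ccb_stieltjes (z : R[i]) : complex.Im z != 0 -> ccb (stieltjes_kernel z).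
Proof.
move=> z0; have I x : complex.Im (x%:C - z) = - complex.Im z by rewrite raddfB/= sub0r.
have b x : `|complex.Im z| <= nc (x%:C - z) by rewrite -normrN -(I x) normr_Im_le.
have p : 0 < `|complex.Im z| by rewrite normr_gt0.
split.
  apply: ccontV => [|x]; last by rewrite -normc_gt0; exact: lt_le_trans (b x).
  apply: (ccontD (ccont_real _) (ccont_cst (- z))) => x; exact: cvg_id.
exists `|complex.Im z|^-1 => x; rewrite /stieltjes_kernel normcV lef_pV2 ?posrE//.
exact: lt_le_trans (b x).
Qed.

End kernels.

Section measurability.
Context (R : realType) d (T : measurableType d) (P : probability T R) (n m : nat).
Variables (xi : 'I_m -> {RV P >-> R}) (y : 'I_m -> 'I_n -> {RV P >-> R}).
Local Notation emp w := (empirical (covmx xi y w)).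

Lemma empirical_mass_out_cvg (L : 'M[R]_n) :
  empirical L (mass_out k.+1%:R) @[k --> \oo] --> (0 : R).
Proof.
pose c := empirical L (fun x => x ^+ 2).
have c0 : 0 <= c.
  by rewrite mulr_ge0 ?invr_ge0// sumr_ge0// => x _; exact: sqr_ge0.
have h : c * k.+1%:R^-1 @[k --> \oo] --> 0.
  by rewrite -[X in _ --> X](mulr0 c); apply: cvgMl_tmp; exact: cvg_harmonic.
apply: (squeeze_cvgr _ (cvg_cst 0) h).
apply: nearW => k; apply/andP; split.
  by rewrite mulr_ge0 ?invr_ge0// sumr_ge0// => x _; exact: mass_out_ge0.
rewrite /c mulrC -empiricalZ; apply: empirical_le => x.
rewrite /mass_out mulrC; apply: ler_wpM2r; first exact: sqr_ge0.
have k1 : (1 : R) <= k.+1%:R by rewrite ler1n.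
rewrite lef_pV2 ?posrE ?ltr0n//; last by rewrite ltr_wpDl ?sqr_ge0// exprn_gt0.
have := sqr_ge0 x; have : k.+1%:R <= k.+1%:R ^+ 2 :> R by rewrite expr2 ler_peMl.
lra.
Qed.

(** The eigenvalues are listed in an unspecified order, so measurability is not sought one
    eigenvalue at a time. For Poisson kernels the average is a trace of the resolvent; density, and
    the vanishing of the averages of [mass_out] for each fixed matrix, do the rest. *)
Lemma measurable_empirical phi : cb phi ->
  measurable_fun [set: T] (fun w => emp w phi).
Proof.
apply: (@poisson_dense R (fun phi => measurable_fun [set: T] (fun w => emp w phi))).
split=> [t s s0|f g mf mg|c f mf|f k cf k0 h].
- have z0 : complex.Im (t +i* s) != 0 by rewrite gt_eqF.
  have [_ mI] := cmeas_gN xi y z0.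
  rewrite (_ : (fun w => _) = (fun w => complex.Im (gN xi y (t +i* s) w))); first exact: mI.
  by apply/funext => w; rewrite gN_empirical.
- by under eq_fun do rewrite empiricalD; exact: measurable_funD.
- by under eq_fun do rewrite empiricalZ; apply: measurable_funM => //; exact: measurable_cst.
have h' (i : nat) : exists g, measurable_fun [set: T] (fun w => emp w g) /\
    forall x, `|f x - g x| <= i.+1%:R^-1 + k * mass_out i.+1%:R x.
  have [||g mg fg] := h i.+1%:R^-1 i.+1%:R; [by rewrite invr_gt0|by rewrite ler1n|].
  by exists g.
have [g hg] := choice h'.
apply: (measurable_fun_cvg (h := fun i w => emp w (g i))) => [i|w _].
  by case: (hg i).
apply/cvgrPdist_le => e e0.
have r0 : empirical (covmx xi y w) (fun=> 1) * i.+1%:R^-1 +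
    k * emp w (mass_out i.+1%:R) @[i --> \oo] --> 0.
  rewrite -[X in _ --> X]addr0.
  rewrite -[X in _ --> X + _](mulr0 (empirical (covmx xi y w) (fun=> 1))).
  rewrite -[X in _ --> _ + X](mulr0 k); apply: cvgD; apply: cvgMl_tmp.
    exact: cvg_harmonic.
  exact: empirical_mass_out_cvg.
move/cvgrPdist_le : r0 => /(_ _ e0); apply: filterS => i.
rewrite sub0r normrN; apply: le_trans; apply: le_trans (ler_norm _).
rewrite mulrC -!empiricalZ -empiricalD -empiricalB.
apply: normr_empirical_le => x; rewrite mulr1; by case: (hg i).
Qed.

End measurability.

Section weak_limit.
Context (R : realType) (d : nat -> measure_display) (T : forall n, measurableType (d n)).
Variables (P : forall n, probability (T n) R) (m : nat -> nat).
Variables (xi : forall n, 'I_(m n) -> {RV (P n) >-> R}).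
Variables (y : forall n, 'I_(m n) -> 'I_n -> {RV (P n) >-> R}).
Variables (Q : forall n, 'I_(m n) -> 'M[R]_n) (B : forall n, 'M[R]_n).
Variables (K : R) (rho : nat -> R).
Hypothesis reg : \forall n \near \oo, regular (@xi n) (@y n) (@Q n) (B n) K (rho n).
Hypothesis rho_cvg : rho n @[n --> \oo] --> 0.
Local Notation C := R[i].
Variable f : C -> C.
Hypothesis gbar_cvg : forall z, 0 < complex.Im z ->
  nc (gbar (@xi n) (@y n) z - f z) @[n --> \oo] --> 0.

Local Notation emp n w phi := (empirical (covmx (@xi n) (@y n) w) phi).

Let rint_gN n z v : regular (@xi n) (@y n) (@Q n) (B n) K (rho n) ->
  complex.Im z != 0 -> rint (P n) (fun w => nc (gN (@xi n) (@y n) z w - v)).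
Proof.
move=> r zn; apply: (rint_bounded (`|complex.Im z|^-1 + nc v)).
  by apply: measurable_normc; apply: cmeasB; [exact: cmeas_gN|exact: cmeas_cst].
move=> w; rewrite ger0_norm ?normc_ge0//; apply: le_trans (normcB _ _) _.
by rewrite lerD2r; exact: (gN_le r zn w).
Qed.

Lemma mean_stieltjes_cvg z : 0 < complex.Im z ->
  \int[P n]_w nc (gN (@xi n) (@y n) z w - f z) @[n --> \oo] --> 0.
Proof.
move=> z0; have zn : complex.Im z != 0 by rewrite gt_eqF.
have h : fluct_max (@xi n) (@y n) (@Q n) z + nc (gbar (@xi n) (@y n) z - f z)
    @[n --> \oo] --> 0.
  by rewrite -[X in _ --> X]addr0; apply: cvgD; [exact: (fluct_cvg0 reg)|exact: gbar_cvg].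
apply: (squeeze_cvgr _ (cvg_cst 0) h); apply: filterS reg => n r; apply/andP; split.
  by apply: Rintegral_ge0 => w _; exact: normc_ge0.
have E w : fluct (P n) (@Q n) (rsv (@xi n) (@y n) z) None w =
    gN (@xi n) (@y n) z w - gbar (@xi n) (@y n) z.
  by rewrite /fluct tr_mul_Dfam_None (tr_Dfam_None r) mulr1.
have i1 := rint_fluct_point r zn None; have i2 := rint_cst (P n) (nc (gbar (@xi n) (@y n) z - f z)).
apply: le_trans _ (lerD (le_fluct_max (@xi n) (@y n) (@Q n) z None) (lexx _)).
rewrite -[X in _ <= _ + X](RintegralT_cst (P n)) -RintegralD//.
have bd w : nc (gN (@xi n) (@y n) z w - f z) <=
    nc (fluct (P n) (@Q n) (rsv (@xi n) (@y n) z) None w) + nc (gbar (@xi n) (@y n) z - f z).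
  by rewrite E; apply: le_trans (normcD _ _); rewrite addrA subrK.
by apply: RintegralT_le => //; [exact: rint_gN|exact: rintD].
Qed.

Let emp_bound n phi c w : (0 < n)%N -> (forall x, `|phi x| <= c) -> `|emp n w phi| <= c.
Proof.
move=> n0 pc; rewrite -[leRHS](empirical_cst n0 (covmx_sym (@xi n) (@y n) w)).
exact: normr_empirical_le.
Qed.

Let rint_emp n phi : (0 < n)%N -> cb phi -> rint (P n) (fun w => emp n w phi).
Proof.
move=> n0 cphi; have [_ [c pc]] := cphi; apply: (rint_bounded c); first exact: measurable_empirical.
by move=> w; exact: emp_bound.
Qed.

Let L1 n phi v := \int[P n]_w `|emp n w phi - v|.

Let rint_L1 n phi v : (0 < n)%N -> cb phi -> rint (P n) (fun w => `|emp n w phi - v|).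
Proof. by move=> n0 cphi; apply: rint_norm; apply: rintB; [exact: rint_emp|exact: rint_cst]. Qed.

Let n_gt0 : \forall n \near \oo, (0 < n)%N.
Proof. by exists 1%N. Qed.

Let L1_ge0 n phi v : 0 <= L1 n phi v.
Proof. exact: Rintegral_ge0. Qed.

Let good phi := cb phi /\ exists v, L1 n phi v @[n --> \oo] --> 0.

Let L1_dist n phi u v : (0 < n)%N -> cb phi -> `|u - v| <= L1 n phi u + L1 n phi v.
Proof.
move=> n0 cphi; rewrite -[leLHS](RintegralT_cst (P n)) -RintegralD//; [|exact: rint_L1..].
apply: RintegralT_le; [exact: rint_cst|by apply: rintD; exact: rint_L1|move=> w].
by rewrite -(subrKA (emp n w phi)) [X in _ <= X + _]distrC ler_normD.
Qed.

Let good_lim phi : cb phi ->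
  (forall e, 0 < e -> exists v, \forall n \near \oo, L1 n phi v <= e) -> good phi.
Proof.
move=> cphi h; split=> //.
(* Completeness of [R]: two admissible pairs satisfy [|v - v'| <= e + e'], so every [v + e] bounds
   [S] from above, and the supremum lies within [e] of each admissible [v]. *)
pose S := [set u | exists e v, [/\ 0 < e, \forall n \near \oo, L1 n phi v <= e & u = v - e]].
have SU e v : 0 < e -> (\forall n \near \oo, L1 n phi v <= e) -> ubound S (v + e).
  move=> e0 hv _ [e' [v' [e'0 hv' ->]]].
  have [n [n0 [h1 h2]]] := filter_ex (filterI n_gt0 (filterI hv hv')).
  have := L1_dist v' v n0 cphi; rewrite ler_norml => /andP[_].
  by move: h1 h2; lra.
have S0 : S !=set0.
  by have [v hv] := h 1 ltr01; exists (v - 1), 1, v.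
have hS : has_sup S.
  by split=> //; have [v hv] := h 1 ltr01; exists (v + 1); exact: SU.
exists (sup S); apply/cvgrPdist_le => e e0; have e2 : 0 < e / 2 by rewrite divr_gt0.
have [v hv] := h _ e2.
have d1 : sup S <= v + e / 2 by apply: sup_le_ub => //; exact: SU.
have d2 : v - e / 2 <= sup S by apply: ub_le_sup; [case: hS|exists (e / 2), v].
apply: filterS2 n_gt0 hv => n n0 hv; rewrite sub0r normrN ger0_norm//.
apply: (@le_trans _ _ (\int[P n]_w (`|emp n w phi - v| + e / 2))).
  apply: RintegralT_le; [exact: rint_L1|by apply: rintD; [exact: rint_L1|exact: rint_cst]|].
  move=> w; rewrite -(subrKA v); apply: le_trans (ler_normD _ _) _; rewrite lerD2l.
  by rewrite ler_norml; apply/andP; split; lra.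
rewrite RintegralD//; [|exact: rint_L1|exact: rint_cst].
by rewrite RintegralT_cst [leRHS]splitr lerD2r.
Qed.

Let mass_out_le M : 1 <= M -> \forall n \near \oo,
  \int[P n]_w emp n w (mass_out M) <= 2 * K ^+ 2 / M.
Proof. by move=> M1; apply: filterS reg => n r; have [] := mean_mass_out r M1. Qed.

(** [pt] is the real or the imaginary part. Imaginary parts are the Poisson kernels that generate
    all test functions; real parts serve to identify the Stieltjes transform of the limit. *)
Let kernel_good (pt : C -> R) z : 0 < complex.Im z ->
  (forall u v, pt (u - v) = pt u - pt v) -> (forall u, `|pt u| <= nc u) ->
  cb (fun x => pt (stieltjes_kernel z x)) ->
  (forall n w, emp n w (fun x => pt (stieltjes_kernel z x)) = pt (gN (@xi n) (@y n) z w)) ->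
  L1 n (fun x => pt (stieltjes_kernel z x)) (pt (f z)) @[n --> \oo] --> 0.
Proof.
move=> z0 ptB ptn cpt ptE; have zn : complex.Im z != 0 by rewrite gt_eqF.
apply: (squeeze_cvgr _ (cvg_cst 0) (mean_stieltjes_cvg z0)).
apply: filterS reg => n r; have n0 := reg_n r.
rewrite L1_ge0; apply: RintegralT_le; [exact: rint_L1|exact: rint_gN|move=> w].
by rewrite ptE -ptB.
Qed.

Let Im_kernel_good z : 0 < complex.Im z ->
  L1 n (fun x => complex.Im (stieltjes_kernel z x)) (complex.Im (f z)) @[n --> \oo] --> 0.
Proof.
move=> z0; have zn : complex.Im z != 0 by rewrite gt_eqF.
apply: (kernel_good z0 (pt := @complex.Im R)) => [u v|u||n w].
- exact: raddfB.
- exact: normr_Im_le.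
- by apply: ccb_Im; exact: ccb_stieltjes.
- by rewrite gN_empirical.
Qed.

Let Re_kernel_good z : 0 < complex.Im z ->
  L1 n (fun x => complex.Re (stieltjes_kernel z x)) (complex.Re (f z)) @[n --> \oo] --> 0.
Proof.
move=> z0; have zn : complex.Im z != 0 by rewrite gt_eqF.
apply: (kernel_good z0 (pt := @complex.Re R)) => [u v|u||n w].
- exact: raddfB.
- exact: normr_Re_le.
- by apply: ccb_Re; exact: ccb_stieltjes.
- by rewrite gN_empirical.
Qed.

Let L1D g h u v : cb g -> cb h -> L1 n g u @[n --> \oo] --> 0 ->
  L1 n h v @[n --> \oo] --> 0 -> L1 n (fun x => g x + h x) (u + v) @[n --> \oo] --> 0.
Proof.
move=> cg ch gu hv; have s0 : L1 n g u + L1 n h v @[n --> \oo] --> 0.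
  by rewrite -[X in _ --> X]addr0; exact: cvgD.
apply: (squeeze_cvgr _ (cvg_cst 0) s0); apply: filterS n_gt0 => n n0.
rewrite L1_ge0 -RintegralD//; [|exact: rint_L1..].
apply: RintegralT_le; [by apply: rint_L1 => //; exact: cbD|by apply: rintD; exact: rint_L1|].
by move=> w; rewrite empiricalD opprD addrACA ler_normD.
Qed.

Let L1Z c g u : cb g -> L1 n g u @[n --> \oo] --> 0 ->
  L1 n (fun x => c * g x) (c * u) @[n --> \oo] --> 0.
Proof.
move=> cg gu; have s0 : `|c| * L1 n g u @[n --> \oo] --> 0.
  by rewrite -[X in _ --> X](mulr0 `|c|); exact: cvgMl_tmp.
apply: (squeeze_cvgr _ (cvg_cst 0) s0); apply: filterS n_gt0 => n n0.
rewrite L1_ge0 -RintegralZl//; last exact: rint_L1.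
apply: RintegralT_le; [by apply: rint_L1 => //; exact: cbZ|by apply: rintZ; exact: rint_L1|].
by move=> w; rewrite empiricalZ -mulrBr normrM.
Qed.

Let goodP phi : cb phi -> good phi.
Proof.
apply: poisson_dense; split=> [t s s0|g h [cg [u gu]] [ch [v hv]]|c g [cg [u gu]]|g k cg k0 h].
- split; last by exists (complex.Im (f (t +i* s))); exact: Im_kernel_good.
  by apply: ccb_Im; apply: ccb_stieltjes; rewrite gt_eqF.
- by split; [exact: cbD|exists (u + v); exact: L1D].
- by split; [exact: cbZ|exists (c * u); exact: L1Z].
(* Large enough for the mean tail [k (2 K^2 / M)] to be at most [e / 4]. *)
apply: good_lim => // e e0; pose M := 1 + 8 * k * K ^+ 2 / e.
have kK : 0 <= 8 * k * K ^+ 2 by apply: mulr_ge0; [exact: mulr_ge0|exact: sqr_ge0].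
have M1 : 1 <= M by rewrite lerDl divr_ge0// ltW.
have M0 : 0 < M by lra.
have kM : k * (2 * K ^+ 2 / M) <= e / 4.
  have -> : k * (2 * K ^+ 2 / M) = 2 * k * K ^+ 2 / M by ring.
  rewrite ler_pdivrMr// /M mulrDr mulr1.
  have -> : e / 4 * (8 * k * K ^+ 2 / e) = 2 * k * K ^+ 2 by field; rewrite gt_eqF.
  by rewrite lerDr divr_ge0// ltW.
have e4 : 0 < e / 4 by rewrite divr_gt0.
have [g' [cg' [v gv]] close] := h _ _ e4 M1.
exists v; have gv' : \forall n \near \oo, L1 n g' v <= e / 4.
  move/cvgrPdist_le : gv => /(_ _ e4); apply: filterS => n.
  by rewrite sub0r normrN ger0_norm.
near=> n.
have r : regular (@xi n) (@y n) (@Q n) (B n) K (rho n) by near: n.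
have n0 := reg_n r.
have g'n : L1 n g' v <= e / 4 by near: n.
have [iM hM] := mean_mass_out r M1.
have i1 := rint_L1 v n0 cg'; have i2 := rint_cst (P n) (e / 4).
have i3 := rintZ k iM.
apply: (@le_trans _ _ (\int[P n]_w (`|emp n w g' - v| + (e / 4 + k * emp n w (mass_out M))))).
  apply: RintegralT_le; [exact: rint_L1|by apply: rintD => //; exact: rintD|move=> w].
  rewrite -(subrKA (emp n w g')); apply: le_trans (ler_normD _ _) _.
  rewrite [leRHS]addrC lerD2r -empiricalB -empiricalZ.
  rewrite -[e / 4 in leRHS](empirical_cst n0 (covmx_sym (@xi n) (@y n) w)) -empiricalD.
  exact: normr_empirical_le.
rewrite (RintegralD _ i1 (rintD i2 i3))// (RintegralD _ i2 i3)// RintegralT_cst RintegralZl//.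
have := ler_wpM2l k0 hM; move: g'n kM => h1 h2 h3.
by apply: le_trans (lerD h1 (lerD (lexx _) (le_trans h3 h2))) _; move: e0; lra.
Unshelve. all: by end_near.
Qed.

(** [lim] is total; the values that matter are those on [cb] functions, where the means do
    converge. *)
Definition mean_limit (phi : R -> R) : R :=
  lim (\int[P n]_w empirical (covmx (@xi n) (@y n) w) phi @[n --> \oo]).

Let mean_cvg_L1 phi v : cb phi -> L1 n phi v @[n --> \oo] --> 0 ->
  \int[P n]_w emp n w phi @[n --> \oo] --> v.
Proof.
move=> cphi h; apply/cvgrPdist_le => e e0; move/cvgrPdist_le : h => /(_ _ e0) h.
apply: filterS2 n_gt0 h => n n0; rewrite sub0r normrN ger0_norm//; apply: le_trans.
rewrite -[X in `|X - _|](RintegralT_cst (P n)) -RintegralB//; [|exact: rint_cst|exact: rint_emp].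
apply: normr_RintegralT_le; [|exact: rint_L1|by move=> w; rewrite distrC].
by apply: rintB; [exact: rint_cst|exact: rint_emp].
Qed.

Let mean_limitE phi v : cb phi -> L1 n phi v @[n --> \oo] --> 0 -> mean_limit phi = v.
Proof. by move=> cphi h; apply: cvg_lim => //; exact: mean_cvg_L1. Qed.

Let L1_cvg phi : cb phi -> L1 n phi (mean_limit phi) @[n --> \oo] --> 0.
Proof. by move=> cphi; have [_ [v h]] := goodP cphi; rewrite (mean_limitE cphi h). Qed.

Let mean_cvg phi : cb phi -> \int[P n]_w emp n w phi @[n --> \oo] --> mean_limit phi.
Proof. by move=> cphi; apply: mean_cvg_L1 => //; exact: L1_cvg. Qed.

Lemma mean_limit_tight : tight_functional mean_limit.
Proof.
split; first split=> [g h cg ch|c g cg|g h cg ch gh|].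
- by apply: mean_limitE; [exact: cbD|apply: L1D => //; exact: L1_cvg].
- by apply: mean_limitE; [exact: cbZ|apply: L1Z => //; exact: L1_cvg].
- apply: (ler_cvg_to (mean_cvg cg) (mean_cvg ch)).
  apply: filterS n_gt0 => n n0; apply: RintegralT_le; [exact: rint_emp..|].
  by move=> w; exact: empirical_le.
- apply: mean_limitE; first exact: cb_cst.
  apply: (squeeze_cvgr _ (cvg_cst 0) (cvg_cst 0)); apply: filterS n_gt0 => n n0.
  rewrite L1_ge0 /L1 -[leRHS](RintegralT_cst (P n)).
  apply: RintegralT_le; [exact: rint_L1 (cb_cst _)|exact: rint_cst|move=> w].
  by rewrite empirical_cst ?subrr ?normr0//; exact: covmx_sym.
move=> e e0; pose M := 1 + 2 * K ^+ 2 / e.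
have K20 : 0 <= 2 * K ^+ 2 by apply: mulr_ge0 => //; exact: sqr_ge0.
have M1 : 1 <= M by rewrite lerDl; apply: divr_ge0 => //; exact: ltW.
exists M => //; apply: (cvgr_to_le (mean_cvg (cb_mass_out _))); first by lra.
apply: filterS (mass_out_le M1) => n /le_trans; apply.
rewrite ler_pdivrMr; last by lra.
rewrite /M mulrDr mulr1.
have -> : e * (2 * K ^+ 2 / e) = 2 * K ^+ 2 by field; rewrite gt_eqF.
by rewrite lerDr ltW.
Qed.

Local Notation N := (riesz_measure mean_limit_tight).

Lemma limit_law_stieltjes z : 0 < complex.Im z -> stieltjes N z = f z.
Proof.
move=> z0; have ck := ccb_stieltjes (lt0r_neq0 z0).
apply: complex_ext; rewrite /stieltjes /=.
  rewrite (riesz_representation _ (ccb_Re ck)).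
  exact: mean_limitE (ccb_Re ck) (Re_kernel_good z0).
rewrite (riesz_representation _ (ccb_Im ck)).
exact: mean_limitE (ccb_Im ck) (Im_kernel_good z0).
Qed.

(** Markov's inequality for the mean absolute deviation. *)
Lemma empirical_cvg_in_probability phi eps : cb phi -> 0 < eps ->
  P n [set w | eps <= `|emp n w phi - \int[N]_x phi x|] @[n --> \oo] --> 0%E.
Proof.
move=> cphi e0; rewrite (riesz_representation _ cphi); set v := mean_limit phi.
have h : (eps^-1 * L1 n phi v)%:E @[n --> \oo] --> 0%E.
  apply: cvg_EFin; first by near=> n.
  by rewrite -[X in _ --> X](mulr0 eps^-1); apply: cvgMl_tmp; exact: L1_cvg.
apply: (squeeze_cvge _ (cvg_cst 0%E) h).
apply: filterS n_gt0 => n n0; rewrite measure_ge0 /=.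
set A := [set w | _].
have mX : measurable_fun [set: T n] (fun w => `|emp n w phi - v|).
  by apply: measurableT_comp => //; apply: measurable_funB => //; exact: measurable_empirical.
have mA : measurable A.
  rewrite -[A]setTI (_ : A = (fun w => `|emp n w phi - v|) @^-1` `[eps, +oo[).
    exact: mX.
  by apply/seteqP; split => w; rewrite /A /= in_itv/= andbT.
rewrite -[P n A]fineK ?fin_num_measure// lee_fin.
have -> : fine (P n A) = \int[P n]_w \1_A w by rewrite /Rintegral integral_indic// setIT.
rewrite /L1 -RintegralZl//; last exact: rint_L1.
apply: RintegralT_le; [|by apply: rintZ; exact: rint_L1|].
  apply: (rint_bounded 1); first exact: measurable_indic.
  by move=> w; rewrite indicE; case: (_ \in _); rewrite ?normr1 ?normr0.
move=> w; rewrite indicE; have [wA|wA] := boolP (w \in A).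
  by rewrite ler_pdivlMl// mulr1; move: wA; rewrite inE.
by rewrite mulr_ge0// invr_ge0 ltW.
Unshelve. all: by end_near.
Qed.

End weak_limit.

(** * The limit equation *)

Section esd.
Variable R : realType.
Local Notation borelR := (measurableTypeR R).

Lemma esd_fin_num n (L : 'M[R]_n) : fin_num_fun (esd L).
Proof. by move=> A mA; rewrite esdE. Qed.

(** The same underlying measure as [esd L], bundled with its finiteness, so that the two integrals
    are convertible. *)
Definition finite_esd n (L : 'M[R]_n) : {finite_measure set borelR -> \bar R} :=
  let muL : {measure set borelR -> \bar R} := esd L in
  HB.pack_for {finite_measure set borelR -> \bar R} (Measure.sort muL)
    (Measure.class muL) (@Measure_isFinite.Build _ _ _ muL (esd_fin_num L)).

Lemma esd_integral n (L : 'M[R]_n) phi : bmeas phi ->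
  \int[esd L]_x phi x = empirical L phi.
Proof.
pose mu := finite_esd L.
change (bmeas phi -> \int[mu]_x phi x = empirical L phi).
pose M := Num.max (fine (mu [set: borelR])) (empirical L (fun=> 1)).
have M0 : 0 <= M by rewrite le_max fine_ge0.
have le0 (c : R) (g : R -> R) : (forall x, `|g x| <= c) -> 0 <= c by move=> h; apply: le_trans (h 0).
move: phi; apply: (@eq_bounded_functional R _ _ M M0).
- split=> [f g bf bg|c f bf|c f bf fc].
  + by rewrite RintegralD//; exact: (bmeas_rint mu).
  + by rewrite RintegralZl//; exact: (bmeas_rint mu).
  apply: (@le_trans _ _ (fine (mu [set: borelR]) * c)); last first.
    by apply: ler_wpM2r; [exact: le0 fc|rewrite le_max lexx].
  rewrite mulrC -(Rintegral_cst (mu))//.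
  apply: normr_RintegralT_le => //; first exact: (bmeas_rint mu).
  by apply: (bmeas_rint mu); exact: bmeas_cst.
- split=> [f g bf bg|c f bf|c f bf fc].
  + exact: empiricalD.
  + exact: empiricalZ.
  apply: (@le_trans _ _ (empirical L (fun=> 1) * c)); last first.
    by apply: ler_wpM2r; [exact: le0 fc|rewrite le_max lexx orbT].
  by rewrite mulrC -empiricalZ; apply: normr_empirical_le => x; rewrite mulr1.
move=> A mA; have -> : \int[mu]_x \1_A x = fine (esd L A).
  by rewrite /Rintegral integral_indic// setIT.
by rewrite esdE /empirical mulrC.
Qed.

End esd.

Section limit_equation.
Variable R : realType.
Local Notation C := R[i].
Local Notation borelR := (measurableTypeR R).
Variables (nu : {charge set borelR -> \bar R}).
Hypothesis nu_pos : forall phi : R -> R, cb phi -> cb (fun x => x * phi x) ->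
  (forall x, 0 <= phi x) -> 0 <= charge_integral nu (fun x => x * phi x).

Let bnu := charge_functional nu.

Lemma stieltjes_kernel_conj (z : C) (x : R) : stieltjes_kernel z^* x = (stieltjes_kernel z x)^*.
Proof.
rewrite /stieltjes_kernel fmorphV rmorphB; congr (_ - _)^-1.
by apply: complex_ext => //=; rewrite oppr0.
Qed.

Lemma stieltjes_conj (mu : {measure set borelR -> \bar R}) z : has_stieltjes mu ->
  complex.Im z != 0 -> stieltjes mu z^* = (stieltjes mu z)^*.
Proof.
move=> hmu z0; have [_ i2] := hmu z z0.
rewrite /stieltjes /Cintegral.
under eq_Rintegral do rewrite stieltjes_kernel_conj.
under [X in _ +i* X]eq_Rintegral do rewrite stieltjes_kernel_conj.
apply: complex_ext => /=; first by apply: eq_Rintegral => x _; case: (stieltjes_kernel _ _).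
rewrite -mulN1r -RintegralZl//; apply: eq_Rintegral => x _.
by case: (stieltjes_kernel _ _) => a b /=; rewrite mulN1r.
Qed.

Lemma clift_rkernel_conj a : 0 < complex.Im a ->
  clift (charge_integral nu) (rkernel a^*) = (clift (charge_integral nu) (rkernel a))^*.
Proof.
move=> a0; have E x : rkernel a^* x = (rkernel a x)^*.
  rewrite /rkernel fmorphV rmorphD rmorph1 rmorphM; congr (_ + _ * _)^-1.
  by apply: complex_ext => //=; rewrite oppr0.
rewrite /clift; apply: complex_ext => /=.
  by congr charge_integral; apply/funext => x; rewrite E; case: (rkernel a x).
rewrite -mulN1r -(bfunZ bnu); last by apply: cb_bmeas; apply: ccb_Im; exact: ccb_rkernel.
by congr charge_integral; apply/funext => x; rewrite E mulN1r; case: (rkernel a x).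
Qed.

(* A solution in the class of Stieltjes transforms has [Im f(z) > 0] on the upper half-plane:
   if [f(z)] were real, so would be the integral, forcing [f(z) = 0] and [0 = -1]. *)
Lemma limit_equation_Im_gt0 (mu : {measure set borelR -> \bar R}) z :
  limit_equation nu (stieltjes mu) -> 0 < complex.Im z -> 0 < complex.Im (stieltjes mu z).
Proof.
move=> eqn z0; have := eqn z (lt0r_neq0 z0); set a := stieltjes mu z => E.
rewrite lt_neqAle; apply/andP; split; last first.
  apply: Rintegral_ge0 => x _; case: (z) z0 => t s s0.
  by rewrite Im_stieltjes_kernel divr_ge0 ?addr_ge0 ?sqr_ge0// ltW.
apply/negP => /eqP /esym a0.
have ra : a = (complex.Re a)%:C by apply: complex_ext.
have Ir x : complex.Im ((1 + x%:C * a)^-1) = 0.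
  by rewrite ra Im_invc /= !mul0r mulr0 !addr0 oppr0 mul0r.
have I0 : complex.Im (charge_Cintegral nu (fun x => (1 + x%:C * a)^-1)) = 0.
  rewrite charge_CintegralE /clift/=.
  have -> : (fun x : R => complex.Im ((1 + x%:C * a)^-1)) = (fun x => 0 * 0).
    by apply/funext => x; rewrite Ir mul0r.
  by rewrite (bfunZ bnu 0 (bmeas_cst 0)) mul0r.
move: E I0; set q := charge_Cintegral _ _ => E I0.
move: (congr1 (@complex.Im R) E) (congr1 (@complex.Re R) E).
have Im1 (u : C) : complex.Im (-1 + u) = complex.Im u by case: u => p r /=; rewrite oppr0 add0r.
have Re1 (u : C) : complex.Re (-1 + u) = -1 + complex.Re u by case: u.
rewrite Im1 Re1 !Im_mulc !Re_mulc I0 a0 !(mulr0, mul0r) add0r addr0 !subr0 => /eqP.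
rewrite mulf_eq0 gt_eqF//= => /eqP ->; rewrite mulr0 mul0r addr0 => /eqP.
by rewrite eq_sym oppr_eq0 oner_eq0.
Qed.

(** Since [nu] is real, the equation is invariant under conjugation; the lower half-plane reduces to
    the upper one. *)
Lemma solution_conj (f : C -> C) z : 0 < complex.Im (f z^*) -> f z = (f z^*)^* ->
  z^* * f z^* = -1 + f z^* * clift (charge_integral nu) (rkernel (f z^*)) ->
  z * f z = -1 + f z * clift (charge_integral nu) (rkernel (f z)).
Proof.
move=> I0 fz E; rewrite fz clift_rkernel_conj//.
have := congr1 (fun u : C => u^*) E; rewrite !rmorphD !rmorphM/= conjcK => ->.
by congr (_ + _); apply: complex_ext => //=; rewrite !oppr0.
Qed.

Lemma limit_equation_unique (mu1 mu2 : {measure set borelR -> \bar R}) :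
  has_stieltjes mu1 -> has_stieltjes mu2 ->
  limit_equation nu (stieltjes mu1) -> limit_equation nu (stieltjes mu2) ->
  forall z, complex.Im z != 0 -> stieltjes mu1 z = stieltjes mu2 z.
Proof.
move=> h1 h2 e1 e2; have pos z : 0 < complex.Im z -> stieltjes mu1 z = stieltjes mu2 z.
  move=> z0; apply: (solution_unique bnu nu_pos z0).
  - exact: limit_equation_Im_gt0.
  - exact: limit_equation_Im_gt0.
  - exact: (e1 z (lt0r_neq0 z0)).
  - exact: (e2 z (lt0r_neq0 z0)).
move=> z z0; have [zn|zp|z00] := ltgtP (complex.Im z) 0.
- have c0 : 0 < complex.Im z^* by case: (z) zn => a b /=; rewrite oppr_gt0.
  rewrite -(conjcK z) (stieltjes_conj h1 (lt0r_neq0 c0)) (stieltjes_conj h2 (lt0r_neq0 c0)).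
  by rewrite pos.
- exact: pos.
- by rewrite z00 eqxx in z0.
Qed.

Lemma probability_has_stieltjes (N : probability borelR R) : has_stieltjes N.
Proof.
move=> z z0; have ck := ccb_stieltjes z0.
by split; apply: bmeas_rint; apply: cb_bmeas; [exact: ccb_Re ck|exact: ccb_Im ck].
Qed.

Lemma limit_equation_upper (N : probability borelR R) :
  (forall z, 0 < complex.Im z -> 0 < complex.Im (stieltjes N z) /\
    z * stieltjes N z = -1 + stieltjes N z * clift (charge_integral nu) (rkernel (stieltjes N z))) ->
  limit_equation nu (stieltjes N).
Proof.
move=> h z z0; have [zn|zp|z00] := ltgtP (complex.Im z) 0.
- have c0 : 0 < complex.Im z^* by case: (z) zn => a b /=; rewrite oppr_gt0.
  have [I0 E] := h _ c0; apply: solution_conj => //.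
  by rewrite -{1}(conjcK z) (stieltjes_conj (probability_has_stieltjes N) (lt0r_neq0 c0)).
- by have [_] := h _ zp.
- by rewrite z00 eqxx in z0.
Qed.

End limit_equation.

(** * From the hypotheses to the uniform bounds *)

Section operator_norm.
Variable R : realType.

Lemma hsnorm_fnorm n (D : 'M[R]_n) : hsnorm D = fnorm (toCmx D).
Proof.
congr Num.sqrt; apply: eq_bigr => i _; apply: eq_bigr => j _.
by rewrite mxE normc_real real_normK ?num_real.
Qed.

Lemma enorm_ge0 n (u : 'cV[R]_n) : 0 <= enorm u. Proof. exact: sqrtr_ge0. Qed.

Lemma enormZ n k (u : 'cV[R]_n) : enorm (k *: u) = `|k| * enorm u.
Proof.
by rewrite -!fnorm_toC -normc_real -fnormZ; congr fnorm; rewrite map_mxZ.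
Qed.

Lemma enorm0 n : enorm (0 : 'cV[R]_n) = 0.
Proof. by rewrite -(scale0r 0) enormZ normr0 mul0r. Qed.

(** Cauchy-Schwarz in each row. It shows that the set under the supremum in [opnorm] is bounded, so
    that this supremum is meaningful. *)
Lemma enorm_hsnorm n (D : 'M[R]_n) u : enorm (D *m u) <= hsnorm D * enorm u.
Proof.
rewrite hsnorm_fnorm -!fnorm_toC map_mxM /fnorm -sqrtrM ?fsq_ge0//.
apply: ler_wsqrtr; rewrite /fsq mulr_suml; apply: ler_sum => i _.
rewrite big_ord1 mxE; apply: (@le_trans _ _ ((\sum_j nc (toCmx D i j) * nc (toCmx u j 0)) ^+ 2)).
  apply: lerXn2r; rewrite ?nnegrE ?normc_ge0//.
    by apply: sumr_ge0 => j _; rewrite mulr_ge0 ?normc_ge0.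
  by apply: le_trans (normc_sum _ _ _) _; apply: ler_sum => j _; rewrite normcM.
have -> : \sum_i \sum_j nc (toCmx u i j) ^+ 2 = \sum_i nc (toCmx u i 0) ^+ 2.
  by apply: eq_bigr => j _; rewrite big_ord1.
set A := \sum_j nc (toCmx D i j) ^+ 2; set B := \sum_i nc (toCmx u i 0) ^+ 2.
have A0 : 0 <= A by apply: sumr_ge0 => j _; exact: sqr_ge0.
have B0 : 0 <= B by apply: sumr_ge0 => j _; exact: sqr_ge0.
rewrite -(sqr_sqrtr A0) -(sqr_sqrtr B0) -exprMn; apply: lerXn2r; rewrite ?nnegrE.
- by apply: sumr_ge0 => j _; rewrite mulr_ge0 ?normc_ge0.
- by rewrite mulr_ge0 ?sqrtr_ge0.
exact: CauchySchwarz_sum.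
Qed.

Let unit_images n (D : 'M[R]_n) :=
  [set enorm (D *m u) | u in [set u : 'cV[R]_n | enorm u <= 1]].

Let has_sup_unit_images n (D : 'M[R]_n) : has_sup (unit_images D).
Proof.
split; first by exists (enorm (D *m 0)), 0; rewrite //= enorm0.
exists (hsnorm D) => _ [u /= u1 <-]; apply: le_trans (enorm_hsnorm _ _) _.
by rewrite ler_piMr// hsnorm_fnorm fnorm_ge0.
Qed.

Lemma opnorm_ge0 n (D : 'M[R]_n) : 0 <= opnorm D.
Proof.
apply: le_trans (enorm_ge0 (D *m 0)) _; apply: ub_le_sup; first by case: (has_sup_unit_images D).
by exists 0; rewrite //= enorm0.
Qed.

Lemma enorm_eq0 n (u : 'cV[R]_n) : enorm u = 0 -> u = 0.
Proof.
rewrite /enorm => /eqP; rewrite sqrtr_eq0 => h; apply/colP => i; rewrite mxE.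
have s0 j : 0 <= u j 0 * u j 0 by rewrite -expr2 sqr_ge0.
have : u i 0 * u i 0 <= 0.
  by apply: le_trans h; rewrite /edot (bigD1 i)//= lerDl sumr_ge0.
by rewrite -expr2 => h'; apply/eqP; rewrite -sqrf_eq0 eq_le h' sqr_ge0.
Qed.

Lemma enorm_opnorm n (D : 'M[R]_n) u : enorm (D *m u) <= opnorm D * enorm u.
Proof.
have [u0|u0] := eqVneq (enorm u) 0.
  by rewrite (enorm_eq0 u0) mulmx0 !enorm0 mulr0.
have up : 0 < enorm u by rewrite lt_neqAle eq_sym u0 enorm_ge0.
rewrite -ler_pdivrMr// mulrC -[(enorm u)^-1]ger0_norm ?invr_ge0 ?enorm_ge0// -enormZ scalemxAr.
apply: ub_le_sup; first by case: (has_sup_unit_images D).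
exists ((enorm u)^-1 *: u) => //=.
by rewrite enormZ ger0_norm ?invr_ge0 ?enorm_ge0// mulVf.
Qed.

Lemma opbound_opnorm n (D : 'M[R]_n) : opbound (toCmx D) (opnorm D).
Proof. by apply: opbound_real; [exact: opnorm_ge0|exact: enorm_opnorm]. Qed.

Lemma opnorm_le n (D : 'M[R]_n) c : 0 <= c -> opbound (toCmx D) c -> opnorm D <= c.
Proof.
move=> c0 Dc; apply: sup_le_ub; first by case: (has_sup_unit_images D).
move=> _ [u /= u1 <-]; apply: le_trans (real_opbound u Dc) _.
by rewrite ler_piMr.
Qed.

Lemma opnorm_eq0 n (D : 'M[R]_n) : opnorm D = 0 -> D = 0.
Proof.
move=> D0; apply/matrixP => i j; rewrite mxE.
have := opbound_entry i j (opbound_opnorm D).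
by rewrite D0 mxE normc_real normr_le0 => /eqP.
Qed.

Lemma opnorm_normalize n (D : 'M[R]_n) : 0 < opnorm D -> opnorm ((opnorm D)^-1 *: D) = 1.
Proof.
move=> D0; apply/eqP; rewrite eq_le; apply/andP; split.
  apply: opnorm_le => //; rewrite map_mxZ -(mulVf (lt0r_neq0 D0)).
  rewrite -[X in X * _]ger0_norm ?invr_ge0 ?ltW// -normc_real.
  exact: opboundZ (opbound_opnorm D).
rewrite -(ler_pM2l D0) mulr1; apply: opnorm_le.
  by rewrite mulr_ge0 ?opnorm_ge0// ltW.
have -> : toCmx D = (opnorm D)%:C *: toCmx ((opnorm D)^-1 *: D).
  by rewrite -map_mxZ scalerA mulfV ?scale1r// gt_eqF.
rewrite -[X in opbound _ (X * _)]gtr0_norm// -normc_real.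
exact: opboundZ (opbound_opnorm _).
Qed.

Lemma opnorm1 n : (0 < n)%N -> opnorm (1%:M : 'M[R]_n) = 1.
Proof.
move=> n0; have D0 : 0 < opnorm (1%:M : 'M[R]_n).
  rewrite lt_neqAle opnorm_ge0 andbT eq_sym; apply/eqP => /opnorm_eq0 /matrixP.
  move=> /(_ (Ordinal n0) (Ordinal n0)); rewrite !mxE eqxx => /eqP.
  by rewrite oner_eq0.
apply/eqP; rewrite eq_le; apply/andP; split.
  by apply: opnorm_le => //; rewrite map_mx1; exact: opbound1.
have := enorm_opnorm (1%:M : 'M[R]_n) (delta_mx (Ordinal n0) 0).
rewrite mul1mx -ler_pdivrMr ?mulfV//.
  rewrite -fnorm_toC map_delta_mx fnorm_delta; exact: oner_neq0.
by rewrite -fnorm_toC map_delta_mx fnorm_delta.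
Qed.

End operator_norm.

Section law_invariance.
Context d (T : measurableType d) (R : realType) (P : probability T R).
Local Notation borelR := (measurableTypeR R).
Variable sg : cumulativeBounded (0 : R) (1 : R).

Lemma Rintegral_law (X : {RV P >-> R}) (phi : R -> R) :
  (forall r, cdf X r = (sg r)%:E) -> measurable_fun [set: borelR] phi ->
  \int[P]_w phi (X w) = \int[lebesgue_stieltjes_measure sg]_x phi x.
Proof.
move=> hX mphi; rewrite /Rintegral; congr fine.
rewrite integralE [RHS]integralE; congr (_ - _)%E.
  rewrite (ge0_stieltjes_integral hX) => [||x]; [|by apply: measurable_funepos; exact/measurable_EFinP|by []].
  by apply: eq_integral => w _; rewrite !funeposE.
rewrite (ge0_stieltjes_integral hX) => [||x]; [|by apply: measurable_funeneg; exact/measurable_EFinP|by []].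
by apply: eq_integral => w _; rewrite !funenegE.
Qed.

End law_invariance.

Section regularity.
Context (R : realType) d (T : measurableType d) (P : probability T R) (n m : nat).
Variables (xi : 'I_m -> {RV P >-> R}) (y : 'I_m -> 'I_n -> {RV P >-> R}).
Variables (sg : cumulativeBounded (0 : R) (1 : R)).
Variable nu : {charge set (measurableTypeR R) -> \bar R}.
Variables (Q : 'I_m -> 'M[R]_n) (B : 'M[R]_n) (K rho : R).
Local Notation C := R[i].
Local Notation borelR := (measurableTypeR R).
Local Notation mu := (lebesgue_stieltjes_measure sg).
Hypotheses (n0 : (0 < n)%N) (m0 : (0 < m)%N).
Hypothesis ind : mutually_independent P (entry_sigma xi y).
Hypothesis cdfX : forall a r, cdf (xi a) r = (sg r)%:E.
Hypothesis nuE : forall A : set borelR, measurable A -> bounded_set (A : set R) ->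
  (nu A = (m%:R / n%:R)%:E * \int[mu]_(x in A) x%:E)%E.
Hypothesis K10 : 10 <= K.
Hypothesis mom2 : ((m%:R / n%:R)%:E * \int[mu]_x (`|x| ^+ 2)%:E <= K%:E)%E.
Hypothesis mom1 : `|charge_integral nu (fun=> 1)| <= K.
Hypotheses (rho0 : 0 < rho) (rho1 : rho <= 1) (rhon : 1 <= rho ^+ 2 * n%:R).
Hypothesis y2 : forall a i, (y a i : T -> R) \in Lfun P 2%:E.
Hypothesis Qmom : forall a, Q a = second_moment_mx (y a).
Hypothesis Qop : forall a, opnorm (Q a) <= K / n%:R.
Hypothesis Qtr : forall a, `|\tr (Q a) - 1| <= rho.
Hypothesis varD : forall (a : 'I_m) (D : 'M[R]_n), opnorm D = 1 ->
  ('V_P[fun w => edot (D *m rvec (y a) w) (rvec (y a) w)] <= (rho ^+ 2)%:E)%E.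
Hypothesis Bhs : Num.sqrt n%:R * hsnorm B <= rho.
Hypothesis avg : m%:R^-1 *: \sum_(a < m) Q a = n%:R^-1 *: 1%:M + B.

Let n0R : 0 < n%:R :> R. Proof. by rewrite ltr0n. Qed.
Let m0R : 0 < m%:R :> R. Proof. by rewrite ltr0n. Qed.
Let mn0 : 0 < m%:R / n%:R :> R. Proof. exact: divr_gt0. Qed.

Lemma xi_square_rint a : rint P (fun w => xi a w ^+ 2).
Proof.
apply/integrableP; split.
  by apply/measurable_EFinP; apply: measurable_funX; exact: measurable_funPT.
have -> : (\int[P]_w `|(xi a w ^+ 2)%:E| = \int[mu]_x (`|x| ^+ 2)%:E)%E.
  rewrite (ge0_stieltjes_integral (cdfX a)); last 2 first.
  - apply/measurable_EFinP; apply: measurable_funX; exact: normr_measurable.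
  - by move=> x; rewrite lee_fin sqr_ge0.
  by apply: eq_integral => w _ /=; rewrite normrX.
rewrite ltNge; apply/negP; rewrite leye_eq => /eqP h; move: mom2.
by rewrite h gt0_muley ?lte_fin// leye_eq.
Qed.

(** The mean is the total mass of [nu] up to the factor [m / n], so the bound comes from testing
    [nu] against 1. *)
Lemma xi_mean_bound a : m%:R * `|\int[P]_w xi a w| <= K * n%:R.
Proof.
have := charge_integral_mean (cdfX a) (xi_square_rint a) (ltW mn0) nuE (bmeas_cst 1).
under eq_Rintegral do rewrite mulr1; move=> E; move: mom1; rewrite E normrM (gtr0_norm mn0).
by rewrite -mulrA mulrCA ler_pdivrMl// mulrC [n%:R * _]mulrC.
Qed.

Lemma xi_square_bound a : m%:R * \int[P]_w (xi a w ^+ 2) <= K * n%:R.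
Proof.
have i2 := xi_square_rint a; move: mom2.
have -> : (\int[mu]_x (`|x| ^+ 2)%:E = (\int[P]_w (xi a w ^+ 2))%:E)%E.
  rewrite (ge0_stieltjes_integral (cdfX a)); last 2 first.
  - apply/measurable_EFinP; apply: measurable_funX; exact: normr_measurable.
  - by move=> x; rewrite lee_fin sqr_ge0.
  rewrite /Rintegral fineK; last exact: integrable_fin_num.
  by apply: eq_integral => w _ /=; rewrite real_normK ?num_real.
by rewrite -EFinM lee_fin -mulrA mulrCA ler_pdivrMl// mulrC [n%:R * _]mulrC.
Qed.

Lemma y_prod_rint a i j : rint P (fun w => y a i w * y a j w).
Proof.
have i1 := Lfun2_integrable_sqr (y2 a i); have i2 := Lfun2_integrable_sqr (y2 a j).
apply: (rint_le (fun w => y a i w ^+ 2 + y a j w ^+ 2)) => [|w|].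
- by apply: measurable_funM; exact: measurable_funPT.
- move: (y a i w) (y a j w) => u v; have := sqr_ge0 (u + v); have := sqr_ge0 (u - v).
  by rewrite ler_norml => h1 h2; apply/andP; split; nra.
- exact: rintD.
Qed.

Lemma second_moment a i j : \int[P]_w (y a i w * y a j w) = Q a i j.
Proof. by rewrite Qmom mxE unlock. Qed.

Definition qform (D : 'M[R]_n) a w : R := edot (D *m rvec (y a) w) (rvec (y a) w).

Lemma qformE D a w : qform D a w = \sum_i \sum_j D i j * (y a j w * y a i w).
Proof.
apply: eq_bigr => i _; rewrite !mxE mulr_suml; apply: eq_bigr => j _.
by rewrite !mxE mulrA.
Qed.

Lemma qform_rint D a : rint P (qform D a).
Proof.
rewrite (_ : qform D a = fun w => \sum_i \sum_j D i j * (y a j w * y a i w)).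
  by apply: rint_sum => i; apply: rint_sum => j; apply: rintZ; exact: y_prod_rint.
by apply/funext => w; exact: qformE.
Qed.

Lemma qform_mean D a : \int[P]_w qform D a w = \tr (D *m Q a).
Proof.
under eq_Rintegral do rewrite qformE.
have i1 i j : rint P (fun w => D i j * (y a j w * y a i w)) by apply: rintZ; exact: y_prod_rint.
rewrite RintegralT_sum; last by move=> i; apply: rint_sum => j; exact: i1.
apply: eq_bigr => i _; rewrite mxE RintegralT_sum//; apply: eq_bigr => j _.
by rewrite RintegralZl ?second_moment//; exact: y_prod_rint.
Qed.

Lemma qform_variance D a : opnorm D = 1 ->
  rint P (fun w => (qform D a w - \tr (D *m Q a)) ^+ 2) /\
  \int[P]_w ((qform D a w - \tr (D *m Q a)) ^+ 2) <= rho ^+ 2.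
Proof.
move=> D1; have := varD a D1; rewrite /variance unlock /= unlock.
have -> : fine (\int[P]_w (qform D a w)%:E) = \tr (D *m Q a) by exact: qform_mean.
have mq : measurable_fun [set: T] (fun w => (qform D a w - \tr (D *m Q a)) ^+ 2).
  by apply: measurable_funX; apply: measurable_funB => //; exact: rint_meas (qform_rint D a).
move=> h; have i2 : rint P (fun w => (qform D a w - \tr (D *m Q a)) ^+ 2).
  apply/integrableP; split; first exact/measurable_EFinP.
  apply: le_lt_trans (ltry (rho ^+ 2)); apply: le_trans h.
  rewrite le_eqVlt; apply/orP; left; apply/eqP; apply: eq_integral => w _ /=.
  by rewrite ger0_norm ?sqr_ge0// expr2.
split=> //; rewrite -lee_fin; apply: le_trans h.
rewrite /Rintegral fineK; last exact: integrable_fin_num.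
by rewrite le_eqVlt; apply/orP; left; apply/eqP; apply: eq_integral => w _ /=; rewrite expr2.
Qed.

Lemma ysq_qform a w : ysq y a w = qform 1%:M a w.
Proof. by rewrite /ysq /qform mul1mx -fnorm_sqr fnorm_toC sqr_sqrtr// /edot sumr_ge0// => i _; rewrite -expr2 sqr_ge0. Qed.

(** [|y|^2] is the quadratic form of the identity, with mean [t = Tr Q_a <= 2] and variance at most
    1. From [q^2 <= 2 (q - t)^2 + 2 t^2] comes the bound 10, the origin of the lower bound imposed
    on [K]. *)
Lemma ysq_moments a : rint P (fun w => ysq y a w ^+ 2) /\ \int[P]_w (ysq y a w ^+ 2) <= K.
Proof.
have [i1 h1] := qform_variance a (opnorm1 R n0).
set t := \tr (1%:M *m Q a) in i1 h1.
have t2 : t ^+ 2 <= 4.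
  have := Qtr a; rewrite /t mul1mx ler_norml => /andP[h2 h3]; move: rho1 h2 h3; nra.
have i2 : rint P (fun w => 2 * (qform 1%:M a w - t) ^+ 2 + 2 * t ^+ 2).
  by apply: rintD; [exact: rintZ|exact: rint_cst].
have le w : ysq y a w ^+ 2 <= 2 * (qform 1%:M a w - t) ^+ 2 + 2 * t ^+ 2.
  by rewrite ysq_qform; have := sqr_ge0 (qform 1%:M a w - 2 * t); move: (qform _ _ _) => q; nra.
have i3 : rint P (fun w => ysq y a w ^+ 2).
  apply: (rint_le _ _ _ i2) => [|w]; first by apply: measurable_funX; exact: measurable_ysq.
  by rewrite ger0_norm ?sqr_ge0.
split=> //; apply: le_trans (RintegralT_le i3 i2 le) _.
rewrite RintegralD//; [|exact: rintZ|exact: rint_cst].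
rewrite RintegralT_cst RintegralZl//.
have r1 : rho ^+ 2 <= 1 by rewrite expr_le1// ltW.
by move: h1 t2 r1 K10; lra.
Qed.

(** Quadratic homogeneity reduces to norm one; a matrix of norm 0 is treated apart, as it cannot be
    normalized. *)
Lemma qform_variance_general a (D : 'M[R]_n) c : 0 <= c -> opbound (toCmx D) c ->
  \int[P]_w ((qform D a w - \tr (D *m Q a)) ^+ 2) <= rho ^+ 2 * c ^+ 2.
Proof.
move=> c0 Dc; have kc := opnorm_le c0 Dc.
have [k0|k0] := eqVneq (opnorm D) 0.
  have -> : (fun w => (qform D a w - \tr (D *m Q a)) ^+ 2) = fun=> 0.
    apply/funext => w; rewrite qformE (opnorm_eq0 k0) mul0mx mxtrace0 subr0.
    by rewrite big1 ?expr0n// => i _; rewrite big1// => j _; rewrite mxE mul0r.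
  by rewrite RintegralT_cst mulr_ge0 ?sqr_ge0.
have kp : 0 < opnorm D by rewrite lt_neqAle eq_sym k0 opnorm_ge0.
have [i1 h1] := qform_variance a (opnorm_normalize kp).
set k := opnorm D in k0 kp kc i1 h1 *; set E := k^-1 *: D in i1 h1.
have DE : D = k *: E by rewrite /E scalerA mulfV// scale1r.
clearbody E.
have -> : (fun w => (qform D a w - \tr (D *m Q a)) ^+ 2) =
    fun w => k ^+ 2 * (qform E a w - \tr (E *m Q a)) ^+ 2.
  apply/funext => w; rewrite -exprMn mulrBr [in LHS]DE -scalemxAl mxtraceZ; congr ((_ - _) ^+ 2).
  rewrite !qformE mulr_sumr; apply: eq_bigr => i _; rewrite mulr_sumr.
  by apply: eq_bigr => j _; rewrite [(k *: E) i j]mxE -mulrA.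
rewrite RintegralZl// mulrC; apply: ler_pM; rewrite ?sqr_ge0//.
  by apply: Rintegral_ge0 => w _; exact: sqr_ge0.
by apply: lerXn2r; rewrite // nnegrE ltW.
Qed.

Lemma regular_of_bounds : regular xi y Q B K rho.
Proof.
split => //.
- by move: K10; lra.
- move=> a b g.
  have mg : cmeas (fun x : borelR => (x : R)%:C * (1 + (x : R)%:C * g)^-1).
    have mi : cmeas (fun x : borelR => (x : R)%:C) by apply: cmeas_real; exact: measurable_id.
    apply: cmeasM => //; apply: cmeasV; apply: cmeasD; first exact: cmeas_cst.
    by apply: cmeasM => //; exact: cmeas_cst.
  have [mR mI] := mg; apply: complex_ext => /=.
    by rewrite !(Rintegral_law (cdfX _) mR).
  by rewrite !(Rintegral_law (cdfX _) mI).
- exact: xi_square_rint.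
- exact: xi_square_bound.
- exact: xi_mean_bound.
- by move=> a; case: (ysq_moments a).
- by move=> a; case: (ysq_moments a).
- move=> a x; apply: le_trans (opbound_opnorm (Q a) x) _.
  by rewrite ler_wpM2r ?fnorm_ge0.
- exact: second_moment.
- by move=> a D c c0 Dc; exact: qform_variance_general.
- by rewrite -hsnorm_fnorm.
Qed.

End regularity.

Section assembly.
Context (R : realType) (d : nat -> measure_display) (T : forall n, measurableType (d n)).
Variables (P : forall n, probability (T n) R) (m : nat -> nat).
Variables (xi : forall n, 'I_(m n) -> {RV (P n) >-> R}).
Variables (y : forall n, 'I_(m n) -> 'I_n -> {RV (P n) >-> R}).
Variables (sigma : nat -> cumulativeBounded (0 : R) (1 : R)).
Variables (sigmat : nat -> {charge set (measurableTypeR R) -> \bar R}).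
Variable sigmat_lim : {charge set (measurableTypeR R) -> \bar R}.
Local Notation C := R[i].

Let quad_var n (a : 'I_(m n)) (D : 'M[R]_n) : \bar R :=
  ('V_(P n)[fun w => edot (D *m rvec (@y n a) w) (rvec (@y n a) w)])%E.

(* Assumption 1 is uniform over [D]: otherwise choose a bad [D_n] for every [n]. *)
Lemma assumption1_uniform : assumption1 y ->
  exists2 v : nat -> R, v n @[n --> \oo] --> 0 & \forall n \near \oo, 0 <= v n /\
    forall (a : 'I_(m n)) (D : 'M[R]_n), opnorm D = 1 -> (quad_var a D <= (v n)%:E)%E.
Proof.
move=> A1; pose q n D : \bar R := \big[maxe/0%E]_(a < m n) quad_var a D.
have unif e : 0 < e -> \forall n \near \oo, forall D : 'M[R]_n, opnorm D = 1 -> (q n D <= e%:E)%E.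
  move=> e0.
  pose bad n (D : 'M[R]_n) := opnorm D = 1 /\ ~ (q n D <= e%:E)%E.
  have [D hD] : exists D : forall n, 'M[R]_n, forall n,
      ((exists E, bad n E) -> bad n (D n)) /\ ((0 < n)%N -> opnorm (D n) = 1).
    have hex n : exists D : 'M[R]_n, ((exists E, bad n E) -> bad n D) /\
        ((0 < n)%N -> opnorm D = 1).
      have [[E hE]|h] := pselect (exists E, bad n E).
        by exists E; split=> // _; case: hE.
      by exists 1%:M; split=> [//|n0]; exact: (opnorm1 R n0).
    by exists (fun n => sval (cid (hex n))) => n; exact: (svalP (cid (hex n))).
  have := A1 D (fun n => (hD n).2).
  move=> /fine_cvgP[fin /cvgrPdist_lt /(_ _ e0) small].
  apply: filterS2 fin small => n /= fin small E E1.
  apply: contrapT => bE; have [_] := (hD n).1 (ex_intro _ E (conj E1 bE)).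
  apply; rewrite -[q n _]fineK// lee_fin; move: small; rewrite sub0r normrN.
  by move=> /ltW; apply: le_trans; exact: ler_norm.
pose s n := ereal_sup [set q n D | D in [set D : 'M[R]_n | opnorm D = 1]].
have q0 n D : (0 <= q n D)%E by exact: bigmax_ge_id.
have s_le e : 0 < e -> \forall n \near \oo, (0 <= s n <= e%:E)%E.
  move=> e0; have n1 : \forall n \near \oo, (0 < n)%N by exists 1%N.
  apply: filterS2 n1 (unif e e0) => n n0 h; apply/andP; split.
    apply: le_trans (q0 n 1%:M) _; apply: ereal_sup_ubound.
    by exists 1%:M => //; exact: (opnorm1 R n0).
  by apply: ge_ereal_sup => _ [D D1 <-]; exact: h.
have sfin n e : (0 <= s n <= e%:E)%E -> s n \is a fin_num.
  by move=> /andP[h1 h2]; rewrite ge0_fin_numE//; exact: le_lt_trans (ltry e).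
exists (fun n => fine (s n)).
  apply/cvgrPdist_le => e e0; apply: filterS (s_le e e0) => n h.
  have f := sfin _ _ h; move/andP: h => [h1 h2].
  by rewrite sub0r normrN ger0_norm ?fine_ge0// -lee_fin fineK.
apply: filterS (s_le 1 ltr01) => n h; have f := sfin _ _ h; move/andP: h => [h1 h2].
split; first exact: fine_ge0.
move=> a D D1; rewrite fineK//; apply: (@le_trans _ _ (q n D)).
  exact: (le_bigmax _ (fun a => quad_var a D)).
by apply: ereal_sup_ubound; exists D.
Qed.

Section moments.
Hypothesis A2 : assumption2 xi sigma sigmat sigmat_lim.

Lemma second_moment_bound : exists K : R, forall n, (0 < n)%N ->
  (((m n)%:R / n%:R)%:E *
     \int[lebesgue_stieltjes_measure (sigma n)]_x (`|x| ^+ 2)%:E <= K%:E)%E.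
Proof.
have [_ _ _ /(_ 1%N isT)] := A2; set s := ereal_sup _ => slt.
exists (fine s) => n n0; apply: (@le_trans _ _ s).
  by apply: ereal_sup_ubound; exists n.
by move: slt; case: {+}s => [r| |] //=; rewrite ?ltxx ?leNye.
Qed.

(** Weak convergence tested against the constant 1. *)
Lemma first_moment_bound : exists K : R, \forall n \near \oo,
  `|charge_integral (sigmat n) (fun=> 1)| <= K.
Proof.
have [_ _ w _] := A2; have c1 := cb_cst (1 : R).
have /cvgrPdist_lt /(_ _ ltr01) h := w _ c1.1 (cb_bounded c1).
exists (`|charge_integral sigmat_lim (fun=> 1)| + 1); apply: filterS h => n h.
rewrite -[X in `|X|](subrK (charge_integral sigmat_lim (fun=> 1))) addrC.
by apply: le_trans (ler_normD _ _) _; rewrite lerD2l distrC ltW.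
Qed.

End moments.
End assembly.

Section assembly.
Context (R : realType) (d : nat -> measure_display) (T : forall n, measurableType (d n)).
Variables (P : forall n, probability (T n) R) (m : nat -> nat).
Variables (xi : forall n, 'I_(m n) -> {RV (P n) >-> R}).
Variables (y : forall n, 'I_(m n) -> 'I_n -> {RV (P n) >-> R}).
Variables (sigma : nat -> cumulativeBounded (0 : R) (1 : R)).
Variables (sigmat : nat -> {charge set (measurableTypeR R) -> \bar R}).
Variable sigmat_lim : {charge set (measurableTypeR R) -> \bar R}.
Variables (Q : forall n, 'I_(m n) -> 'M[R]_n) (B : forall n, 'M[R]_n).
Local Notation C := R[i].
Local Notation borelR := (measurableTypeR R).
Hypothesis m_infty : m @ \oo --> \oo.
Hypothesis ind : forall n, (0 < n)%N -> jointly_independent xi y n.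
Hypothesis A1 : assumption1 y.
Hypothesis A2 : assumption2 xi sigma sigmat sigmat_lim.
Hypothesis y2 : forall n (a : 'I_(m n)) (i : 'I_n), (@y n a i : T n -> R) \in Lfun (P n) 2%:E.
Hypothesis Qmom : forall n (a : 'I_(m n)), @Q n a = second_moment_mx (@y n a).
Hypothesis Qop : (fun n => \big[Order.max/0]_(a < m n) opnorm (@Q n a))
  =O_\oo (fun n => n%:R^-1 : R).
Hypothesis Qtr : \big[Order.max/0]_(a < m n) `|\tr (@Q n a) - 1| @[n --> \oo] --> (0 : R).
Hypothesis avg : forall n, (0 < n)%N ->
  (m n)%:R^-1 *: \sum_(a < m n) @Q n a = n%:R^-1 *: 1%:M + B n.
Hypothesis Bhs : (fun n => hsnorm (B n)) =o_\oo (fun n => (Num.sqrt n%:R)^-1 : R).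

Lemma Qop_bound : exists K : R, \forall n \near \oo,
  forall a : 'I_(m n), opnorm (@Q n a) <= K / n%:R.
Proof.
have /eqO_exP [K [_ h]] := Qop; exists K; apply: filterS h => n h a.
apply: le_trans (le_bigmax _ (fun a => opnorm (@Q n a)) a) _.
by apply: le_trans (ler_norm _) _; apply: le_trans h _; rewrite ger0_norm ?invr_ge0.
Qed.

Lemma Bhs_cvg : Num.sqrt n%:R * hsnorm (B n) @[n --> \oo] --> (0 : R).
Proof.
have /eqoP h := Bhs; apply/cvgrPdist_le => e e0; have := h _ e0.
have n1 : \forall n \near \oo, (0 < n)%N by exists 1%N.
apply: filterS2 n1 => n n0 hn; rewrite sub0r normrN.
have s0 : 0 < Num.sqrt n%:R :> R by rewrite sqrtr_gt0 ltr0n.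
rewrite normrM (gtr0_norm s0) -ler_pdivlMl//; apply: le_trans hn _.
by rewrite gtr0_norm ?invr_gt0// mulrC.
Qed.

Lemma eventually_regular : exists (K : R) (rho : nat -> R), [/\ 10 <= K,
  rho n @[n --> \oo] --> 0 &
  \forall n \near \oo, regular (@xi n) (@y n) (@Q n) (B n) K (rho n)].
Proof.
have [v v0 hv] := assumption1_uniform A1.
have [K1 hK1] := first_moment_bound A2; have [K2 hK2] := second_moment_bound A2.
have [K3 hK3] := Qop_bound.
pose K := Num.max 10 (Num.max K1 (Num.max K2 K3)).
have K10 : 10 <= K by rewrite le_max lexx.
have KK1 : K1 <= K by rewrite !le_max lexx !orbT.
have KK2 : K2 <= K by rewrite !le_max lexx !orbT.
have KK3 : K3 <= K by rewrite !le_max lexx !orbT.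
pose t n := \big[Order.max/0]_(a < m n) `|\tr (@Q n a) - 1|.
pose b n := Num.sqrt n%:R * hsnorm (B n).
have t_ge0 n : 0 <= t n by exact: bigmax_ge_id.
have b_ge0 n : 0 <= b n by rewrite mulr_ge0 ?sqrtr_ge0.
pose r n : R := Num.sqrt n%:R^-1.
(* A sum of nonnegative null sequences dominates each of them. The term [r n = n^(-1/2)] secures
   positivity and [1 <= rho^2 n]; the square root of [v n] appears because variances are compared
   with [rho^2]. *)
pose rho n := r n + (Num.sqrt (v n) + (t n + b n)).
have sqrt0 (u : nat -> R) : u n @[n --> \oo] --> 0 -> Num.sqrt (u n) @[n --> \oo] --> 0.
  move=> u0; rewrite -(@sqrtr0 R); apply: (@continuous_cvg _ _ _ _ _ _ (fun x : R => Num.sqrt x)).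
    exact: sqrt_continuous.
  exact: u0.
have rho_cvg : rho n @[n --> \oo] --> 0.
  rewrite -[X in _ --> X]addr0; apply: cvgD.
    by apply: sqrt0; rewrite -(cvg_shiftS (fun n => n%:R^-1 : R)); exact: cvg_harmonic.
  rewrite -[X in _ --> X]addr0; apply: cvgD; first exact: sqrt0.
  by rewrite -[X in _ --> X]addr0; apply: cvgD; [exact: Qtr|exact: Bhs_cvg].
exists K, rho; split=> //; near=> n.
have n0 : (0 < n)%N by near: n; exists 1%N.
have n0R : 0 < n%:R :> R by rewrite ltr0n.
have m0 : (0 < m n)%N by near: n; exact: m_infty (nbhs_infty_ge 1%N).
have [vn hvn] : 0 <= v n /\ forall (a : 'I_(m n)) (D : 'M[R]_n), opnorm D = 1 ->
    ('V_(P n)[fun w => edot (D *m rvec (@y n a) w) (rvec (@y n a) w)] <= (v n)%:E)%E.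
  by near: n.
have rn : 0 < r n by rewrite sqrtr_gt0 invr_gt0.
have s0 := sqrtr_ge0 (v n); have t0 := t_ge0 n; have b0 := b_ge0 n.
have r_sq : r n ^+ 2 * n%:R = 1 by rewrite sqr_sqrtr ?invr_ge0// mulVf// gt_eqF.
have rrho : r n <= rho n by rewrite /rho; move: s0 t0 b0; lra.
have rho0 : 0 < rho n by exact: lt_le_trans rrho.
have sq x : 0 <= x -> x <= rho n -> x ^+ 2 <= rho n ^+ 2.
  by move=> x0 xr; apply: lerXn2r; rewrite // nnegrE// ltW.
have [cdfX nuE _ _] := A2.
apply: (regular_of_bounds n0 m0 (sg := sigma n) (nu := sigmat n)) => //.
- exact: ind n0.
- by move=> a s; exact: cdfX.
- by move=> A mA bA; exact: nuE.
- by apply: le_trans (hK2 n n0) _; rewrite lee_fin.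
- by apply: le_trans KK1; near: n; exact: hK1.
- apply: le_trans (ler_norm _) _; rewrite -[X in `|X|]subr0 distrC; apply: ltW.
  by near: n; move/cvgrPdist_lt : rho_cvg; apply.
- by rewrite -[leLHS]r_sq ler_wpM2r//; apply: sq => //; exact: ltW.
- move=> a; apply: (@le_trans _ _ (K3 / n%:R)); last by rewrite ler_wpM2r ?invr_ge0.
  by move: a; near: n.
- move=> a; apply: (@le_trans _ _ (t n)).
    exact: (le_bigmax _ (fun a => `|\tr (@Q n a) - 1|) a).
  by rewrite /rho; move: s0 rn b0; lra.
- move=> a D D1; apply: le_trans (hvn a D D1) _; rewrite lee_fin -(sqr_sqrtr vn).
  by apply: sq => //; rewrite /rho; move: t0 rn b0; lra.
- by rewrite -/(b n) /rho; move: t0 rn s0; lra.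
- exact: avg.
Unshelve. all: by end_near.
Qed.

Section limit.
Variables (K : R) (rho : nat -> R).
Hypothesis reg : \forall n \near \oo, regular (@xi n) (@y n) (@Q n) (B n) K (rho n).
Hypothesis rho_cvg : rho n @[n --> \oo] --> 0.

Let charge_mean : \forall n \near \oo, forall (a : 'I_(m n)) phi, bmeas phi ->
  charge_integral (sigmat n) phi =
  (m n)%:R / n%:R * \int[P n]_w (@xi n a w * phi (@xi n a w)).
Proof.
have [cdfX nuE _ _] := A2; apply: filterS reg => n r a phi bphi.
have n0 := reg_n r; apply: (charge_integral_mean (sg := sigma n)) => //.
- by move=> s; exact: cdfX.
- exact: reg_xi2i r a.
- by move=> A mA bA; exact: nuE.
Qed.

Let K0 : 0 <= K.
Proof. by have [n /reg_K] := filter_ex reg; apply: le_trans. Qed.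

(** [x sigma~_n(dx)] is [(m / n) x^2 sigma_n(dx)], a measure of mass at most [K]. *)
Let charge_lip : \forall n \near \oo, forall (psi : R -> R) (c : R), cb psi ->
  cb (fun x => x * psi x) -> (forall x, `|psi x| <= c) ->
  `|charge_integral (sigmat n) (fun x => x * psi x)| <= K * c.
Proof.
apply: filterS2 reg charge_mean => n r cm psi c cpsi cxpsi pc.
have a := Ordinal (reg_m r).
have c0 : 0 <= c by apply: le_trans (pc 0).
have n0 : 0 < n%:R :> R by rewrite ltr0n (reg_n r).
rewrite (cm a _ (cb_bmeas cxpsi)) normrM ger0_norm ?divr_ge0//.
have i2 := reg_xi2i r a.
have pw w : `|@xi n a w * (@xi n a w * psi (@xi n a w))| <= c * @xi n a w ^+ 2.
  rewrite mulrA -expr2 normrM (ger0_norm (sqr_ge0 _)) mulrC.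
  by apply: ler_wpM2r; first exact: sqr_ge0.
have h : `|\int[P n]_w (@xi n a w * (@xi n a w * psi (@xi n a w)))| <=
    c * \int[P n]_w (@xi n a w ^+ 2).
  rewrite -RintegralZl//; apply: normr_RintegralT_le => //; last exact: rintZ.
  apply: (rint_le _ _ pw (rintZ c i2)).
  apply: measurable_funM; first exact: measurable_funPT.
  apply: measurable_funM; first exact: measurable_funPT.
  by apply: measurableT_comp (cb_bmeas cpsi).1 _; exact: measurable_funPT.
apply: le_trans (ler_wpM2l _ h) _; first by rewrite divr_ge0.
rewrite mulrCA [leRHS]mulrC; apply: ler_wpM2l => //.
by rewrite mulrAC ler_pdivrMr//; exact: reg_xi2 r a.
Qed.

(** The weight [x^2] is nonnegative. This sign passes to the weak limit and feeds the uniqueness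
    argument. *)
Let charge_pos : \forall n \near \oo, forall psi : R -> R, cb psi ->
  cb (fun x => x * psi x) -> (forall x, 0 <= psi x) ->
  0 <= charge_integral (sigmat n) (fun x => x * psi x).
Proof.
apply: filterS2 reg charge_mean => n r cm psi cpsi cxpsi p0.
have a := Ordinal (reg_m r).
rewrite (cm a _ (cb_bmeas cxpsi)) mulr_ge0 ?divr_ge0//.
by apply: Rintegral_ge0 => w _; rewrite mulrA -expr2 mulr_ge0// sqr_ge0.
Qed.

Let weak phi : cb phi ->
  charge_integral (sigmat n) phi @[n --> \oo] --> charge_integral sigmat_lim phi.
Proof. by move=> cphi; have [_ _ w _] := A2; apply: w; [exact: cphi.1|exact: cb_bounded]. Qed.

Let lim_pos := limit_pos weak charge_pos.

Lemma gbar_limit : exists f : C -> C, forall z, 0 < complex.Im z ->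
  [/\ 0 < complex.Im (f z),
      z * f z = -1 + f z * clift (charge_integral sigmat_lim) (rkernel (f z)) &
      nc (gbar (@xi n) (@y n) z - f z) @[n --> \oo] --> 0].
Proof.
suff h z : exists a : C, 0 < complex.Im z -> [/\ 0 < complex.Im a,
    z * a = -1 + a * clift (charge_integral sigmat_lim) (rkernel a) &
    nc (gbar (@xi n) (@y n) z - a) @[n --> \oo] --> 0].
  by have [f hf] := choice h; exists f.
have [z0|z0] := boolP (0 < complex.Im z); last by exists 0.
have [c c0 bounds] := gbar_bounds reg z0.
have [e e_cvg eqn] := scalar_equation_cvg reg rho_cvg z0.
have S0 : 0 < `|complex.Im z|^-1 by rewrite invr_gt0 normr_gt0 gt_eqF.
have eqn' : \forall n \near \oo, nc (1 + (z - clift (charge_integral (sigmat n))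
    (rkernel (gbar (@xi n) (@y n) z))) * gbar (@xi n) (@y n) z) <= e n.
  near=> n.
  have r : regular (@xi n) (@y n) (@Q n) (B n) K (rho n) by near: n.
  have a := Ordinal (reg_m r).
  have cm : forall (a : 'I_(m n)) phi, bmeas phi -> charge_integral (sigmat n) phi =
      (m n)%:R / n%:R * \int[P n]_w (@xi n a w * phi (@xi n a w)) by near: n.
  have [cg _] : c <= complex.Im (gbar (@xi n) (@y n) z) /\
      nc (gbar (@xi n) (@y n) z) <= `|complex.Im z|^-1 by near: n.
  have eqn_n : forall a, nc (1 + (z - xi_transform (@xi n) (gbar (@xi n) (@y n) z) a *
      ((m n)%:R / n%:R)%:C) * gbar (@xi n) (@y n) z) <= e n by near: n.
  set g := gbar (@xi n) (@y n) z in cg eqn_n *.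
  have g0 : 0 < complex.Im g by exact: lt_le_trans cg.
  have ck := ccb_rkernel g0.
  (* The coefficient [(m / n) E (xi / (1 + xi g))] of the finite-size equation is the integral of
     [1 / (1 + x g)] against [sigma~_n], the form in which weak convergence can be used. *)
  have -> : clift (charge_integral (sigmat n)) (rkernel g) =
      xi_transform (@xi n) g a * ((m n)%:R / n%:R)%:C.
    have ER : complex.Re (xi_transform (@xi n) g a) =
        \int[P n]_w (@xi n a w * complex.Re (rkernel g (@xi n a w))).
      rewrite /xi_transform /cexp -[LHS]/(\int[P n]_w complex.Re
        ((@xi n a w)%:C * rkernel g (@xi n a w))).
      by apply: eq_Rintegral => w _; exact: ReM_real.
    have EI : complex.Im (xi_transform (@xi n) g a) =
        \int[P n]_w (@xi n a w * complex.Im (rkernel g (@xi n a w))).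
      rewrite /xi_transform /cexp -[LHS]/(\int[P n]_w complex.Im
        ((@xi n a w)%:C * rkernel g (@xi n a w))).
      by apply: eq_Rintegral => w _; exact: ImM_real.
    rewrite mulrC; apply: complex_ext; rewrite ?ReM_real ?ImM_real ?ER ?EI.
      exact: (cm a _ (cb_bmeas (ccb_Re ck))).
    exact: (cm a _ (cb_bmeas (ccb_Im ck))).
  exact: eqn_n.
have [a [ca sa cvg]] := solution_cvg (fun n => charge_functional (sigmat n))
  (charge_functional sigmat_lim) weak K0 charge_lip charge_pos z0 c0 S0 bounds e_cvg eqn'.
by exists a => _; split=> //; exact: lt_le_trans ca.
Unshelve. all: by end_near.
Qed.

Lemma limit_law : exists N : probability borelR R,
  [/\ weak_cvg_in_probability P (fun n w => esd (Lmx xi y w)) N,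
      limit_equation sigmat_lim (stieltjes N) &
      forall mu : {measure set borelR -> \bar R},
        has_stieltjes mu -> limit_equation sigmat_lim (stieltjes mu) ->
        forall z, complex.Im z != 0 -> stieltjes mu z = stieltjes N z].
Proof.
have [f hf] := gbar_limit.
have gcvg z : 0 < complex.Im z -> nc (gbar (@xi n) (@y n) z - f z) @[n --> \oo] --> 0.
  by move=> /hf[].
pose N := riesz_measure (mean_limit_tight reg rho_cvg gcvg).
have eqN : limit_equation sigmat_lim (stieltjes N).
  apply: limit_equation_upper => z z0; rewrite /N (limit_law_stieltjes reg rho_cvg gcvg z0).
  by have [] := hf z z0.
exists N; split=> //.
  move=> phi cphi bphi eps eps0.
  have cbphi : cb phi.
    split=> //; have [M [_ hM]] := bphi; exists (M + 1) => x.
    by apply: hM => //; rewrite ltrDl.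
  have E n w : \int[esd (Lmx xi y w)]_x phi x = empirical (covmx (@xi n) (@y n) w) phi.
    exact: (esd_integral _ (cb_bmeas cbphi)).
  rewrite (_ : (fun n => P n _) = fun n => P n [set w | eps <=
    `|empirical (covmx (@xi n) (@y n) w) phi - \int[N]_x phi x|]).
    exact: (empirical_cvg_in_probability reg rho_cvg gcvg cbphi eps0).
  by apply/funext => n; congr (P n _); apply/seteqP; split=> w /=; rewrite E.
move=> mu hmu emu.
exact: (limit_equation_unique lim_pos hmu (probability_has_stieltjes N) emu eqN).
Qed.

End limit.
End assembly.

Close Scope complex_scope.

Theorem theorem1p2 (R : realType)
    (d : nat -> measure_display) (T : forall n, measurableType (d n))
    (P : forall n, probability (T n) R) (m : nat -> nat)
    (xi : forall n, 'I_(m n) -> {RV (P n) >-> R})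
    (y : forall n, 'I_(m n) -> 'I_n -> {RV (P n) >-> R})
    (sigma : nat -> cumulativeBounded (0 : R) (1 : R))
    (sigmat : nat -> {charge set (measurableTypeR R) -> \bar R})
    (sigmat_lim : {charge set (measurableTypeR R) -> \bar R})
    (Q : forall n, 'I_(m n) -> 'M[R]_n) (B : forall n, 'M[R]_n) :
  m @ \oo --> \oo ->
  (forall n, (0 < n)%N -> jointly_independent xi y n) ->
  assumption1 y ->
  assumption2 xi sigma sigmat sigmat_lim ->
  (forall n (a : 'I_(m n)) (i : 'I_n), (y n a i : T n -> R) \in Lfun (P n) 2%:E) ->
  (forall n (a : 'I_(m n)), Q n a = second_moment_mx (y n a)) ->
  (fun n => \big[Order.max/0]_(a < m n) opnorm (Q n a))
    =O_\oo (fun n => n%:R^-1 : R) ->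
  \big[Order.max/0]_(a < m n) `|\tr (Q n a) - 1| @[n --> \oo] --> (0 : R) ->
  (forall n, (0 < n)%N ->
     (m n)%:R^-1 *: \sum_(a < m n) Q n a = n%:R^-1 *: 1%:M + B n) ->
  (fun n => hsnorm (B n)) =o_\oo (fun n => (Num.sqrt n%:R)^-1 : R) ->
  exists N : probability (measurableTypeR R) R,
    [/\ weak_cvg_in_probability P (fun n w => esd (Lmx xi y w)) N,
        limit_equation sigmat_lim (stieltjes N) &
        forall mu : {measure set (measurableTypeR R) -> \bar R},
          has_stieltjes mu -> limit_equation sigmat_lim (stieltjes mu) ->
          forall z, complex.Im z != 0 -> stieltjes mu z = stieltjes N z].
Proof.
move=> m_infty ind A1 A2 y2 Qmom Qop Qtr avg Bhs.
have [K [rho [_ rho_cvg reg]]] :=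
  eventually_regular m_infty ind A1 A2 y2 Qmom Qop Qtr avg Bhs.
exact: (limit_law A2 reg rho_cvg).
Qed.
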